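(* Let $N\geq3$, let $\Omega$ be a bounded smooth open subset of $\mathbb{R}^N$, let $\lambda\in(-\Lambda_\Omega,0]$, and let $c\in\mathbb{R}$. Let $(u_k)$ be a sequence in $D^{1,2}(\mathbb{R}^N)$ such that $$J_\lambda(u_k)\to c\qquad\text{and}\qquad J_\lambda'(u_k)\to0\ \text{ in }(D^{1,2}(\mathbb{R}^N))'.$$ Then, passing to a subsequence, there exist a (possibly trivial) solution $u$ of the problem $$-\Delta u+\lambda\mathds{1}_\Omega u=Q_\Omega(x)|u|^{2^*-2}u,\qquad u\in D^{1,2}(\mathbb{R}^N),$$ a number $m\in\mathbb{N}\cup\{0\}$, $m$ sequences $(\xi_{1,k}),\dots,(\xi_{m,k})$ of points in $\Omega$, $m$ sequences $(\varepsilon_{1,k}),\dots,(\varepsilon_{m,k})$ in $(0,\infty)$, and $m$ nontrivial solutions $w_1,\dots,w_m$ to the limit problem $$-\Delta w=|w|^{2^*-2}w,\qquad w\in D^{1,2}(\mathbb{R}^N),$$ with the following properties: (i) $\lim_{k\to\infty}\varepsilon_{i,k}^{-1}\,\mathrm{dist}(\xi_{i,k},\partial\Omega)=\infty$ for each $i=1,\dots,m$. (ii) $\lim_{k\to\infty}\big\|u_k-u-\sum_{i=1}^m[w_i]_{\varepsilon_{i,k},\xi_{i,k}}\big\|=0$. (iii) $J_\lambda(u)+\sum_{i=1}^mJ_\infty(w_i)=c\geq0$.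
   Context: $\Omega$ is not necessarily connected. $2^*:=\frac{2N}{N-2}$; $\mathds{1}_\Omega$ is the characteristic function of $\Omega$; $Q_\Omega(x):=1$ if $x\in\Omega$ and $Q_\Omega(x):=-1$ if $x\in\mathbb{R}^N\smallsetminus\Omega$. $D^{1,2}(\mathbb{R}^N)=\{u\in L^{2^*}(\mathbb{R}^N):\nabla u\in L^2(\mathbb{R}^N;\mathbb{R}^N)\}$ with norm $\|u\|=(\int_{\mathbb{R}^N}|\nabla u|^2)^{1/2}$, and $(D^{1,2}(\mathbb{R}^N))'$ is its dual. Set $$\Lambda_\Omega:=\inf_{u\in D^{1,2}(\mathbb{R}^N),\,u\neq0}\frac{\int_{\mathbb{R}^N}|\nabla u|^2}{\int_\Omega u^2}$$ (the quotient being $+\infty$ if the denominator vanishes), $$J_\lambda(u):=\frac12\int_{\mathbb{R}^N}(|\nabla u|^2+\lambda\mathds{1}_\Omega u^2)-\frac1{2^*}\int_{\mathbb{R}^N}Q_\Omega|u|^{2^*},\qquad J_\infty(u):=\frac12\|u\|^2-\frac1{2^*}\int_{\mathbb{R}^N}|u|^{2^*}.$$ Solutions of the problem (resp. of the limit problem) are the critical points of $J_\lambda$ (resp. $J_\infty$) on $D^{1,2}(\mathbb{R}^N)$. For $w\in D^{1,2}(\mathbb{R}^N)$, $\varepsilon>0$ and $\xi\in\mathbb{R}^N$, $[w]_{\varepsilon,\xi}(x):=w_{\varepsilon,\xi}(x):=\varepsilon^{\frac{2-N}2}w\big(\frac{x-\xi}\varepsilon\big)$. *)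

(* Defs.v *)
From HB Require Import structures.
From mathcomp Require Import all_boot all_order all_algebra.
From mathcomp Require Import all_classical all_reals all_analysis.

Set Implicit Arguments.
Unset Strict Implicit.
Unset Printing Implicit Defensive.

Import Order.TTheory GRing.Theory Num.Theory.
Import numFieldNormedType.Exports.

Local Open Scope classical_set_scope.
Local Open Scope ring_scope.

Section tuple_lebesgue.
Context (R : realType).
Local Notation T n := (n.-tuple (measurableTypeR R)).

Definition tcons (n : nat) (p : measurableTypeR R * T n) : T n.+1 :=
  [tuple of p.1 :: p.2].

Lemma measurable_tcons n : measurable_fun setT (@tcons n).
Proof. exact: measurable_cons. Qed.

HB.instance Definition _ n :=
  isMeasurableFun.Build _ _ _ _ (@tcons n) (@measurable_tcons n).

Lemma behead_tcons n (p : measurableTypeR R * T n) :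
  [tuple of behead (tcons p)] = p.2.
Proof. exact/val_inj. Qed.

Section step.
Context (n : nat) (m : {sigma_finite_measure set (T n) -> \bar R}).

Definition leb_step : set (T n.+1) -> \bar R :=
  pushforward (lebesgue_measure \x m)%E (@tcons n).

Let leb_step0 : leb_step set0 = 0%E.
Proof. exact: measure0. Qed.

Let leb_step_ge0 A : (0 <= leb_step A)%E.
Proof. exact: measure_ge0. Qed.

Let leb_step_sigma_additive : semi_sigma_additive leb_step.
Proof.
exact: (@measure_semi_sigma_additive _ _ _
  (pushforward (lebesgue_measure \x m)%E (@tcons n))).
Qed.

HB.instance Definition _ := isMeasure.Build _ _ _ leb_step
  leb_step0 leb_step_ge0 leb_step_sigma_additive.

Lemma leb_stepX (A : set (measurableTypeR R)) (B : set (T n)) :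
  measurable A -> measurable B ->
  leb_step [set t | A (thead t) /\ B [tuple of behead t]] =
  (lebesgue_measure A * m B)%E.
Proof.
move=> mA mB; rewrite -product_measure1E// /leb_step /pushforward.
congr (_ _); apply/funext => p /=; rewrite behead_tcons.
by rewrite /setX /= /tcons theadE.
Qed.

Let leb_step_sigma_finite : sigma_finite setT leb_step.
Proof.
have /sigma_finiteP[F [TF ndF Foo]] :=
  sigma_finiteT (@lebesgue_measure R : {sigma_finite_measure set _ -> \bar R}).
have /sigma_finiteP[G [TG ndG Goo]] := sigma_finiteT m.
exists (fun k => [set t | F k (thead t) /\ G k [tuple of behead t]]).
  apply/seteqP; split => // t _.
  have [i _ Fi] : (\bigcup_i F i) (thead t) by rewrite -TF.
  have [j _ Gj] : (\bigcup_i G i) [tuple of behead t] by rewrite -TG.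
  exists (maxn i j) => //; split.
    by move: Fi; exact/subsetPset/ndF/leq_maxl.
  by move: Gj; exact/subsetPset/ndG/leq_maxr.
move=> k; have [mF Fk] := Foo k; have [mG Gk] := Goo k; split; last first.
  by rewrite leb_stepX// lte_mul_pinfty// ge0_fin_numE.
apply: measurableI; rewrite -[X in measurable X]setTI.
  exact: (@measurable_tnth _ _ _ ord0).
exact: measurable_behead.
Qed.

HB.instance Definition _ := Measure_isSigmaFinite.Build _ _ _ leb_step
  leb_step_sigma_finite.

End step.

(* The Lebesgue measure on tuples: R^0 is a point of mass 1 and the measure on R^(n+1) is the image, under the
   canonical map R * R^n -> R^(n+1), of the product measure. *)
Fixpoint leb_tuple (n : nat) : {sigma_finite_measure set (T n) -> \bar R} :=
  match n with
  | 0 => \d_([tuple] : T 0)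
  | n'.+1 => leb_step (leb_tuple n')
  end.

End tuple_lebesgue.

(* The product sigma-algebra on row vectors; it is the Borel one. *)
Section rV_measurable.
Context (R : realType) (n : nat).

Let coord (i : 'I_n) (x : 'rV[R]_n) : measurableTypeR R := x ord0 i.

Definition rV_display : measure_display. Proof. exact: default_measure_display. Qed.

HB.instance Definition _ := @isMeasurable.Build rV_display 'rV[R]_n
  (g_sigma_preimage coord) (@sigma_algebra0 _ _ _)
  (@sigma_algebraC _ _) (@sigma_algebra_bigcup _ _ _).

Lemma measurable_coord i : measurable_fun [set: 'rV[R]_n] (coord i).
Proof.
move=> _ Y mY; rewrite setTI; apply: sub_sigma_algebra => /=.
rewrite -bigcup_seq/=; exists i => /=; first by rewrite mem_index_enum.
by exists Y => //; rewrite setTI.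
Qed.

Lemma measurable_rVP d (T : measurableType d) (f : T -> 'rV[R]_n) :
  (forall i, measurable_fun setT (coord i \o f)) -> measurable_fun setT f.
Proof.
move=> mf.
apply: (@measurability _ _ _ _ setT f
  (\big[setU/set0]_(i < n) preimage_set_system setT (coord i) measurable)) => //.
move=> _ [A + <-]; rewrite -bigcup_seq/= => -[i _ [B mB <-]].
rewrite !setTI -comp_preimage -[X in measurable X]setTI.
exact: mf.
Qed.

End rV_measurable.

Lemma tnth_behead_lift (T : Type) n (t : n.+1.-tuple T) (i : 'I_n) :
  tnth [tuple of behead t] i = tnth t (lift ord0 i).
Proof. by rewrite [in RHS](tuple_eta t) tnthS. Qed.

Lemma leb_tuple_box (R : realType) n (A : 'I_n -> set (measurableTypeR R)) :
  (forall i, measurable (A i)) ->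
  leb_tuple R n [set t | forall i, A i (tnth t i)] =
  (\prod_(i < n) lebesgue_measure (A i))%E.
Proof.
elim: n A => [|n IH] A mA.
  rewrite big_ord0 /= diracE mem_set//=; by case.
rewrite big_ord_recl -(IH (fun i => A (lift ord0 i)))//.
have mB : measurable [set t : n.-tuple (measurableTypeR R) |
    forall i, A (lift ord0 i) (tnth t i)].
  rewrite (_ : mkset _ = \bigcap_i ((@tnth n _ ^~ i) @^-1` A (lift ord0 i))).
    apply: fin_bigcap_measurable => // i _.
    by rewrite -[X in measurable X]setTI; exact: measurable_tnth.
  by apply/seteqP; split => t /= tA i; [move=> _; exact: tA | exact: tA].
rewrite -leb_stepX//=; congr (leb_step _ _).
apply/seteqP; split => t /=.
  move=> tA; split => [|i]; first exact: tA.
  by have := tA (lift ord0 i); rewrite tnth_behead_lift.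
move=> [A0 AS] i; case: (unliftP ord0 i) => [j|] ->//.
by have := AS j; rewrite tnth_behead_lift.
Qed.

Section rV_lebesgue.
Context (R : realType) (n : nat).

Definition rV_of_tuple (t : n.-tuple (measurableTypeR R)) : 'rV[R]_n :=
  \row_i tnth t i.

Lemma measurable_rV_of_tuple : measurable_fun setT rV_of_tuple.
Proof.
apply: measurable_rVP => i.
rewrite (_ : _ \o _ = fun t => tnth t i); first exact: measurable_tnth.
by apply/funext => t; rewrite /= mxE.
Qed.

HB.instance Definition _ :=
  isMeasurableFun.Build _ _ _ _ rV_of_tuple measurable_rV_of_tuple.

Definition lebesgue_rV : set 'rV[R]_n -> \bar R :=
  pushforward (leb_tuple R n) rV_of_tuple.

Let lebesgue_rV0 : lebesgue_rV set0 = 0%E.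
Proof. exact: measure0. Qed.

Let lebesgue_rV_ge0 A : (0 <= lebesgue_rV A)%E.
Proof. exact: measure_ge0. Qed.

Let lebesgue_rV_sigma_additive : semi_sigma_additive lebesgue_rV.
Proof.
exact: (@measure_semi_sigma_additive _ _ _
  (pushforward (leb_tuple R n) rV_of_tuple)).
Qed.

HB.instance Definition _ := isMeasure.Build _ _ _ lebesgue_rV
  lebesgue_rV0 lebesgue_rV_ge0 lebesgue_rV_sigma_additive.

Definition tuple_of_rV (x : 'rV[R]_n) : n.-tuple (measurableTypeR R) :=
  [tuple x ord0 i | i < n].

Lemma rV_of_tupleK : cancel rV_of_tuple tuple_of_rV.
Proof. by move=> t; apply: eq_from_tnth => i; rewrite tnth_mktuple mxE. Qed.

Lemma measurable_tuple_of_rV : measurable_fun setT tuple_of_rV.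
Proof.
apply/measurable_fun_tnthP => i.
rewrite (_ : _ \o _ = fun x : 'rV[R]_n => x ord0 i); first exact: measurable_coord.
by apply/funext => x; rewrite /= tnth_mktuple.
Qed.

Let lebesgue_rV_sigma_finite : sigma_finite setT lebesgue_rV.
Proof.
have [F TF mF] := sigma_finiteT (leb_tuple R n).
exists (fun i => tuple_of_rV @^-1` F i).
  by rewrite -preimage_bigcup -TF preimage_setT.
move=> i; have [mFi Fioo] := mF i; split.
  by rewrite -[X in measurable X]setTI; exact: measurable_tuple_of_rV.
rewrite /lebesgue_rV /pushforward -comp_preimage.
rewrite (_ : _ \o _ = id) ?preimage_id//.
by apply/funext => t; exact: rV_of_tupleK.
Qed.

HB.instance Definition _ := Measure_isSigmaFinite.Build _ _ _ lebesgue_rV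
  lebesgue_rV_sigma_finite.

Lemma lebesgue_rV_box (A : 'I_n -> set (measurableTypeR R)) :
  (forall i, measurable (A i)) ->
  lebesgue_rV [set x | forall i, A i (x ord0 i)] =
  (\prod_(i < n) lebesgue_measure (A i))%E.
Proof.
move=> mA; rewrite -leb_tuple_box// /lebesgue_rV /pushforward.
congr (_ _); apply/seteqP; split => t /= tA i; move: (tA i);
  by rewrite mxE.
Qed.

End rV_lebesgue.

Definition partial (R : realType) (n : nat) (i : 'I_n) (f : 'rV[R]_n -> R) :
    'rV[R]_n -> R :=
  fun x => 'D_(delta_mx ord0 i) f x.

Fixpoint Cn (R : realType) (n : nat) (k : nat) (f : 'rV[R]_n -> R) : Prop :=
  match k with
  | 0 => continuous f
  | k'.+1 => continuous f /\ forall i : 'I_n,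
      (forall x, derivable f x (delta_mx ord0 i)) /\ Cn k' (partial i f)
  end.

Definition smooth (R : realType) (n : nat) (f : 'rV[R]_n -> R) : Prop :=
  forall k, Cn k f.

Definition boundary (T : topologicalType) (A : set T) : set T :=
  closure A `\` interior A.

(* Near each boundary point, up to the choice of a coordinate axis [i] and of
   an orientation [b] of it, [A] is the set of points lying strictly above the
   graph of a smooth function of the remaining coordinates [col' i x]. *)
Definition smooth_open_set (R : realType) (n : nat) (A : set 'rV[R]_n) : Prop :=
  open A /\
  forall x0, boundary A x0 ->
    exists (r : R) (i : 'I_n) (b : bool) (gamma : 'rV[R]_n.-1 -> R),
      [/\ 0 < r, smooth gamma &
        forall x, ball x0 r x ->
          (A x <-> 0 < (-1) ^+ b * (x ord0 i - gamma (col' i x)))].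

(* The library norm on ['rV[R]_n] is the sup norm, whence the explicit
   Euclidean distance. *)
Definition eucl_dist (R : realType) (n : nat) (x y : 'rV[R]_n) : R :=
  Num.sqrt (\sum_(i < n) (x ord0 i - y ord0 i) ^+ 2).

Definition dist_set (R : realType) (n : nat) (x : 'rV[R]_n)
    (A : set 'rV[R]_n) : R :=
  inf [set eucl_dist x y | y in A].

Section D12.
Context (R : realType) (N : nat).
Local Notation E := 'rV[R]_N.
Local Notation mu := (@lebesgue_rV R N).

Definition two_star : R := 2 * N%:R / (N%:R - 2).

Definition test_function (phi : E -> R) : Prop :=
  smooth phi /\ compact (closure [set x | phi x != 0]).

Definition loc_integrable (f : E -> R) : Prop :=
  measurable_fun setT f /\
  forall K : set E, compact K -> mu.-integrable K (EFin \o f).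

Definition is_weak_partial (i : 'I_N) (u g : E -> R) : Prop :=
  [/\ loc_integrable u, loc_integrable g &
    forall phi, test_function phi ->
      \int[mu]_x (u x * partial i phi x) = - \int[mu]_x (g x * phi x)].

(* The weak partial derivative, which is unique up to a null set. *)
Definition weak_partial (i : 'I_N) (u : E -> R) : E -> R :=
  xget (cst 0) [set g | is_weak_partial i u g].

(* Elements of D^{1,2} are represented by Borel functions; two of them are the
   same element when they are equal almost everywhere. *)
Definition D12 : set (E -> R) :=
  [set u | u \in Lfun mu two_star%:E /\
    forall i : 'I_N, exists2 g, is_weak_partial i u g & g \in Lfun mu 2%:E].

Definition grad_sq (u : E -> R) (x : E) : R :=
  \sum_(i < N) weak_partial i u x ^+ 2.

Definition D12_norm (u : E -> R) : R :=
  Num.sqrt (\int[mu]_x grad_sq u x).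

(* Bounded linear functionals on D^{1,2}: only their values on D^{1,2} matter. *)
Definition D12_dual : set ((E -> R) -> R) :=
  [set l | (forall (a : R) (u v : E -> R), D12 u -> D12 v ->
               l (fun x => a * u x + v x) = a * l u + l v) /\
           exists C : R, forall v, D12 v -> `|l v| <= C * D12_norm v].

Definition dual_norm (l : (E -> R) -> R) : R :=
  sup [set `|l v| | v in [set v | D12 v /\ D12_norm v <= 1]].

(* The Frechet derivative for the norm [D12_norm]; [l] is unique as an element
   of the dual space. *)
Definition is_frechet_derivative (J : (E -> R) -> R) (u : E -> R)
    (l : (E -> R) -> R) : Prop :=
  D12_dual l /\
  forall e : R, 0 < e -> exists2 d : R, 0 < d &
    forall v, D12 v -> D12_norm v <= d ->
      `|J (u \+ v) - J u - l v| <= e * D12_norm v.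

Definition critical_point (J : (E -> R) -> R) (u : E -> R) : Prop :=
  D12 u /\ is_frechet_derivative J u (fun=> 0).

(* Nonzero as an element of D^{1,2}. *)
Definition nontrivial (u : E -> R) : Prop := ~ (u = cst 0 %[ae mu]).

Definition rescale (w : E -> R) (eps : R) (xi : E) : E -> R :=
  fun x => eps `^ ((2 - N%:R) / 2) * w (eps^-1 *: (x - xi)).

Definition Q_Omega (Omega : set E) (x : E) : R := if x \in Omega then 1 else -1.

(* The integral over [Omega] is finite for bounded [Omega]. *)
Definition rayleigh (Omega : set E) (u : E -> R) : \bar R :=
  let den := \int[mu]_(x in Omega) (u x ^+ 2) in
  if den == 0 then +oo%E else ((\int[mu]_x grad_sq u x) / den)%:E.

Definition Lambda (Omega : set E) : \bar R :=
  ereal_inf [set rayleigh Omega u | u in [set u | D12 u /\ nontrivial u]].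

Definition J_lambda (Omega : set E) (lambda : R) (u : E -> R) : R :=
  2^-1 * \int[mu]_x (grad_sq u x + lambda * \1_Omega x * u x ^+ 2)
  - two_star^-1 * \int[mu]_x (Q_Omega Omega x * `|u x| `^ two_star).

Definition J_infty (u : E -> R) : R :=
  2^-1 * D12_norm u ^+ 2 - two_star^-1 * \int[mu]_x (`|u x| `^ two_star).

End D12.

(* Main.v *)
(** A Palais-Smale sequence is bounded (0 <= -lambda < Lambda_Omega), and its weak limit is a critical point; by
Brezis-Lieb splitting, the remainder is a Palais-Smale sequence of the functional without the lambda-term. If it
does not vanish, it is rescaled so that a fixed small L^{2*}-mass sits in a unit ball; small mass on every unit ball
would force vanishing, so the weak limit w of the blow-up is nontrivial. It solves the limit equation on the blown-up
domain: with Q = 1 on the whole space, w is a bubble and the centres can be taken deep inside Omega; Q = -1 forces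
w = 0 by testing with w; a half-space is excluded because translating in the normal direction gives w = 0 on the
interface, and unique continuation (Carleman estimate) then yields w = 0. Each bubble costs a fixed amount of
energy, so the extraction ends. *)
From HB Require Import structures.
From mathcomp Require Import all_boot all_order all_algebra.
From mathcomp Require Import all_classical all_reals all_analysis.
From mathcomp Require Import measurable_realfun ring lra.
Require Import Defs.

Set Implicit Arguments.
Unset Strict Implicit.
Unset Printing Implicit Defensive.

Import Order.TTheory GRing.Theory Num.Theory.
Import numFieldNormedType.Exports.

Local Open Scope classical_set_scope.
Local Open Scope ring_scope.

(* Three devices shape the proof. First, weak derivatives are handled through difference quotients:
   translation in L^2 is controlled by the gradient, and this yields the product and chain rules,
   integration by parts, local compactness and, after averaging over balls and dyadic truncation, a
   Sobolev inequality. Second, every functional is an instance of one [Jf] with a bounded compactly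
   supported potential [a] and a weight [|Q| <= 1] that may vary along the sequence, so one
   splitting result serves the weak limit and every bubble. Third, on a half-space the weight jumps.
   The zero trace there comes from a discrete form of translation invariance, the test function
   being the difference of two opposite translates of [w]. The error is small compared with the step
   only if the nonlinearity lies in L^2, which is the purpose of the Brezis-Kato estimate. The same
   integrability bounds [|w|^(p-2) v] in L^2 by the gradient of [v], so that the Carleman estimate
   absorbs the potential on strips of a fixed width. *)
Create HintDb mes.
Create HintDb li.
Create HintDb pos.
Create HintDb cv.

Ltac hyp := match goal with h : _ |- _ => first [exact: h | exact: h.1 | exact: (h _).1 | exact: h.2 | exact: (h _).2] end.

Ltac mfun := repeat (first
  [ hyp | solve [auto 2 with mes nocore] | exact: measurable_cst | apply: measurable_funD
  | apply: measurable_funB | apply: measurable_funM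
  | apply: measurable_funX | apply: (measurableT_comp (@oppr_measurable _ _))
  | apply: (measurableT_comp (@normr_measurable _ _))
  | apply: (measurableT_comp (measurable_powR _)) ]).

Ltac cv := solve [repeat first [ exact: cvg_cst | hyp | solve [auto 2 with cv nocore] | apply: cvgD | apply: cvgB | apply: cvgM | apply: cvgN ]].

Section linear_arithmetic.
Context {R : realFieldType}.
Implicit Types y z : R.

Lemma add0_sub y z : y+z = 0 -> z-y = - (2*y).
Proof. lra. Qed.

Lemma double_le y z1 z2 : 0 <= y -> z1 <= z2 -> 2*y <= z1 -> y <= z2.
Proof. lra. Qed.

Lemma double_le_add y y1 y2 z1 z2 : 0 <= y -> y1 <= z1 -> y2 <= z2 -> 2*y <= y2+y1 -> y <= z1+z2.
Proof. lra. Qed.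

End linear_arithmetic.

Lemma eqle d (T : porderType d) (x y : T) : x = y -> (x <= y)%O.
Proof. by move=> ->. Qed.

(** More than a sign tactic: its [lra] branch also closes equalities and inequalities that are
    linear in their monomials, and it ends many purely algebraic goals below. *)
Ltac pos := solve [repeat first
 [ assumption | solve [auto 1 with pos nocore] | exact: ltW | exact: sqr_ge0 | exact: powR_ge0 | exact: expR_ge0 | exact: expR_gt0
 | exact: sqrtr_ge0 | apply: mulr_ge0 | apply: addr_ge0 | apply: divr_ge0 | apply: exprn_ge0 | apply: divr_gt0
 | apply: mulr_gt0 | apply: exprn_gt0 | apply: powR_gt0 | rewrite ?invr_ge0 ?invr_gt0 ?oppr_ge0 ?nnegrE; lra | done
 | apply: ltr_wpDl | apply: ltr_pwDl | rewrite ?invr_ge0 ?invr_gt0 ?nnegrE; assumption ]].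

(** * Integrals of real-valued functions, dominated convergence and Fatou *)

Section measure_tools.
Context d (T : measurableType d) (R : realType).
Variable mu : {measure set T -> \bar R}.
Implicit Types f g h : T -> R.

Notation mes f := (measurable_fun [set: T] f).
Notation ig f := (mu.-integrable [set: T] (EFin \o f)).

Lemma ig_mes f : ig f -> mes f.
Proof. by move=> /measurable_int/measurable_EFinP. Qed.

Lemma ig_le f g : mes f -> ig g -> (forall x, `|f x| <= g x) -> ig f.
Proof.
move=> mf ig_g fg; apply: (le_integrable measurableT _ _ ig_g).
 exact/measurable_EFinP.
by move=> x _ /=; rewrite lee_fin (le_trans (fg x))// ler_norm.
Qed.

Lemma ig_aeeq f g : mes f -> ig g -> f = g %[ae mu] -> ig f.
Proof.
move=> mf /integrableP[mg goo] fg; apply/integrableP; split.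
 exact/measurable_EFinP.
rewrite (ge0_ae_eq_integral (g := fun x => (`|g x|)%:E))//.
- apply/measurable_EFinP; mfun.
- by apply/measurable_EFinP; mfun; apply/measurable_EFinP.
- by apply: filterS fg => x /= h _; rewrite h.
Qed.

(** The minimum of [|f|] and [|g|] is dominated everywhere and agrees with [|f|] almost
    everywhere. *)
Lemma ig_le_ae f g : mes f -> ig g -> {ae mu, forall x, `|f x| <= g x} -> ig f.
Proof.
move=> mf gi fg.
pose h x := Num.min (`|f x|) `|g x|.
have hi : ig h.
 apply: (@ig_le _ (fun x => `|g x|)).
 - apply: measurable_minr; mfun; exact: ig_mes.
 - exact: integrable_norm.
 - by move=> x; rewrite /h ger0_norm ?ge_min ?lexx ?orbT// le_min.
have : ig (fun x => `|f x|).
 apply: (ig_aeeq _ hi); first mfun.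
 apply: filterS fg => x fgx _; rewrite /h; apply/esym/min_idPl.
 by rewrite (le_trans fgx)// ler_norm.
by move=> fi; apply: (ig_le mf fi).
Qed.

Lemma ig0 : ig (fun=> 0).
Proof. exact: integrable0. Qed.

Lemma igD f g : ig f -> ig g -> ig (fun x => f x+g x).
Proof. move=> fi gi; exact: (integrableD measurableT fi gi). Qed.

Lemma igB f g : ig f -> ig g -> ig (fun x => f x-g x).
Proof. move=> fi gi; exact: (integrableB measurableT fi gi). Qed.

Lemma igZ k f : ig f -> ig (fun x => k*f x).
Proof. move=> fi; exact: (integrableZl measurableT k fi). Qed.

Lemma igN f : ig f -> ig (fun x => - f x).
Proof. move=> fi; under eq_fun do rewrite -mulN1r; exact: igZ. Qed.

Lemma ig_norm f : ig f -> ig (fun x => `|f x|).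
Proof. exact: integrable_norm. Qed.

Lemma ig_sum (I : Type) (s : seq I) (F : I -> T -> R) :
 (forall i, ig (F i)) -> ig (fun x => \sum_(i <- s) F i x).
Proof.
move=> iF; elim: s => [|i s IH].
 under eq_fun do rewrite big_nil; exact: ig0.
under eq_fun do rewrite big_cons; exact: igD.
Qed.

Lemma IntD f g : ig f -> ig g ->
 \int[mu]_x (f x+g x) = \int[mu]_x f x+\int[mu]_x g x.
Proof. exact: RintegralD. Qed.

Lemma IntB f g : ig f -> ig g ->
 \int[mu]_x (f x-g x) = \int[mu]_x f x-\int[mu]_x g x.
Proof. exact: RintegralB. Qed.

Lemma IntZ k f : ig f -> \int[mu]_x (k*f x) = k*\int[mu]_x f x.
Proof. exact: RintegralZl. Qed.

Lemma IntN f : ig f -> \int[mu]_x (- f x) = - \int[mu]_x f x.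
Proof.
by move=> fi; under eq_Rintegral do rewrite -mulN1r; rewrite IntZ// mulN1r.
Qed.

Lemma Int0 : \int[mu]_x (0 : R) = 0.
Proof. by rewrite /Rintegral integral0. Qed.

Lemma Int_sum (I : Type) (s : seq I) (F : I -> T -> R) :
 (forall i, ig (F i)) ->
 \int[mu]_x (\sum_(i <- s) F i x) = \sum_(i <- s) \int[mu]_x F i x.
Proof.
move=> iF; elim: s => [|i s IH].
 by under eq_Rintegral do rewrite big_nil; rewrite big_nil Int0.
under eq_Rintegral do rewrite big_cons.
rewrite big_cons IntD ?IH//; exact: ig_sum.
Qed.

Lemma Int_ext f g : f =1 g -> \int[mu]_x f x = \int[mu]_x g x.
Proof. by move=> fg; apply: eq_Rintegral => x _. Qed.

Lemma Int_ge0 f : (forall x, 0 <= f x) -> 0 <= \int[mu]_x f x.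
Proof. move=> f0; exact: Rintegral_ge0. Qed.

Lemma Int_le f g : ig f -> ig g -> (forall x, f x <= g x) ->
 \int[mu]_x f x <= \int[mu]_x g x.
Proof. move=> fi gi fg; exact: le_Rintegral. Qed.

Lemma Int_aeeq f g : mes f -> mes g -> f = g %[ae mu] ->
 \int[mu]_x f x = \int[mu]_x g x.
Proof.
move=> mf mg fg; rewrite /Rintegral; congr fine.
apply: ae_eq_integral => //; try exact/measurable_EFinP.
by apply: filterS fg => x + _ => ->.
Qed.

Lemma Int_norm_le f : ig f -> `|\int[mu]_x f x| <= \int[mu]_x `|f x|.
Proof. move=> fi; exact: le_normr_Rintegral. Qed.

Lemma Int_le_norm f g : ig f -> ig g -> (forall x, `|f x| <= g x) ->
 `|\int[mu]_x f x| <= \int[mu]_x g x.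
Proof.
move=> fi gi fg; rewrite (le_trans (Int_norm_le fi))// Int_le//; exact: ig_norm.
Qed.

Lemma Int_eq0 f : ig f -> (forall x, 0 <= f x) -> \int[mu]_x f x = 0 ->
 f = (fun=> 0) %[ae mu].
Proof.
move=> fi f0 If.
have mf := ig_mes fi.
have /(_ measurableT) h := @ae_eq_integral_abs _ T R mu setT.
have [|h1 _] := h (EFin \o f); first exact/measurable_EFinP.
have : ae_eq mu setT (EFin \o f) (cst 0%E).
 apply: h1; under eq_integral do rewrite /= ger0_norm//.
 move: If; rewrite /Rintegral => /eqP; rewrite fine_eq0 => [/eqP//|].
 exact: integrable_fin_num.
by apply: filterS => x + _ => /(_ I) /= [].
Qed.

Lemma EFin_Int f : ig f -> (\int[mu]_x f x)%:E = (\int[mu]_x (f x)%:E)%E.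
Proof. move=> fi; rewrite fineK//; exact: integrable_fin_num. Qed.

Lemma ig_ge0P f C : mes f -> (forall x, 0 <= f x) ->
 (\int[mu]_x (f x)%:E <= C%:E)%E -> ig f /\ \int[mu]_x f x <= C.
Proof.
move=> mf f0 fC; have fi : ig f.
 apply/integrableP; split; first exact/measurable_EFinP.
 under eq_integral do rewrite /= ger0_norm//.
 by rewrite (le_lt_trans fC)// ltry.
by split => //; rewrite -lee_fin EFin_Int.
Qed.

Lemma DCT (f_ : nat -> T -> R) f g : (forall k, mes (f_ k)) -> mes f ->
 {ae mu, forall x, f_ ^~ x @ \oo --> f x} -> ig g ->
 {ae mu, forall x, forall k, `|f_ k x| <= g x} ->
 [/\ ig f, \int[mu]_x f_ k x @[k --> \oo] --> \int[mu]_x f x &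
   \int[mu]_x `|f_ k x-f x| @[k --> \oo] --> (0 : R)].
Proof.
move=> mf_ mf cf gi fg.
have fki k : ig (f_ k).
 by apply: (ig_le_ae (mf_ k) gi); apply: filterS fg => x /(_ k).
have [||||fi h1 h2] := @dominated_convergence _ T R mu _ measurableT
  (fun k => EFin \o f_ k) (EFin \o f) (EFin \o g) _ _ _ gi _.
- by move=> k; apply/measurable_EFinP.
- exact/measurable_EFinP.
- apply: filterS cf => x cfx _ /=; apply/fine_cvgP; split => //; exact: nearW.
- by apply: filterS fg => x fgx m _ /=; mfun.
split => //.
 have : EFin (\int[mu]_x f_ k x) @[k --> \oo] --> (\int[mu]_x f x)%:E.
  rewrite EFin_Int//; under eq_fun do rewrite EFin_Int//.
  pos.
 by move/fine_cvgP => [].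
have : EFin (\int[mu]_x `|f_ k x-f x|) @[k --> \oo] --> (0:R)%:E.
 under eq_fun do rewrite (EFin_Int (ig_norm (igB (fki _) fi))).
 pos.
by move/fine_cvgP => [].
Qed.

(** Packaged so that an eventual bound on the integrals gives both the integrability of the limit
    and the same bound for its integral. *)
Lemma Fatou (f_ : nat -> T -> R) f C : (forall k, ig (f_ k)) -> mes f ->
 (forall k x, 0 <= f_ k x) ->
 {ae mu, forall x, f_ ^~ x @ \oo --> f x} ->
 (\forall k \near \oo, \int[mu]_x f_ k x <= C) -> (forall x, 0 <= f x) ->
 ig f /\ \int[mu]_x f x <= C.
Proof.
move=> fi mf f0 cf IC f0'; apply: ig_ge0P => //.
have h := @fatou _ T R mu _ measurableT (fun k => EFin \o f_ k) _ _.
have -> : (\int[mu]_x (f x)%:E = \int[mu]_x limn_einf (fun k => (f_ k x)%:E))%E.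
 apply: ae_eq_integral => //.
 - exact/measurable_EFinP.
 - rewrite (_ : (fun _ => _) =
   fun x => (- limn_esup (fun k => - (f_ k x)%:E))%E); last first.
   apply/funext => x; rewrite -limn_einfN; congr limn_einf.
   apply/funext => k; exact/esym/oppeK.
  apply: measurableT_comp => //; apply: measurable_fun_limn_esup => k.
  apply: measurableT_comp => //; exact/measurable_EFinP/ig_mes.
 - apply: filterS cf => x cfx _ /=; apply/esym.
  have : (f_ k x)%:E @[k --> \oo] --> (f x)%:E.
   apply/fine_cvgP; split => //; exact: nearW.
  by move/cvg_limn_einf_sup => [].
apply: le_trans (h _ _) _.
- move=> k; exact/measurable_EFinP/ig_mes.
- by move=> k x _; mfun.
rewrite limn_einf_lim; apply: lime_le; first exact: is_cvg_einfs.
near=> n.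
have ICn : \int[mu]_x f_ n x <= C by near: n.
apply: le_trans (_ : (\int[mu]_x f_ n x)%:E <= _)%E => //.
rewrite EFin_Int//; apply: ereal_inf_lbound; exists n => //=.
Unshelve. all: by end_near. Qed.

End measure_tools.

(** * Extraction of subsequences *)

Section subsequences.
Context {R : realType}.

Lemma subseq_ex (P : nat -> nat -> Prop) :
 (forall j n, exists2 k, (n <= k)%N & P j k) ->
 exists2 s : nat -> nat, {homo s : i j/(i < j)%N} & forall j, P j (s j).
Proof.
move=> h0; have h j n := cid2 (h0 j n).
pose F := fix F j := match j with 0 => s2val (h 0 0) | j'.+1 => s2val (h j'.+1 (F j').+1) end.
exists F.
 apply: homo_ltn => [y x z|i /=]; first exact: ltn_trans.
 exact: (s2valP (h i.+1 (F i).+1)).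
by case=> [|j]; [exact: (s2valP' (h 0 0))|exact: (s2valP' (h j.+1 (F j).+1))].
Qed.

Lemma subseq_near (P : nat -> nat -> Prop) :
 (forall j, \forall k \near \oo, P j k) ->
 exists2 s : nat -> nat, {homo s : i j/(i < j)%N} & forall j, P j (s j).
Proof.
move=> h; apply: subseq_ex => j n; have [m _ hm] := h j.
by exists (maxn n m); rewrite ?leq_maxl//; apply: hm; rewrite /= leq_maxr.
Qed.

Lemma homo_ge_id (s : nat -> nat) : {homo s : i j/(i < j)%N} ->
 forall n, (n <= s n)%N.
Proof. by move=> sh; elim=> // n IH; apply: leq_ltn_trans IH (sh _ _ _). Qed.

Lemma homo_cvg (s : nat -> nat) : {homo s : i j/(i < j)%N} -> s @ \oo --> \oo.
Proof.
move=> sh A [n _ nA]; exists n => // k /= nk; apply: nA => /=.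
apply: leq_trans nk _; exact: homo_ge_id.
Qed.

Lemma homo_comp (s t : nat -> nat) : {homo s : i j/(i < j)%N} ->
 {homo t : i j/(i < j)%N} -> {homo (s \o t) : i j/(i < j)%N}.
Proof. by move=> sh th i j ij /=; apply/sh/th. Qed.

Lemma cvg_sub {U : topologicalType} (s : nat -> nat) (u : nat -> U) (l : U) :
 {homo s : i j/(i < j)%N} -> u k @[k --> \oo] --> l ->
 u (s k) @[k --> \oo] --> l.
Proof. by move=> /homo_cvg sc ul; apply: cvg_comp sc ul. Qed.

Lemma near_sub (s : nat -> nat) (P : nat -> Prop) :
 {homo s : i j/(i < j)%N} -> (\forall k \near \oo, P k) ->
 \forall k \near \oo, P (s k).
Proof. move=> /homo_cvg sc; cv. Qed.

Lemma compact_subseq {U : pseudoMetricType R} (K : set U) (u : nat -> U) :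
 compact K -> (forall k, K (u k)) ->
 exists l, exists s : nat -> nat, [/\ K l, {homo s : i j/(i < j)%N} &
  u (s k) @[k --> \oo] --> l].
Proof.
move=> cK Ku; have uK : (u @ \oo) K by exists 0%N => // k _.
have [l [Kl cl]] := cK _ _ uK.
have [j n|s sh sP] := @subseq_ex (fun j k => ball l (j.+1%:R^-1 : R) (u k)).
 have [|//|y [[k nk <-] yb]] := cl [set u k | k in [set k | (n <= k)%N]]
  (ball l (j.+1%:R^-1 : R)).
 - by exists n => // k /= nk; exists k.
 - by apply: nbhsx_ballx.
 by exists k.
exists l, s; split => //; apply/cvg_ballP => e e0; near=> k.
apply: le_ball (sP k); apply/ltW; near: k; exact: near_infty_natSinv_lt (PosNum e0).
Unshelve. all: by end_near. Qed.

Lemma bounded_subseq (u : nat -> R) (C : R) : (forall k, `|u k| <= C) ->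
 exists2 s : nat -> nat, {homo s : i j/(i < j)%N} & cvgn (u \o s).
Proof.
move=> uC; have [|l [s [_ sh sl]]] := @compact_subseq R^o `[- C, C] u (@segment_compact R _ _) _.
 by move=> k /=; rewrite in_itv/= -ler_norml.
by exists s => //; apply/cvg_ex; exists l.
Qed.

Lemma diag_subseq (a : nat -> nat -> R) (C : nat -> R) :
 (forall i k, `|a i k| <= C i) ->
 exists2 s : nat -> nat, {homo s : i j/(i < j)%N} &
  forall i, cvgn (fun k => a i (s k)).
Proof.
move=> aC.
have ex i (t : nat -> nat) : {s : nat -> nat | {homo s : i j/(i < j)%N} /\
  cvgn (fun k => a i (t (s k)))}.
 apply: cid; have [|s sh sc] := @bounded_subseq (a i \o t) (C i).
  by move=> k /=.
 by exists s.
pose S := fix S i := match i with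
 | 0 => sval (ex 0 id)
 | i'.+1 => S i' \o sval (ex i'.+1 (S i')) end.
have Sh i : {homo S i : k l/(k < l)%N}.
 elim: i => [|i IH] /=; first by case: (ex _ _) => ? [].
 by apply: homo_comp => //; case: (ex _ _) => ? [].
have Sc i : cvgn (fun k => a i (S i k)).
 by case: i => [|i] /=; case: (ex _ _) => ? [].
(* Every later extraction runs through [S i] along indices [t k >= k]; from rank [i] on, the
   diagonal therefore inherits the convergence of row [i]. *)
have Ssub i n : exists2 t : nat -> nat, (forall k, (k <= t k)%N) &
  forall k, S (i+n)%N k = S i (t k).
 elim: n => [|n [t th tE]]; first by exists id => // k; rewrite addn0.
 rewrite addnS /=; case: (ex _ _) => s [sh _] /=; exists (t \o s) => k /=.
  apply: leq_trans (th _); exact: homo_ge_id.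
 mfun.
exists (fun k => S k k).
 apply: homo_ltn => [y x z|i]; first exact: ltn_trans.
 have [t th tE] := Ssub i 1%N; rewrite addn1 in tE; rewrite tE.
 mfun.
move=> i; have /cvg_ex[l hl] := Sc i; apply/cvg_ex; exists l.
apply/cvgrPdist_lt => e e0; move/cvgrPdist_lt : hl => /(_ _ e0)[n _ hn].
exists (maxn i n) => // k /=; rewrite geq_max => /andP[ik nk].
have [t th tE] := Ssub i (k-i)%N; rewrite subnKC// in tE; rewrite tE.
by apply: hn => /=; apply: leq_trans nk (th _).
Qed.

End subsequences.

(** * The L^2 norm on a measure space *)

Section L2_tools.
Context d (T : measurableType d) (R : realType).
Variable mu : {measure set T -> \bar R}.
Implicit Types f g h : T -> R.

Notation mes f := (measurable_fun [set: T] f).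
Notation ig f := (mu.-integrable [set: T] (EFin \o f)).

Definition L2 f := mes f /\ ig (fun x => f x^+2).

Lemma L2_mul f g : L2 f -> L2 g -> ig (fun x => f x*g x).
Proof.
move=> [mf fi] [mg gi]; apply: (ig_le _ (igD fi gi)); first mfun.
move=> x; rewrite ler_norml; apply/andP; split; nra.
Qed.

Lemma L2D f g : L2 f -> L2 g -> L2 (fun x => f x+g x).
Proof.
move=> [mf fi] [mg gi]; split; first mfun.
apply: (ig_le _ (igZ 2 (igD fi gi))); first mfun.
move=> x; rewrite ger0_norm ?sqr_ge0; have := sqr_ge0 (f x-g x); pos.
Qed.

Lemma L2Z k f : L2 f -> L2 (fun x => k*f x).
Proof.
move=> [mf fi]; split; first mfun.
under eq_fun do rewrite exprMn; exact: igZ.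
Qed.

Lemma L2opp f : L2 f -> L2 (fun x => - f x).
Proof. by move=> [mf fi]; split; [mfun|under eq_fun do rewrite sqrrN]. Qed.

Lemma L2B f g : L2 f -> L2 g -> L2 (fun x => f x-g x).
Proof. move=> fi gi; apply: L2D => //; exact: L2opp. Qed.

Lemma L2_0 : L2 (fun=> 0).
Proof. split => //; under eq_fun do rewrite expr0n/=; exact: ig0. Qed.

Lemma L2_sum (I : Type) (s : seq I) (F : I -> T -> R) :
 (forall i, L2 (F i)) -> L2 (fun x => \sum_(i <- s) F i x).
Proof.
move=> iF; elim: s => [|i s IH].
 under eq_fun do rewrite big_nil; exact: L2_0.
under eq_fun do rewrite big_cons; exact: L2D.
Qed.

Lemma L2_le f g : mes f -> L2 g -> (forall x, `|f x| <= `|g x|) -> L2 f.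
Proof.
move=> mf [mg gi] fg; split => //; apply: (ig_le _ gi); first mfun.
by move=> x; rewrite normrX -(real_normK (num_real (g x))) ler_pXn2r.
Qed.

Lemma L2_aeeq f g : mes f -> L2 g -> f = g %[ae mu] -> L2 f.
Proof.
move=> mf [mg gi] fg; split => //; apply: (ig_aeeq _ gi); first mfun.
by apply: filterS fg => x /(_ I) -> _.
Qed.

Lemma Int_sqD f g : L2 f -> L2 g ->
 \int[mu]_x (f x+g x)^+2 =
 \int[mu]_x f x^+2+2*\int[mu]_x (f x*g x)+\int[mu]_x g x^+2.
Proof.
move=> fL gL; have fg := L2_mul fL gL.
rewrite -IntZ// -IntD; [|exact: fL.2|exact: igZ].
rewrite -IntD; [|exact: igD fL.2 (igZ _ fg)|exact: gL.2].
apply: Int_ext => x; pos.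
Qed.

(** Discriminant argument: the integral of [(f + t g)^2] is a nonnegative polynomial in [t],
    evaluated at its minimum, or, when [g] has norm 0, at a [t] that makes the affine function equal
    to -1. *)
Lemma CS_sq f g : L2 f -> L2 g ->
 (\int[mu]_x (f x*g x))^+2 <= \int[mu]_x f x^+2*\int[mu]_x g x^+2.
Proof.
move=> fL gL.
set F := \int[mu]_x f x^+2; set G := \int[mu]_x g x^+2; set H := \int[mu]_x _.
have h t : 0 <= F+2*(t*H)+t^+2*G.
 have -> : F+2*(t*H)+t^+2*G = \int[mu]_x (f x+t*g x)^+2.
  rewrite Int_sqD//; last exact: L2Z.
  congr (_+2*_ + _).
   by rewrite -IntZ//; [apply: Int_ext => x; ring|exact: L2_mul].
  by rewrite -IntZ//; [apply: Int_ext => x; ring|exact: gL.2].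
 apply: Int_ge0 => x; pos.
have : 0 <= G by apply: Int_ge0 => x; exact: sqr_ge0.
rewrite le_eqVlt => /predU1P[G0|G0].
 have [->|H0] := eqVneq H 0; first by rewrite -G0 mulr0 expr0n.
 have := h (- (F+1)/(2*H)); rewrite -G0 mulr0 addr0.
 have -> : F+2*(- (F+1)/(2*H)*H) = -1 by field.
 pos.
have := h (- H/G).
have -> : F+2*(- H/G*H)+(- H/G)^+2*G = (F*G-H^+2)/G.
 field; pos.
by rewrite pmulr_lge0 ?invr_gt0// subr_ge0.
Qed.

Definition n2 f := Num.sqrt (\int[mu]_x f x^+2).

Lemma n2_ge0 f : 0 <= n2 f. Proof. pos. Qed.

Lemma n2_sq f : n2 f^+2 = \int[mu]_x f x^+2.
Proof. rewrite sqr_sqrtr//; apply: Int_ge0 => x; pos. Qed.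

Lemma CS f g : L2 f -> L2 g -> `|\int[mu]_x (f x*g x)| <= n2 f*n2 g.
Proof.
move=> fL gL; rewrite -(@ler_pXn2r _ 2) ?nnegrE ?mulr_ge0 ?n2_ge0//.
rewrite exprMn !n2_sq real_normK ?num_real//; exact: CS_sq.
Qed.

Lemma CS_abs f g : L2 f -> L2 g -> \int[mu]_x `|f x*g x| <= n2 f*n2 g.
Proof.
move=> fL gL.
have aL h : L2 h -> L2 (fun x => `|h x|).
 by move=> hL; apply: (L2_le _ hL) => [|x]; [mfun; exact: hL.1|rewrite normr_id].
have := CS (aL _ fL) (aL _ gL).
rewrite ger0_norm; last by apply: Int_ge0 => x.
under eq_Rintegral do rewrite -normrM.
move=> /le_trans; apply; rewrite ler_pM ?n2_ge0// /n2; by under eq_Rintegral do rewrite real_normK ?num_real//.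
Qed.

Lemma n2D f g : L2 f -> L2 g -> n2 (fun x => f x+g x) <= n2 f+n2 g.
Proof.
move=> fL gL; rewrite -(@ler_pXn2r _ 2) ?nnegrE ?addr_ge0 ?n2_ge0//.
rewrite n2_sq Int_sqD// sqrrD !n2_sq lerD2r lerD2l -[leRHS]mulr_natl ler_pM2l//.
by rewrite (le_trans (ler_norm _))// CS.
Qed.

Lemma n2Z k f : L2 f -> n2 (fun x => k*f x) = `|k|*n2 f.
Proof.
move=> fL; rewrite /n2; under eq_Rintegral do rewrite exprMn.
by rewrite IntZ; [rewrite sqrtrM ?sqr_ge0// sqrtr_sqr|exact: fL.2].
Qed.

Lemma n2N f : n2 (fun x => - f x) = n2 f.
Proof. by rewrite /n2; under eq_Rintegral do rewrite sqrrN. Qed.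

Lemma n2B f g : n2 (fun x => f x-g x) = n2 (fun x => g x-f x).
Proof. rewrite -n2N; congr n2; apply/funext => x; pos. Qed.

Lemma n2_le f g : L2 f -> L2 g -> (forall x, `|f x| <= `|g x|) -> n2 f <= n2 g.
Proof.
move=> fL gL fg; rewrite ler_wsqrtr//; apply: Int_le; [exact: fL.2|exact: gL.2|].
move=> x; rewrite -(real_normK (num_real (f x))) -(real_normK (num_real (g x))).
by rewrite ler_pXn2r.
Qed.

Lemma n2_sum (I : Type) (s : seq I) (F : I -> T -> R) :
 (forall i, L2 (F i)) -> n2 (fun x => \sum_(i <- s) F i x) <= \sum_(i <- s) n2 (F i).
Proof.
move=> iF; elim: s => [|i s IH].
 under eq_fun do rewrite big_nil.
 by rewrite big_nil /n2; under eq_Rintegral do rewrite expr0n/=; rewrite Int0 sqrtr0.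
under eq_fun do rewrite big_cons.
rewrite big_cons (le_trans (n2D _ _)) ?lerD2l//; exact: L2_sum.
Qed.

Lemma n2_eq0 f : L2 f -> n2 f = 0 -> f = (fun=> 0) %[ae mu].
Proof.
move=> [mf fi] f0; have := n2_sq f; rewrite f0 expr0n/= => /esym.
move=> /(Int_eq0 fi (fun x => sqr_ge0 (f x))).
by apply: filterS => x /(_ I) /eqP; rewrite sqrf_eq0 => /eqP.
Qed.

Lemma n2_aeeq f g : mes f -> mes g -> f = g %[ae mu] -> n2 f = n2 g.
Proof.
move=> mf mg fg; rewrite /n2; congr Num.sqrt; apply: Int_aeeq; try by mfun.
by apply: filterS fg => x /(_ I) -> _.
Qed.

End L2_tools.

Ltac li := solve [repeat first
 [ hyp | done | solve [auto 2 with li nocore] | exact: L2_mul | apply: igD | apply: igB | apply: igZ | apply: ig_norm | apply: L2D | apply: L2B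
 | apply: L2Z | apply: igN ]].

(** * Completeness of L^2 and representation of weak limits *)

Section L2_complete.
Context d (T : measurableType d) (R : realType).
Variable mu : {measure set T -> \bar R}.
Implicit Types f g h : T -> R.

Notation mes f := (measurable_fun [set: T] f).
Notation ig f := (mu.-integrable [set: T] (EFin \o f)).
Notation L2 := (L2 mu).
Notation n2 := (n2 mu).

Lemma ae_lim_ex (f_ : nat -> T -> R) : (forall k, mes (f_ k)) ->
 {ae mu, forall x, cvgn (f_ ^~ x)} ->
 exists2 f : T -> R, mes f & {ae mu, forall x, f_ ^~ x @ \oo --> f x}.
Proof.
move=> mf cf; exists (fun x => fine (limn_esup (fun k => (f_ k x)%:E))).
 apply: (measurableT_comp (fine_measurable measurableT)) => //.
 apply: measurable_fun_limn_esup => k; exact/measurable_EFinP.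
apply: filterS cf => x /cvg_ex[l fl].
have /cvg_limn_einf_sup[_ ->//] : (f_ k x)%:E @[k --> \oo] --> l%:E.
apply/fine_cvgP; split => //; exact: nearW.
Qed.

(* The weighted sum of the squared increments has a finite integral, so almost
  everywhere the increments are [O(2^-j)]. *)
Lemma ae_cvg_fast (f_ : nat -> T -> R) : (forall k, mes (f_ k)) ->
 (forall j, ig (fun x => (f_ j.+1 x-f_ j x)^+2)) ->
 (forall j, \int[mu]_x (f_ j.+1 x-f_ j x)^+2 <= (8^-1)^+j) ->
 {ae mu, forall x, cvgn (f_ ^~ x)}.
Proof.
move=> mf fi If.
pose G j x := (4^+j*(f_ j.+1 x-f_ j x)^+2)%:E.
have G0 j x : (0 <= G j x)%E by pos.
have mG j : measurable_fun setT (G j) by apply/measurable_EFinP; mfun.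
have IG : (\int[mu]_x (\sum_(j <oo) G j x) < +oo)%E.
 rewrite integral_nneseries//.
 apply: (@le_lt_trans _ _ (2%:E)); last exact: ltry.
 apply: lime_le.
  apply: is_cvg_nneseries => k _ _; exact: integral_ge0.
 apply: nearW => n.
 have le1 : (\sum_(0 <= j < n) \int[mu]_x G j x <= \sum_(0 <= j < n) ((2^-1)^+j)%:E)%E.
  apply: lee_sum => j _; rewrite -EFin_Int; last li.
  rewrite lee_fin IntZ// -ler_pdivlMl ?exprn_gt0//.
  by rewrite -exprVn -exprMn; have -> : 4^-1*2^-1 = 8^-1 :> R by field.
 apply: le_trans le1 _; rewrite sumEFin lee_fin.
 have -> : \sum_(0 <= j < n) (2^-1 : R)^+j = 2-2*(2^-1)^+n.
  elim: n => [|n IH]; first by rewrite big_geq// mulr1 subrr.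
  rewrite big_nat_recr//= IH exprS; pos.
 by rewrite gerBl mulr_ge0//.
have /integrable_ae : mu.-integrable setT (fun x => \sum_(j <oo) G j x)%E.
 apply/integrableP; split; first exact: ge0_emeasurable_sum.
 by under eq_integral do rewrite gee0_abs ?nneseries_ge0//.
move=> /(_ measurableT); apply: filterS => x /(_ I) Gx.
pose S := fine (\sum_(j <oo) G j x)%E.
have GS j : 4^+j*(f_ j.+1 x-f_ j x)^+2 <= S.
 rewrite -lee_fin fineK//.
 apply: le_trans (nneseries_lim_ge j.+1 (fun k _ _ => G0 k x)).
 by rewrite big_nat_recr//= leeDr// sume_ge0.
have S0 : 0 <= S by apply: le_trans (GS 0%N); rewrite mul1r sqr_ge0.
have fS j : `|f_ j.+1 x-f_ j x| <= Num.sqrt S*(2^-1)^+j.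
 rewrite -(@ler_pXn2r _ 2) ?nnegrE ?mulr_ge0 ?exprn_ge0//.
 rewrite real_normK ?num_real// exprMn sqr_sqrtr// -exprM mulnC exprM.
 rewrite -[_*_]mulrC -ler_pdivrMl ?exprn_gt0 ?exprn_even_gt0//.
 by rewrite -exprVn; have -> : ((2^-1)^+2)^-1 = 4 :> R by field.
apply/cvg_ex.
have : cvgn (series (fun j => f_ j.+1 x-f_ j x)).
 apply: normed_cvg; apply: (series_le_cvg _ _ fS) => [j|j|]; first li.
  li.
 by apply: is_cvg_geometric_series; rewrite ger0_norm// invf_lt1// ltr1n.
move=> /cvg_ex[l fl]; exists (l+f_ 0%N x).
have -> : f_^~ x = (fun n => series (fun j => f_ j.+1 x-f_ j x) n+f_ 0%N x).
 apply/funext => n; rewrite /series/=.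
 by rewrite (telescope_sumr (fun j => f_ j x))// subrK.
cv.
Qed.

(** Riesz-Fischer: a subsequence with squared increments at most [8^-j] converges almost everywhere,
    and Fatou applied to [f_ (s j) - f_ n] in [j] turns the Cauchy bound into convergence in
    norm. *)
Lemma L2_complete (f_ : nat -> T -> R) : (forall k, L2 (f_ k)) ->
 (forall e, 0 < e -> \forall n \near \oo, forall k, (n <= k)%N ->
   \int[mu]_x (f_ k x-f_ n x)^+2 <= e) ->
 exists2 f, L2 f & \int[mu]_x (f_ k x-f x)^+2 @[k --> \oo] --> (0 : R).
Proof.
move=> fL fC.
have [j|s sh sP] := @subseq_near (fun j n => forall k, (n <= k)%N ->
  \int[mu]_x (f_ k x-f_ n x)^+2 <= (8^-1)^+j).
 mfun.
have BL i j : L2 (fun x => f_ i x-f_ j x) by exact: L2B.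
have [||f mf ff] := @ae_lim_ex (fun j => f_ (s j)).
- move=> k; exact: (fL _).1.
- apply: ae_cvg_fast => [k|j|j]; [cv|li|].
 apply: sP; exact/ltnW/sh.
have main e : 0 < e -> \forall n \near \oo, L2 (fun x => f x-f_ n x) /\
  \int[mu]_x (f x-f_ n x)^+2 <= e.
 move=> e0; have := fC _ e0; apply: filterS => n hn.
 have [||||||h1 h2] := @Fatou _ T R mu (fun j x => (f_ (s j) x-f_ n x)^+2)
   (fun x => (f x-f_ n x)^+2) e.
 - move=> k; li.
 - mfun.
 - move=> k x; pos.
 - apply: filterS ff => x fx; rewrite expr2; under eq_fun do rewrite expr2.
  cv.
 - near=> k; apply: hn; apply: leq_trans (homo_ge_id sh k).
  near: k; exact: nbhs_infty_ge.
 - move=> x; pos.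
 split => //; split => //; mfun; exact: (fL _).1.
exists f.
 have [n [h _]] := filter_ex (main 1 ltr01).
 have -> : f = (fun x => (f x-f_ n x)+f_ n x).
  apply/funext => x; pos.
 li.
apply/cvgrPdist_le => e e0; have := main _ e0; apply: filterS => n [_].
rewrite sub0r normrN ger0_norm; last by apply: Int_ge0 => x; exact: sqr_ge0.
by under eq_Rintegral do rewrite -sqrrN opprB.
Unshelve. all: by end_near. Qed.

Lemma cvg_n2P (f_ : nat -> T -> R) f :
 (\int[mu]_x (f_ k x-f x)^+2 @[k --> \oo] --> (0 : R)) <->
 (n2 (fun x => f_ k x-f x) @[k --> \oo] --> (0 : R)).
Proof.
split => h.
 rewrite -[X in _ --> X](@sqrtr0 R); apply: continuous_cvg h; exact: sqrt_continuous.
rewrite (_ : (fun _ => _) = fun k => n2 (fun x => f_ k x-f x)*n2 (fun x => f_ k x-f x)); last first.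
 by apply/funext => k; rewrite -expr2 n2_sq.
rewrite -[X in _ --> X](mulr0 0); exact: cvgM.
Qed.

Lemma cvg_Int_mul (f_ : nat -> T -> R) f g : (forall k, L2 (f_ k)) -> L2 f -> L2 g ->
 n2 (fun x => f_ k x-f x) @[k --> \oo] --> (0 : R) ->
 \int[mu]_x (f_ k x*g x) @[k --> \oo] --> \int[mu]_x (f x*g x).
Proof.
move=> fkL fL gL h; apply/subr_cvg0.
apply/norm_cvg0P; apply: (@squeeze_cvgr _ _ _ _ (fun=> 0) (fun k => n2 (fun x => f_ k x-f x)*n2 g)).
- apply: nearW => k; rewrite normr_ge0 /=.
 rewrite -IntB; [|li|li].
 under eq_Rintegral do rewrite -mulrBl.
 apply: CS => //; exact: L2B.
- cv.
- rewrite -[X in _ --> X](mul0r (n2 g)); apply: cvgM => //; cv.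
Qed.

Lemma cvg_n2 (f_ : nat -> T -> R) f : (forall k, L2 (f_ k)) -> L2 f ->
 n2 (fun x => f_ k x-f x) @[k --> \oo] --> (0 : R) ->
 n2 (f_ k) @[k --> \oo] --> n2 f.
Proof.
move=> fkL fL h; apply/subr_cvg0/norm_cvg0P.
apply: (@squeeze_cvgr _ _ _ _ (fun=> 0) (fun k => n2 (fun x => f_ k x-f x))) => //; last cv.
apply: nearW => k; rewrite normr_ge0/= ler_norml.
have h1 : n2 (f_ k) <= n2 (fun x => f_ k x-f x)+n2 f.
 have := n2D (L2B (fkL k) fL) fL; by under [X in n2 X]eq_fun do rewrite subrK.
have h2 : n2 f <= n2 (fun x => f_ k x-f x)+n2 (f_ k).
 have := n2D (L2B fL (fkL k)) (fkL k); rewrite n2B.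
 by under [X in n2 X]eq_fun do rewrite subrK.
apply/andP; split; lra.
Qed.

(** Closure of a tail under midpoints: the only convex combinations that the parallelogram identity
    uses. By induction on it, a pairing that is close to its limit on the tail stays close on the
    hull. *)
Inductive mid_hull (G : nat -> T -> R) (n : nat) : (T -> R) -> Prop :=
| mid_hull_elt k : (n <= k)%N -> mid_hull G n (G k)
| mid_hull_mid f g : mid_hull G n f -> mid_hull G n g ->
  mid_hull G n (fun x => 2^-1*(f x+g x)).

(* A sequence of almost minimal elements of the convex hulls of the tails is
  Cauchy by the parallelogram identity. *)
Lemma L2_weak_limit (g_ : nat -> T -> R) (C : R) (P : (T -> R) -> Prop)
  (l : (T -> R) -> R) : (forall k, L2 (g_ k)) -> (forall k, n2 (g_ k) <= C) ->
 (forall phi, P phi -> L2 phi) ->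
 (forall phi, P phi -> \int[mu]_x (g_ k x * phi x) @[k --> \oo] --> l phi) ->
 exists2 g, L2 g & n2 g <= C /\ forall phi, P phi -> \int[mu]_x (g x * phi x) = l phi.
Proof.
move=> gL gC PL gl.
have hL n f : mid_hull g_ n f -> L2 f.
 elim=> // {}f g _ fL _ {}gL'; li.
have hC n f : mid_hull g_ n f -> n2 f <= C.
 elim=> // {}f g fh fC gh gC'; have fL := hL _ _ fh; have gL' := hL _ _ gh.
 rewrite n2Z; last li.
 rewrite ger0_norm// ler_pdivrMl// (le_trans (n2D fL gL')); lra.
have hS n m f : (n <= m)%N -> mid_hull g_ m f -> mid_hull g_ n f.
 move=> nm; elim=> [k mk|{}f g _ hf _ hg]; last exact: mid_hull_mid.
 exact/mid_hull_elt/(leq_trans nm).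
pose A n := [set n2 f | f in mid_hull g_ n].
have A0 n : A n !=set0 by exists (n2 (g_ n)); exists (g_ n) => //; exact: mid_hull_elt.
have Al n : lbound (A n) 0 by move=> _ [f _ <-]; exact: n2_ge0.
have Ainf n : has_inf (A n) by split => //; exists 0.
pose D n := inf (A n).
have D0 n : 0 <= D n by apply: lb_le_inf => //.
have Dle n f : mid_hull g_ n f -> D n <= n2 f.
 by move=> fh; apply: ge_inf; [exists 0; exact: Al|exists f].
have DC n : D n <= C by apply: le_trans (Dle _ _ _) (gC n); exact: mid_hull_elt.
have Dnd : nondecreasing_seq D.
 move=> n m nm; apply: lb_le_inf => // _ [f fh <-]; apply: Dle; exact: hS fh.
have Dcv : cvgn D by apply: nondecreasing_is_cvgn => //; exists C => _ [n _ <-].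
pose L := limn D.
have DL n : D n <= L by exact: nondecreasing_cvgn_le.
have L0 : 0 <= L := le_trans (D0 0%N) (DL 0%N).
have /all_sig2[a ah aD] n : {f | mid_hull g_ n f & n2 f < D n+n.+1%:R^-1}.
 apply: cid2; have [|_ [f fh <-] h] := @inf_adherent R (A n) n.+1%:R^-1 _ (Ainf n).
  li.
 by exists f.
have aL n : L2 (a n) := hL _ _ (ah n).
have inv0 : (n.+1%:R^-1 : R) @[n --> \oo] --> (0 : R).
 by have := @cvg_harmonic R.
have [e e0|g gL' ga] := @L2_complete a aL.
 have c1 : 2*(D n+n.+1%:R^-1)^+2+2*(L+n.+1%:R^-1)^+2-4*D n^+2 @[n --> \oo]
   --> 2*(L+0)^+2+2*(L+0)^+2-4*L^+2.
  apply: cvgB; [apply: cvgD|]; (apply: cvgM; first exact: cvg_cst); rewrite expr2; under eq_fun do rewrite expr2; apply: cvgM => //; apply: cvgD => //; cv.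
 have : 2*(L+0)^+2+2*(L+0)^+2-4*L^+2 < e by pos.
 move=> /(cvgr_lt _ c1); apply: filterS => n hn k nk.
 have akn : mid_hull g_ n (a k) := hS _ _ _ nk (ah k).
 have mid : D n^+2 <= \int[mu]_x (2^-1*(a k x+a n x))^+2.
  rewrite -n2_sq ler_pXn2r ?nnegrE ?n2_ge0//; apply: Dle; exact: mid_hull_mid.
 have -> : \int[mu]_x (a k x-a n x)^+2 =
   2*n2 (a k)^+2+2*n2 (a n)^+2-4*\int[mu]_x (2^-1*(a k x+a n x))^+2.
  rewrite !n2_sq -!IntZ; [|exact: (L2Z _ (L2D _ _)).2|li|li].
  rewrite -IntD; [|li|li].
  rewrite -IntB; last 2 first.
  - li.
  - exact: igZ (L2Z _ (L2D (aL k) (aL n))).2.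
  apply: Int_ext => x; pos.
 have k1 : n2 (a k) <= L+n.+1%:R^-1.
  rewrite (le_trans (ltW (aD k)))// lerD// lef_pV2 ?posrE ?ltr0n// ler_nat//.
 have k2 := ltW (aD n).
 have : n2 (a k)^+2 <= (L+n.+1%:R^-1)^+2.
  by rewrite ler_pXn2r ?nnegrE ?n2_ge0// addr_ge0//.
 have : n2 (a n)^+2 <= (D n+n.+1%:R^-1)^+2.
  by rewrite ler_pXn2r ?nnegrE ?n2_ge0// addr_ge0//.
 move=> an ak; apply: le_trans (ltW hn).
 by rewrite lerB ?ler_pM2l// [leLHS]addrC lerD// ler_pM2l.
exists g => //.
have ga2 := (cvg_n2P a g).1 ga; split.
 have := cvg_n2 aL gL' ga2 => h.
 apply: (ler_cvg_to h (cvg_cst C)); apply: nearW => n; cv.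
move=> phi Pphi; have phiL := PL _ Pphi.
have c1 := cvg_Int_mul aL gL' phiL ga2.
suff c2 : \int[mu]_x (a k x * phi x) @[k --> \oo] --> l phi.
 exact: (cvg_unique _ c1 c2).
apply/cvgrPdist_le => e e0.
have /cvgrPdist_le/(_ _ e0)[n _ hn] := gl _ Pphi.
exists n => // k /= nk.
suff : forall m f, mid_hull g_ m f -> (n <= m)%N -> `|l phi-\int[mu]_x (f x * phi x)| <= e.
 by apply.
move=> m f fh nm; elim: fh => [j mj|{}f h fh IHf hh IHh].
 apply: hn => /=; exact: leq_trans mj.
have fL := hL _ _ fh; have hL' := hL _ _ hh.
have -> : \int[mu]_x (2^-1*(f x+h x) * phi x) =
  2^-1*(\int[mu]_x (f x * phi x)+\int[mu]_x (h x * phi x)).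
 rewrite -IntD; [|li|li].
 rewrite -IntZ; last by apply: igD; exact: L2_mul.
 apply: Int_ext => x; pos.
move: IHf IHh; rewrite !ler_norml => /andP[? ?] /andP[? ?]; apply/andP; split; lra.
Qed.

End L2_complete.

(** * Lebesgue measure on row vectors: boxes and affine changes of variables *)

Section boxes.
Context {R : realType} {N : nat}.
Local Notation E := 'rV[R]_N.
Local Notation mu := (@lebesgue_rV R N).

Definition box (a b : E) : set E :=
 [set x | forall i, a ord0 i < x ord0 i < b ord0 i].

Definition boxes : set (set E) := [set A | exists a b, A = box a b].

Lemma box_rect a b :
 box a b = [set x | forall i, `]a ord0 i, b ord0 i[%classic (x ord0 i)].
Proof. li. Qed.

Lemma measurable_box a b : measurable (box a b).
Proof.
rewrite box_rect [X in measurable X](_ : _ =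
  \bigcap_i ((fun x : E => x ord0 i) @^-1` `]a ord0 i, b ord0 i[%classic)).
 apply: fin_bigcap_measurable => // i _.
 by rewrite -[X in measurable X]setTI; apply: measurable_coord => //.
by apply/seteqP; split => x /= h i; [move=> _; exact: h|exact: h].
Qed.

Lemma boxI a b c d : box a b `&` box c d =
 box (\row_i Num.max (a ord0 i) (c ord0 i)) (\row_i Num.min (b ord0 i) (d ord0 i)).
Proof.
apply/seteqP; split => x /=.
 by move=> [h k] i; rewrite !mxE gt_max lt_min; have /andP[-> ->] := h i; mfun.
move=> h; split=> i; have := h i; rewrite !mxE gt_max lt_min => /andP[/andP[a1 a2] /andP[b1 b2]];
 exact/andP.
Qed.

Lemma boxes_setI : setI_closed boxes.
Proof. by move=> _ _ [a [b ->]] [c [d ->]]; rewrite boxI; do 2 eexists. Qed.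

(** The norm on row vectors is the sup norm, so that balls are cubes. *)
Lemma ball_box (x : E) r : 0 < r -> ball x r = box (x-const_mx r) (x+const_mx r).
Proof.
move=> r0; apply/seteqP; split => y /=.
 by move=> [_ h] i; have := h ord0 i; rewrite /ball/= !mxE distrC ltr_distl.
move=> h; split => // i j; rewrite (ord1 i) /ball/= distrC ltr_distl.
by have := h j; rewrite !mxE.
Qed.

Lemma measurable_ballE (x : E) r : measurable (ball x r).
Proof.
have [r0|r0] := ltP 0 r; first by rewrite ball_box//; exact: measurable_box.
rewrite (_ : ball x r = set0) ?measurable0//; apply/seteqP; split => // y [].
pos.
Qed.

Lemma normE_bigmax (x : E) : `|x| = \big[Num.max/0]_ij `|x ij.1 ij.2|.
Proof. by rewrite -mx_normrE. Qed.

Lemma coord_norm (x : E) j : `|x ord0 j| <= `|x|.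
Proof. by rewrite normE_bigmax; apply: (le_bigmax _ _ (ord0, j)). Qed.

Lemma norm_le_coord (x : E) (c : R) : 0 <= c -> (forall j, `|x ord0 j| <= c) -> `|x| <= c.
Proof.
move=> c0 h; rewrite normE_bigmax; apply/bigmax_leP; split => // -[i j] _ /=.
by rewrite (ord1 i).
Qed.

Lemma norm_lt_coord (x : E) (c : R) : 0 < c -> (forall j, `|x ord0 j| < c) -> `|x| < c.
Proof.
move=> c0 h; rewrite normE_bigmax; apply/bigmax_ltP; split => // -[i j] _ /=.
by rewrite (ord1 i).
Qed.

Lemma boxes_generate : @measurable _ E = <<s boxes >>.
Proof.
apply/seteqP; split; last first.
 apply: smallest_sub; first exact: sigma_algebra_measurable.
 move=> _ [a [b ->]]; exact: measurable_box.
apply: smallest_sub => //.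
move=> A; rewrite -bigcup_seq/= => -[i _ [B mB <-]].
pose coord i (x : g_sigma_algebraType boxes) : R := (x : E) ord0 i.
suff mc : measurable_fun setT (coord i) by exact: (mc measurableT B mB).
apply: (measurability _ (RGenOInfty.measurableE R)) => //.
move=> _ [_ [x ->] <-]; rewrite setTI.
have -> : coord i @^-1` `]x, +oo[%classic =
  \bigcup_n box (\row_j if j == i then x else - n%:R) (const_mx n%:R).
 apply/seteqP; split => y /=; rewrite in_itv/= andbT; last first.
  by move=> [n _ /(_ i)]; rewrite !mxE eqxx => /andP[].
 move=> xy; exists (Num.bound `|(y : E)|) => // j; rewrite !mxE.
 have yj : `|(y : E) ord0 j| < (Num.bound `|(y : E)|)%:R.
  apply: le_lt_trans (archi_boundP (normr_ge0 _)); exact: coord_norm.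
 move: yj; rewrite ltr_norml => /andP[y1 y2]; rewrite y2 andbT.
 by case: eqP => // ->.
apply: bigcupT_measurable => n; apply: sub_sigma_algebra.
by do 2 eexists.
Qed.

Lemma lebesgue_box (a b : E) : (forall i, a ord0 i <= b ord0 i) ->
 mu (box a b) = (\prod_i (b ord0 i-a ord0 i))%:E.
Proof.
move=> ab; rewrite (@lebesgue_rV_box R N (fun i => `]a ord0 i, b ord0 i[%classic)); last first.
 li.
rewrite -prodEFin; apply: eq_bigr => i _.
have := ab i; rewrite le_eqVlt => /predU1P[->|h].
 by rewrite set_itvoo0 ?measure0 ?subrr.
by rewrite lebesgue_measure_itv/= lte_fin h.
Qed.

Lemma box_out (a b : E) i : b ord0 i <= a ord0 i -> box a b = set0.
Proof.
move=> ba; apply/seteqP; split => // x /(_ i) /andP[ax xb].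
pos.
Qed.

Lemma box_lty (a b : E) : (mu (box a b) < +oo)%E.
Proof.
have [h|/existsNP[i]] := pselect (forall i, a ord0 i <= b ord0 i).
 by rewrite lebesgue_box// ltry.
by move=> /negP; rewrite -ltNge => /ltW h; rewrite (box_out h) measure0.
Qed.

Lemma lebesgue_ball (x : E) r : 0 < r -> mu (ball x r) = ((2*r)^+N)%:E.
Proof.
move=> r0; rewrite ball_box// lebesgue_box; last first.
 by move=> i; rewrite !mxE lerD2l ge0_cp// ltW.
congr EFin; rewrite (eq_bigr (fun=> 2*r)); last by move=> i _; rewrite !mxE; ring.
by rewrite prodr_const card_ord.
Qed.

Lemma bigcup_box : \bigcup_k box (- const_mx k%:R) (const_mx k%:R) = [set: E].
Proof.
apply/seteqP; split => // x _; exists (Num.bound `|x|) => // j; rewrite !mxE.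
rewrite -ltr_norml; apply: le_lt_trans (archi_boundP (normr_ge0 _)).
exact: coord_norm.
Qed.

Lemma measurable_affine (xi : E) (e : R) :
 measurable_fun setT (fun x : E => xi+e*:x).
Proof.
apply: measurable_rVP => i.
rewrite (_ : _ \o _ = (fun x : E => xi ord0 i+e*x ord0 i)).
 apply: measurable_funD => //; apply: measurable_funM => //; exact: measurable_coord.
by apply/funext => x; rewrite /= !mxE.
Qed.

Lemma affine_box (xi a b : E) (e : R) : 0 < e ->
 (fun x : E => xi+e*:x) @^-1` box a b = box (e^-1*:(a-xi)) (e^-1*:(b-xi)).
Proof.
move=> e0; apply/seteqP; split => x /= h i; have := h i; rewrite !mxE.
 by rewrite ltr_pdivrMl// ltr_pdivlMl// ltrBlDl ltrBrDl.
by rewrite ltr_pdivrMl// ltr_pdivlMl// ltrBlDl ltrBrDl.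
Qed.

(** Both sides are measures in [A] that agree on boxes, an intersection-stable generating class
    exhausted by boxes of finite measure. *)
Lemma lebesgue_affine (xi : E) (e : R) A : 0 < e -> measurable A ->
 mu ((fun x : E => xi+e*:x) @^-1` A) = ((e ^- N)%:E * mu A)%E.
Proof.
move=> e0 mA.
have en0 : 0 <= e ^- N by rewrite invr_ge0 exprn_ge0// ltW.
pose T (x : E) : E := xi+e*:x.
pose Tm : {mfun E >-> E} := HB.pack T (isMeasurableFun.Build _ _ _ _ T (measurable_affine xi e)).
suff H : mscale (NngNum en0) mu A = pushforward mu Tm A by rewrite -[LHS]H.
apply: (@measure_unique _ R E boxes (fun k => box (- const_mx k%:R) (const_mx k%:R))) => //.
- exact: boxes_generate.
- exact: boxes_setI.
- by move=> i; do 2 eexists.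
- exact: bigcup_box.
- move=> _ [a [b ->]]; change ((e ^- N)%:E * mu (box a b) = mu (T @^-1` box a b))%E; rewrite affine_box//.
 have [h|/existsNP[i /negP]] := pselect (forall i, a ord0 i <= b ord0 i); last first.
  rewrite -ltNge => ba; rewrite (box_out (ltW ba)) (@box_out _ _ i) ?measure0 ?mule0//.
  by rewrite !mxE ler_pM2l ?invr_gt0// lerB// ltW.
 rewrite !lebesgue_box//; last by move=> i; rewrite !mxE ler_pM2l ?invr_gt0// lerB.
 rewrite -EFinM; congr EFin; rewrite -exprVn -[X in _^+X]card_ord -prodr_const -big_split/=.
 apply: eq_bigr => i _; rewrite !mxE; pos.
- move=> k; apply: lte_mul_pinfty => //; exact: box_lty.
Qed.

Notation mes f := (measurable_fun [set: E] f).
Local Notation muE := (Defs_lebesgue_rV__canonical__measure_function_Measure R N).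
Notation ig f := (muE.-integrable [set: E] (EFin \o f)).

Lemma ge0_integral_affine (xi : E) (e : R) (f : E -> \bar R) : 0 < e ->
 measurable_fun setT f -> (forall x, (0 <= f x)%E) ->
 (\int[muE]_x f (xi+e*:x)%R = (e ^- N)%:E*\int[muE]_x f x)%E.
Proof.
move=> e0 mf f0.
have en0 : 0 <= e ^- N by rewrite invr_ge0 exprn_ge0// ltW.
pose T (x : E) : E := xi+e*:x.
have mT : measurable_fun setT T := measurable_affine xi e.
have := @ge0_integral_pushforward _ _ _ _ R T mT mu setT f measurableT mf (fun y _ => f0 y).
rewrite preimage_setT => <-.
transitivity (\int[mscale (NngNum en0) mu]_x f x)%E; last by rewrite ge0_integral_mscale.
apply: eq_measure_integral => A mA _.
change (mu (T @^-1` A) = (e ^- N)%:E * mu A)%E; exact: lebesgue_affine.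
Qed.

Lemma mes_affine (xi : E) (e : R) (f : E -> R) : mes f -> mes (fun x => f (xi+e*:x)).
Proof. move=> mf; apply: (measurableT_comp mf); exact: measurable_affine. Qed.

Lemma ig_affine (xi : E) (e : R) (f : E -> R) : 0 < e -> ig f -> ig (fun x => f (xi+e*:x)).
Proof.
move=> e0 fi; have mf := ig_mes fi.
move/integrableP : fi => [_ foo]; apply/integrableP; split.
 apply/measurable_EFinP; exact: mes_affine.
have := @ge0_integral_affine xi e (fun x => `|(f x)%:E|%E) e0 _ (fun x => abse_ge0 _).
move=> ->; first by rewrite lte_mul_pinfty ?lee_fin ?invr_ge0 ?exprn_ge0// ltW.
apply: measurableT_comp => //; exact/measurable_EFinP.
Qed.

Lemma Int_affine (xi : E) (e : R) (f : E -> R) : 0 < e -> ig f ->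
 \int[muE]_x f (xi+e*:x) = e ^- N*\int[muE]_x f x.
Proof.
move=> e0.
suff pos (g : E -> R) : ig g -> (forall x, 0 <= g x) ->
  \int[muE]_x g (xi+e*:x) = e ^- N*\int[muE]_x g x.
 move=> fi; have mf := ig_mes fi.
 have fE x : f x = Num.max (f x) 0-Num.max (- f x) 0.
  rewrite /Num.max; case: ifPn; case: ifPn; rewrite -?leNgt ?oppr_le0; lra.
 have f1 : ig (fun x => Num.max (f x) 0).
  apply: (ig_le _ (ig_norm fi)); first exact: measurable_maxr.
  by move=> x; rewrite ger0_norm ?le_max ?lexx ?orbT// ge_max ler_norm normr_ge0.
 have f2 : ig (fun x => Num.max (- f x) 0).
  apply: (ig_le _ (ig_norm fi)); first by apply: measurable_maxr => //; exact: measurable_funN.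
  by move=> x; rewrite ger0_norm ?le_max ?lexx ?orbT// ge_max -normrN ler_norm normr_ge0.
 under eq_Rintegral do rewrite fE.
 under [in RHS]eq_Rintegral do rewrite fE.
 rewrite !IntB//; [|exact: ig_affine f1|exact: ig_affine f2].
 rewrite (pos _ f1) ?(pos _ f2) ?mulrBr// => x; by rewrite le_max lexx orbT.
move=> gi g0; rewrite /Rintegral.
rewrite (@ge0_integral_affine xi e (fun x => (g x)%:E) e0)//; last first.
 apply/measurable_EFinP; exact: ig_mes gi.
by rewrite -EFin_Int//.
Qed.

Lemma ig_shift (h : E) (f : E -> R) : ig f -> ig (fun x => f (x+h)).
Proof.
move=> fi; under eq_fun do rewrite addrC -[X in _+X]scale1r.
exact: ig_affine.
Qed.

Lemma mes_shift (h : E) (f : E -> R) : mes f -> mes (fun x => f (x+h)).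
Proof.
move=> fi; under eq_fun do rewrite addrC -[X in _+X]scale1r.
exact: mes_affine.
Qed.

Lemma Int_shift (h : E) (f : E -> R) : ig f ->
 \int[muE]_x f (x+h) = \int[muE]_x f x.
Proof.
move=> fi; under eq_Rintegral do rewrite addrC -[X in _+X]scale1r.
by rewrite Int_affine// expr1n invr1 mul1r.
Qed.

Lemma measurable_addE : measurable_fun setT (fun z : E*E => z.1+z.2).
Proof.
apply: measurable_rVP => i.
rewrite (_ : _ \o _ = (fun z : E*E => z.1 ord0 i+z.2 ord0 i)).
 by apply: measurable_funD; apply: (measurableT_comp (measurable_coord i)).
by apply/funext => z; rewrite /= !mxE.
Qed.

(** The sigma-algebra is generated by the coordinates, so an open set is first written as a
    countable union of balls with rational centres and radii [1/(n+1)]. *)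
Lemma open_measurable_rV (A : set E) : open A -> measurable A.
Proof.
move=> oA.
pose F (k : nat) : set E := match unpickle k with
 | Some (q, n) => let B := ball (map_mx (ratr : rat -> R) (q : 'rV[rat]_N)) n.+1%:R^-1 in
   if pselect (B `<=` A) then B else set0
 | None => set0 end.
suff -> : A = \bigcup_k F k.
 apply: bigcupT_measurable => k; rewrite /F; case: (unpickle k) => [[q n]|//].
 case: ifP => // _; exact: measurable_ballE.
apply/seteqP; split => [x Ax|x [k _]]; last first.
 rewrite /F; case: (unpickle k) => [[q n]|//]; case: pselect => // h; li.
have /nbhs_ballP[e /= e0 xeA] : nbhs x A by mfun.
have [n ne] : exists n : nat, n.+1%:R^-1 < e/2.
 have := near_infty_natSinv_lt (PosNum (divr_gt0 e0 (ltr0n _ 2))).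
 by move=> /filter_ex[n]; exists n.
have n0 : 0 < (n.+1%:R^-1 : R) by li.
set r : R := n.+1%:R^-1 in ne n0.
have /choice[q hq] (i : 'I_N) : exists q : rat, `|x ord0 i-ratr q| < r.
 have [|q] := @rat_in_itvoo R (x ord0 i-r) (x ord0 i+r); first lra.
 rewrite in_itv/= => /andP[h1 h2]; exists q; rewrite ltr_norml; apply/andP; split; lra.
exists (pickle (\row_i q i, n)) => //; rewrite /F pickleK.
have xq : ball (map_mx (ratr : rat -> R) (\row_i q i)) r x.
 by split => // i j; rewrite (ord1 i) !mxE /ball/= distrC.
case: pselect => // -[] y qy; apply: xeA.
apply: (@le_ball _ _ x (r+r)); first lra.
apply: ball_triangle qy; exact: ball_sym.
Qed.

Lemma closed_measurable_rV (A : set E) : closed A -> measurable A.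
Proof.
move=> cA; have -> : A = ~` ~` A by rewrite setCK.
apply: measurableC; apply: open_measurable_rV; exact: closed_openC.
Qed.

Lemma continuous_mes (f : E -> R) : continuous f -> mes f.
Proof.
move=> cf; apply: (measurability _ (RGenOInfty.measurableE R)) => //.
move=> _ [_ [x ->] <-]; rewrite setTI; apply: open_measurable_rV.
move/continuousP : cf; apply; exact: interval_open.
Qed.

End boxes.

(** * Smooth functions, test functions and bumps *)

Section smooth_functions.
Context {R : realType} {N : nat}.
Local Notation E := 'rV[R]_N.
Implicit Types (f g phi : E -> R) (x y : E).

Definition ebasis (i : 'I_N) : E := delta_mx ord0 i.

Lemma is_derive_lim {V : normedModType R} (f : V -> R) (x v : V) (l : R) :
 h^-1*(f (h*:v+x)-f x) @[h --> (0 : R)^'] --> l -> is_derive x v f l.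
Proof.
move=> h; apply: DeriveDef; last exact/cvg_lim.
by apply/cvg_ex; exists l.
Qed.

Lemma is_derive_line f x v (t : R) : derivable f (x+t*:v) v ->
 is_derive t 1 (fun s : R => f (x+s*:v)) ('D_v f (x+t*:v)).
Proof.
move=> df; apply: is_derive_lim.
move: df; rewrite /derive => /cvg_ex[l fl].
rewrite (cvg_lim _ fl)//.
rewrite (_ : (fun _ => _) = (fun h => h^-1*:(f (h*:v+(x+t*:v))-f (x+t*:v)))) //.
apply/funext => h; congr (_*(f _ - _)).
by rewrite [h*:1]mulr1 scalerDl addrCA.
Qed.

Lemma is_derive_of_line f x v (l : R) :
 is_derive (0 : R) 1 (fun s : R => f (x+s*:v)) l -> is_derive x v f l.
Proof.
move=> [df dE]; apply: is_derive_lim; move: df dE; rewrite /derivable /derive.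
move=> /cvg_ex[m fm]; rewrite (cvg_lim _ fm)// => <-.
rewrite (_ : (fun _ => _) = (fun h => h^-1 *:
 (f (x+(h*:1+0)*:v)-f (x+0*:v)))) //.
apply/funext => h; rewrite addr0 scale0r addr0 [h*:1]mulr1.
by rewrite [x + _]addrC.
Qed.

Lemma line_MVT f (i : 'I_N) x (h : R) : (forall y, derivable f y (ebasis i)) ->
 exists2 t : R, `|t| <= `|h| &
  f (x+h*:ebasis i)-f x = h * partial i f (x+t*:ebasis i).
Proof.
move=> df; set v := ebasis i; pose F (s : R) := f (x+s*:v).
have dF (s : R) : is_derive s 1 F (partial i f (x+s*:v)) by exact: is_derive_line.
have cF : continuous F.
 move=> s; apply: differentiable_continuous; apply/derivable1_diffP.
 by have [] := dF s.
have F0 : F 0 = f x by rewrite /F scale0r addr0.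
have [h0|h0|->] := ltgtP h 0; last first.
- by exists 0; rewrite ?normr0// scale0r addr0 subrr mul0r.
- have [t th ft] := MVT h0 (fun s _ => dF s) (continuous_subspaceT cF).
 exists t; last by rewrite -F0 ft subr0 mulrC.
 move: th; rewrite in_itv/= => /andP[t0 th].
 by rewrite !gtr0_norm// ltW.
- have [t th ft] := MVT h0 (fun s _ => dF s) (continuous_subspaceT cF).
 exists t; last by rewrite -F0 -opprB ft sub0r mulrN opprK mulrC.
 move: th; rewrite in_itv/= => /andP[t0 th].
 by rewrite !ltr0_norm// lerN2 ltW.
Qed.

Lemma Cn_continuous k f : Cn k f -> continuous f.
Proof. by case: k => [//|k] []. Qed.

Lemma CnS k f : Cn k.+1 f -> Cn k f.
Proof.
elim: k f => [f [//]|k IH f [cf df]]; split => // i.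
by have [d1 d2] := df i; split => //; mfun.
Qed.

Lemma smooth_partial f i : smooth f -> smooth (partial i f).
Proof. by move=> sf k; have [_ /(_ i)[]] := sf k.+1. Qed.

Lemma smooth_continuous f : smooth f -> continuous f.
Proof. move=> sf; exact: Cn_continuous (sf 0). Qed.

Lemma smooth_derivable f i y : smooth f -> derivable f y (ebasis i).
Proof. by move=> sf; have [_ /(_ i)[]] := sf 1. Qed.

Lemma is_deriveE {V : normedModType R} (f : V -> R) (x v : V) (l : R) :
 is_derive x v f l -> derivable f x v /\ 'D_v f x = l.
Proof. by case. Qed.

Lemma Cn_succ k f (df : 'I_N -> E -> R) : continuous f ->
 (forall i x, derivable f x (ebasis i) /\ 'D_(ebasis i) f x = df i x) ->
 (forall i, Cn k (df i)) -> Cn k.+1 f.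
Proof.
move=> cf h hk; split => // i; split; first by move=> x; case: (h i x).
by have -> : partial i f = df i by apply/funext => x; have [] := h i x.
Qed.

Lemma Cn_cst k (c : R) : Cn k (fun _ : E => c).
Proof.
elim: k c => [c|k IH c]; first exact: cst_continuous.
apply: (@Cn_succ _ _ (fun _ _ => 0)) => [|i x|i]; first exact: cst_continuous.
 by apply: is_deriveE.
li.
Qed.

Lemma CnD k f g : Cn k f -> Cn k g -> Cn k (fun x => f x+g x).
Proof.
elim: k f g => [f g /Cn_continuous cf /Cn_continuous cg x|k IH f g [cf df] [cg dg]].
 by apply: continuousD; [exact: cf|exact: cg].
apply: (@Cn_succ _ _ (fun i x => partial i f x+partial i g x)) => [x|i x|i].
- by apply: continuousD; [exact: cf|exact: cg].
- apply: is_deriveE; apply: is_deriveD; apply: derivableP; [exact: (df i).1|exact: (dg i).1].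
- by apply: IH; [exact: (df i).2|exact: (dg i).2].
Qed.

Lemma CnM k f g : Cn k f -> Cn k g -> Cn k (fun x => f x*g x).
Proof.
elim: k f g => [f g /Cn_continuous cf /Cn_continuous cg x|k IH f g Cf Cg].
 by apply: continuousM; [exact: cf|exact: cg].
have [cf df] := Cf; have [cg dg] := Cg.
apply: (@Cn_succ _ _ (fun i x => f x * partial i g x+g x * partial i f x)) => [x|i x|i].
- by apply: continuousM; [exact: cf|exact: cg].
- by apply: is_deriveE; apply: is_deriveM; apply: derivableP; [exact: (df i).1|exact: (dg i).1].
- by apply: CnD; apply: IH; [exact: CnS|exact: (dg i).2|exact: CnS|exact: (df i).2].
Qed.

Lemma Cn_prod k (I : Type) (s : seq I) (F : I -> E -> R) :
 (forall i, Cn k (F i)) -> Cn k (fun x => \prod_(i <- s) F i x).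
Proof.
move=> hF; elim: s => [|i s IH].
 under eq_fun do rewrite big_nil; exact: Cn_cst.
under eq_fun do rewrite big_cons; exact: CnM.
Qed.

Lemma affine_continuous (d : E) (c : R) : continuous (fun x : E => d+c*:x).
Proof.
by move=> x; apply: continuousD; [exact: cst_continuous|exact: scaler_continuous].
Qed.

Lemma Cn_affine k f (d : E) (c : R) : Cn k f -> Cn k (fun x => f (d+c*:x)).
Proof.
have cc g : continuous g -> continuous (fun x => g (d+c*:x)).
 move=> cg x; apply: (@continuous_comp _ _ _ (fun x : E => d+c*:x) g); last exact: cg.
 exact: affine_continuous.
elim: k f => [f cf|k IH f [cf df]]; first mfun.
apply: (@Cn_succ _ _ (fun i x => c * partial i f (d+c*:x))) => [|i x|i]; first mfun.
- apply: is_deriveE; apply: is_derive_of_line.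
 rewrite (_ : (fun _ => _) =
   (fun s : R => f (d+c*:x+s*:ebasis i)) \o (fun s : R => c*s)); last first.
  by apply/funext => s /=; rewrite scalerDr addrA scalerA.
 rewrite mulrC; apply: is_derive1_comp.
  rewrite mulr0; have := @is_derive_line f (d+c*:x) (ebasis i) 0.
  rewrite scale0r addr0; apply; mfun.
 have := @is_deriveZ R R^o R^o id c 0 1 1 (@is_derive_id R R^o 0 1).
 by rewrite [c*:1]mulr1.
- by apply: CnM; [exact: Cn_cst|exact: IH (df i).2].
Qed.

(** The flat function [exp (-1/t)] times a polynomial in [t^-1]: this family is stable under
    derivation, which gives smoothness by induction on the order. *)
Definition psi (P : {poly R}) (t : R) : R :=
 if 0 < t then P.[t^-1]*expR (- t^-1) else 0.

Lemma poly_expR_bound (P : {poly R}) n :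
 exists2 C : R, 0 <= C & forall s : R, 1 <= s -> `|P.[s]|*s^+n <= C*expR s.
Proof.
elim/poly_ind: P n => [|P c IH] n.
 by exists 0 => // s _; rewrite horner0 normr0 !mul0r.
have [C C0 hC] := IH n.+1.
have hn : forall s : R, 1 <= s -> s^+n <= n.+1%:R^+n.+1*expR s.
 move=> s s1; have s0 : 0 <= s by rewrite (le_trans _ s1).
 have h : (s/n.+1%:R)^+n.+1 <= expR s.
  have -> : expR s = expR (s/n.+1%:R)^+n.+1 by rewrite -expRM_natl mulrC divfK.
  rewrite ler_pXn2r ?nnegrE ?divr_ge0 ?expR_ge0//.
  by apply: le_trans (expR_ge1Dx _); rewrite lerDr.
 rewrite (@le_trans _ _ (s^+n.+1))//.
  by rewrite exprS ler_peMl// exprn_ge0.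
 by move: h; rewrite expr_div_n ler_pdivrMr ?exprn_gt0// mulrC.
exists (C+`|c|*n.+1%:R^+n.+1); first pos.
move=> s s1; have s0 : 0 <= s by rewrite (le_trans _ s1).
rewrite hornerMXaddC.
apply: (@le_trans _ _ (`|P.[s]|*s^+n.+1+`|c|*s^+n)).
 rewrite exprS mulrA -mulrDl ler_wpM2r ?exprn_ge0//.
 by rewrite (le_trans (ler_normD _ _))// normrM (ger0_norm s0).
by rewrite mulrDl lerD ?hC// -mulrA ler_wpM2l// hn.
Qed.

(** Quadratic decay at 0, enough for the derivative to exist and vanish there. *)
Lemma psi_bound P : exists2 C : R, 0 <= C & forall h : R, 0 < h <= 1 -> `|psi P h| <= C*h^+2.
Proof.
have [C C0 hC] := poly_expR_bound P 2; exists C => // h /andP[h0 h1].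
rewrite /psi h0 normrM (ger0_norm (expR_ge0 _)).
have s1 : 1 <= h^-1 by rewrite invf_ge1.
rewrite expRN ler_pdivrMr ?expR_gt0// mulrAC.
have := hC _ s1; rewrite exprVn ler_pdivrMr ?exprn_gt0//.
Qed.

Lemma is_derive_psi (P : {poly R}) (t : R) : is_derive t 1 (psi P) (psi ('X^2*(P-P^`())) t).
Proof.
have [t0|t0|->] := ltgtP t 0.
- rewrite {2}/psi ltNge (ltW t0)/=.
 apply: (@near_eq_is_derive _ _ _ (cst 0)).
 near=> s; rewrite /psi ifF//; apply/negbTE; rewrite -leNgt ltW//; near: s; exact: lt_nbhsl.
- rewrite {2}/psi t0.
 apply: (@near_eq_is_derive R R^o R^o (fun s : R => P.[s^-1]*expR (- s^-1))).
  near=> s; rewrite /psi ifT//; near: s; exact: lt_nbhsr.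
 have dV : is_derive t 1 (fun s : R => s^-1) (- t ^- 2).
  have := @is_deriveV R id t 1 1; rewrite /= => /(_ (lt0r_neq0 t0) (@is_derive_id R R^o t 1)).
  by rewrite [_*:1]mulr1.
 have dP : is_derive t 1 (fun s : R => P.[s^-1]) (P^`().[t^-1] * - t ^- 2).
  exact: (@is_derive1_comp _ (horner P) (fun s : R => s^-1)).
 have dNV : is_derive t 1 (fun s : R => - s^-1) (t ^- 2).
  by have := is_deriveN dV; rewrite opprK.
 have dE : is_derive t 1 (fun s : R => expR (- s^-1)) (expR (- t^-1)*t ^- 2).
  exact: (@is_derive1_comp _ expR (fun s : R => - s^-1)).
 have := is_deriveM dP dE.
 rewrite (_ : P.[t^-1] *: _ + _ = ('X^2*(P-P^`())).[t^-1]*expR (- t^-1))//.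
 rewrite hornerM hornerXn hornerD hornerN -![_ *: _]/(_*_) exprVn; ring.
- rewrite {2}/psi ltxx; apply: is_derive_lim.
 have [C C0 hC] := psi_bound P.
 apply/cvgrPdist_le => e e0.
 have eC : 0 < e/(C+1) by pos.
 near=> h.
 rewrite sub0r normrN addr0 [h*:1]mulr1 {2}/psi ltxx subr0 normrM normfV.
 have [h0|h0] := ltP 0 h; last by rewrite /psi ltNge h0/= normr0 mulr0 ltW.
 have h1 : `|h| <= Num.min 1 (e/(C+1)).
  near: h; apply: dnbhs0_le; by rewrite lt_min ltr01.
 move: h1; rewrite (gtr0_norm h0) le_min => /andP[h1 h2].
 rewrite ler_pdivrMl//; apply: (le_trans (hC _ _)); first by rewrite h0.
 rewrite mulrA mulrC ler_wpM2l ?(ltW h0)//.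
 move: h2; rewrite ler_pdivlMr ?ltr_wpDl// => h2; nra.
Unshelve. all: by end_near. Qed.

Lemma psi_continuous P : continuous (psi P).
Proof.
move=> t; apply: differentiable_continuous; apply/derivable1_diffP.
by case: (is_derive_psi P t).
Qed.

Lemma coord_contE i : continuous (fun x : E => x ord0 i).
Proof. exact: coord_continuous. Qed.

Lemma Cn_psi_coord k P (c d : R) (i : 'I_N) : Cn k (fun x : E => psi P (c*x ord0 i+d)).
Proof.
have cont Q : continuous (fun x : E => psi Q (c*x ord0 i+d)).
 move=> x; apply: (@continuous_comp _ _ _ (fun x : E => c*x ord0 i+d) (psi Q)).
  apply: continuousD; last exact: cst_continuous.
  by apply: continuousM; [exact: cst_continuous|exact: coord_contE].
 exact: psi_continuous.
elim: k P => [P|k IH P]//.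
apply: (@Cn_succ _ _ (fun j x => c*(j == i)%:R * psi ('X^2*(P-P^`())) (c*x ord0 i+d))) => [x|j x|j]//.
- apply: is_deriveE; apply: is_derive_of_line.
 rewrite (_ : (fun _ => _) = psi P \o
   (fun s : R => c*(j == i)%:R*s+(c*x ord0 i+d))); last first.
  apply/funext => s /=; congr (psi P _); rewrite !mxE /= [i == j]eq_sym; ring.
 rewrite [X in is_derive _ _ _ X]mulrC; apply: is_derive1_comp.
  rewrite mulr0 add0r; exact: is_derive_psi.
 have := is_deriveD (@is_deriveZ R R^o R^o id (c*(j == i)%:R) 0 1 1 (@is_derive_id R R^o 0 1))
  (@is_derive_cst R R^o R^o (c*x ord0 i+d) 0 1).
 by rewrite addr0 [_*:1]mulr1.
- by apply: CnM; [exact: Cn_cst|exact: IH].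
Qed.

(** Quantitative form of compact support, with respect to the sup norm. *)
Definition vanish_out (M : R) f := forall x, M <= `|x| -> f x = 0.

Lemma test_functionP phi :
 test_function phi <-> smooth phi /\ exists M, vanish_out M phi.
Proof.
split => [[sphi cphi]|[sphi [M hM]]]; split => //.
 have [M [_ /(_ (M+1))]] := compact_bounded cphi.
 rewrite ltrDl ltr01 => /(_ isT) hM; exists (M+2) => x Mx.
 apply/eqP/negPn/negP => px; have : `|x| <= M+1.
  by apply: hM; apply: subset_closure.
 pos.
apply: bounded_closed_compact; last exact: closed_closure.
exists M; split; first exact: num_real.
move=> y My x; have cl : closed [set x : E | `|x| <= y].
 apply: (@closed_comp E R^o (fun x => `|x|) [set t : R | t <= y]) => [z _|].
  exact: norm_continuous.
 li.
rewrite (closureE [set x | phi x != 0]) => /(_ _ (conj cl _)); apply=> z /=.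
move=> pz; rewrite leNgt; apply/negP => yz; move/eqP : pz; apply; apply: hM.
pos.
Qed.

Lemma partial_vanish M phi i : smooth phi -> vanish_out M phi -> vanish_out (M+1) (partial i phi).
Proof.
move=> sphi hM x Mx.
have near0 : \near x, phi x = 0.
 have : \forall z \near x, M < `|z|.
  apply: (cvgr_gt _ (@norm_continuous _ E x)); by rewrite (lt_le_trans _ Mx)// ltrDl.
 apply: filterS => z Mz; apply: hM; pos.
rewrite /partial (@near_eq_derive _ _ _ phi (cst 0))//; exact: derive_cst.
Qed.

Lemma test_partial phi i : test_function phi -> test_function (partial i phi).
Proof.
move=> /test_functionP[sphi [M hM]]; apply/test_functionP; split; first exact: smooth_partial.
exists (M+1); exact: partial_vanish.
Qed.

Lemma testD phi psi : test_function phi -> test_function psi ->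
 test_function (fun x => phi x+psi x).
Proof.
move=> /test_functionP[sphi [M hM]] /test_functionP[spsi [K hK]].
apply/test_functionP; split; first by move=> k; exact: CnD.
exists (Num.max M K) => x; rewrite ge_max => /andP[xM xK].
by rewrite hM// hK// addr0.
Qed.

Lemma testMl phi psi : test_function phi -> smooth psi ->
 test_function (fun x => phi x * psi x).
Proof.
move=> /test_functionP[sphi [M hM]] spsi; apply/test_functionP; split.
 move=> k; exact: CnM.
by exists M => x xM; rewrite hM// mul0r.
Qed.

Lemma testZ (c : R) phi : test_function phi -> test_function (fun x => c * phi x).
Proof.
move=> tphi; under eq_fun do rewrite mulrC.
apply: testMl => // k; exact: Cn_cst.
Qed.

Lemma test_affine phi (d : E) (c : R) : c != 0 -> test_function phi ->
 test_function (fun x => phi (d+c*:x)).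
Proof.
move=> c0 /test_functionP[sphi [M hM]]; apply/test_functionP; split.
 move=> k; exact: Cn_affine.
exists (`|c|^-1*(M+`|d|)) => x; rewrite ler_pdivrMl ?normr_gt0// => h.
apply: hM; have : `|c*:x| <= `|d+c*:x|+`|d|.
 by rewrite -{1}(addKr d (c*:x)) addrC (le_trans (ler_normD _ _))// normrN.
rewrite normrZ; move: h; lra.
Qed.

Lemma test_shift phi (h : E) : test_function phi -> test_function (fun x => phi (x+h)).
Proof.
move=> tphi; under eq_fun do rewrite addrC -[X in _+X]scale1r.
by apply: test_affine => //.
Qed.

Lemma test_continuous phi : test_function phi -> continuous phi.
Proof. move=> [sphi _]; exact: smooth_continuous. Qed.

Lemma test_bounded phi : test_function phi -> exists2 C : R, 0 <= C & forall x, `|phi x| <= C.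
Proof.
move=> tphi; have /test_functionP[sphi [M hM]] := tphi.
have := @compact_bounded R R^o (phi @` closure [set x | phi x != 0]).
case.
 apply: continuous_compact; last exact: tphi.2.
 exact/continuous_subspaceT/test_continuous.
move=> K [_ /(_ (`|K|+1))].
rewrite (le_lt_trans (ler_norm _)) ?ltrDl// => /(_ isT) h.
exists (`|K|+1) => [|x]//.
have [->|px] := eqVneq (phi x) 0; first by rewrite normr0.
apply: h; exists x => //; exact: subset_closure.
Qed.

(** Each factor is [exp (-1/((n+1) s))] with [s] the distance to a face, so these test functions
    converge pointwise to the indicator of the box as [n] grows. *)
Definition bump (a b : E) (n : nat) (x : E) : R :=
 \prod_(i < N) (psi 1 (n.+1%:R*x ord0 i + - (n.+1%:R*a ord0 i)) *
         psi 1 (- n.+1%:R*x ord0 i+n.+1%:R*b ord0 i)).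

Lemma psi1_ge0 t : 0 <= psi 1 t <= 1.
Proof.
rewrite /psi; case: ifPn => t0; last pos.
by rewrite hornerC mul1r expR_ge0 -expR0 ler_expR oppr_le0 invr_ge0 ltW.
Qed.

Lemma bump_ge0 a b n x : 0 <= bump a b n x <= 1.
Proof.
rewrite /bump; have h i : 0 <= psi 1 (n.+1%:R*x ord0 i + - (n.+1%:R*a ord0 i)) *
         psi 1 (- n.+1%:R*x ord0 i+n.+1%:R*b ord0 i) <= 1.
 have /andP[? ?] := psi1_ge0 (n.+1%:R*x ord0 i + - (n.+1%:R*a ord0 i)).
 have /andP[? ?] := psi1_ge0 (- n.+1%:R*x ord0 i+n.+1%:R*b ord0 i).
 by rewrite mulr_ge0// mulr_ile1.
apply: (big_ind (fun y : R => 0 <= y <= 1)) => [|y z /andP[? ?] /andP[? ?]|i _]//.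
 pos.
by rewrite mulr_ge0// mulr_ile1.
Qed.

Lemma bump_out a b n x : ~ box a b x -> bump a b n x = 0.
Proof.
move=> /existsNP[i]; rewrite /bump (bigD1 i)//= => /negP; rewrite negb_and -!leNgt.
move=> /orP[xa|bx]; [rewrite {1}/psi|rewrite {2}/psi]; rewrite ifF ?mulr0 ?mul0r//.
 by apply/negbTE; rewrite -leNgt -mulrBr pmulr_rle0// subr_le0.
by apply/negbTE; rewrite -leNgt mulNr addrC -mulrBr pmulr_rle0// subr_le0.
Qed.

Lemma smooth_bump a b n : smooth (bump a b n).
Proof.
move=> k; apply: Cn_prod => i; apply: CnM; exact: Cn_psi_coord.
Qed.

Lemma box_norm_le (a b x : E) : box a b x -> `|x| <= `|a|+`|b|.
Proof.
move=> h; apply: norm_le_coord => [|j]//.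
have /andP[aj bj] := h j; have := coord_norm a j; have := coord_norm b j.
rewrite !ler_norml => /andP[? ?] /andP[? ?]; have := normr_ge0 a; have := normr_ge0 b.
pos.
Qed.

Lemma test_bump a b n : test_function (bump a b n).
Proof.
apply/test_functionP; split; first exact: smooth_bump.
exists (`|a|+`|b|+1) => x h; apply: bump_out => /box_norm_le xab.
pos.
Qed.

Lemma psi1_cvg (s : R) : psi 1 (n.+1%:R*s) @[n --> \oo] --> ((0 < s)%R%:R : R).
Proof.
have [s0|s0] := ltP 0 s; last first.
 rewrite (_ : (fun _ => _) = cst 0); first cv.
 by apply/funext => n; rewrite /psi ifF//; apply/negbTE; rewrite -leNgt pmulr_rle0.
rewrite (_ : (fun _ => _) = (fun n => expR (- (s^-1*n.+1%:R^-1)))); last first.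
 by apply/funext => n; rewrite /psi mulr_gt0// hornerC mul1r invfM mulrC.
have h : - (s^-1*n.+1%:R^-1) @[n --> \oo] --> (0 : R).
 rewrite -[X in _ --> X](@oppr0 R); apply: cvgN.
 rewrite -[X in _ --> X](mulr0 s^-1); apply: cvgM; first cv.
 exact: cvg_harmonic.
by have := cvg_comp _ _ h (@continuous_expR R 0); rewrite expR0.
Qed.

Lemma bump_cvg a b x : bump a b n x @[n --> \oo] --> (\1_(box a b) x : R).
Proof.
rewrite indicE; have [xab|xab] := boolP (x \in box a b); last first.
 rewrite (_ : (fun _ => _) = cst 0); first cv.
 by apply/funext => n; rewrite bump_out; move: xab; rewrite notin_setE.
rewrite inE in xab.
rewrite /bump; elim: (index_enum _) => [|i s IH].
 under eq_fun do rewrite big_nil; cv.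
under eq_fun do rewrite big_cons.
have -> : true%:R = 1*true%:R :> R by pos.
apply: cvgM => //.
have /andP[ai bi] := xab i.
rewrite -[X in _ --> X](mul1r 1); apply: cvgM.
 under eq_fun do rewrite -mulrBr.
 by have := @psi1_cvg (x ord0 i-a ord0 i); rewrite subr_gt0 ai.
under eq_fun do rewrite mulNr addrC -mulrBr.
by have := @psi1_cvg (b ord0 i-x ord0 i); rewrite subr_gt0 bi.
Qed.

End smooth_functions.

(** * Inequalities for powers *)

Section power_inequalities.
Context {R : realType}.
Implicit Types a b s t q e : R.

Lemma powRD_le a b q : 0 <= q -> `|a+b| `^ q <= 2`^q*(`|a| `^ q+`|b| `^ q).
Proof.
move=> q0; have m0 : 0 <= Num.max `|a| `|b| by rewrite le_max normr_ge0.
apply: (@le_trans _ _ ((2*Num.max `|a| `|b|)`^q)).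
 apply: ge0_ler_powR; rewrite ?nnegrE ?mulr_ge0//.
 have h1 : `|a| <= Num.max `|a| `|b| by rewrite le_max lexx.
 have h2 : `|b| <= Num.max `|a| `|b| by rewrite le_max lexx orbT.
 have := ler_normD a b; move: h1 h2; set m := Num.max _ _; lra.
rewrite powRM// ler_wpM2l ?powR_ge0//.
by have [_|_] := leP `|a| `|b|; rewrite ?lerDl ?lerDr.
Qed.

(** The larger of [a] and [b] dominates. Applied to normalised functions, this form of Young's
    inequality gives Hölder's up to a factor 2. *)
Lemma young_max a b (al be : R) : 0 <= al -> 0 <= be -> 0 <= a -> 0 <= b ->
 a`^al*b`^be <= a`^(al+be)+b`^(al+be).
Proof.
move=> al0 be0 a0 b0; have [ab|ab] := leP a b.
 apply: (@le_trans _ _ (b`^al*b`^be)).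
  by rewrite ler_wpM2r ?powR_ge0// ge0_ler_powR//.
 have [->|bn] := eqVneq b 0; last by rewrite -powRD ?bn ?implybT// lerDr powR_ge0.
 have [->|aln] := eqVneq al 0; first by rewrite add0r powRr0 mul1r lerDr powR_ge0.
 by rewrite (powR0 aln) mul0r addr_ge0// powR_ge0.
apply: (@le_trans _ _ (a`^al*a`^be)).
 by rewrite ler_wpM2l ?powR_ge0// ge0_ler_powR// ltW.
have an : a != 0 by pos.
by rewrite -powRD ?an ?implybT// lerDl powR_ge0.
Qed.

Lemma powRDn0 a (al be : R) : 0 < al -> 0 < be -> 0 <= a -> a`^al*a`^be = a`^(al+be).
Proof.
move=> al0 be0 a0; have [->|an] := eqVneq a 0.
 by rewrite !powR0 ?gt_eqF ?addr_gt0// mul0r.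
by rewrite -powRD// an implybT.
Qed.

Lemma powR_norm_continuous q : 0 < q -> continuous (fun t : R => `|t| `^ q).
Proof.
move=> q0 x; have [->|xn] := eqVneq x 0; last first.
 apply: (@continuous_comp _ _ _ (fun t : R => `|t|) (fun t => t`^q)).
  exact: norm_continuous.
 apply: differentiable_continuous; apply/derivable1_diffP.
 by apply: derivable_powR; rewrite in_itv/= andbT normr_gt0.
rewrite /continuous_at normr0 powR0 ?gt_eqF//.
apply/cvgrPdist_le => e e0; apply/nbhs_ballP.
exists (e`^q^-1); first pos.
move=> t; rewrite /ball/= !sub0r !normrN => te; rewrite ger0_norm ?powR_ge0//.
have -> : e = (e`^q^-1)`^q by rewrite -powRrM mulVf ?gt_eqF// powRr1// ltW.
apply: ge0_ler_powR; rewrite ?nnegrE ?powR_ge0//; pos.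
Qed.

(** Multiplicativity reduces the increment to [f (1 + r) - 1] with [r = t / s], small by continuity
    at 1 when [|t| <= d |s|]; otherwise both terms are at most a multiple of [|t|^q]. It gives the
    pointwise Brezis-Lieb inequalities for [|t|^q] and for the nonlinearity. *)
Lemma mult_increment (f : R -> R) q : 0 < q -> (forall s t, f (s*t) = f s*f t) ->
 (forall s, `|f s| = `|s| `^ q) -> {for 1, continuous f} ->
 forall e, 0 < e -> exists2 C, 0 <= C & forall s t,
  `|f (s+t)-f s| <= e * `|s| `^ q+C * `|t| `^ q.
Proof.
move=> q0 fM fn fc e e0.
have f1n : f 1 != 0 by rewrite -normr_gt0 fn normr1 powR1.
have f1 : f 1 = 1 by apply: (mulfI f1n); rewrite -fM !mulr1.
have [d d0 hd] : exists2 d : R, 0 < d & forall r, `|r| <= d -> `|f (1+r)-1| <= e.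
 move/cvgrPdist_le : fc => /(_ e e0) /nbhs_ballP[d /= d0 hd].
 exists (d/2); first pos.
 move=> r rd; rewrite distrC -[X in `|X - _|]f1; apply: hd.
 rewrite /ball /= opprD addrA subrr sub0r normrN.
 pos.
exists ((1+d^-1)`^q+d^-1`^q) => [|s t]; first pos.
have [td|td] := leP `|t| (d * `|s|).
 apply: (@le_trans _ _ (e * `|s| `^ q)); last first.
  by rewrite lerDl mulr_ge0 ?addr_ge0 ?powR_ge0.
 have [s0|s0] := eqVneq s 0.
  move: td; rewrite s0 normr0 mulr0 normr_le0 => /eqP ->.
  by rewrite addr0 subrr normr0 mulr_ge0 ?powR_ge0 ?ltW.
 have -> : s+t = s*(1+t/s) by rewrite mulrDr mulr1 mulrCA divff// mulr1.
 rewrite fM -[X in _-X]mulr1 -mulrBr normrM fn mulrC ler_wpM2r ?powR_ge0//.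
 by apply: hd; rewrite normrM normfV ler_pdivrMr ?normr_gt0.
apply: (@le_trans _ _ (((1+d^-1)`^q+d^-1`^q) * `|t| `^ q)); last first.
 by rewrite lerDr mulr_ge0 ?powR_ge0 ?ltW.
have sd : `|s| <= d^-1 * `|t| by rewrite -ler_pdivrMl ?invr_gt0// invrK ltW.
have di0 : 0 <= d^-1 by pos.
rewrite (le_trans (ler_normB _ _))// mulrDl !fn.
have di1 : 0 <= 1+d^-1 by pos.
rewrite -!powRM//; apply: lerD; apply: ge0_ler_powR; rewrite ?nnegrE ?mulr_ge0 ?(ltW q0)//.
by rewrite (le_trans (ler_normD _ _))// mulrDl mul1r addrC lerD2l.
Qed.

Lemma powR_increment q : 0 < q -> forall e, 0 < e -> exists2 C, 0 <= C & forall s t,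
  `| `|s+t| `^ q-`|s| `^ q| <= e * `|s| `^ q+C * `|t| `^ q.
Proof.
move=> q0; apply: mult_increment => //.
- by move=> s t; rewrite normrM powRM.
- by move=> s; rewrite ger0_norm.
- exact: powR_norm_continuous.
Qed.

(** The nonlinearity [|t|^(q-2) t], that is the derivative of [|t|^q / q]. *)
Definition gp q t : R := t * `|t| `^ (q-2).

Lemma gpE q t : 2 < q -> gp q t*t = `|t| `^ q.
Proof.
move=> q2; rewrite mulrAC -expr2 -(real_normK (num_real t)) -powR_mulrn//.
rewrite powRDn0 ?subr_gt0//; congr (_ `^ _); pos.
Qed.

Lemma gp_norm q t : 2 < q -> `|gp q t| = `|t| `^ (q-1).
Proof.
move=> q2; rewrite normrM [X in _*X]ger0_norm ?powR_ge0// -[X in X*_]powRr1//.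
rewrite powRDn0 ?subr_gt0//; congr (_ `^ _); pos.
Qed.

Lemma gp_continuous q : 2 < q -> continuous (gp q).
Proof.
move=> q2 x; apply: (@continuousM _ _ (fun t : R => t) (fun t : R => `|t| `^ (q-2))).
 li.
by apply: powR_norm_continuous; rewrite subr_gt0.
Qed.

Lemma gp_increment q : 2 < q -> forall e, 0 < e -> exists2 C, 0 <= C & forall s t,
  `|gp q (s+t)-gp q s| <= e * `|s| `^ (q-1)+C * `|t| `^ (q-1).
Proof.
move=> q2; apply: mult_increment.
- lra.
- move=> s t; rewrite /gp normrM powRM//; pos.
- move=> s; exact: gp_norm.
- exact: gp_continuous.
Qed.

Lemma powR_convex q a b : 2 < q -> q*(gp q a*(b-a)) <= `|b| `^ q-`|a| `^ q.
Proof.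
move=> q2; rewrite mulrBr gpE// mulrBr.
suff : q*(gp q a*b) <= (q-1) * `|a| `^ q+`|b| `^ q by lra.
have q0 : 0 < q by lra.
have q10 : 0 < q-1 by lra.
have := @conjugate_powR R (`|a| `^ (q-1)) `|b| (q/(q-1)) q
 (powR_ge0 _ _) (normr_ge0 _) (divr_gt0 q0 q10) q0.
rewrite -powRrM [(q-1)*_]mulrC divfK ?gt_eqF// invf_div => h.
have {}h : `|a| `^ (q-1) * `|b| <= `|a| `^ q*((q-1)/q)+`|b| `^ q/q.
 apply: h; field; pos.
apply: (@le_trans _ _ (q*(`|a| `^ (q-1) * `|b|))).
 by rewrite ler_pM2l// -gp_norm// -normrM ler_norm.
have -> : (q-1) * `|a| `^ q+`|b| `^ q = q*(`|a| `^ q*((q-1)/q)+`|b| `^ q/q).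
 field; pos.
by rewrite ler_pM2l.
Qed.

(** Sum of the convexity inequalities of [|t|^q] at [a] and at [b]: a first-order expansion whose
    error is an increment of [gp], with no differentiation under the integral. *)
Lemma powR_convex_gap q a b : 2 < q ->
 `| `|b| `^ q-`|a| `^ q-q*(gp q a*(b-a))| <= q*(`|gp q b-gp q a| * `|b-a|).
Proof.
move=> q2; have h1 := powR_convex a b q2; have h2 := powR_convex b a q2.
rewrite ger0_norm ?subr_ge0// -normrM.
have : q*((gp q b-gp q a)*(b-a)) <= q * `|(gp q b-gp q a)*(b-a)|.
 rewrite ler_pM2l ?ler_norm; lra.
move: h1 h2; have -> : gp q b*(a-b) = - (gp q b*(b-a)) by ring.
pos.
Qed.

End power_inequalities.

(** * L^q norms for real exponents *)

Section Lq_tools.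
Context d (T : measurableType d) (R : realType).
Variable mu : {measure set T -> \bar R}.
Implicit Types f g u v : T -> R.
Notation mes f := (measurable_fun [set: T] f).
Notation ig f := (mu.-integrable [set: T] (EFin \o f)).

Definition Lq (q : R) u := mes u /\ ig (fun x => `|u x| `^ q).

Definition nq (q : R) u := (\int[mu]_x `|u x| `^ q)`^q^-1.

Lemma nq_ge0 q u : 0 <= nq q u. Proof. pos. Qed.

Lemma nq_powR q u : 0 < q -> nq q u`^q = \int[mu]_x `|u x| `^ q.
Proof.
move=> q0; rewrite -powRrM mulVf ?gt_eqF// powRr1//.
by apply: Int_ge0 => x.
Qed.

Lemma nq_leP q u C : 0 < q -> 0 <= C -> (nq q u <= C) = (\int[mu]_x `|u x| `^ q <= C`^q).
Proof.
move=> q0 C0; rewrite -nq_powR//; apply/idP/idP => [h|h].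
 apply: ge0_ler_powR; pos.
rewrite leNgt; apply/negP => Cn; move: h; rewrite leNgt gt0_ltr_powR// nnegrE.
pos.
Qed.

Lemma Lq_le q u v : 0 <= q -> mes u -> Lq q v -> (forall x, `|u x| <= `|v x|) -> Lq q u.
Proof.
move=> q0 mu' [mv vi] uv; split => //; apply: (ig_le _ vi); first mfun.
by move=> x; rewrite ger0_norm ?powR_ge0// ge0_ler_powR//.
Qed.

Lemma LqD q u v : 0 <= q -> Lq q u -> Lq q v -> Lq q (fun x => u x+v x).
Proof.
move=> q0 [mu' ui] [mv vi]; split; first mfun.
apply: (ig_le _ (igZ (2`^q) (igD ui vi))); first mfun.
by move=> x; rewrite ger0_norm ?powR_ge0// powRD_le.
Qed.

Lemma LqZ q k u : Lq q u -> Lq q (fun x => k*u x).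
Proof.
move=> [mu' ui]; split; first mfun.
under eq_fun do rewrite normrM powRM//; exact: igZ.
Qed.

Lemma LqB q u v : 0 <= q -> Lq q u -> Lq q v -> Lq q (fun x => u x-v x).
Proof. move=> q0 uL vL; under eq_fun do rewrite -mulN1r; exact: LqD (LqZ _ vL). Qed.

Lemma Lq_aeeq q u v : mes u -> Lq q v -> u = v %[ae mu] -> Lq q u.
Proof.
move=> mu' [mv vi] uv; split => //; apply: (ig_aeeq _ vi); first mfun.
by apply: filterS uv => x h _; rewrite h.
Qed.

Lemma Int_Lq_aeeq q u v : mes u -> mes v -> u = v %[ae mu] ->
 \int[mu]_x `|u x| `^ q = \int[mu]_x `|v x| `^ q.
Proof.
move=> mu' mv uv; apply: Int_aeeq; try by mfun.
by apply: filterS uv => x h _; rewrite h.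
Qed.

Lemma nq_aeeq q u v : mes u -> mes v -> u = v %[ae mu] -> nq q u = nq q v.
Proof. by move=> mu' mv uv; rewrite /nq (Int_Lq_aeeq _ mu' mv uv). Qed.

Lemma Lq_mul (al be : R) u v : 0 <= al -> 0 <= be -> Lq (al+be) u -> Lq (al+be) v ->
 ig (fun x => `|u x| `^ al * `|v x| `^ be).
Proof.
move=> al0 be0 [mu' ui] [mv vi]; apply: (ig_le _ (igD ui vi)); first mfun.
by move=> x; rewrite ger0_norm ?powR_ge0// young_max.
Qed.

(* Young's inequality for the normalized functions, hence the factor 2. *)
Lemma holder_young (al be A B : R) u v : 0 <= al -> 0 <= be -> Lq (al+be) u -> Lq (al+be) v ->
 0 < A -> 0 < B -> \int[mu]_x `|u x| `^ (al+be) <= A`^(al+be) ->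
 \int[mu]_x `|v x| `^ (al+be) <= B`^(al+be) ->
 \int[mu]_x (`|u x| `^ al * `|v x| `^ be) <= 2*A`^al*B`^be.
Proof.
move=> al0 be0 uL vL A0 B0 uA vB; set q := al+be in uL vL uA vB *.
have [mu' ui] := uL; have [mv vi] := vL.
pose D := A`^al*B`^be.
apply: (@le_trans _ _ (\int[mu]_x (D*((A`^q)^-1 * `|u x| `^ q+(B`^q)^-1 * `|v x| `^ q)))).
 apply: Int_le; first exact: Lq_mul.
  li.
 move=> x; have := @young_max _ (A^-1 * `|u x|) (B^-1 * `|v x|) al be al0 be0.
 have Ai : 0 <= A^-1 by rewrite invr_ge0 ltW.
 have Bi : 0 <= B^-1 by rewrite invr_ge0 ltW.
 rewrite !mulr_ge0// => /(_ isT isT); rewrite !powRM// -/q.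
 have inv (z r : R) : 0 < z -> z^-1`^r = (z`^r)^-1.
  by move=> z0; rewrite -powR_inv1 ?(ltW z0)// -powRrM mulN1r powRN.
 rewrite !inv// => h.
 have D0 : 0 < D by pos.
 have -> : `|u x| `^ al * `|v x| `^ be =
   D*((A`^al)^-1 * `|u x| `^ al*((B`^be)^-1 * `|v x| `^ be)).
  by rewrite /D; field; rewrite !gt_eqF ?powR_gt0.
 by rewrite ler_pM2l.
rewrite IntZ; last by apply: igD; exact: igZ.
rewrite IntD; [|li|li]; rewrite !IntZ// -[X in _ <= X]mulrA [2*_]mulrC.
rewrite ler_wpM2l ?mulr_ge0 ?powR_ge0//.
have -> : 2 = 1+1 :> R by [].
by apply: lerD; rewrite ler_pdivrMl ?powR_gt0// mulr1.
Qed.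

Lemma nq_eq0 q u : 0 < q -> Lq q u -> nq q u = 0 -> u = (fun=> 0) %[ae mu].
Proof.
move=> q0 [mu' ui] /(congr1 (fun z => z`^q)); rewrite nq_powR// powR0 ?gt_eqF//.
move=> /(Int_eq0 ui) h; have := h (fun x => powR_ge0 _ _).
apply: filterS => x /(_ I) /eqP; rewrite powR_eq0 normr_eq0 => /andP[/eqP-> _ _] //.
Qed.

Lemma holder_nq (al be : R) u v : 0 < al -> 0 < be -> Lq (al+be) u -> Lq (al+be) v ->
 \int[mu]_x (`|u x| `^ al * `|v x| `^ be) <= 2*nq (al+be) u`^al*nq (al+be) v`^be.
Proof.
move=> al0 be0 uL vL; set q := al+be in uL vL *.
have q0 : 0 < q by pos.
have z (w : T -> R) (r : R) : 0 < r -> w = (fun=> 0) %[ae mu] ->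
  {ae mu, forall x, `|w x| `^ r = 0}.
 by move=> r0; apply: filterS => x /(_ I) ->; rewrite normr0 powR0// gt_eqF.
have [mu' _] := uL; have [mv _] := vL.
have RHS0 : 0 <= 2*nq q u`^al*nq q v`^be by pos.
have [u0|u0] := eqVneq (nq q u) 0.
 rewrite (@Int_aeeq _ _ _ _ _ (fun=> 0)); [by rewrite Int0|by mfun|li|].
 by apply: filterS (z _ _ al0 (nq_eq0 q0 uL u0)) => x -> _; rewrite mul0r.
have [v0|v0] := eqVneq (nq q v) 0.
 rewrite (@Int_aeeq _ _ _ _ _ (fun=> 0)); [by rewrite Int0|by mfun|li|].
 by apply: filterS (z _ _ be0 (nq_eq0 q0 vL v0)) => x -> _; rewrite mulr0.
have u1 : 0 < nq q u by rewrite lt_neqAle nq_ge0 eq_sym u0.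
have v1 : 0 < nq q v by rewrite lt_neqAle nq_ge0 eq_sym v0.
by apply: (holder_young (ltW al0) (ltW be0) uL vL u1 v1); rewrite nq_powR.
Qed.

(** Brezis-Lieb device: the excess of [|X k|] over [e |a k|^p] is dominated by [|B|] and tends to 0
    almost everywhere, so its integral tends to 0, while the part removed costs at most [e M]. *)
Lemma vitali_young (p M : R) (X a : nat -> T -> R) :
 (forall k, mes (X k)) -> (forall k, ig (fun x => `|a k x| `^ p)) ->
 (forall k, \int[mu]_x (`|a k x| `^ p) <= M) ->
 {ae mu, forall x, X ^~ x @ \oo --> (0 : R)} ->
 (forall e, 0 < e -> exists2 B, ig B & forall k x, `|X k x| <= e * `|a k x| `^ p+B x) ->
 (forall k, ig (X k)) /\ \int[mu]_x `|X k x| @[k --> \oo] --> (0 : R).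
Proof.
move=> mX ai aM X0 XB.
have Xi k : ig (X k).
 have [B Bi hB] := XB 1 ltr01.
 by apply: (ig_le (mX k) (igD (igZ 1 (ai k)) Bi)) => x.
split => //.
have M0 : 0 <= M by apply: le_trans (aM 0%N); apply: Int_ge0 => x.
apply/cvgrPdist_le => e e0.
pose e1 := e/(2*(M+1)).
have e10 : 0 < e1 by pos.
have [B Bi hB] := XB _ e10.
pose W k x := Num.max (`|X k x| - e1 * `|a k x| `^ p) 0.
have mW k : mes (W k).
 apply: measurable_maxr => //.
 by apply: measurable_funB; [mfun|exact: ig_mes (igZ _ (ai k))].
have W0 k x : 0 <= W k x by rewrite /W le_max lexx orbT.
have WC k x : W k x <= `|B x|.
 by rewrite /W ge_max normr_ge0 lerBlDl (le_trans (hB k x))// lerD2l ler_norm.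
have WH k x : W k x <= `|X k x|.
 by rewrite /W ge_max normr_ge0 gerBl mulr_ge0 ?powR_ge0// ltW.
have [|||||W1 W2 _] := @DCT _ T R mu W (fun=> 0) (fun x => `|B x|).
- li.
- li.
- apply: filterS X0 => x ax.
 apply: (@squeeze_cvgr _ _ _ _ (fun=> 0) (fun k => `|X k x|)).
 + by apply: nearW => k; rewrite W0 WH.
 + cv.
 + exact/norm_cvg0P.
- li.
- by apply: aeW => x k; rewrite ger0_norm.
have Wi k : ig (W k).
 by apply: (ig_le (mW k) (ig_norm Bi)) => x; rewrite ger0_norm.
rewrite Int0 in W2.
move/cvgrPdist_le : W2 => /(_ (e/2)); rewrite divr_gt0// => /(_ isT).
apply: filterS => k; rewrite !sub0r !normrN.
rewrite ger0_norm; last by apply: Int_ge0 => x.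
move=> We; rewrite ger0_norm; last exact: Int_ge0.
apply: (@le_trans _ _ (\int[mu]_x (W k x+e1 * `|a k x| `^ p))).
 apply: Int_le; [exact: ig_norm|exact: igD (Wi k) (igZ _ (ai k))|] => x.
 by rewrite -lerBlDr le_max lexx.
rewrite IntD ?IntZ//; last li.
have : e1*\int[mu]_x `|a k x| `^ p <= e/2.
 apply: (@le_trans _ _ (e1*(M+1))).
  by rewrite ler_pM2l// (le_trans (aM k))// lerDl.
 rewrite /e1; apply: eqle; field; pos.
lra.
Qed.

(** Absolute continuity of the integral: the part of [f] above a high level [n] has integral at most
    [e], and [K = n] serves for the rest. *)
Lemma Int_abs_cont f e : ig f -> (forall x, 0 <= f x) -> 0 < e ->
 exists2 K, 0 <= K & forall A : set T, measurable A -> (mu A < +oo)%E ->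
  \int[mu]_x (f x*\1_A x) <= K*fine (mu A)+e.
Proof.
move=> fi f0 e0; have mf := ig_mes fi.
pose W (n : nat) x := Num.max (f x-n%:R) 0.
have mW n : mes (W n) by apply: measurable_maxr => //; mfun.
have W0 n x : 0 <= W n x by rewrite /W le_max lexx orbT.
have Wf n x : W n x <= f x by rewrite /W ge_max f0 gerBl ler0n.
have [|||||_ W2 _] := @DCT _ T R mu W (fun=> 0) f.
- li.
- li.
- apply: aeW => x; apply: cvg_near_cst.
 exists (Num.bound (f x)) => // n /= bn; apply/max_idPr.
 by rewrite subr_le0 (le_trans (ltW (archi_boundP (f0 x))))// ler_nat.
- li.
- by apply: aeW => x n; rewrite ger0_norm.
rewrite Int0 in W2; move/cvgrPdist_le : W2 => /(_ e e0)[n _ /(_ n (leqnn n))].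
rewrite sub0r normrN ger0_norm ?Int_ge0// => We.
exists n%:R => // A mA Aoo.
have iA : ig (\1_A : T -> R).
 apply/integrableP; split; first exact/measurable_EFinP.
 rewrite (eq_integral (fun x => (\1_A x)%:E)); last first.
  by move=> t _; rewrite /= ger0_norm.
 by rewrite integral_indic// setIT.
have Wi : ig (W n) by apply: (ig_le (mW n) fi) => x; rewrite ger0_norm.
apply: (@le_trans _ _ (\int[mu]_x (n%:R*\1_A x+W n x))).
 apply: Int_le => [||x].
 - apply: (ig_le _ fi); first by mfun.
  by move=> x; rewrite normrM !ger0_norm// ler_piMr// lern1 leq_b1.
 - li.
 - rewrite indicE; case: (_ \in _); rewrite ?mulr1 ?mulr0 ?add0r//.
  by rewrite -lerBlDl le_max lexx.
rewrite IntD//; last li.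
rewrite IntZ// lerD//; apply: eqle; congr (_*_).
by rewrite /Rintegral integral_indic// setIT.
Qed.

End Lq_tools.

(** * Differentiable truncation to a layer of values *)

Section truncation.
Context {R : realType}.
Implicit Types s t h l : R.

Definition qpos t : R := Num.max t 0^+2.

Lemma qpos_rem t h : `|qpos (t+h)-qpos t-2*Num.max t 0*h| <= h^+2.
Proof.
rewrite /qpos; have h2 := sqr_ge0 h.
have [t0|t0] := leP t 0; have [th|th] := leP (t+h) 0.
- by rewrite expr0n/= mulr0 mul0r !subr0 normr0.
- rewrite expr0n/= mulr0 mul0r !subr0 ger0_norm ?sqr_ge0// ler_pXn2r ?nnegrE ?(ltW th)//; first lra.
 pos.
- rewrite ler_norml; apply/andP; split; nra.
- rewrite ler_norml; apply/andP; split; nra.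
Qed.

(** A quadratic spline with knots 1, 3/2, 2: a C^1 step from 0 on [t <= 1] to 1 on [2 <= t], with
    the quadratic Taylor remainder that the weak chain rule consumes. *)
Definition T t : R := 2*qpos (t-1)-4*qpos (t-3/2)+2*qpos (t-2).
Definition dT t : R :=
 4*Num.max (t-1) 0-8*Num.max (t-3/2) 0+4*Num.max (t-2) 0.

Lemma T_small t : t <= 1 -> T t = 0.
Proof.
move=> t1; by rewrite /T /qpos !max_r; try lra; rewrite expr0n/=.
Qed.

Lemma T_big t : 2 <= t -> T t = 1.
Proof. by move=> t2; rewrite /T /qpos !max_l; try lra. Qed.

Lemma T_01 t : 0 <= T t <= 1.
Proof.
have [t1|t1] := leP t 1; first by rewrite T_small// lexx ler01.
have [t2|t2] := leP 2 t; first by rewrite T_big// lexx ler01.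
rewrite /T /qpos [Num.max (t-1) 0]max_l; last lra.
rewrite [Num.max (t-2) 0]max_r; last pos.
have [t3|t3] := leP (t-3/2) 0; apply/andP; rewrite expr0n/=; split; nra.
Qed.

Lemma dT_small t : t <= 1 -> dT t = 0.
Proof. move=> t1; rewrite /dT !max_r; pos. Qed.

Lemma dT_big t : 2 <= t -> dT t = 0.
Proof. move=> t2; rewrite /dT !max_l; lra. Qed.

Lemma dT_02 t : 0 <= dT t <= 2.
Proof.
have [t1|t1] := leP t 1; first by rewrite dT_small// lexx ler0n.
have [t2|t2] := leP 2 t; first by rewrite dT_big// lexx ler0n.
rewrite /dT [Num.max (t-1) 0]max_l; last lra.
rewrite [Num.max (t-2) 0]max_r; last pos.
have [t3|t3] := leP (t-3/2) 0; apply/andP; split; lra.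
Qed.

Lemma T_rem t h : `|T (t+h)-T t-dT t*h| <= 8*h^+2.
Proof.
have q1 := qpos_rem (t-1) h; have q2 := qpos_rem (t-3/2) h; have q3 := qpos_rem (t-2) h.
rewrite /T /dT; have e a : t+h-a = t-a+h by ring.
rewrite !e; move: q1 q2 q3; rewrite !ler_norml => /andP[a1 a2] /andP[b1 b2] /andP[c1 c2].
pos.
Qed.

(* [Tl l] truncates [|s|] to the layer [l <= |s| <= 2 l], in a differentiable way. *)
Definition Tl l s : R := l*(T (s/l)+T (- (s/l))).
Definition dTl l s : R := dT (s/l)-dT (- (s/l)).

Variable l : R.
Hypothesis l0 : 0 < l.
Ltac llra := move: l0; lra.

Lemma Tl_small s : `|s| <= l -> Tl l s = 0.
Proof.
rewrite ler_norml => /andP[s1 s2]; rewrite /Tl !T_small ?addr0 ?mulr0//.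
 rewrite -mulNr ler_pdivrMr//; pos.
by rewrite ler_pdivrMr// mul1r.
Qed.

Lemma Tl_big s : 2 * l <= `|s| -> Tl l s = l.
Proof.
rewrite ler_normr /Tl => /orP[h|h].
 rewrite T_big ?ler_pdivlMr// T_small ?addr0 ?mulr1//.
 by rewrite -mulNr ler_pdivrMr//; llra.
rewrite [X in X + _]T_small; last by rewrite ler_pdivrMr//; llra.
by rewrite add0r T_big ?mulr1// -mulNr ler_pdivlMr.
Qed.

Lemma Tl_0l s : 0 <= Tl l s <= l.
Proof.
have [s0|s0] := leP s 0.
 rewrite /Tl [X in X + _]T_small; last by rewrite ler_pdivrMr//; llra.
 have /andP[a b] := T_01 (- (s/l)).
 by rewrite add0r mulr_ge0 ?(ltW l0)//= ler_piMr// ltW.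
rewrite /Tl [X in _+X]T_small; last by rewrite -mulNr ler_pdivrMr//; llra.
have /andP[a b] := T_01 (s/l).
by rewrite addr0 mulr_ge0 ?(ltW l0)//= ler_piMr// ltW.
Qed.

Lemma Tl_le s : `|Tl l s| <= 2 * `|s|.
Proof.
have [h|h] := leP `|s| l; first by rewrite Tl_small// normr0.
by have /andP[a b] := Tl_0l s; rewrite ger0_norm; llra.
Qed.

Lemma dTl_le s : `|dTl l s| <= 2.
Proof.
rewrite /dTl; have /andP[a1 a2] := dT_02 (s/l); have /andP[b1 b2] := dT_02 (- (s/l)).
rewrite ler_norml; apply/andP; split; pos.
Qed.

Lemma dTl_out s : ~~ (l < `|s| < 2 * l) -> dTl l s = 0.
Proof.
rewrite negb_and -!leNgt => /orP[h|].
 move: h; rewrite ler_norml => /andP[s1 s2]; rewrite /dTl !dT_small ?subrr//.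
  rewrite -mulNr ler_pdivrMr//; pos.
 by rewrite ler_pdivrMr// mul1r.
rewrite ler_normr /dTl => /orP[h|h].
 rewrite dT_big ?ler_pdivlMr// dT_small ?subrr//.
 by rewrite -mulNr ler_pdivrMr//; llra.
rewrite [X in X - _]dT_small; last by rewrite ler_pdivrMr//; llra.
by rewrite dT_big ?subrr// -mulNr ler_pdivlMr.
Qed.

Lemma Tl_rem s t : `|Tl l (s+t)-Tl l s-dTl l s*t| <= 16/l*t^+2.
Proof.
have ln : l != 0 by rewrite gt_eqF.
have := T_rem (s/l) (t/l); have := T_rem (- (s/l)) (- (t/l)).
rewrite -opprD -mulrDl sqrrN mulrN => h1 h2.
have -> : Tl l (s+t)-Tl l s-dTl l s*t =
 l*((T ((s+t)/l)-T (s/l)-dT (s/l)*(t/l)) +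
    (T (- ((s+t)/l))-T (- (s/l)) - - (dT (- (s/l))*(t/l)))).
 by rewrite /Tl /dTl; field.
rewrite normrM (gtr0_norm l0).
have -> : 16/l*t^+2 = l*(16*(t/l)^+2) by field.
rewrite ler_pM2l// (le_trans (ler_normD _ _))//.
pos.
Qed.

Lemma measurable_T : measurable_fun setT (@T).
Proof.
have mq (a : R) : measurable_fun setT (fun t : R => qpos (t-a)).
 by apply: measurable_funX; apply: measurable_maxr => //; mfun.
mfun.
Qed.

Lemma measurable_dT : measurable_fun setT (@dT).
Proof.
have mq (a : R) : measurable_fun setT (fun t : R => Num.max (t-a) 0).
 by apply: measurable_maxr => //; mfun.
mfun.
Qed.

Lemma measurable_Tl : measurable_fun setT (Tl l).
Proof.
have m1 : measurable_fun setT (fun s : R => s/l) by mfun.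
have m2 : measurable_fun setT (fun s : R => - (s/l)) by mfun.
apply: measurable_funM => //; apply: measurable_funD.
 exact: (measurableT_comp measurable_T m1).
exact: (measurableT_comp measurable_T m2).
Qed.

Lemma measurable_dTl : measurable_fun setT (dTl l).
Proof.
have m1 : measurable_fun setT (fun s : R => s/l) by mfun.
have m2 : measurable_fun setT (fun s : R => - (s/l)) by mfun.
apply: measurable_funB.
 exact: (measurableT_comp measurable_dT m1).
exact: (measurableT_comp measurable_dT m2).
Qed.

End truncation.

(** * One-variable splines and exponential weights *)

Section splines.
Context {R : realType}.
Implicit Types (f df : R -> R) (s t h K : R).

Lemma MVT1 f df s t : (forall x : R, is_derive x 1 f (df x)) ->
 exists2 c, `|c| <= `|t| & f (s+t)-f s = df (s+c)*t.
Proof.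
move=> fd; have cf : continuous f.
 by move=> x; apply: differentiable_continuous; apply/derivable1_diffP; case: (fd x).
have [t0|t0] := leP 0 t.
 have [||c cI E] := @MVT_segment _ f df s (s+t).
 - pos.
 - exact: continuous_subspaceT.
 move: cI; rewrite in_itv/= => /andP[c1 c2]; exists (c-s).
  by rewrite !ger0_norm ?subr_ge0// lerBlDl.
 by rewrite E addrAC subrr add0r [s + _]addrC subrK.
have [||c cI E] := @MVT_segment _ f df (s+t) s.
- pos.
- exact: continuous_subspaceT.
move: cI; rewrite in_itv/= => /andP[c1 c2]; exists (c-s).
 rewrite !ler0_norm ?subr_le0; move: c1; lra.
by rewrite [s+(c-s)]addrC subrK -opprB E opprD addrA subrr add0r mulrN opprK.
Qed.

Lemma lip_of_derive f df K : (forall x : R, is_derive x 1 f (df x)) ->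
 (forall x, `|df x| <= K) -> forall s t, `|f (s+t)-f s| <= K * `|t|.
Proof.
by move=> fd dK s t; have [c _ ->] := MVT1 s t fd; rewrite normrM ler_wpM2r.
Qed.

Lemma quad_of_lip f df K : (forall x : R, is_derive x 1 f (df x)) -> 0 <= K ->
 (forall s t, `|df (s+t)-df s| <= K * `|t|) ->
 forall s t, `|f (s+t)-f s-df s*t| <= K*t^+2.
Proof.
move=> fd K0 dK s t; have [c ct ->] := MVT1 s t fd; rewrite -mulrBl normrM.
rewrite -(real_normK (num_real t)) mulrA ler_wpM2r//.
by rewrite (le_trans (dK s c))// ler_wpM2l.
Qed.

Lemma is_derive_rem f s (d K : R) : (forall h, `|f (s+h)-f s-d*h| <= K*h^+2) ->
 is_derive s 1 f d.
Proof.
move=> fK; apply: is_derive_lim.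
have K0 : 0 <= K by have := le_trans (normr_ge0 _) (fK 1); rewrite expr1n mulr1.
apply/cvgrPdist_le => e e0.
have eK : 0 < e/(K+1) by pos.
near=> h; have hn0 : h != 0 by near: h; exact: nbhs_dnbhs_neq.
have h1 : `|h| <= e/(K+1) by near: h; exact: dnbhs0_le.
rewrite distrC.
have -> : h^-1*(f (h*:1+s)-f s)-d = h^-1*(f (s+h)-f s-d*h).
 by rewrite [h*:1]mulr1 [h+s]addrC; field.
rewrite normrM normfV ler_pdivrMl ?normr_gt0// (le_trans (fK h))//.
rewrite -(real_normK (num_real h)) mulrCA ler_wpM2l//.
rewrite (le_trans (ler_wpM2l K0 h1))// mulrA ler_pdivrMr ?ltr_wpDl// mulrC ler_wpM2l ?(ltW e0)//.
by rewrite lerDl.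
Unshelve. all: by end_near. Qed.

Lemma deriv_mul f g s (a b : R) : is_derive s 1 f a -> is_derive s 1 g b ->
 is_derive s 1 (fun t => f t*g t) (f s*b+g s*a).
Proof. move=> fa gb; exact: (@is_deriveM _ _ f g s 1 a b). Qed.

Lemma deriv_add f g s (a b : R) : is_derive s 1 f a -> is_derive s 1 g b ->
 is_derive s 1 (fun t => f t+g t) (a+b).
Proof. move=> fa gb; exact: (@is_deriveD R R^o R^o f g s 1 a b). Qed.

Lemma deriv_scale f s (k a : R) : is_derive s 1 f a ->
 is_derive s 1 (fun t => k*f t) (k*a).
Proof. move=> fa; exact: (@is_deriveZ R R^o R^o f k s 1 a). Qed.

Lemma deriv_affine f (k b s d : R) : is_derive (k*s+b) 1 f d ->
 is_derive s 1 (fun t => f (k*t+b)) (k * d).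
Proof.
move=> fd; rewrite mulrC; apply: (@is_derive1_comp _ f (fun t : R => k*t+b)) => //.
have := deriv_add (@is_deriveZ R R^o R^o id k s 1 1 (@is_derive_id R R^o s 1))
 (@is_derive_cst R R^o R^o b s 1).
by rewrite addr0 [_*:1]mulr1.
Qed.

Definition mpos t : R := Num.max t 0.
Definition cpos t : R := t*qpos t.
Definition dpos t : R := t*cpos t.

Lemma mpos_le0 t : t <= 0 -> mpos t = 0. Proof. move=> ?; exact: max_r. Qed.
Lemma mpos_ge0 t : 0 <= t -> mpos t = t. Proof. move=> ?; exact: max_l. Qed.
Lemma qpos_le0 t : t <= 0 -> qpos t = 0.
Proof. by move=> t0; rewrite /qpos max_r// expr0n. Qed.
Lemma qpos_ge0 t : 0 <= t -> qpos t = t^+2.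
Proof. by move=> t0; rewrite /qpos max_l. Qed.

Lemma mul_mpos t : t * mpos t = qpos t.
Proof.
have [t0|t0] := leP t 0; first by rewrite mpos_le0// qpos_le0// mulr0.
by rewrite mpos_ge0 ?qpos_ge0 ?(ltW t0).
Qed.

Lemma is_derive_qpos t : is_derive t 1 qpos (2 * mpos t).
Proof. apply: (@is_derive_rem _ _ _ 1) => h; rewrite mul1r; exact: qpos_rem. Qed.

Lemma is_derive_cpos t : is_derive t 1 cpos (3*qpos t).
Proof.
have := deriv_mul (@is_derive_id R R^o t 1) (is_derive_qpos t).
rewrite (_ : id t*_ + _ = 3*qpos t)// -mul_mpos; ring.
Qed.

Lemma is_derive_dpos t : is_derive t 1 dpos (4*cpos t).
Proof.
have := deriv_mul (@is_derive_id R R^o t 1) (is_derive_cpos t).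
rewrite (_ : id t*_ + _ = 4*cpos t)// /cpos; ring.
Qed.

(** Fourth finite difference. Applied to the truncated powers [max t 0 ^ n / n!] it yields cardinal
    B-splines, here a step and its successive derivatives. *)
Definition spl f t : R := f t-4*f (t-1)+6*f (t-2)-4*f (t-3)+f (t-4).

Lemma is_derive_spl f df t : (forall x : R, is_derive x 1 f (df x)) -> is_derive t 1 (spl f) (spl df t).
Proof.
move=> fd; have h (a : R) : is_derive t 1 (fun x => f (x-a)) (df (t-a)).
 have := @deriv_affine f 1 (- a) t (df (t-a)); rewrite !mul1r => /(_ (fd _)).
 by under eq_fun do rewrite mul1r.
have := deriv_add (deriv_add (deriv_add (deriv_add (fd t) (deriv_scale (-4) (h 1)))
 (deriv_scale 6 (h 2))) (deriv_scale (-4) (h 3))) (h 4).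
rewrite (_ : _ + _ + _ + _ + _ = spl df t); last by rewrite /spl; ring.
rewrite (_ : (fun _ => _) = spl f)//; apply/funext => x; rewrite /spl; pos.
Qed.

(* The C^3 step from 0 (for [t <= 0]) to 1 (for [4 <= t]) and its derivatives. *)
Definition S0 t := 24^-1*spl dpos t.
Definition S1 t := 6^-1*spl cpos t.
Definition S2 t := 2^-1*spl qpos t.
Definition S3 t := spl mpos t.

Lemma is_derive_spline t : [/\ is_derive t 1 S0 (S1 t), is_derive t 1 S1 (S2 t) & is_derive t 1 S2 (S3 t)].
Proof.
split.
- have := deriv_scale (24^-1) (is_derive_spl t is_derive_dpos).
 rewrite (_ : _*_ = S1 t)// /S1 /spl; pos.
- have := deriv_scale (6^-1) (is_derive_spl t is_derive_cpos).
 rewrite (_ : _*_ = S2 t)// /S2 /spl; pos.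
- have := deriv_scale (2^-1) (is_derive_spl t is_derive_qpos).
 rewrite (_ : _*_ = S3 t)// /S3 /spl; pos.
Qed.

Lemma spl_le0 f t : (forall x, x <= 0 -> f x = 0) -> t <= 0 -> spl f t = 0.
Proof. by move=> f0 t0; rewrite /spl !f0; try lra; rewrite !mulr0. Qed.

Lemma cpos_le0 t : t <= 0 -> cpos t = 0. Proof. by move=> t0; rewrite /cpos qpos_le0// mulr0. Qed.
Lemma dpos_le0 t : t <= 0 -> dpos t = 0. Proof. by move=> t0; rewrite /dpos cpos_le0// mulr0. Qed.

Lemma S_le0 t : t <= 0 -> [/\ S0 t = 0, S1 t = 0, S2 t = 0 & S3 t = 0].
Proof.
move=> t0; rewrite /S0 /S1 /S2 /S3.
by rewrite (spl_le0 dpos_le0)// (spl_le0 cpos_le0)// (spl_le0 qpos_le0)// (spl_le0 mpos_le0)// !mulr0.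
Qed.

Lemma S_ge4 t : 4 <= t -> [/\ S0 t = 1, S1 t = 0, S2 t = 0 & S3 t = 0].
Proof.
move=> t4; rewrite /S0 /S1 /S2 /S3 /spl /dpos /cpos !mpos_ge0 ?qpos_ge0; try lra.
split; pos.
Qed.

Lemma spl_bound f B : (forall x, x <= 4 -> `|f x| <= B) -> forall t, t <= 4 -> `|spl f t| <= 16*B.
Proof.
move=> fB t t4; have h (a : R) : 0 <= a -> `|f (t-a)| <= B by move=> a0; apply: fB; lra.
have h0 := fB t t4; have h1 := h 1 ler01; have h2 := h 2 (ler0n _ _); have h3 := h 3 (ler0n _ _).
have h4 := h 4 (ler0n _ _).
move: h0 h1 h2 h3 h4; rewrite /spl !ler_norml.
move=> /andP[? ?] /andP[? ?] /andP[? ?] /andP[? ?] /andP[? ?].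
pos.
Qed.

Lemma S_bounded : exists2 B, 0 <= B & forall t, [/\ `|S0 t| <= B, `|S1 t| <= B, `|S2 t| <= B & `|S3 t| <= B].
Proof.
have m4 x : x <= 4 -> 0 <= mpos x <= 4.
 move=> x4; have [x0|x0] := leP x 0; first by rewrite mpos_le0// lexx ler0n.
 by rewrite mpos_ge0 ?(ltW x0).
have qE x : qpos x = mpos x^+2 by [].
have cE x : cpos x = mpos x^+3.
 have [x0|x0] := leP x 0; first by rewrite cpos_le0// mpos_le0// expr0n.
 by rewrite /cpos qpos_ge0 ?mpos_ge0 ?(ltW x0)//.
have dE x : dpos x = mpos x^+4.
 have [x0|x0] := leP x 0; first by rewrite dpos_le0// mpos_le0// expr0n.
 by rewrite /dpos cE mpos_ge0 ?(ltW x0)//.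
have pw n x : x <= 4 -> `|mpos x^+n| <= 4^+n.
 by move=> /m4/andP[a b]; rewrite ger0_norm ?exprn_ge0// lerXn2r// nnegrE.
exists (16*4^+4) => // t; have [t4|t4] := leP t 4; last first.
 have [-> -> -> ->] := S_ge4 (ltW t4); rewrite normr0 normr1; split; pos.
have b4 := @spl_bound dpos (4^+4) _ t t4; have b3 := @spl_bound cpos (4^+3) _ t t4.
have b2 := @spl_bound qpos (4^+2) _ t t4; have b1 := @spl_bound mpos (4^+1) _ t t4.
have {}b4 : `|spl dpos t| <= 16*4^+4 by apply: b4 => x x4; rewrite dE; exact: pw.
have {}b3 : `|spl cpos t| <= 16*4^+3 by apply: b3 => x x4; rewrite cE; exact: pw.
have {}b2 : `|spl qpos t| <= 16*4^+2 by apply: b2 => x x4; rewrite qE; exact: pw.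
have {}b1 : `|spl mpos t| <= 16*4^+1 by apply: b1 => x x4; rewrite -[mpos x]expr1; exact: pw.
have pm (c x : R) : 0 <= c -> `|c*x| = c * `|x| by move=> c0; rewrite normrM ger0_norm.
rewrite /S1 /S2 /S3 !pm ?invr_ge0//.
move: b1 b2 b3 b4; split; lra.
Qed.

(** Three bounded derivatives, so that both [f] and [f1] have a quadratic Taylor remainder and both
    can multiply elements of D^{1,2}. *)
Definition D3 f f1 f2 f3 := (forall t : R, [/\ is_derive t 1 f (f1 t), is_derive t 1 f1 (f2 t) & is_derive t 1 f2 (f3 t)])
 /\ exists2 B, 0 <= B & forall t, [/\ `|f t| <= B, `|f1 t| <= B, `|f2 t| <= B & `|f3 t| <= B].

Lemma D3_spline (k b : R) : D3 (fun t => S0 (k*t+b)) (fun t => k*S1 (k*t+b))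
 (fun t => k*(k*S2 (k*t+b))) (fun t => k*(k*(k*S3 (k*t+b)))).
Proof.
split=> [t|].
 have [h1 h2 h3] := is_derive_spline (k*t+b); split.
 - exact: deriv_affine.
 - apply: deriv_scale; exact: deriv_affine.
 - apply/deriv_scale/deriv_scale; exact: deriv_affine.
have [B B0 hB] := S_bounded.
have k1 : 0 <= 1+`|k| by li.
have kk : `|k| <= 1+`|k| by pos.
have k1' : 1 <= 1+`|k| by rewrite lerDl.
exists ((1+`|k|)^+3*B) => [|t]; first pos.
have [h0 h1 h2 h3] := hB (k*t+b); move: h0 h1 h2 h3.
move: (S0 _) (S1 _) (S2 _) (S3 _) => c0 c1 c2 c3 h0 h1 h2 h3; rewrite !normrM; split.
- rewrite -[X in X <= _]mul1r ler_pM// exprn_ege1//.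
- by rewrite ler_pM// (le_trans kk)// -[X in X <= _]expr1 ler_weXn2l.
- rewrite mulrA -expr2 ler_pM ?exprn_ge0//.
 by apply: (@le_trans _ _ ((1+`|k|)^+2)); [rewrite lerXn2r ?nnegrE|rewrite ler_weXn2l].
- have -> : `|k|*(`|k|*(`|k| * `|c3|)) = `|k|^+3 * `|c3| by pos.
 by rewrite ler_pM ?exprn_ge0// lerXn2r.
Qed.

(* The weight [expR (- s t)], cut off on the half-line [t <= -4]. *)
Definition ew0 s t : R := expR (- s*t+0)*S0 (1*t+4).
Definition ew1 s t : R := expR (- s*t+0)*(S1 (1*t+4)-s*S0 (1*t+4)).
Definition ew2 s t : R := expR (- s*t+0)*(S2 (1*t+4)-2*s*S1 (1*t+4)+s^+2*S0 (1*t+4)).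
Definition ew3 s t : R := expR (- s*t+0) *
 (S3 (1*t+4)-3*s*S2 (1*t+4)+3*s^+2*S1 (1*t+4)-s^+3*S0 (1*t+4)).

Lemma D3_ew s : 0 <= s -> D3 (ew0 s) (ew1 s) (ew2 s) (ew3 s).
Proof.
move=> s0; split=> [t|].
 have [h1 h2 h3] := is_derive_spline (1*t+4).
 have e0 : is_derive t 1 (fun t => expR (- s*t+0)) (- s*expR (- s*t+0)).
  by apply: deriv_affine.
 have g1 := deriv_affine h1; have g2 := deriv_affine h2; have g3 := deriv_affine h3.
 split.
 - have := deriv_mul e0 g1.
  rewrite (_ : _ + _ = ew1 s t)// /ew1; pos.
 - have := deriv_mul e0 (deriv_add g2 (deriv_scale (- s) g1)).
  rewrite (_ : expR _*_ + _ = ew2 s t); last first.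
   rewrite /ew2; move: (S0 _) (S1 _) (S2 _) (expR _) => ? ? ? ?; pos.
  rewrite (_ : (fun _ => _) = ew1 s)//; apply/funext => x; rewrite /ew1; pos.
 - have := deriv_mul e0 (deriv_add (deriv_add g3 (deriv_scale (- (2*s)) g2)) (deriv_scale (s^+2) g1)).
  rewrite (_ : expR _*_ + _ = ew3 s t); last first.
   rewrite /ew3; move: (S0 _) (S1 _) (S2 _) (S3 _) (expR _) => ? ? ? ? ?; pos.
  rewrite (_ : (fun _ => _) = ew2 s)//; apply/funext => x; rewrite /ew2; pos.
have [B B0 hB] := S_bounded.
pose X := expR (4*s); pose Y := (1+s)^+3.
have XYB : 0 <= X*(Y*B) by pos.
exists (X*(Y*B)) => // t.
have [t4|t4] := leP t (-4).
 have t4' : 1*t+4 <= 0 by lra.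
 have [z0 z1 z2 z3] := S_le0 t4'; rewrite /ew0 /ew1 /ew2 /ew3 z0 z1 z2 z3 !mulr0 !subr0 !addr0 !mulr0 normr0.
 pos.
have eX : expR (- s*t+0) <= X by rewrite ler_expR; nra.
have [h0 h1 h2 h3] := hB (1*t+4); move: h0 h1 h2 h3.
rewrite /ew0 /ew1 /ew2 /ew3; move: (S0 _) (S1 _) (S2 _) (S3 _) => c0 c1 c2 c3 h0 h1 h2 h3.
have b c z : 0 <= z -> `|c| <= B -> `|z*c| <= z*B.
 by move=> z0 cB; rewrite normrM ger0_norm// ler_wpM2l.
have s2 : 0 <= s^+2 by pos.
have s3 : 0 <= s^+3 by pos.
have n1 := b _ _ s0 h0; have n2 := b _ _ s0 h1; have n3 := b _ _ s2 h0.
have n4 := b _ _ s0 h2; have n5 := b _ _ s2 h1; have n6 := b _ _ s3 h0.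
have YE : Y*B = B+3*(s*B)+3*(s^+2*B)+s^+3*B by rewrite /Y; ring.
have m1 : 0 <= s*B by pos.
have m2 : 0 <= s^+2*B by pos.
have m3 : 0 <= s^+3*B by pos.
have key z : `|z| <= Y*B -> `|expR (- s*t+0)*z| <= X*(Y*B).
 by move=> zY; rewrite normrM ger0_norm ?expR_ge0// ler_pM.
split; apply: key; rewrite YE.
- lra.
- have := ler_normB c1 (s*c0); lra.
- have -> : c2-2*s*c1+s^+2*c0 = c2+(- (2*(s*c1))+s^+2*c0) by pos.
 have q1 := ler_normD c2 (- (2*(s*c1))+s^+2*c0).
 have q2 := ler_normD (- (2*(s*c1))) (s^+2*c0).
 rewrite normrN normrM [`|2|]ger0_norm// in q2.
 lra.
- have -> : c3-3*s*c2+3*s^+2*c1-s^+3*c0 = c3+(- (3*(s*c2))+(3*(s^+2*c1)-s^+3*c0)) by pos.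
 have q1 := ler_normD c3 (- (3*(s*c2))+(3*(s^+2*c1)-s^+3*c0)).
 have q2 := ler_normD (- (3*(s*c2))) (3*(s^+2*c1)-s^+3*c0).
 have q3 := ler_normB (3*(s^+2*c1)) (s^+3*c0).
 rewrite normrN normrM [`|3|]ger0_norm// in q2.
 rewrite [`|3*_|]normrM [`|3|]ger0_norm// in q3.
 lra.
Qed.

Lemma ew_ge0 s t : 0 <= t ->
 [/\ ew0 s t = expR (- (s*t)), ew1 s t = - s*expR (- (s*t)) & ew2 s t = s^+2*expR (- (s*t))].
Proof.
move=> t0; have t4 : 4 <= 1*t+4 by lra.
have [z0 z1 z2 _] := S_ge4 t4; rewrite /ew0 /ew1 /ew2 z0 z1 z2 addr0 mulNr.
split; pos.
Qed.

Lemma D3_quad f f1 f2 f3 : D3 f f1 f2 f3 -> exists2 K, 0 <= K &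
 [/\ forall t, `|f t| <= K, forall t, `|f1 t| <= K, forall t, `|f2 t| <= K,
  forall s t, `|f (s+t)-f s-f1 s*t| <= K*t^+2 &
  forall s t, `|f1 (s+t)-f1 s-f2 s*t| <= K*t^+2].
Proof.
move=> [fd [K K0 hK]]; exists K => //; split=> [t|t|t|s t|s t]; try by have [] := hK t.
- apply: (@quad_of_lip f f1) => // x; first by have [] := fd x.
 apply: (@lip_of_derive f1 f2) => y; first by have [] := fd y.
 by have [] := hK y.
- apply: (@quad_of_lip f1 f2) => // x; first by have [] := fd x.
 apply: (@lip_of_derive f2 f3) => y; first by have [] := fd y.
 by have [] := hK y.
Qed.

Lemma derive_mes f df : (forall t : R, is_derive t 1 f (df t)) -> measurable_fun [set: R] f.
Proof.
move=> fd; apply: continuous_measurable_fun => x.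
by apply: differentiable_continuous; apply/derivable1_diffP; case: (fd x).
Qed.

Lemma D3_mes f f1 f2 f3 : D3 f f1 f2 f3 ->
 [/\ measurable_fun [set: R] f, measurable_fun [set: R] f1 & measurable_fun [set: R] f2].
Proof.
by move=> [fd _]; split; [apply: (@derive_mes f f1)|apply: (@derive_mes f1 f2)|apply: (@derive_mes f2 f3)] => t;
 have [] := fd t.
Qed.

End splines.

(** * Truncated powers for the Brezis-Kato argument *)

Section truncated_square.
Context {R : realType}.
Implicit Types s t L : R.

Definition tmin L s := Num.min `|s| L.
(** [tsq L] is the primitive of [2 min(|s|, L)], equal to [s |s|] for [|s| <= L], and [tcb L] that
    of [4 min(|s|, L)^2]. Hence [tcb' = tsq'^2]: testing an equation for [w] with [tcb L w] produces
    the squared gradient norm of [tsq L w]. *)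
Definition tsq L s := qpos s-qpos (- s)-qpos (s-L)+qpos (- s-L).
Definition tcb L s := 4/3*(cpos s-cpos (- s)-cpos (s-L)+cpos (- s-L))
 - 4*L*(qpos (s-L)-qpos (- s-L)).

Variable L : R.
Hypothesis L0 : 0 < L.

Lemma tmin_ge0 s : 0 <= tmin L s. Proof. by rewrite le_min normr_ge0 ltW. Qed.
Lemma tmin_leL s : tmin L s <= L. Proof. by rewrite ge_min lexx orbT. Qed.
Lemma tmin_le s : tmin L s <= `|s|. Proof. by rewrite ge_min lexx. Qed.

Lemma tmin_mono s t : `|s| <= `|t| -> tmin L s <= tmin L t.
Proof. by move=> st; rewrite le_min ge_min st /= ge_min lexx orbT. Qed.

Lemma tmin_lip s t : `|tmin L (s+t)-tmin L s| <= `|t|.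
Proof.
rewrite /tmin; have := ler_normD s t; have := ler_normB (s+t) t; rewrite addrK => h1 h2.
move: L0 (normr_ge0 t) h1 h2; move: (`|s+t|) (`|s|) (`|t|) => a b c L1 c0 h1 h2.
case: (leP a L) => h3; case: (leP b L) => h4; rewrite ler_norml; apply/andP; split; lra.
Qed.

Lemma mpos_tmin s : 2 * mpos s+2 * mpos (- s)-2 * mpos (s-L)-2 * mpos (- s-L) = 2*tmin L s.
Proof.
rewrite /tmin; have [s0|s0] := leP 0 s.
 rewrite ger0_norm// mpos_ge0// (@mpos_le0 R (- s)); last lra.
 rewrite (@mpos_le0 R (- s-L)); last by move: L0; lra.
 have [h|h] := leP s L; first by rewrite mpos_le0; lra.
 rewrite mpos_ge0; lra.
rewrite ltr0_norm// mpos_le0; last lra.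
rewrite (@mpos_ge0 R (- s)); last lra.
rewrite (@mpos_le0 R (s-L)); last by move: L0; lra.
have [h|h] := leP (- s) L; first by rewrite mpos_le0; lra.
rewrite mpos_ge0; lra.
Qed.

Lemma qpos_tmin s : 4/3*(3*qpos s - - 1*(3*qpos (- s))-3*qpos (s-L) + - 1*(3*qpos (- s-L)))
 - 4*L*(2 * mpos (s-L) - - 1*(2 * mpos (- s-L))) = 4*tmin L s^+2.
Proof.
rewrite /tmin; have [s0|s0] := leP 0 s.
 rewrite ger0_norm// qpos_ge0// (@qpos_le0 R (- s)); last lra.
 rewrite (@qpos_le0 R (- s-L)); last by move: L0; lra.
 rewrite (@mpos_le0 R (- s-L)); last by move: L0; lra.
 have [h|h] := leP s L; first by rewrite qpos_le0 ?mpos_le0; lra.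
 by rewrite qpos_ge0 ?mpos_ge0; [field|lra|lra].
rewrite ltr0_norm// qpos_le0; last lra.
rewrite (@qpos_ge0 R (- s)); last lra.
rewrite (@qpos_le0 R (s-L)); last by move: L0; lra.
rewrite (@mpos_le0 R (s-L)); last by move: L0; lra.
have [h|h] := leP (- s) L; first by rewrite qpos_le0 ?mpos_le0; [field|lra|lra].
by rewrite qpos_ge0 ?mpos_ge0; [field|lra|lra].
Qed.

Lemma is_derive_tsq s : is_derive s 1 (tsq L) (2*tmin L s).
Proof.
have q1 := is_derive_qpos s.
have q2 := deriv_affine (is_derive_qpos (- 1*s+0)).
have q3 := deriv_affine (is_derive_qpos (1*s + - L)).
have q4 := deriv_affine (is_derive_qpos (- 1*s + - L)).
have := deriv_add (deriv_add (deriv_add q1 (deriv_scale (- 1) q2)) (deriv_scale (- 1) q3)) q4.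
rewrite -mpos_tmin !mulN1r !mul1r !addr0.
rewrite (_ : (fun _ => _) = tsq L); last first.
 by apply/funext => x; rewrite !mulN1r !mul1r addr0.
move=> h; apply: (is_derive_eq h); pos.
Qed.

Lemma is_derive_tcb s : is_derive s 1 (tcb L) (4*tmin L s^+2).
Proof.
have c1 := is_derive_cpos s.
have c2 := deriv_affine (is_derive_cpos (- 1*s+0)).
have c3 := deriv_affine (is_derive_cpos (1*s + - L)).
have c4 := deriv_affine (is_derive_cpos (- 1*s + - L)).
have q3 := deriv_affine (is_derive_qpos (1*s + - L)).
have q4 := deriv_affine (is_derive_qpos (- 1*s + - L)).
have := deriv_add (deriv_scale (4/3) (deriv_add (deriv_add (deriv_add c1 (deriv_scale (- 1) c2)) (deriv_scale (- 1) c3)) c4))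
 (deriv_scale (- (4*L)) (deriv_add q3 (deriv_scale (- 1) q4))).
rewrite -qpos_tmin.
rewrite (_ : (fun _ => _) = tcb L); last first.
 apply/funext => x; rewrite /tcb !mulN1r !mul1r addr0; pos.
rewrite !mulN1r !mul1r !addr0.
move=> h; apply: (is_derive_eq h); pos.
Qed.

Lemma tsq0 : tsq L 0 = 0.
Proof. by rewrite /tsq oppr0 subrr sub0r addNr. Qed.

Lemma tcb0 : tcb L 0 = 0.
Proof. by rewrite /tcb oppr0 subrr !sub0r addNr subrr !mulr0 subrr. Qed.

Lemma tsq_le s : `|tsq L s| <= 2*tmin L s * `|s|.
Proof.
have [c cs] := MVT1 0 s is_derive_tsq; rewrite !add0r tsq0 subr0 => ->.
rewrite normrM ler_wpM2r// ger0_norm; last by apply: mulr_ge0 => //; exact: tmin_ge0.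
rewrite ler_wpM2l//; exact: tmin_mono.
Qed.

Lemma tcb_le s : `|tcb L s| <= 4*tmin L s^+2 * `|s|.
Proof.
have [c cs] := MVT1 0 s is_derive_tcb; rewrite !add0r tcb0 subr0 => ->.
rewrite normrM ler_wpM2r// ger0_norm; last by apply: mulr_ge0 => //; exact: sqr_ge0.
rewrite ler_wpM2l// lerXn2r ?nnegrE ?tmin_ge0//; exact: tmin_mono.
Qed.

Lemma tsq_small s : `|s| <= L -> `|tsq L s| = s^+2.
Proof.
move=> sL; have /ler_normlP[h1 h2] := sL; rewrite /tsq.
rewrite (@qpos_le0 R (s-L)) ?(@qpos_le0 R (- s-L)) ?subr0 ?addr0; try lra.
have [s0|s0] := leP 0 s.
 by rewrite qpos_ge0// qpos_le0; [rewrite subr0 ger0_norm// sqr_ge0|lra].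
rewrite qpos_le0; last lra.
by rewrite qpos_ge0; [rewrite sub0r normrN sqrrN ger0_norm// sqr_ge0|lra].
Qed.

Lemma tsq_ge s : tmin L s * `|s| <= `|tsq L s|.
Proof.
have [h|h] := leP `|s| L.
 by rewrite tsq_small// /tmin min_l// -expr2 real_normK ?num_real.
rewrite /tmin min_r; last pos.
move: h; have [s0|s0] := leP 0 s.
 rewrite ger0_norm// => h; rewrite /tsq qpos_ge0// (@qpos_le0 R (- s)); last lra.
 rewrite (@qpos_le0 R (- s-L)); last by move: L0; lra.
 rewrite qpos_ge0; last lra.
 rewrite subr0 addr0 (_ : s^+2 - _ = L*s+L*(s-L)); last pos.
 have q : 0 <= L*(s-L) by apply: mulr_ge0; [pos|lra].
 apply: le_trans (ler_norm _); lra.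
rewrite ltr0_norm// => h; rewrite /tsq qpos_le0; last lra.
rewrite (@qpos_ge0 R (- s)); last lra.
rewrite (@qpos_le0 R (s-L)); last by move: L0; lra.
rewrite qpos_ge0; last lra.
rewrite (_ : 0-(- s)^+2-0+(- s-L)^+2 = - (L * - s+L*(- s-L))); last pos.
rewrite normrN.
have q : 0 <= L*(- s-L) by apply: mulr_ge0; [pos|lra].
apply: le_trans (ler_norm _); lra.
Qed.

(** Lets the tested nonlinearity [|w|^(p-2) w tcb(w)] be estimated by [|w|^(p-2) tsq(w)^2], with a
    constant independent of [L]. *)
Lemma tcb_tsq s : `|tcb L s| * `|s| <= 4*tsq L s^+2.
Proof.
apply: (@le_trans _ _ (4*(tmin L s * `|s|)^+2)).
 rewrite (_ : 4*_ = 4*tmin L s^+2 * `|s| * `|s|); last pos.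
 by rewrite ler_wpM2r// tcb_le.
rewrite ler_wpM2l// -[tsq L s^+2]real_normK ?num_real// lerXn2r ?nnegrE//; last exact: tsq_ge.
apply: mulr_ge0 => //; exact: tmin_ge0.
Qed.

Lemma tsq_rem s t : `|tsq L (s+t)-tsq L s-2*tmin L s*t| <= 2*t^+2.
Proof.
apply: (@quad_of_lip _ (tsq L) (fun s => 2*tmin L s)) => // [x|x y]; first exact: is_derive_tsq.
by rewrite -mulrBr normrM ger0_norm// ler_wpM2l// tmin_lip.
Qed.

Lemma tcb_rem s t : `|tcb L (s+t)-tcb L s-4*tmin L s^+2*t| <= 8*L*t^+2.
Proof.
apply: (@quad_of_lip _ (tcb L) (fun s => 4*tmin L s^+2) (8*L)) => [x||x y]; first exact: is_derive_tcb.
 pos.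
rewrite -mulrBr normrM ger0_norm// subr_sqr normrM.
rewrite (_ : 8*L*_ = 4*(`|y|*(2*L))); last pos.
rewrite ler_wpM2l//; apply: ler_pM => //; first exact: tmin_lip.
rewrite ger0_norm; first by have := tmin_leL (x+y); have := tmin_leL x; lra.
apply: addr_ge0; exact: tmin_ge0.
Qed.

Lemma measurable_tmin : measurable_fun [set: R] (tmin L).
Proof. by apply: measurable_minr. Qed.

End truncated_square.

(** * Local integrability, density of test functions and duality in L^2 *)

Section euclidean.
Context {R : realType} {N : nat}.
Local Notation E := 'rV[R]_N.
Local Notation mu := (Defs_lebesgue_rV__canonical__measure_function_Measure R N).
Notation mes f := (measurable_fun [set: E] f).
Notation ig f := (mu.-integrable [set: E] (EFin \o f)).
Notation L2 := (L2 mu).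
Notation n2 := (n2 mu).
Notation Lq := (Lq mu).
Notation nq := (nq mu).
Local Notation p := (two_star R N).

Local Notation "E ~>0 k" := (E @[k --> \oo] --> (0 : R)) (at level 69, k name).
Implicit Types (f g u phi : E -> R).

Definition Bn (M : R) : set E := [set x | `|x| < M].

Lemma BnE M : Bn M = ball (0 : E) M.
Proof. by rewrite mx_norm_ball; apply/seteqP; split => x /=; rewrite sub0r normrN. Qed.

Lemma measurable_Bn M : measurable (Bn M).
Proof. rewrite BnE; exact: measurable_ballE. Qed.

Lemma Bn_box M : 0 < M -> Bn M = box (- const_mx M) (const_mx M).
Proof. by move=> M0; rewrite BnE ball_box// sub0r add0r. Qed.

Lemma ig_indic (A : set E) : measurable A -> (mu A < +oo)%E -> ig (\1_A : E -> R).
Proof.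
move=> mA Aoo; apply/integrableP; split; first exact/measurable_EFinP.
rewrite (eq_integral (fun x => (\1_A x)%:E)); last first.
 by move=> t _; rewrite /= ger0_norm.
by rewrite integral_indic// setIT.
Qed.

Lemma ig_Bn M : ig (\1_(Bn M) : E -> R).
Proof.
apply: ig_indic; first exact: measurable_Bn.
have [M0|M0] := ltP 0 M; first by rewrite Bn_box// box_lty.
rewrite (_ : Bn M = set0) ?measure0//; apply/seteqP; split => // x /=.
by rewrite /Bn/= ltNge (le_trans M0).
Qed.

Definition cut (M : R) f : E -> R := fun x => f x*\1_(Bn M) x.

Lemma cutE M f x : cut M f x = if `|x| < M then f x else 0.
Proof.
rewrite /cut indicE; case: ifPn => h; first by rewrite mem_set// mulr1.
rewrite memNset ?mulr0//; exact/negP.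
Qed.

Lemma mes_cut M f : mes f -> mes (cut M f).
Proof. move=> mf; apply: measurable_funM => //; apply: measurable_indic; exact: measurable_Bn. Qed.
#[local] Hint Resolve mes_cut mes_affine mes_shift : mes.

Lemma norm_cut_le M f x : `|cut M f x| <= `|f x|.
Proof. by rewrite cutE; case: ifP => // _; rewrite normr0. Qed.

Lemma ig_bounded f (C M : R) : mes f -> (forall x, `|f x| <= C) -> vanish_out M f -> ig f.
Proof.
move=> mf fC fM; apply: (ig_le mf (igZ C (ig_Bn (M)))) => x.
rewrite indicE; have [xM|xM] := ltP `|x| M.
 by rewrite mem_set// mulr1.
by rewrite fM// normr0 memNset ?mulr0//= /Bn/= ltNge xM.
Qed.

Definition loc f := mes f /\ forall M, ig (cut M f).

Lemma compact_ball_le (M : R) : compact [set x : E | `|x| <= M].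
Proof.
apply: bounded_closed_compact.
 exists M; split; first exact: num_real.
 move=> y My x /= xM; pos.
apply: (@closed_comp E R^o (fun x => `|x|) [set t : R | t <= M]) => [z _|].
 exact: norm_continuous.
li.
Qed.

Lemma loc_integrableP f : loc_integrable f <-> loc f.
Proof.
split=> -[mf fK]; split => //.
 move=> M; have := fK _ (@compact_ball_le M).
 move=> /(@integrableS _ _ _ mu _ (Bn M)) h.
 have : mu.-integrable (Bn M) (EFin \o f).
  apply: h; [|exact: measurable_Bn|by move=> x /ltW].
  apply: closed_measurable_rV; apply: compact_closed; [li|exact: compact_ball_le].
 move=> /(integrable_mkcond _ (measurable_Bn M)).
 apply: eq_integrable => // x _; rewrite /= patchE cutE.
 have -> : (x \in Bn M) = (`|x| < M) by apply/idP/idP => [/set_mem//|h']; exact/mem_set.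
 by case: ifPn.
move=> K cK; have [M [_ /(_ (M+1))]] := compact_bounded cK.
rewrite ltrDl ltr01 => /(_ isT) KM.
have mK : measurable K by apply: closed_measurable_rV; apply: compact_closed => //.
have := @integrableS _ _ _ mu setT K (EFin \o cut (M+2) f) measurableT mK (@subsetT _ _) (fK _).
apply: eq_integrable => // x; rewrite inE => Kx /=; rewrite cutE ifT//.
have := KM _ Kx; rewrite /=; lra.
Qed.

Lemma loc_mulP f phi (C M : R) : loc f -> mes phi -> (forall x, `|phi x| <= C) ->
 vanish_out M phi -> ig (fun x => f x * phi x).
Proof.
move=> [mf fM] mphi phiC phiM; apply: (ig_le _ (igZ C (ig_norm (fM M)))); first mfun.
move=> x; rewrite cutE; have [xM|xM] := ltP `|x| M.
 by rewrite normrM mulrC ler_wpM2r.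
by rewrite phiM// mulr0 normr0 mulr0.
Qed.

Lemma test_mes phi : test_function phi -> mes phi.
Proof. by move=> /test_continuous/continuous_mes. Qed.

Lemma test_ig phi : test_function phi -> ig phi.
Proof.
move=> tphi; have [C _ hC] := test_bounded tphi.
have /test_functionP[_ [M hM]] := tphi.
exact: ig_bounded (test_mes tphi) hC hM.
Qed.

Lemma test_L2 phi : test_function phi -> L2 phi.
Proof.
move=> tphi; have mphi := test_mes tphi; split => //.
apply: test_ig; apply: testMl => //; li.
Qed.
#[local] Hint Resolve test_mes : mes.
#[local] Hint Resolve test_L2 : li.

Lemma loc_test f phi : loc f -> test_function phi -> ig (fun x => f x * phi x).
Proof.
move=> lf tphi; have [C _ hC] := test_bounded tphi.
have /test_functionP[_ [M hM]] := tphi.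
exact: loc_mulP (test_mes tphi) hC hM.
Qed.

Lemma locD f g : loc f -> loc g -> loc (fun x => f x+g x).
Proof.
move=> [mf fi] [mg gi]; split => [|M]; first mfun.
rewrite (_ : cut M _ = fun x => cut M f x+cut M g x); first li.
by apply/funext => x; rewrite /cut mulrDl.
Qed.

Lemma locZ (c : R) f : loc f -> loc (fun x => c*f x).
Proof.
move=> [mf fi]; split => [|M]; first mfun.
rewrite (_ : cut M _ = fun x => c*cut M f x); first li.
by apply/funext => x; rewrite mulrA.
Qed.

Lemma locB f g : loc f -> loc g -> loc (fun x => f x-g x).
Proof. move=> lf lg; under eq_fun do rewrite -mulN1r; exact/locD/locZ. Qed.

Lemma L2_cut M f : L2 f -> L2 (cut M f).
Proof.
by move=> fL; apply: (L2_le _ fL) => [|x]; [exact: mes_cut fL.1|exact: norm_cut_le].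
Qed.

Lemma L2loc_loc f : mes f -> (forall M, L2 (cut M f)) -> loc f.
Proof.
move=> mf fL; split => // M.
apply: (ig_le (mes_cut M mf) (igD (fL M).2 (ig_Bn M))) => x.
rewrite cutE indicE; case: ifPn => h; last by rewrite normr0 addr_ge0//.
rewrite mem_set//; have := sqr_ge0 (`|f x| - 1); rewrite -(real_normK (num_real (f x))).
have := sqr_ge0 (`|f x|); rewrite /= => h2; pos.
Qed.

Lemma L2_loc f : L2 f -> loc f.
Proof. move=> fL; apply: (L2loc_loc fL.1) => M; exact: L2_cut. Qed.

Lemma near_Bn (x : E) : \forall n \near \oo, `|x| < n%:R.
Proof.
exists (Num.bound `|x|) => // n /= bn.
by rewrite (lt_le_trans (archi_boundP (normr_ge0 _)))// ler_nat.
Qed.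

Lemma cut_cvg f x : cut n%:R f x @[n --> \oo] --> f x.
Proof.
apply: cvg_near_cst; near=> n; rewrite cutE ifT//; near: n; exact: near_Bn.
Unshelve. all: by end_near. Qed.

(* The boxes generate the sigma-algebra, so that a locally integrable function
  with vanishing integrals on them vanishes almost everywhere. *)
Lemma test_ae0 f : loc f ->
 (forall phi, test_function phi -> \int[mu]_x (f x * phi x) = 0) ->
 f = (fun=> 0) %[ae mu].
Proof.
move=> lf ft; have [mf fi] := lf.
have fbox a b : \int[mu]_x (f x*\1_(box a b) x) = 0.
 pose M := `|a|+`|b|+1.
 have [|||||_ h _] := @DCT _ _ R mu (fun n x => f x*bump a b n x)
   (fun x => f x*\1_(box a b) x) (fun x => `|cut M f x|).
 - move=> n; mfun; apply: test_mes; exact: test_bump.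
 - mfun; apply: measurable_indic; exact: measurable_box.
 - by apply: aeW => x; apply: cvgM; [cv|exact: bump_cvg].
 - li.
 - apply: aeW => x n; have [xab|xab] := pselect (box a b x); last first.
   by rewrite bump_out// mulr0 normr0.
  rewrite cutE ifT; last by rewrite (le_lt_trans (box_norm_le xab))// ltrDl.
  have /andP[b0 b1] := bump_ge0 a b n x.
  by rewrite normrM (ger0_norm b0) ler_piMr.
 rewrite (_ : (fun _ => _) = cst 0) in h; last first.
  apply/funext => n; rewrite ft//; exact: test_bump.
 exact: (cvg_unique _ h (cvg_cst 0)).
have cut0 M : 0 < M -> cut M f = (fun=> 0) %[ae mu].
 move=> M0; pose F := cut M f.
 have Fi : ig F by li.
 have mF := ig_mes Fi.
 have FA A : measurable A -> ig (fun x => F x*\1_A x).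
  move=> mA; apply: (ig_le _ (ig_norm Fi)); first by mfun.
  by move=> x; rewrite normrM indicE; case: (x \in A); rewrite ?normr1 ?mulr1// normr0 mulr0.
 have main A : measurable A -> \int[mu]_x (F x*\1_A x) = 0.
  rewrite boxes_generate; move: A.
  apply: (@dynkin_induction _ E boxes (fun A => \int[mu]_x (F x*\1_A x) = 0)).
  - exact: boxes_generate.
  - exact: boxes_setI.
  - under eq_Rintegral do rewrite indicT mulr1.
   by rewrite /F /cut Bn_box.
  - move=> _ [a [b ->]]; rewrite /F /cut Bn_box//.
   under eq_Rintegral do rewrite -mulrA.
   rewrite -(fbox (\row_i Num.max ((- const_mx M : E) ord0 i) (a ord0 i))
    (\row_i Num.min ((const_mx M : E) ord0 i) (b ord0 i))) -boxI.
   by apply: Int_ext => x; rewrite indicI.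
  - move=> A mA A0.
   have -> : \int[mu]_x (F x*\1_(~` A) x) = \int[mu]_x (F x-F x*\1_A x).
    apply: Int_ext => x; rewrite !indicE in_setC.
    by case: (x \in A); rewrite ?mulr1 ?mulr0 ?subrr ?subr0.
   rewrite IntB//; last mfun.
   by rewrite A0 subr0 /F /cut Bn_box.
  - move=> A mA tA A0.
   pose S n := \big[setU/set0]_(k < n) A k.
   have mS n : measurable (S n) by exact: bigsetU_measurable.
   have S0 n : \int[mu]_x (F x*\1_(S n) x) = 0.
    elim: n => [|n IH].
     under eq_Rintegral do rewrite /S big_ord0 indic0 mulr0.
     exact: Int0.
    transitivity (\int[mu]_x (F x*\1_(S n) x)+\int[mu]_x (F x*\1_(A n) x)); last by rewrite A0 addr0.
    rewrite -IntD; [|mfun|exact: FA].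
    apply: Int_ext => x; rewrite -mulrDr; congr (_*_).
    rewrite /S big_ord_recr/= -/(S n) !indicE in_setU.
    have : ~ (S n x /\ A n x).
     move=> [+ An]; rewrite /S -bigcup_mkord => -[k /= kn Ak].
     have /trivIsetP/(_ k n I I) := tA; rewrite (ltn_eqF kn) => /(_ isT).
     by move/seteqP => [/(_ x) + _]; apply.
    have [/set_mem h1|h1] := boolP (x \in S n); have [/set_mem h2|h2] := boolP (x \in A n); rewrite ?addr0 ?add0r// => h; exfalso; exact: h.
   have [|||||_ h _] := @DCT _ _ R mu (fun n x => F x*\1_(S n) x)
     (fun x => F x*\1_(\bigcup_k A k) x) (fun x => `|F x|).
   + by move=> n; mfun.
   + apply: ig_mes; apply: FA; exact: bigcupT_measurable.
   + apply: aeW => x; apply: cvgM; first cv.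
    apply: cvg_near_cst.
    have [[k _ Ak]|nA] := pselect ((\bigcup_k A k) x).
     exists k.+1 => // n /= kn; rewrite !indicE !mem_set//; first by exists k.
     by rewrite /S -bigcup_mkord; exists k.
    apply: nearW => n; rewrite !indicE !memNset//.
    by rewrite /S -bigcup_mkord => -[k _ Ak]; apply: nA; exists k.
   + li.
   + apply: aeW => x n; rewrite normrM indicE.
    by case: (x \in S n); rewrite ?normr1 ?mulr1// normr0 mulr0.
   rewrite (_ : (fun _ => _) = cst 0) in h; last by apply/funext => n.
   exact: (cvg_unique _ h (cvg_cst 0)).
 pose P := [set x | 0 < F x]; pose Q := [set x | F x < 0].
 have mP : measurable P.
  have -> : P = setT `&` (F @^-1` `]0, +oo[%classic).
   by apply/seteqP; split => x /=; rewrite in_itv/= andbT; [|case].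
  mfun.
 have mQ : measurable Q.
  have -> : Q = setT `&` (F @^-1` `]-oo, 0[%classic).
   by apply/seteqP; split => x /=; rewrite /Q/=; [|case].
  mfun.
 have FP0 x : 0 <= F x*\1_P x.
  by rewrite indicE; case: (boolP (x \in P)) => [/set_mem/ltW h|_]; rewrite ?mulr0// mulr1.
 have FQ0 x : 0 <= - (F x*\1_Q x).
  by rewrite indicE; case: (boolP (x \in Q)) => [/set_mem/ltW h|_]; rewrite ?mulr0 ?oppr0// mulr1 oppr_ge0.
 have h1 := Int_eq0 (FA _ mP) FP0 (main _ mP).
 have h2 : (fun x => - (F x*\1_Q x)) = (fun=> 0) %[ae mu].
  by apply: Int_eq0 => //; [li|rewrite IntN ?main ?oppr0//; exact: FA].
 apply: filterS2 h1 h2 => x /(_ I) + /(_ I) + _; rewrite -/(F x) !indicE.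
 have [F0|F0|//] := ltgtP (F x) 0.
  rewrite (mem_set (F0 : Q x)) mulr1 => _ /eqP; pos.
 by rewrite (mem_set (F0 : P x)) mulr1.
have : {ae mu, forall x, forall n, cut n.+1%:R f x = 0}.
 by apply: ae_foralln => n; apply: filterS (cut0 n.+1%:R (ltr0Sn _ _)) => x /(_ I).
apply: filterS => x h _; have [n _ hn] := near_Bn x.
by have := h n; rewrite cutE hn//=.
Qed.

(* The best approximation error is orthogonal to all test functions. *)
Lemma test_dense f e : L2 f -> 0 < e -> exists2 phi, test_function phi & n2 (fun x => f x-phi x) <= e.
Proof.
move=> fL e0.
pose A := [set n2 (fun x => f x-phi x) | phi in @test_function R N].
have t0 : test_function (fun _ : E => 0 : R).
 apply/test_functionP; split; first by move=> k; exact: Cn_cst.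
 by exists 0.
have Al : lbound A 0 by move=> _ [phi _ <-]; exact: n2_ge0.
have Ainf : has_inf A by split; [exists (n2 (fun x => f x-0)); exists (fun=> 0)|exists 0].
pose D := inf A.
have D0 : 0 <= D by apply: lb_le_inf => //; case: Ainf.
have Dle phi : test_function phi -> D <= n2 (fun x => f x-phi x).
 by move=> tphi; apply: ge_inf; [exists 0|exists phi].
suff D00 : D = 0.
 have [_ [phi tphi <-] h] := @inf_adherent R A e e0 Ainf.
 exists phi => //; rewrite -/D D00 add0r in h; pos.
have /all_sig2[a at_ aD] n : {phi | test_function phi & n2 (fun x => f x-phi x) < D+n.+1%:R^-1}.
 apply: cid2; have [|_ [phi tphi <-] h] := @inf_adherent R A n.+1%:R^-1 _ Ainf.
  li.
 by exists phi.
pose b n x := f x-a n x.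
have bL n : L2 (b n) by apply: L2B => //; exact: test_L2.
have bc : n2 (b n) @[n --> \oo] --> D.
 apply: (@squeeze_cvgr _ _ _ _ (fun=> D) (fun n => D+n.+1%:R^-1)).
 - by apply: nearW => n; apply/andP; split; [mfun|exact: ltW (aD n)].
 - cv.
 - by rewrite -[X in _ --> X]addr0; apply: cvgD; [cv|exact: (@cvg_harmonic R)].
have [e1 e10|g gL bg] := @L2_complete _ _ R mu b bL.
 have c1 : 4*(D+n.+1%:R^-1)^+2-4*D^+2 @[n --> \oo] --> 4*(D+0)^+2-4*D^+2.
  apply: cvgB; last cv.
  apply: cvgM; first cv.
  rewrite expr2; under eq_fun do rewrite expr2.
  apply: cvgM; apply: cvgD; try exact: cvg_cst; exact: (@cvg_harmonic R).
 have : 4*(D+0)^+2-4*D^+2 < e1 by pos.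
 move=> /(cvgr_lt _ c1); apply: filterS => n hn k nk.
 have mid : D^+2 <= \int[mu]_x (2^-1*(b k x+b n x))^+2.
  rewrite -n2_sq ler_pXn2r ?nnegrE ?n2_ge0//.
  have -> : (fun x => 2^-1*(b k x+b n x)) = (fun x => f x-2^-1*(a k x+a n x)).
   apply/funext => x; rewrite /b; pos.
  apply: Dle; apply: testZ; exact: testD.
 have -> : \int[mu]_x (b k x-b n x)^+2 =
   2*n2 (b k)^+2+2*n2 (b n)^+2-4*\int[mu]_x (2^-1*(b k x+b n x))^+2.
  rewrite !n2_sq -!IntZ; [|exact: (L2Z _ (L2D _ _)).2|li|li].
  rewrite -IntD; [|li|li].
  rewrite -IntB; last 2 first.
  - li.
  - exact: igZ (L2Z _ (L2D (bL k) (bL n))).2.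
  apply: Int_ext => x; pos.
 have sq m : (n <= m)%N -> n2 (b m)^+2 <= (D+n.+1%:R^-1)^+2.
  move=> nm; rewrite ler_pXn2r ?nnegrE ?n2_ge0//; last pos.
  by rewrite (le_trans (ltW (aD m)))// lerD2l lef_pV2 ?posrE ?ltr0n// ler_nat.
 have := sq _ nk; have := sq _ (leqnn n) => h1 h2; apply: le_trans (ltW hn).
 set q := (D + _)^+2 in h1 h2 *; rewrite lerB; lra.
have bg2 := (cvg_n2P mu b g).1 bg.
have gD : n2 g = D by apply: cvg_unique (cvg_n2 bL gL bg2) bc.
have orth phi : test_function phi -> \int[mu]_x (g x * phi x) = 0.
 move=> tphi; have phiL := test_L2 tphi.
 have key t : n2 g^+2 <= n2 g^+2+2*(t*\int[mu]_x (g x * phi x))+t^+2*n2 phi^+2.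
  have -> : n2 g^+2+2*(t*\int[mu]_x (g x * phi x))+t^+2*n2 phi^+2
    = n2 (fun x => g x+t * phi x)^+2.
   rewrite !n2_sq Int_sqD//; last li.
   congr (_+2*_ + _).
    by rewrite -IntZ; [apply: Int_ext => x; ring|li].
   by rewrite -IntZ; [apply: Int_ext => x; ring|exact: phiL.2].
  rewrite ler_pXn2r ?nnegrE ?n2_ge0// gD.
  have c1 : n2 (fun x => b n x+t * phi x) @[n --> \oo] --> n2 (fun x => g x+t * phi x).
   apply: cvg_n2 => [n||]; [li|li|].
   rewrite (_ : (fun _ => _) = (fun k => n2 (fun x => b k x-g x)))//.
   apply/funext => k; congr n2; apply/funext => x; pos.
  apply: (ler_cvg_to (cvg_cst D) c1); apply: nearW => n.
  have -> : (fun x => b n x+t * phi x) = (fun x => f x-(a n x+(- t) * phi x)).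
   apply/funext => x; rewrite /b; pos.
  apply: Dle; apply: testD => //; exact: testZ.
 set H := \int[mu]_x _ in key *; set G := n2 phi^+2 in key.
 have G0 : 0 <= G by pos.
 (* The minimiser in [t] would be [- H / G]; the denominator [G + 1] avoids a separate case for
    [phi] of norm 0 and still gives a negative value unless [H = 0]. *)
 have := key (- H/(G+1)); set t := _ / _ => k1.
 have : 0 <= 2*(t*H)+t^+2*G by lra.
 have -> : 2*(t*H)+t^+2*G = - (H^+2*(G+2)/(G+1)^+2).
  rewrite /t; field; pos.
 rewrite oppr_ge0 pmulr_lle0 ?invr_gt0 ?exprn_gt0 ?ltr_wpDl// pmulr_lle0 ?ltr_wpDl//.
 by move=> h; apply/eqP; rewrite -sqrf_eq0 eq_le h sqr_ge0.
rewrite -gD; have g0 := test_ae0 (L2_loc gL) orth.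
rewrite (n2_aeeq gL.1 _ g0)//; rewrite /n2.
by under eq_Rintegral do rewrite expr0n; rewrite Int0 sqrtr0.
Qed.

Lemma weak_cvg_L2 (g_ : nat -> E -> R) g (C : R) : (forall k, L2 (g_ k)) -> L2 g ->
 (forall k, n2 (g_ k) <= C) ->
 (forall phi, test_function phi ->
  \int[mu]_x (g_ k x * phi x) @[k --> \oo] --> \int[mu]_x (g x * phi x)) ->
 forall f, L2 f -> \int[mu]_x (g_ k x*f x) @[k --> \oo] --> \int[mu]_x (g x*f x).
Proof.
move=> gkL gL gC gt f fL; apply/cvgrPdist_le => e e0.
have C0 : 0 <= C by exact: le_trans (n2_ge0 _ _) (gC 0%N).
pose e1 := e/(2*(C+n2 g+1)).
have K0 : 0 < C+n2 g+1 by pos.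
have e10 : 0 < e1 by pos.
have [phi tphi fphi] := test_dense fL e10.
have phiL := test_L2 tphi.
have : 0 < e/2 by pos.
move: (gt _ tphi) => /cvgrPdist_le/[apply]; apply: filterS => k hk.
have dec h : L2 h -> \int[mu]_x (h x*f x) = \int[mu]_x (h x * phi x)+\int[mu]_x (h x*(f x-phi x)).
 move=> hL; rewrite -IntD; [|li|exact/L2_mul/L2B].
 apply: Int_ext => x; pos.
rewrite !dec//.
have b1 := CS gL (L2B fL phiL); have b2 := CS (gkL k) (L2B fL phiL).
have b3 : n2 g*n2 (fun x => f x-phi x) <= n2 g*e1 by rewrite ler_wpM2l// n2_ge0.
have b4 : n2 (g_ k)*n2 (fun x => f x-phi x) <= C*e1 by rewrite ler_pM ?n2_ge0.
have eE : C*e1+n2 g*e1+e1 = e/2 by rewrite /e1; field; rewrite gt_eqF.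
move: hk b1 b2; rewrite !ler_norml => /andP[? ?] /andP[? ?] /andP[? ?].
apply/andP; split; lra.
Qed.

(** Expanding [n2 (g_ k - g)^2] and using the norm bound leaves twice a pairing with [g] that tends
    to 0. It is applied to difference quotients, whose norms are at most that of the derivative. *)
Lemma weak_norm_strong (g_ : nat -> E -> R) g : (forall k, L2 (g_ k)) -> L2 g ->
 (forall k, n2 (g_ k) <= n2 g) ->
 (forall phi, test_function phi ->
  \int[mu]_x (g_ k x * phi x) @[k --> \oo] --> \int[mu]_x (g x * phi x)) ->
 n2 (fun x => g_ k x-g x) ~>0 k.
Proof.
move=> gkL gL gC gt; have h := weak_cvg_L2 gkL gL gC gt gL.
apply/cvg_n2P; apply: (@squeeze_cvgr _ _ _ _ (fun=> 0)
 (fun k => 2*(\int[mu]_x (g x*g x)-\int[mu]_x (g_ k x*g x)))).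
- apply: nearW => k; rewrite Int_ge0 => [/=|x]; last pos.
 have -> : \int[mu]_x (g_ k x-g x)^+2 =
   n2 (g_ k)^+2-2*\int[mu]_x (g_ k x*g x)+n2 g^+2.
  rewrite !n2_sq Int_sqD//; last exact: L2opp.
  under [X in _+2*X + _]eq_Rintegral do rewrite mulrN.
  under [X in _+X = _]eq_Rintegral do rewrite sqrrN.
  rewrite IntN ?mulrN//; li.
 have : n2 (g_ k)^+2 <= n2 g^+2 by rewrite ler_pXn2r ?nnegrE ?n2_ge0.
 have -> : \int[mu]_x (g x*g x) = n2 g^+2 by rewrite n2_sq.
 lra.
- cv.
- rewrite -[X in _ --> X](mulr0 2); apply: cvgM; first cv.
 rewrite -[X in _ --> X](subrr (\int[mu]_x (g x*g x))); apply: cvgB => //; cv.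
Qed.

(** Multiplying test functions by bumps transfers the bound to [cut M f]; a test function close to
    [cut M f] in L^2 then gives [n2^2 <= C n2], and Fatou removes the cut. *)
Lemma L2_duality f (C : R) : mes f -> (forall M, L2 (cut M f)) -> 0 <= C ->
 (forall phi, test_function phi -> `|\int[mu]_x (f x * phi x)| <= C*n2 phi) ->
 L2 f /\ n2 f <= C.
Proof.
move=> mf fL C0 fC.
have lf := L2loc_loc mf fL.
have cutC M : 0 < M -> n2 (cut M f) <= C.
 move=> M0; pose F := cut M f; have FL : L2 F := fL M.
 have bd phi : test_function phi -> `|\int[mu]_x (F x * phi x)| <= C*n2 phi.
  move=> tphi; pose b n := bump (- const_mx M : E) (const_mx M) n.
  have tb n : test_function (fun x => phi x*b n x) by apply: testMl => //; exact: smooth_bump.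
  have ph := test_L2 tphi.
  have bb n : n2 (fun x => phi x*b n x) <= n2 phi.
   apply: n2_le => // [|x]; first li.
   have /andP[b0 b1] := bump_ge0 (- const_mx M : E) (const_mx M) n x.
   by rewrite normrM (ger0_norm b0) ler_piMr.
  have [|||||_ h _] := @DCT _ _ R mu (fun n x => f x*(phi x*b n x))
    (fun x => F x * phi x) (fun x => `|f x * phi x|).
  - move=> n; apply: measurable_funM => //; mfun.
  - mfun.
  - apply: aeW => x; rewrite /F /cut Bn_box// -mulrA [_ * phi x]mulrC.
   apply: cvgM; first cv.
   by apply: cvgM; [cv|exact: bump_cvg].
  - apply: ig_norm; exact: loc_test.
  - apply: aeW => x n.
   have /andP[b0 b1] := bump_ge0 (- const_mx M : E) (const_mx M) n x.
   by rewrite mulrA normrM (ger0_norm b0) ler_piMr.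
  apply: (ler_cvg_to (cvg_norm h) (cvg_cst _)); apply: nearW => n.
  by rewrite (le_trans (fC _ (tb n)))// ler_wpM2l.
 have : n2 F^+2 <= C*n2 F.
  apply/ler_addgt0Pr => e e0.
  pose e1 := e/(C+n2 F+1).
  have K0 : 0 < C+n2 F+1 by pos.
  have e10 : 0 < e1 by pos.
  have [phi tphi Fphi] := test_dense FL e10; have phiL := test_L2 tphi.
  have -> : n2 F^+2 = \int[mu]_x (F x * phi x)+\int[mu]_x (F x*(F x-phi x)).
   rewrite n2_sq -IntD; [|li|exact/L2_mul/L2B].
   apply: Int_ext => x; pos.
  have b1 := le_trans (ler_norm _) (bd _ tphi).
  have b2 := le_trans (ler_norm _) (CS FL (L2B FL phiL)).
  have b3 : n2 phi <= n2 F+e1.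
   have := n2D FL (L2B phiL FL); rewrite n2B => b3.
   rewrite (le_trans _ (le_trans b3 _)) ?lerD2l//.
   apply: eqle; congr n2; apply/funext => x; pos.
  have b4 : C*n2 phi <= C*(n2 F+e1) by rewrite ler_wpM2l.
  have b5 : n2 F*n2 (fun x => F x-phi x) <= n2 F*e1 by rewrite ler_wpM2l// n2_ge0.
  have eE : C*e1+n2 F*e1+e1 = e by rewrite /e1; field; rewrite gt_eqF.
  lra.
 have := n2_ge0 mu F; rewrite le_eqVlt => /predU1P[<-//|F0].
 by rewrite ler_pM2r.
have [||||||h1 h2] := @Fatou _ _ R mu (fun n x => cut n.+1%:R f x^+2) (fun x => f x^+2) (C^+2).
- move=> k; li.
- mfun.
- move=> k x; pos.
- apply: aeW => x; rewrite expr2; under eq_fun do rewrite expr2.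
 have c := @cvg_sub R^o succn (fun n => cut n%:R f x) (f x) (fun i j ij => ij) (@cut_cvg f x).
 cv.
- apply: nearW => k; rewrite -n2_sq ler_pXn2r ?nnegrE ?n2_ge0//; exact: cutC.
- move=> x; pos.
split => //.
by rewrite -(@ler_pXn2r _ 2) ?nnegrE ?n2_ge0// n2_sq.
Qed.

(** * Weak derivatives and difference quotients *)

Implicit Types (v w z th Q : E -> R) (G H U V W Z Phi : 'I_N -> E -> R) (i : 'I_N).

Lemma L2_shift (h : E) f : L2 f -> L2 (fun x => f (x+h)).
Proof. by move=> [mf fi]; split; [exact: mes_shift|exact: (@ig_shift _ _ h (fun x => f x^+2))]. Qed.
#[local] Hint Resolve L2_shift : li.

Lemma n2_shift (h : E) f : L2 f -> n2 (fun x => f (x+h)) = n2 f.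
Proof. move=> [mf fi]; congr Num.sqrt; exact: (@Int_shift _ _ h (fun x => f x^+2)). Qed.

Lemma norm_hbasis (h : R) i : `|h*:(ebasis i : E)| <= `|h|.
Proof.
apply: norm_le_coord => // j; rewrite !mxE /= normrM.
by case: eqP => _; rewrite ?normr1 ?mulr1// normr0 mulr0.
Qed.

Lemma partial_affine phi i (d : E) (c : R) : smooth phi ->
 partial i (fun x => phi (d+c*:x)) = (fun x => c * partial i phi (d+c*:x)).
Proof.
move=> sphi; apply/funext => x.
suff : is_derive x (ebasis i) (fun x => phi (d+c*:x)) (c * partial i phi (d+c*:x)).
 by case.
apply: is_derive_of_line.
rewrite (_ : (fun _ => _) =
  (fun s : R => phi (d+c*:x+s*:ebasis i)) \o (fun s : R => c*s)); last first.
 by apply/funext => s /=; rewrite scalerDr addrA scalerA.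
rewrite [X in is_derive _ _ _ X]mulrC; apply: is_derive1_comp.
 rewrite mulr0; have := @is_derive_line _ _ phi (d+c*:x) (ebasis i) 0.
 rewrite scale0r addr0; apply; exact: smooth_derivable.
have := @is_deriveZ R R^o R^o id c 0 1 1 (@is_derive_id R R^o 0 1).
by rewrite [c*:1]mulr1.
Qed.

Lemma partial_shift phi i (h : E) : smooth phi ->
 partial i (fun x => phi (x+h)) = (fun x => partial i phi (x+h)).
Proof.
move=> sphi; under eq_fun do rewrite addrC -[X in _+X]scale1r.
by rewrite partial_affine//; apply/funext => x; rewrite mul1r scale1r addrC.
Qed.

Definition taylor_rem phi i (h : R) (x : E) : R :=
 phi (x+h*:ebasis i)-phi x-h * partial i phi x.

Lemma test_taylor phi i : test_function phi ->
 exists K M, [/\ 0 <= K, forall h x, `|taylor_rem phi i h x| <= K*h^+2 &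
  forall h, `|h| <= 1 -> vanish_out M (taylor_rem phi i h)].
Proof.
move=> tphi; have [sphi _] := tphi.
have /test_functionP[_ [M hM]] := tphi.
have [K K0 hK] := test_bounded (test_partial i (test_partial i tphi)).
exists K, (M+1); split => // [h x|h h1 x Mx].
 rewrite /taylor_rem.
 have [t th ->] := @line_MVT _ _ phi i x h (fun y => @smooth_derivable _ _ _ i y sphi).
 have [r rt rE] := @line_MVT _ _ (partial i phi) i x t
  (fun y => @smooth_derivable _ _ _ i y (smooth_partial i sphi)).
 rewrite -mulrBr rE !normrM -(real_normK (num_real h)) expr2 mulrC -mulrA.
 rewrite [K*_]mulrCA; apply: ler_pM => //.
 exact: ler_wpM2r.
rewrite /taylor_rem (partial_vanish i sphi hM Mx) mulr0 subr0.
have hb := le_trans (norm_hbasis h i) h1.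
rewrite !hM ?subrr//; first pos.
have : `|x| <= `|x+h*:ebasis i|+`|h*:(ebasis i : E)|.
 by rewrite -{1}(addrK (h*:ebasis i) x) (le_trans (ler_normB _ _)).
pos.
Qed.

Lemma taylor_rem_mes phi i h : test_function phi -> mes (taylor_rem phi i h).
Proof.
move=> tphi; apply: measurable_funB; last first.
 by apply: measurable_funM; [mfun|apply: test_mes; exact: test_partial].
by apply: measurable_funB; [apply: mes_shift; exact: test_mes|mfun].
Qed.

(** The function of [t] that integrates [u] against the translate of [phi] by [t] along axis [i]
    has, up to a quadratic error uniform for [|t| <= T], the derivative obtained by replacing [u]
    with [g]. *)
Lemma weak_partial_shift u g i phi : is_weak_partial i u g -> test_function phi ->
 forall T : R, exists2 K, 0 <= K & forall t s : R, `|t| <= T -> `|s| <= 1 ->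
  `| \int[mu]_x (u x * phi (x+(- (t+s))*:ebasis i))
   - \int[mu]_x (u x * phi (x+(- t)*:ebasis i))
   - s*\int[mu]_x (g x * phi (x+(- t)*:ebasis i)) | <= K*s^+2.
Proof.
move=> [/loc_integrableP lu /loc_integrableP lg wug] tphi T.
have [K [M [K0 hK hM]]] := test_taylor i tphi.
pose M' := M+T; exists (K*\int[mu]_x `|cut M' u x|).
 by rewrite mulr_ge0// Int_ge0.
move=> t s tT s1.
pose h := (- t)*:(ebasis i : E).
have tp1 : test_function (fun x => phi (x+h)) by exact: test_shift.
have tp2 : test_function (fun x => phi (x+(- (t+s))*:ebasis i)) by exact: test_shift.
have -> : s*\int[mu]_x (g x * phi (x+h)) = - s*\int[mu]_x (u x * partial i phi (x+h)).
 have := wug _ tp1; rewrite partial_shift; last exact: tphi.1.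
 move=> ->; pos.
have i1 := loc_test lu tp1; have i2 := loc_test lu tp2.
have i3 : ig (fun x => u x * partial i phi (x+h)).
 apply: loc_test => //; exact/test_shift/test_partial.
have rE x : u x * phi (x+(- (t+s))*:ebasis i)-u x * phi (x+h)
  - (- s)*(u x * partial i phi (x+h)) = u x*taylor_rem phi i (- s) (x+h).
 have -> : x+(- (t+s))*:ebasis i = (x+h)+(- s)*:ebasis i.
  by rewrite -addrA -scalerDl opprD.
 rewrite /taylor_rem; pos.
have mr : mes (fun x => taylor_rem phi i (- s) (x+h)).
 apply: mes_shift; exact: taylor_rem_mes.
have vr : vanish_out M' (fun x => taylor_rem phi i (- s) (x+h)).
 move=> x Mx; apply: hM; first by rewrite normrN.
 have hT : `|h| <= T by rewrite (le_trans (norm_hbasis _ _))// normrN.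
 have : `|x| <= `|x+h|+`|h| by rewrite -{1}(addrK h x) (le_trans (ler_normB _ _)).
 move: Mx; rewrite /M'; lra.
have br x : `|taylor_rem phi i (- s) (x+h)| <= K*s^+2.
 by rewrite -(sqrrN s).
have ir := loc_mulP lu mr br vr.
rewrite -IntB// -IntZ// -IntB; last 2 first.
- li.
- li.
under eq_Rintegral do rewrite rE.
have ic : ig (fun x => K*s^+2 * `|cut M' u x|) by li.
rewrite mulrAC -IntZ; last by apply: ig_norm; exact: lu.2.
apply: Int_le_norm => // x; rewrite normrM mulrC cutE.
case: ifPn => [_|]; first by rewrite ler_wpM2r.
by rewrite -leNgt => /vr ->; rewrite !normr0 mulr0.
Qed.

(** The translation is cut into [n] equal steps; the linear terms add up to the bound and the
    quadratic errors to [K h^2 / n]. *)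
Lemma test_shift_bound u g i phi h : is_weak_partial i u g -> L2 g -> test_function phi ->
 `| \int[mu]_x (u x * phi (x+(- h)*:ebasis i))-\int[mu]_x (u x * phi x)| <=
  `|h|*(n2 g*n2 phi).
Proof.
move=> wug gL tphi; have phiL := test_L2 tphi.
have [K K0 hK] := weak_partial_shift wug tphi `|h|.
pose Phi t := \int[mu]_x (u x * phi (x+(- t)*:ebasis i)).
have step t s : `|t| <= `|h| -> `|s| <= 1 ->
  `|Phi (t+s)-Phi t| <= `|s|*(n2 g*n2 phi)+K*s^+2.
 move=> th s1; have := hK _ _ th s1; rewrite -/(Phi (t+s)) -/(Phi t).
 set I := \int[mu]_x _ => h1.
 have I1 : `|I| <= n2 g*n2 phi.
  by rewrite (le_trans (CS gL (L2_shift _ phiL)))// n2_shift.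
 have -> : Phi (t+s)-Phi t = (Phi (t+s)-Phi t-s*I)+s*I by pos.
 rewrite (le_trans (ler_normD _ _))// addrC lerD// normrM ler_wpM2l//.
have tele n : (0 < n)%N -> `|h| <= n%:R ->
  `|Phi h-Phi 0| <= `|h|*(n2 g*n2 phi)+K*h^+2/n%:R.
 move=> n0 hn; have n0' : n%:R != 0 :> R by rewrite pnatr_eq0 -lt0n.
 pose s := h/n%:R.
 have s1 : `|s| <= 1 by rewrite /s normrM normfV normr_nat ler_pdivrMr ?ltr0n// mul1r.
 have ind j : (j <= n)%N -> `|Phi (j%:R*s)-Phi 0| <=
   j%:R*(`|s|*(n2 g*n2 phi)+K*s^+2).
  elim: j => [_|j IH jn]; first by rewrite !mul0r subrr normr0.
  have js : `|j%:R*s| <= `|h|.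
   rewrite normrM normr_nat normrM normfV normr_nat mulrCA ler_piMr//.
   by rewrite ler_pdivrMr ?ltr0n// mul1r ler_nat ltnW.
  have := step _ _ js s1; have -> : j%:R*s+s = (j%:R+1)*s by pos.
  move=> st; rewrite -natr1 [X in _ <= X]mulrDl mul1r [X in _ <= X]addrC.
  have -> : Phi ((j%:R+1)*s)-Phi 0 =
   (Phi ((j%:R+1)*s)-Phi (j%:R*s))+(Phi (j%:R*s)-Phi 0) by ring.
  rewrite (le_trans (ler_normD _ _))// lerD// IH//; exact: ltnW.
 have := ind n (leqnn n); have -> : n%:R*s = h by rewrite /s mulrC divfK.
 move=> /le_trans; apply; apply: eqle.
 by rewrite /s normrM normfV normr_nat; field.
have -> : \int[mu]_x (u x * phi x) = Phi 0.
 by rewrite /Phi; under [RHS]eq_Rintegral do rewrite oppr0 scale0r addr0.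
apply/ler_addgt0Pr => e e0.
(* Large enough for steps of length at most 1 and for a total quadratic error at most [e]. *)
pose n := (Num.bound (`|h|+K*h^+2/e)).+1.
have A0 : 0 <= K*h^+2/e := divr_ge0 (mulr_ge0 K0 (sqr_ge0 h)) (ltW e0).
have hn : `|h|+K*h^+2/e < n%:R.
 rewrite (lt_trans (archi_boundP _))//; first pos.
 by rewrite ltr_nat.
apply: le_trans (tele n _ _) _ => //; first by move: hn A0; lra.
rewrite lerD2l ler_pdivrMr ?ltr0n// -ler_pdivrMl// mulrC.
move: hn (normr_ge0 h); pos.
Qed.

Lemma Int_shift_mul u phi (h : E) : loc u -> test_function phi ->
 \int[mu]_x (u (x+h) * phi x) = \int[mu]_x (u x * phi (x-h)).
Proof.
move=> lu tphi; rewrite -[RHS](Int_shift h).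
 by apply: Int_ext => x; rewrite addrK.
apply: loc_test => //; exact: test_shift.
Qed.

Lemma loc_shift u (h : E) : loc u -> loc (fun x => u (x+h)).
Proof.
move=> [mu' ui]; split => [|M]; first mfun.
apply: (ig_le _ (ig_shift h (ig_norm (ui (M+`|h|))))).
 apply: mes_cut; mfun.
move=> x; rewrite !cutE; case: ifPn => [xM|_]; last by rewrite normr0.
by rewrite (le_lt_trans (ler_normD _ _))// ltrD2r.
Qed.

Lemma L2loc_shift u (h : E) : mes u -> (forall M, L2 (cut M u)) ->
 forall M, L2 (cut M (fun x => u (x+h))).
Proof.
move=> mu' uL M; apply: (L2_le _ (L2_shift h (uL (M+`|h|)))).
 apply: mes_cut; mfun.
move=> x; rewrite !cutE; case: ifPn => [xM|_]; last by rewrite normr0.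
by rewrite (le_lt_trans (ler_normD _ _))// ltrD2r.
Qed.

Lemma shift_L2 u g i h : mes u -> (forall M, L2 (cut M u)) -> is_weak_partial i u g -> L2 g ->
 L2 (fun x => u (x+h*:ebasis i)-u x) /\
 n2 (fun x => u (x+h*:ebasis i)-u x) <= `|h|*n2 g.
Proof.
move=> mu' uL wug gL.
have lu : loc u by exact: L2loc_loc.
apply: L2_duality => [|M||phi tphi].
- apply: measurable_funB => //; exact: mes_shift.
- rewrite (_ : cut M _ = fun x => cut M (fun x => u (x+h*:ebasis i)) x-cut M u x).
  apply: L2B => //; exact: L2loc_shift.
 apply/funext => x; rewrite !cutE; case: ifP; pos.
- pos.
have -> : \int[mu]_x ((u (x+h*:ebasis i)-u x) * phi x) =
  \int[mu]_x (u x * phi (x+(- h)*:ebasis i))-\int[mu]_x (u x * phi x).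
 rewrite scaleNr -Int_shift_mul// -IntB; last 2 first.
 - apply: loc_test => //; exact: loc_shift.
 - exact: loc_test.
 apply: Int_ext => x; pos.
rewrite -mulrA; exact: test_shift_bound.
Qed.

Definition dq u i (h : R) : E -> R := fun x => h^-1*(u (x+h*:ebasis i)-u x).

Lemma dq_L2 u g i h : h != 0 -> mes u -> (forall M, L2 (cut M u)) -> is_weak_partial i u g -> L2 g ->
 L2 (dq u i h) /\ n2 (dq u i h) <= n2 g.
Proof.
move=> h0 mu' uL wug gL; have [sL sn] := @shift_L2 u g i h mu' uL wug gL.
split; first li.
by rewrite n2Z// normfV ler_pdivrMl ?normr_gt0.
Qed.

Lemma dq_test u i h phi : loc u -> test_function phi ->
 \int[mu]_x (dq u i h x * phi x) =
 h^-1*(\int[mu]_x (u x * phi (x+(- h)*:ebasis i))-\int[mu]_x (u x * phi x)).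
Proof.
move=> lu tphi; rewrite scaleNr -Int_shift_mul// -IntB; last 2 first.
- apply: loc_test => //; exact: loc_shift.
- exact: loc_test.
rewrite -IntZ; first by apply: Int_ext => x; rewrite /dq; ring.
apply: igB; apply: loc_test => //; exact: loc_shift.
Qed.

Lemma dq_test_cvg u g i (h_ : nat -> R) phi : is_weak_partial i u g ->
 (forall n, h_ n != 0) -> h_ @ \oo --> (0 : R) -> test_function phi ->
 \int[mu]_x (dq u i (h_ n) x * phi x) @[n --> \oo] --> \int[mu]_x (g x * phi x).
Proof.
move=> wug h0 hc tphi.
have lu : loc u by case: wug => /loc_integrableP.
have [K K0 hK] := weak_partial_shift wug tphi 1.
apply/subr_cvg0/norm_cvg0P.
apply: (@squeeze_cvgr _ _ _ _ (fun=> 0) (fun n => K * `|h_ n|)).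
- have : \forall n \near \oo, `|h_ n| <= 1.
  by move/cvgr0Pnorm_le : hc => /(_ 1 ltr01).
 apply: filterS => n hn1; rewrite normr_ge0/= dq_test//.
 have := hK 0 (h_ n); rewrite normr0 ler01 => /(_ isT hn1).
 rewrite add0r; set A := \int[mu]_x _; set B := \int[mu]_x _; set C := \int[mu]_x _.
 have -> : B = \int[mu]_x (u x * phi x).
  by apply: Int_ext => x; rewrite oppr0 scale0r addr0.
 have -> : C = \int[mu]_x (g x * phi x).
  by apply: Int_ext => x; rewrite oppr0 scale0r addr0.
 have hn0 : 0 < `|h_ n| by rewrite normr_gt0.
 move=> hh; rewrite -(ler_pM2l hn0).
 rewrite -normrM mulrBr mulrA divff// mul1r (le_trans hh)//.
 rewrite -(real_normK (num_real (h_ n))); apply: eqle; pos.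
- cv.
- rewrite -[X in _ --> X](mulr0 K); apply: cvgM; first cv.
 exact/norm_cvg0P.
Qed.

(** Difference quotients converge weakly to the derivative and their norms do not exceed its norm,
    hence the convergence is strong. *)
Lemma dq_cvg u g i (h_ : nat -> R) : mes u -> (forall M, L2 (cut M u)) ->
 is_weak_partial i u g -> L2 g -> (forall n, h_ n != 0) -> h_ @ \oo --> (0 : R) ->
 n2 (fun x => dq u i (h_ n) x-g x) ~>0 n.
Proof.
move=> mu' uL wug gL h0 hc; apply: weak_norm_strong => // [n|n|phi tphi].
- by have [] := @dq_L2 u g i (h_ n) (h0 n) mu' uL wug gL.
- by have [] := @dq_L2 u g i (h_ n) (h0 n) mu' uL wug gL.
- exact: dq_test_cvg.
Qed.

(** Converse criterion: it is the way weak derivatives are produced below, for products, for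
    compositions and for test functions. *)
Lemma weak_partial_of_dq u g i (h_ : nat -> R) : loc u -> loc g ->
 (forall n, h_ n != 0) -> h_ @ \oo --> (0 : R) ->
 (forall phi, test_function phi ->
   \int[mu]_x (dq u i (h_ n) x * phi x) @[n --> \oo] --> \int[mu]_x (g x * phi x)) ->
 is_weak_partial i u g.
Proof.
move=> lu lg h0 hc ht; split; try exact/loc_integrableP.
move=> phi tphi; have [K [M [K0 hK hM]]] := test_taylor i tphi.
have td := test_partial i tphi.
suff c : \int[mu]_x (dq u i (h_ n) x * phi x) @[n --> \oo] -->
  - \int[mu]_x (u x * partial i phi x).
 have := cvg_unique _ c (ht _ tphi) => <-//; pos.
apply/subr_cvg0/norm_cvg0P.
pose C := K*\int[mu]_x `|cut M u x|.
apply: (@squeeze_cvgr _ _ _ _ (fun=> 0) (fun n => C * `|h_ n|)); last 2 first.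
- cv.
- by rewrite -[X in _ --> X](mulr0 C); apply: cvgM; [cv|exact/norm_cvg0P].
have : \forall n \near \oo, `|h_ n| <= 1.
 by move/cvgr0Pnorm_le : hc => /(_ 1 ltr01).
apply: filterS => n hn1; rewrite normr_ge0/= dq_test//.
set h := h_ n; have hn0 : h != 0 by exact: h0.
have vr : vanish_out M (taylor_rem phi i (- h)) by apply: hM; rewrite normrN.
have ir : ig (fun x => u x*taylor_rem phi i (- h) x).
 apply: (loc_mulP lu _ (hK _) vr); exact: taylor_rem_mes.
have i1 : ig (fun x => u x * phi (x+(- h)*:ebasis i)) by apply: loc_test => //; exact: test_shift.
have i2 := loc_test lu tphi; have i3 := loc_test lu td.
have -> : h^-1*(\int[mu]_x (u x * phi (x+(- h)*:ebasis i))-\int[mu]_x (u x * phi x)) -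
  (- \int[mu]_x (u x * partial i phi x)) = h^-1*\int[mu]_x (u x*taylor_rem phi i (- h) x).
 have -> : \int[mu]_x (u x*taylor_rem phi i (- h) x) =
  (\int[mu]_x (u x * phi (x+(- h)*:ebasis i))-\int[mu]_x (u x * phi x))
   - (- h)*\int[mu]_x (u x * partial i phi x).
  rewrite -IntB// -IntZ// -IntB; [|li|li].
  apply: Int_ext => x; rewrite /taylor_rem; pos.
 by field.
rewrite normrM normfV ler_pdivrMl ?normr_gt0// mulrCA -expr2 real_normK ?num_real//.
have ic : ig (fun x => K*h^+2 * `|cut M u x|) by li.
rewrite mulrAC -IntZ; last by apply: ig_norm; exact: lu.2.
apply: Int_le_norm => // x; rewrite normrM mulrC cutE.
case: ifPn => [_|]; first by rewrite ler_wpM2r// -(sqrrN h).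
by rewrite -leNgt => /vr ->; rewrite !normr0 mulr0.
Qed.

Lemma weak_partial_unique u g g' i : is_weak_partial i u g -> is_weak_partial i u g' ->
 g = g' %[ae mu].
Proof.
move=> [_ /loc_integrableP lg wg] [_ /loc_integrableP lg' wg'].
have : (fun x => g x-g' x) = (fun=> 0) %[ae mu].
 apply: test_ae0; first exact: locB.
 move=> phi tphi; have h1 := wg _ tphi; have h2 := wg' _ tphi.
 transitivity (\int[mu]_x (g x * phi x)-\int[mu]_x (g' x * phi x)).
  rewrite -IntB; [|exact: loc_test|exact: loc_test].
  apply: Int_ext => x; pos.
 pos.
apply: filterS => x /(_ I)/eqP; pos.
Qed.

Lemma is_weakD u v g h i : is_weak_partial i u g -> is_weak_partial i v h ->
 is_weak_partial i (fun x => u x+v x) (fun x => g x+h x).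
Proof.
move=> [/loc_integrableP lu /loc_integrableP lg wg] [/loc_integrableP lv /loc_integrableP lh wh].
split; try by apply/loc_integrableP; exact: locD.
move=> phi tphi; have td := test_partial i tphi.
under eq_Rintegral do rewrite mulrDl; under [in RHS]eq_Rintegral do rewrite mulrDl.
rewrite !IntD; try by apply: loc_test.
by rewrite wg// wh// opprD.
Qed.

Lemma is_weakZ (c : R) u g i : is_weak_partial i u g ->
 is_weak_partial i (fun x => c*u x) (fun x => c*g x).
Proof.
move=> [/loc_integrableP lu /loc_integrableP lg wg].
split; try by apply/loc_integrableP; exact: locZ.
move=> phi tphi; have td := test_partial i tphi.
under eq_Rintegral do rewrite -mulrA; under [in RHS]eq_Rintegral do rewrite -mulrA.
rewrite !IntZ; try by apply: loc_test.
by rewrite wg// mulrN.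
Qed.

Lemma loc_affine u (d : E) (c : R) : 0 < c -> loc u -> loc (fun x => u (d+c*:x)).
Proof.
move=> c0 [mu' ui]; split => [|M]; first mfun.
apply: (ig_le _ (ig_affine d c0 (ig_norm (ui (`|d|+c*M))))).
 apply: mes_cut; mfun.
move=> x; rewrite !cutE; case: ifPn => [xM|_]; last by rewrite normr0.
by rewrite (le_lt_trans (ler_normD _ _))// ltrD2l normrZ gtr0_norm// ltr_pM2l.
Qed.

Lemma is_weak_affine u g i (d : E) (c : R) : 0 < c -> is_weak_partial i u g ->
 is_weak_partial i (fun x => u (d+c*:x)) (fun x => c*g (d+c*:x)).
Proof.
move=> c0 [/loc_integrableP lu /loc_integrableP lg wg]; split.
- apply/loc_integrableP; exact: loc_affine.
- apply/loc_integrableP; apply: locZ; exact: loc_affine.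
move=> phi tphi.
have cn0 : c != 0 by pos.
pose phi' x := phi (- (c^-1*:d)+c^-1*:x).
have tphi' : test_function phi' by apply: test_affine => //; rewrite invr_eq0.
have inv (x : E) : - (c^-1*:d)+c^-1*:(d+c*:x) = x.
 by rewrite scalerDr scalerA mulVf// scale1r addKr.
have td := test_partial i tphi'.
have h1 : \int[mu]_x (u (d+c*:x) * partial i phi x) = c ^- N*(c*\int[mu]_x (u x * partial i phi' x)).
 rewrite -IntZ; last exact: loc_test.
 rewrite -(Int_affine d c0); last by apply: igZ; exact: loc_test.
 apply: Int_ext => x; rewrite partial_affine; last exact: tphi.1.
 by rewrite inv; field.
have h2 : \int[mu]_x (c*g (d+c*:x) * phi x) = c ^- N*(c*\int[mu]_x (g x * phi' x)).
 rewrite -IntZ; last exact: loc_test.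
 rewrite -(Int_affine d c0); last by apply: igZ; exact: loc_test.
 by apply: Int_ext => x; rewrite /phi' inv mulrA.
by rewrite h1 h2 wg// !mulrN.
Qed.

(** * Gradient fields and the space D^{1,2} *)

Definition ip G H : R := \sum_i \int[mu]_x (G i x*H i x).
Definition gn G : R := Num.sqrt (ip G G).
Definition L2N G := forall i, L2 (G i).

Lemma L2N_D G H : L2N G -> L2N H -> L2N (fun i x => G i x+H i x).
Proof. move=> GL HL i; li. Qed.

Lemma L2N_B G H : L2N G -> L2N H -> L2N (fun i x => G i x-H i x).
Proof. move=> GL HL i; exact: L2B. Qed.

Lemma L2N_Z (c : R) G : L2N G -> L2N (fun i x => c*G i x).
Proof. move=> GL i; li. Qed.

Lemma ipC G H : ip G H = ip H G.
Proof. apply: eq_bigr => i _; apply: Int_ext => x; pos. Qed.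

Lemma ipDl G H K : L2N G -> L2N H -> L2N K -> ip (fun i x => G i x+H i x) K = ip G K+ip H K.
Proof.
move=> GL HL KL; rewrite -big_split/=; apply: eq_bigr => i _.
under eq_Rintegral do rewrite mulrDl.
rewrite IntD//; li.
Qed.

Lemma ipZl (c : R) G K : L2N G -> L2N K -> ip (fun i x => c*G i x) K = c*ip G K.
Proof.
move=> GL KL; rewrite mulr_sumr; apply: eq_bigr => i _.
under eq_Rintegral do rewrite -mulrA.
rewrite IntZ//; li.
Qed.

Lemma ipBl G H K : L2N G -> L2N H -> L2N K -> ip (fun i x => G i x-H i x) K = ip G K-ip H K.
Proof.
move=> GL HL KL; rewrite -sumrB; apply: eq_bigr => i _.
under eq_Rintegral do rewrite mulrBl.
rewrite IntB//; li.
Qed.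

Lemma ipDr G H K : L2N G -> L2N H -> L2N K -> ip K (fun i x => G i x+H i x) = ip K G+ip K H.
Proof. by move=> *; rewrite ipC ipDl// [ip G _]ipC [ip H _]ipC. Qed.

Lemma ipBr G H K : L2N G -> L2N H -> L2N K -> ip K (fun i x => G i x-H i x) = ip K G-ip K H.
Proof. by move=> *; rewrite ipC ipBl// [ip G _]ipC [ip H _]ipC. Qed.

Lemma ipZr (c : R) G K : L2N G -> L2N K -> ip K (fun i x => c*G i x) = c*ip K G.
Proof. by move=> *; rewrite ipC ipZl// [ip G _]ipC. Qed.

Lemma ip_ge0 G : 0 <= ip G G.
Proof. apply: sumr_ge0 => i _; apply: Int_ge0 => x; pos. Qed.

Lemma gn_ge0 G : 0 <= gn G. Proof. pos. Qed.
#[local] Hint Resolve gn_ge0 n2_ge0 nq_ge0 : pos.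

Lemma gn_sq G : gn G^+2 = ip G G. Proof. by rewrite sqr_sqrtr// ip_ge0. Qed.

Lemma gn_sqE G : gn G^+2 = \sum_i n2 (G i)^+2.
Proof. by rewrite gn_sq; apply: eq_bigr => i _; rewrite n2_sq. Qed.

Lemma n2_le_gn G i : n2 (G i) <= gn G.
Proof.
rewrite -(ler_pXn2r (ltn0Sn 1)) ?nnegrE ?n2_ge0 ?gn_ge0// gn_sqE (bigD1 i)//= lerDl.
apply: sumr_ge0 => j _; pos.
Qed.

Lemma gn_sqD G H : L2N G -> L2N H ->
 gn (fun i x => G i x+H i x)^+2 = gn G^+2+2*ip G H+gn H^+2.
Proof.
move=> GL HL; rewrite !gn_sq ipDl//; last exact: L2N_D.
rewrite !ipDr// [ip H G]ipC; pos.
Qed.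

Lemma gn_sqB G H : L2N G -> L2N H ->
 gn (fun i x => G i x-H i x)^+2 = gn G^+2-2*ip G H+gn H^+2.
Proof.
move=> GL HL; rewrite !gn_sq ipBl//; last exact: L2N_B.
rewrite !ipBr// [ip H G]ipC; pos.
Qed.

Lemma gnZ (c : R) G : L2N G -> gn (fun i x => c*G i x) = `|c|*gn G.
Proof.
move=> GL; rewrite /gn ipZl ?ipZr//; last exact: L2N_Z.
by rewrite mulrA sqrtrM ?sqr_ge0// sqrtr_sqr.
Qed.

Lemma ip_CS G H : L2N G -> L2N H -> `|ip G H| <= gn G*gn H.
Proof.
move=> GL HL; rewrite -(ler_pXn2r (ltn0Sn 1)) ?nnegrE ?mulr_ge0 ?gn_ge0//.
rewrite real_normK ?num_real// exprMn.
have key (t : R) : 0 <= gn G^+2+2*t*ip G H+t^+2*gn H^+2.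
 have := sqr_ge0 (gn (fun i x => G i x+t*H i x)).
 rewrite gn_sqD//; last exact: L2N_Z.
 by rewrite ipZr// gnZ// exprMn real_normK ?num_real// mulrA.
have [h0|h0] := eqVneq (gn H) 0.
 rewrite h0 expr0n/= mulr0; have [->|i0] := eqVneq (ip G H) 0; first pos.
 exfalso; have := key (- (gn G^+2+1)/(2*ip G H)).
 have -> : 2*(- (gn G^+2+1)/(2*ip G H))*ip G H = - (gn G^+2+1) by field.
 rewrite h0; set A := gn G^+2; rewrite expr0n/=; lra.
have hp : 0 < gn H^+2 by rewrite exprn_gt0// lt_neqAle gn_ge0 eq_sym h0.
have := mulr_ge0 (ltW hp) (key (- ip G H/gn H^+2)).
have -> : gn H^+2*(gn G^+2+2*(- ip G H/gn H^+2)*ip G H +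
  (- ip G H/gn H^+2)^+2*gn H^+2) = gn G^+2*gn H^+2-ip G H^+2.
 by field.
pos.
Qed.

Lemma gnD G H : L2N G -> L2N H -> gn (fun i x => G i x+H i x) <= gn G+gn H.
Proof.
move=> GL HL; rewrite -(ler_pXn2r (ltn0Sn 1)) ?nnegrE ?addr_ge0 ?gn_ge0//.
rewrite gn_sqD// sqrrD lerD2r lerD2l mulr2n; have := ip_CS GL HL; have := ler_norm (ip G H).
lra.
Qed.

Lemma gnB G H : L2N G -> L2N H -> gn (fun i x => G i x-H i x) <= gn G+gn H.
Proof.
move=> GL HL; have := gnD GL (L2N_Z (-1) HL); rewrite gnZ// normrN normr1 mul1r.
by under [X in gn X]eq_fun do under eq_fun do rewrite mulN1r.
Qed.

Lemma gn_le (C : R) G : 0 <= C -> (forall i, n2 (G i) <= C) -> gn G <= N%:R*C.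
Proof.
move=> C0 GC; rewrite -(ler_pXn2r (ltn0Sn 1)) ?nnegrE ?mulr_ge0 ?gn_ge0// gn_sqE.
apply: (@le_trans _ _ (\sum_(i < N) C^+2)).
 by apply: ler_sum => i _; rewrite ler_pXn2r ?nnegrE// n2_ge0.
rewrite sumr_const card_ord exprMn -[_ *+ N]mulr_natl ler_wpM2r ?sqr_ge0//.
by rewrite -natrX ler_nat; case: (N) => // n; rewrite expnS leq_pmulr.
Qed.

Lemma gn_aeeq G H : L2N G -> L2N H -> (forall i, G i = H i %[ae mu]) -> gn G = gn H.
Proof.
move=> GL HL GH; congr Num.sqrt; apply: eq_bigr => i _.
have [mG _] := GL i; have [mH _] := HL i.
apply: Int_aeeq; try by mfun.
by apply: filterS (GH i) => x h _; rewrite h.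
Qed.

Hypothesis hN : (3 <= N)%N.

Lemma N2_gt0 : 0 < N%:R-2 :> R.
Proof. by rewrite subr_gt0 ltr_nat. Qed.

Lemma N_gt0 : 0 < N%:R :> R.
Proof. by rewrite ltr0n (leq_trans _ hN). Qed.

Lemma two_starE : p*(N%:R-2) = 2*N%:R.
Proof. by rewrite divfK// gt_eqF// N2_gt0. Qed.

Lemma two_star_gt2 : 2 < p.
Proof. rewrite ltr_pdivlMr ?N2_gt0//; pos. Qed.
Hint Resolve two_star_gt2 : core.

Lemma two_star_gt0 : 0 < p. Proof. have := two_star_gt2; lra. Qed.
Hint Resolve two_star_gt0 : core.

Lemma two_star_ge0 : 0 <= p. Proof. pos. Qed.
Hint Resolve two_star_ge0 : core.

Lemma Lp_sq_le u x : u x^+2 <= 1+`|u x| `^ p.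
Proof.
rewrite -(real_normK (num_real _)); have [h|h] := leP `|u x| 1.
 by apply: (@le_trans _ _ 1); [rewrite exprn_ile1|rewrite lerDl powR_ge0].
apply: (@le_trans _ _ (`|u x| `^ p)); last pos.
by rewrite -powR_mulrn// ler_powR ?ltW.
Qed.

Lemma Lp_L2cut u M : Lq p u -> L2 (cut M u).
Proof.
move=> [mu' ui]; split; first mfun.
apply: (ig_le _ (igD (ig_Bn M) ui)).
 mfun.
move=> x; rewrite ger0_norm ?sqr_ge0// cutE indicE.
case: ifPn => xM; first by rewrite mem_set//; exact: Lp_sq_le.
by rewrite expr0n/= addr_ge0//.
Qed.

Lemma Lp_loc u : Lq p u -> loc u.
Proof. move=> uL; apply: L2loc_loc uL.1 _ => M; exact: Lp_L2cut. Qed.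

(** Elements of D^{1,2} carried along with an explicit gradient, determined up to null sets.
    Calculus rules become formulas for [G], whereas [weak_partial] is an arbitrary choice. *)
Definition HD u G := [/\ Lq p u, L2N G & forall i, is_weak_partial i u (G i)].

Lemma Lfun_Lq (q : R) u : 0 < q -> (u \in Lfun mu q%:E <-> Lq q u).
Proof.
move=> q0; rewrite inE; split=> [/andP[]|[mu' ui]].
 rewrite !inE /= => mu' uoo; split => //.
 apply/integrableP; split; first by apply/measurable_EFinP; mfun.
 move: uoo; rewrite /finite_norm unlock/= => uoo.
 have : (\int[mu]_x (`|(EFin \o u) x| `^ q) < +oo)%E.
  have : (0 <= \int[mu]_x (`|(EFin \o u) x| `^ q))%E.
   apply: integral_ge0 => x _; pos.
  move: uoo; move: (\int[mu]_x _)%E => J.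
  by case: J => [r| |]//; rewrite ?ltry// poweRyr// invr_neq0// gt_eqF.
 apply: le_lt_trans; apply: ge0_le_integral => //.
 - apply/measurable_EFinP; mfun.
 - apply/measurable_EFinP; mfun.
 - by move=> x _; rewrite /= lee_fin ger0_norm.
apply/andP; rewrite !inE/=; split => //.
rewrite /finite_norm unlock/=.
have -> : (\int[mu]_x (`|(EFin \o u) x| `^ q) = (\int[mu]_x (`|u x| `^ q))%:E)%E.
 by rewrite EFin_Int.
by rewrite ltry.
Qed.

Lemma L2_Lq u : Lq 2 u <-> L2 u.
Proof.
rewrite /L2 /Lq; under eq_fun do rewrite powR_mulrn// real_normK ?num_real//.
li.
Qed.

Lemma HD_D12 u G : HD u G -> D12 u.
Proof.
move=> [uL GL wG]; split; first exact/Lfun_Lq.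
move=> i; exists (G i) => //; apply/Lfun_Lq => //; exact/L2_Lq.
Qed.

Lemma D12_HD u : D12 u -> HD u (fun i => weak_partial i u).
Proof.
move=> [/(Lfun_Lq u two_star_gt0) uL uG]; split => //.
 move=> i; have [g wg /(Lfun_Lq g (ltr0n R 2)) /L2_Lq gL] := uG i.
 have wp : is_weak_partial i u (weak_partial i u) by apply: (xgetPex _ (ex_intro _ g wg)).
 apply: (L2_aeeq _ gL); last exact: weak_partial_unique wp wg.
 by case: wp => _ [].
move=> i; have [g wg _] := uG i; exact: (xgetPex _ (ex_intro _ g wg)).
Qed.

Lemma HD_unique u G H : HD u G -> HD u H -> forall i, G i = H i %[ae mu].
Proof. move=> [_ _ wG] [_ _ wH] i; exact: weak_partial_unique (wG i) (wH i). Qed.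

Lemma HD_gn_unique u G H : HD u G -> HD u H -> gn G = gn H.
Proof.
by move=> uG uH; apply: gn_aeeq; [case: uG|case: uH|exact: HD_unique uG uH].
Qed.

Lemma Int_grad_sq u : D12 u -> \int[mu]_x grad_sq u x = gn (fun i => weak_partial i u)^+2.
Proof.
move=> /D12_HD[_ GL _]; rewrite gn_sq /grad_sq Int_sum//.
move=> i; li.
Qed.

Lemma D12_normE u G : HD u G -> D12_norm u = gn G.
Proof.
move=> uG; have uD := HD_D12 uG; rewrite /D12_norm Int_grad_sq// sqrtr_sqr.
rewrite ger0_norm ?gn_ge0//; exact: HD_gn_unique (D12_HD uD) uG.
Qed.

Lemma HDD u v G H : HD u G -> HD v H -> HD (fun x => u x+v x) (fun i x => G i x+H i x).
Proof.
move=> [uL GL wG] [vL HL wH]; split; first exact: LqD.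
 exact: L2N_D.
move=> i; exact: is_weakD.
Qed.

Lemma HDZ (c : R) u G : HD u G -> HD (fun x => c*u x) (fun i x => c*G i x).
Proof.
move=> [uL GL wG]; split; first exact: LqZ.
 exact: L2N_Z.
move=> i; exact: is_weakZ.
Qed.

Lemma HDB u v G H : HD u G -> HD v H -> HD (fun x => u x-v x) (fun i x => G i x-H i x).
Proof.
move=> uG vH; under eq_fun do rewrite -mulN1r.
under [X in HD _ X]eq_fun do under eq_fun do rewrite -mulN1r.
apply: HDD => //; exact: HDZ.
Qed.

Lemma HD0 : HD (fun=> 0) (fun _ _ => 0).
Proof.
have z : Lq p (fun=> 0).
 split => //.
 under eq_fun do rewrite normr0 powR0 ?gt_eqF//; exact: ig0.
split => // i; first exact: L2_0.
split; try by apply/loc_integrableP; exact: Lp_loc.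
by move=> phi _; under eq_Rintegral do rewrite mul0r; under [in RHS]eq_Rintegral do rewrite mul0r;
 rewrite Int0 oppr0.
Qed.

Lemma HD_aeeq u v G : HD u G -> mes v -> v = u %[ae mu] -> HD v G.
Proof.
move=> [uL GL wG] mv vu; split => //; first exact: Lq_aeeq vu.
move=> i; have vL := Lq_aeeq mv uL vu; have [_ lG wi] := wG i; split => //.
 apply/loc_integrableP; exact: Lp_loc.
move=> phi tphi; rewrite -wi//; have mp := test_mes (test_partial i tphi).
by apply: Int_aeeq; [mfun|mfun|]; apply: filterS vu => x h _; rewrite h.
Qed.

Lemma Lp_affine u (d : E) (c : R) : 0 < c -> Lq p u -> Lq p (fun x => u (d+c*:x)).
Proof.
move=> c0 [mu' ui]; split; first exact: mes_affine.
exact: (ig_affine d c0 ui).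
Qed.

Lemma L2_affine u (d : E) (c : R) : 0 < c -> L2 u -> L2 (fun x => u (d+c*:x)).
Proof.
move=> c0 [mu' ui]; split; first exact: mes_affine.
exact: (ig_affine d c0 ui).
Qed.

Lemma HD_affine u G (d : E) (c : R) : 0 < c -> HD u G ->
 HD (fun x => u (d+c*:x)) (fun i x => c*G i (d+c*:x)).
Proof.
move=> c0 [uL GL wG]; split; first exact: Lp_affine.
 move=> i; apply: L2Z; exact: L2_affine.
move=> i; exact: is_weak_affine.
Qed.

Lemma HD_shift u G (h : E) : HD u G -> HD (fun x => u (x+h)) (fun i x => G i (x+h)).
Proof.
move=> uG; have := HD_affine h ltr01 uG.
under eq_fun do rewrite scale1r addrC.
by under [X in HD _ X -> _]eq_fun do under eq_fun do rewrite scale1r addrC mul1r.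
Qed.

Lemma HD_shift_L2 u G i (h : R) : HD u G ->
 L2 (fun x => u (x+h*:ebasis i)-u x) /\
 n2 (fun x => u (x+h*:ebasis i)-u x) <= `|h|*n2 (G i).
Proof.
by move=> [uL GL wG]; apply: shift_L2 => //; [li|move=> M; exact: Lp_L2cut].
Qed.

Lemma HD_dq_L2 u G i (h : R) : HD u G -> h != 0 ->
 L2 (dq u i h) /\ n2 (dq u i h) <= n2 (G i).
Proof.
by move=> [uL GL wG] h0; apply: dq_L2 => //; [li|move=> M; exact: Lp_L2cut].
Qed.

Lemma HD_dq_cvg u G i (h_ : nat -> R) : HD u G -> (forall n, h_ n != 0) -> h_ @ \oo --> (0 : R) ->
 n2 (fun x => dq u i (h_ n) x-G i x) ~>0 n.
Proof.
by move=> [uL GL wG] h0 hc; apply: dq_cvg => //; [li|move=> M; exact: Lp_L2cut].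
Qed.

Lemma HD_ext u v G H : u =1 v -> (forall i, G i =1 H i) -> HD u G -> HD v H.
Proof.
move=> uv GH; have -> : u = v by exact/funext.
by have -> : G = H by apply/funext => i; exact/funext.
Qed.

Let p2 : 2 < p. Proof. exact: two_star_gt2. Qed.
Let p0 : 0 < p. Proof. exact: two_star_gt0. Qed.
Hint Resolve p2 p0 : core.

Lemma cvg_of_diff (a b : nat -> R) (l : R) : a n-b n ~>0 n ->
 b n @[n --> \oo] --> l -> a n @[n --> \oo] --> l.
Proof.
move=> ab bl; have -> : a = (fun n => (a n-b n)+b n) by apply/funext => n; rewrite subrK.
rewrite -[l]add0r; cv.
Qed.

(** * Product rule, chain rule and translations *)

Definition hseq (n : nat) : R := n.+1%:R^-1.

Lemma hseq_neq0 n : hseq n != 0. Proof. by rewrite invr_neq0//. Qed.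

Lemma hseq_cvg : hseq @ \oo --> (0 : R). Proof. exact: cvg_harmonic. Qed.
#[local] Hint Resolve hseq_cvg : cv.

Lemma L2_mulb f th (K : R) : L2 f -> mes th -> (forall x, `|th x| <= K) ->
 L2 (fun x => th x*f x) /\ n2 (fun x => th x*f x) <= K*n2 f.
Proof.
move=> fL mth thK; have [mf fi] := fL.
have K0 : 0 <= K by exact: le_trans (thK 0).
have le x : `|th x*f x| <= `|K*f x|.
 by rewrite !normrM [`|K|]ger0_norm// ler_wpM2r.
have tL : L2 (fun x => th x*f x) by apply: (L2_le _ (L2Z K fL) le); mfun.
by split => //; rewrite (le_trans (n2_le tL (L2Z K fL) le))// n2Z// ger0_norm.
Qed.

(** A bounded multiplier with bounded partial derivatives and a uniform quadratic remainder along
    the axes: the data consumed by the difference-quotient proof of the product rule. *)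
Definition mult_ok (K : R) th (dth : 'I_N -> E -> R) :=
 [/\ mes th, forall i, mes (dth i), forall x, `|th x| <= K, forall i x, `|dth i x| <= K &
  forall i x h, `|th (x+h*:ebasis i)-th x-h * dth i x| <= K*h^+2].

Lemma Int_dq_bound u G i phi h : HD u G -> h != 0 -> L2 phi ->
 \int[mu]_x `|dq u i h x * phi x| <= n2 (G i)*n2 phi.
Proof.
move=> uG h0 pL; have [dL dn] := HD_dq_L2 i uG h0.
by rewrite (le_trans (CS_abs dL pL))// ler_wpM2r// n2_ge0.
Qed.

Lemma HD_mul (K : R) u G th dth : HD u G -> mult_ok K th dth ->
 (forall i, L2 (fun x => dth i x*u x)) ->
 HD (fun x => th x*u x) (fun i x => th x*G i x+dth i x*u x).
Proof.
move=> uG [mth mdth thK dthK thq] duL; have [uL GL wG] := uG.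
have K0 : 0 <= K by exact: le_trans (thK 0).
have tuL : Lq p (fun x => th x*u x).
 apply: (@Lq_le _ _ _ _ _ _ (fun x => K*u x)); rewrite ?ltW//.
 - mfun.
 - exact: LqZ.
 - by move=> x; rewrite !normrM [`|K|]ger0_norm// ler_wpM2r.
have DL : L2N (fun i x => th x*G i x+dth i x*u x).
 move=> i; apply: L2D => //; exact: (L2_mulb (GL i) mth thK).1.
split => // i; apply: (weak_partial_of_dq (h_ := hseq)) => //.
- exact: Lp_loc.
- exact: L2_loc.
- exact: hseq_neq0.
- cv.
move=> phi tphi; have phL := test_L2 tphi.
have lu := Lp_loc uL.
have [B B0 phB] := test_bounded tphi.
pose A1 n x := dq u i (hseq n) x*(th x * phi x).
have thphL : L2 (fun x => th x * phi x) by exact: (L2_mulb phL mth thK).1.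
have dL n := HD_dq_L2 i uG (hseq_neq0 n).
have c1 : \int[mu]_x A1 n x @[n --> \oo] --> \int[mu]_x (G i x*(th x * phi x)).
 apply: cvg_Int_mul => //; last exact: HD_dq_cvg uG hseq_neq0 hseq_cvg.
 move=> n; exact: (dL n).1.
have iU : ig (fun x => u x*(dth i x * phi x)).
 have [M vM] : exists M, vanish_out M (fun x => dth i x * phi x).
  have /test_functionP[_ [M hM]] := tphi; exists M => x Mx.
  by rewrite hM// mulr0.
 apply: (loc_mulP lu _ (C := K*B) _ vM).
  mfun.
 by move=> x; rewrite normrM ler_pM.
have -> : \int[mu]_x ((th x*G i x+dth i x*u x) * phi x) =
  \int[mu]_x (G i x*(th x * phi x))+\int[mu]_x (u x*(dth i x * phi x)).
 rewrite -IntD//; last li.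
 apply: Int_ext => x; pos.
pose I0 := \int[mu]_x (u x*(dth i x * phi x)).
have ip0 := ig_norm (loc_test lu tphi).
pose C := 2*K*(n2 (G i)*n2 phi)+K*\int[mu]_x `|u x * phi x|.
suff c2 : \int[mu]_x (dq (fun x => th x*u x) i (hseq n) x * phi x) -
  (\int[mu]_x A1 n x+I0) ~>0 n.
 apply: cvg_of_diff c2 _; apply: cvgD c1 _; cv.
apply/norm_cvg0P; apply: (@squeeze_cvgr _ _ _ _ (fun=> 0) (fun n => C*hseq n)); last 2 first.
- cv.
- rewrite -[X in _ --> X](mulr0 C); apply: cvgM; cv.
apply: nearW => n; rewrite normr_ge0/=.
have hp : 0 < hseq n by rewrite invr_gt0.
have hh1 : hseq n <= 1 by rewrite invf_le1// ler1n.
move: hp hh1 (hseq_neq0 n) (dL n); rewrite /A1; move: (hseq n) => h hp hh1 hn [dLn dn].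
have ltu := Lp_loc tuL.
have i1 : ig (fun x => dq (fun x => th x*u x) i h x * phi x).
 apply: loc_test => //; apply: locZ; apply: locB => //.
 exact: (loc_shift (h*:ebasis i) ltu).
have i2 : ig (fun x => dq u i h x*(th x * phi x)) by li.
rewrite -IntD// -IntB//; last li.
have ib : ig (fun x => 2*K*h * `|dq u i h x * phi x|+K*h * `|u x * phi x|) by li.
apply: (@le_trans _ _ (\int[mu]_x (2*K*h * `|dq u i h x * phi x|+K*h * `|u x * phi x|))).
 apply: Int_le_norm => //; first by apply: igB => //; exact: igD.
 move=> x; have q1 := thq i x h.
 set r := th (x+h*:ebasis i)-th x-h * dth i x in q1 *.
 (* Discrete Leibniz rule: the error is an increment of [th] times a difference quotient of [u],
    plus the remainder [r / h] times [u]; both are O(h). *)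
 have -> : dq (fun x => th x*u x) i h x * phi x -
   (dq u i h x*(th x * phi x)+u x*(dth i x * phi x)) =
   (th (x+h*:ebasis i)-th x)*(dq u i h x * phi x)+h^-1*r*(u x * phi x).
  by rewrite /dq /r; field.
 have t1 : `|th (x+h*:ebasis i)-th x| <= 2*K*h.
  have -> : th (x+h*:ebasis i)-th x = r+h * dth i x by rewrite subrK.
  rewrite (le_trans (ler_normD _ _))// normrM (gtr0_norm hp).
  have h2 : h^+2 <= h by rewrite expr2 ler_piMl// ltW.
  have k1 : K*h^+2 <= K*h by rewrite ler_wpM2l.
  have k2 : h * `|dth i x| <= h*K by rewrite ler_pM2l.
  lra.
 rewrite (le_trans (ler_normD _ _))// !normrM -!normrM; apply: lerD.
  by rewrite normrM ler_wpM2r.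
 rewrite [X in X <= _]normrM ler_wpM2r// normrM normfV (gtr0_norm hp) ler_pdivrMl//.
 pos.
rewrite IntD; [|li|li].
rewrite !IntZ//; last by apply: ig_norm; exact: L2_mul.
have -> : C*h = 2*K*h*(n2 (G i)*n2 phi)+K*h*\int[mu]_x `|u x * phi x|.
 rewrite /C; pos.
rewrite lerD2r ler_wpM2l ?mulr_ge0 ?(ltW hp)//; exact: Int_dq_bound.
Qed.

(** The Taylor remainder of [F] contributes [h dq^2], whose integral is O(h) because difference
    quotients are bounded in L^2. *)
Lemma HD_comp (K L : R) u G (F dF : R -> R) : HD u G ->
 measurable_fun setT F -> measurable_fun setT dF ->
 (forall s, `|F s| <= L * `|s|) -> (forall s, `|dF s| <= L) ->
 (forall s t, `|F (s+t)-F s-dF s*t| <= K*t^+2) ->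
 HD (fun x => F (u x)) (fun i x => dF (u x)*G i x).
Proof.
move=> uG mF mdF FL dFL Fq; have [uL GL wG] := uG.
have L0 : 0 <= L by exact: le_trans (dFL 0).
have K0 : 0 <= K by have := le_trans (normr_ge0 _) (Fq 0 1); rewrite expr1n mulr1.
have mFu : mes (fun x => F (u x)) by apply: (measurableT_comp mF); exact: uL.1.
have mdFu : mes (fun x => dF (u x)) by apply: (measurableT_comp mdF); exact: uL.1.
have tuL : Lq p (fun x => F (u x)).
 apply: (@Lq_le _ _ _ _ _ _ (fun x => L*u x)); rewrite ?ltW//.
 - exact: LqZ.
 - by move=> x; rewrite normrM [`|L|]ger0_norm.
have DL : L2N (fun i x => dF (u x)*G i x).
 move=> i; exact: (L2_mulb (GL i) mdFu (fun x => dFL (u x))).1.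
split => // i; apply: (weak_partial_of_dq (h_ := hseq)) => //.
- exact: Lp_loc.
- exact: L2_loc.
- exact: hseq_neq0.
- cv.
move=> phi tphi; have phL := test_L2 tphi.
have [B B0 phB] := test_bounded tphi.
have thphL : L2 (fun x => dF (u x) * phi x) by exact: (L2_mulb phL mdFu (fun x => dFL (u x))).1.
have dL n := HD_dq_L2 i uG (hseq_neq0 n).
pose A1 n x := dq u i (hseq n) x*(dF (u x) * phi x).
have c1 : \int[mu]_x A1 n x @[n --> \oo] --> \int[mu]_x (dF (u x)*G i x * phi x).
 rewrite (_ : (fun x => dF (u x)*G i x * phi x) = (fun x => G i x*(dF (u x) * phi x))); last first.
  apply/funext => x; pos.
 apply: cvg_Int_mul => //; last exact: HD_dq_cvg uG hseq_neq0 hseq_cvg.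
 move=> n; exact: (dL n).1.
pose C := K*B*n2 (G i)^+2.
suff c2 : \int[mu]_x (dq (fun x => F (u x)) i (hseq n) x * phi x) -
  \int[mu]_x A1 n x ~>0 n.
 exact: cvg_of_diff c2 c1.
apply/norm_cvg0P; apply: (@squeeze_cvgr _ _ _ _ (fun=> 0) (fun n => C*hseq n)); last 2 first.
- cv.
- rewrite -[X in _ --> X](mulr0 C); apply: cvgM; cv.
apply: nearW => n; rewrite normr_ge0/=.
have hp : 0 < hseq n by rewrite invr_gt0.
move: hp (hseq_neq0 n) (dL n); rewrite /A1; move: (hseq n) => h hp hn [dLn dn].
have ltu := Lp_loc tuL.
have i1 : ig (fun x => dq (fun x => F (u x)) i h x * phi x).
 apply: loc_test => //; apply: locZ; apply: locB => //.
 exact: (loc_shift (h*:ebasis i) ltu).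
have i2 : ig (fun x => dq u i h x*(dF (u x) * phi x)) by li.
rewrite -IntB//.
have ib : ig (fun x => K*B*h * dq u i h x^+2) by li.
apply: (@le_trans _ _ (\int[mu]_x (K*B*h * dq u i h x^+2))).
 apply: Int_le_norm => //; first li.
 move=> x; have := Fq (u x) (u (x+h*:ebasis i)-u x).
 rewrite [u x + _]addrC subrK.
 have -> : u (x+h*:ebasis i)-u x = h * dq u i h x by rewrite /dq mulrA divff// mul1r.
 set r := F _-F _ - _ => hr.
 have -> : dq (fun x => F (u x)) i h x * phi x-dq u i h x*(dF (u x) * phi x) =
   h^-1*r * phi x.
  by rewrite {1}/dq /r; field.
 rewrite !normrM normfV (gtr0_norm hp) -mulrA ler_pdivrMl//.
 have -> : h*(K*B*h * dq u i h x^+2) = K*(h * dq u i h x)^+2*B by pos.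
 by rewrite ler_pM.
rewrite IntZ; last li.
have -> : C*h = K*B*h*n2 (G i)^+2 by rewrite /C; ring.
rewrite ler_wpM2l ?mulr_ge0 ?(ltW hp)// -n2_sq ler_pXn2r// nnegrE n2_ge0//.
Qed.

(** The translation is performed one coordinate at a time, whence the factor [N]. *)
Lemma HD_shiftv u G (h : E) : HD u G ->
 L2 (fun x => u (x+h)-u x) /\ n2 (fun x => u (x+h)-u x) <= N%:R*(`|h|*gn G).
Proof.
move=> uG.
have key (s : seq 'I_N) :
  L2 (fun x => u (x+\sum_(i <- s) h ord0 i*:ebasis i)-u x) /\
  n2 (fun x => u (x+\sum_(i <- s) h ord0 i*:ebasis i)-u x) <= (size s)%:R*(`|h|*gn G).
 elim: s => [|i s [IH1 IH2]].
  under eq_fun do rewrite big_nil addr0 subrr; split; first exact: L2_0.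
  by rewrite mul0r /n2; under eq_Rintegral do rewrite expr0n; rewrite Int0 sqrtr0.
 set k := \sum_(j <- s) _ in IH1 IH2 *.
 have [S1 S2] := HD_shift_L2 i (h ord0 i) uG.
 have T1 := L2_shift k S1; have T2 := n2_shift k S1.
 have -> : (fun x => u (x+\sum_(j <- i :: s) h ord0 j*:ebasis j)-u x) =
   (fun x => (u (x+k+h ord0 i*:ebasis i)-u (x+k))+(u (x+k)-u x)).
  by apply/funext => x; rewrite [RHS]addrA subrK big_cons -/k [h ord0 i *: _+k]addrC addrA.
 split; first li.
 rewrite (le_trans (n2D T1 IH1))// T2 /= -natr1 mulrDl mul1r addrC lerD//.
 by rewrite (le_trans S2)// ler_pM ?n2_ge0 ?n2_le_gn// coord_norm.
have [] := key (enum 'I_N); rewrite size_enum_ord.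
by have -> : \sum_(i <- enum 'I_N) h ord0 i*:ebasis i = h by rewrite big_enum [RHS]row_sum_delta.
Qed.

(** * The Sobolev inequality *)

Local Notation mus := (Defs_lebesgue_rV__canonical__measure_function_SigmaFiniteMeasure R N).

Lemma Int_le_eintegral f g : ig g -> mes f -> (forall x, 0 <= f x) -> (forall x, g x <= f x) ->
 ((\int[mu]_x g x)%:E <= \int[mu]_x (f x)%:E)%E.
Proof.
move=> gi mf f0 gf; have mg := ig_mes gi.
have mm : mes (fun x => Num.max (g x) 0) by apply: measurable_maxr => //.
have im : ig (fun x => Num.max (g x) 0).
 apply: (ig_le mm (ig_norm gi)) => x; rewrite ger0_norm ?le_max ?lexx ?orbT//.
 by rewrite ge_max ler_norm normr_ge0.
apply: (@le_trans _ _ (\int[mu]_x Num.max (g x) 0)%:E).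
 by rewrite lee_fin; apply: Int_le => // x; rewrite le_max lexx.
rewrite EFin_Int//; apply: ge0_le_integral => //.
- by move=> x _; rewrite lee_fin le_max lexx orbT.
- exact/measurable_EFinP.
- exact/measurable_EFinP.
- by move=> x _; rewrite lee_fin ge_max gf f0.
Qed.

Lemma mes_diff2 u : mes u -> measurable_fun setT (fun z : E*E => u (z.1+z.2)-u z.1).
Proof.
move=> mu'; apply: measurable_funB.
 exact: (measurableT_comp mu' (@measurable_addE R N)).
exact: (measurableT_comp mu' measurable_fst).
Qed.

Lemma Int_Bn (r : R) : 0 < r -> \int[mu]_h (\1_(Bn r) h : R) = (2*r)^+N.
Proof.
move=> r0; rewrite /Rintegral integral_indic//; last exact: measurable_Bn.
rewrite setIT BnE; change (fine (@lebesgue_rV R N (ball 0 r)) = (2*r)^+N).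
by rewrite lebesgue_ball.
Qed.

(* Tonelli turns the translation estimate into an estimate of the local mean oscillation. *)
Lemma HD_avg u G (r : R) f : HD u G -> 0 < r -> mes f -> (forall x, 0 <= f x) ->
 (forall x, (((2*r)^+N*f x)%:E <=
   \int[mu]_h (\1_(Bn r) h*(u (x+h)-u x)^+2)%:E)%E) ->
 ig f /\ \int[mu]_x f x <= (N%:R*(r*gn G))^+2.
Proof.
move=> uG r0 mf f0 fu; have [[mu' _] _ _] := uG.
have V0 : 0 < (2*r)^+N by pos.
apply: ig_ge0P => //.
rewrite -(@lee_pmul2l _ ((2*r)^+N)%:E)//.
rewrite -ge0_integralZl_EFin//; last 3 first.
- by move=> x _; mfun.
- exact/measurable_EFinP.
- pos.
pose F (z : E*E) : R := \1_(Bn r) z.2*(u (z.1+z.2)-u z.1)^+2.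
have mF : measurable_fun setT F.
 apply: measurable_funM; last by apply: measurable_funX; exact: mes_diff2.
 apply: (@measurableT_comp _ _ _ _ _ _ (\1_(Bn r) : E -> R)) => //.
 apply: measurable_indic; exact: measurable_Bn.
have F0 y : 0 <= F y by pos.
apply: (@le_trans _ _ (\int[mus]_x \int[mus]_h (F (x, h))%:E)%E).
 apply: ge0_le_integral => //.
 - move=> x _; pos.
 - apply: measurable_funeM; exact/measurable_EFinP.
 - apply: (@measurable_fun_fubini_tonelli_F _ _ _ _ _ mus (fun z : E*E => (F z)%:E)).
  + exact/measurable_EFinP.
  + li.
 - by move=> x _; rewrite -EFinM.
rewrite (@fubini_tonelli _ _ _ _ _ mus mus (fun z : E*E => (F z)%:E)); last 2 first.
- exact/measurable_EFinP.
- li.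
pose C := (N%:R*(r*gn G))^+2.
apply: (@le_trans _ _ (\int[mu]_h (C*\1_(Bn r) h)%:E)%E).
 apply: ge0_le_integral => //.
 - move=> h _; apply: integral_ge0 => x _; pos.
 - apply: (@measurable_fun_fubini_tonelli_G _ _ _ _ _ mus (fun z : E*E => (F z)%:E)).
  + exact/measurable_EFinP.
  + li.
 - apply/measurable_EFinP; apply: measurable_funM => //.
  apply: measurable_indic; exact: measurable_Bn.
 move=> h _; rewrite /F /= indicE; have [hr|hr] := boolP (h \in Bn r); last first.
  under eq_integral do rewrite mul0r.
  by rewrite integral0 mulr0.
 under eq_integral do rewrite mul1r.
 have [[sL1 sL2] sn] := HD_shiftv h uG.
 rewrite -EFin_Int// mulr1 lee_fin -n2_sq ler_pXn2r ?nnegrE ?n2_ge0//; last first.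
  pos.
 rewrite (le_trans sn)// ler_wpM2l// ler_wpM2r ?gn_ge0//.
 by move: hr; rewrite inE => /ltW.
rewrite -EFin_Int; last by apply: igZ; exact: ig_Bn.
rewrite IntZ; last exact: ig_Bn.
rewrite lee_fin mulrC ler_wpM2r ?sqr_ge0//.
by rewrite Int_Bn.
Qed.

Definition superl (l : R) v : E -> R := \1_[set x | l <= `|v x|].

Lemma superlE l v x : superl l v x = (l <= `|v x|)%R%:R.
Proof. by rewrite /superl; congr ((nat_of_bool _)%:R); apply/idP/idP; rewrite inE. Qed.

Lemma mes_superl l v : mes v -> mes (superl l v).
Proof.
move=> mv; apply: measurable_indic.
rewrite (_ : [set x | _] = (fun x => `|v x|) @^-1` `[l, +oo[); last first.
 by apply/seteqP; split => x /=; rewrite in_itv/= andbT.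
by rewrite -[X in measurable X]setTI; mfun.
Qed.

(** Because [2 p / N = p - 2] for the critical exponent [p]; the powers of the level then balance in
    the weak-type estimate. *)
Lemma powR_two_starN (t : R) : 0 <= t -> t`^(p/N%:R)^+2 = t`^(p-2).
Proof.
move=> t0; rewrite -powR_mulrn ?powR_ge0// -powRrM; congr (_ `^ _).
have pE := two_starE; have N2 := N2_gt0; have N0 := N_gt0.
have -> : p = 2*N%:R/(N%:R-2) by li.
field; pos.
Qed.

Definition weak_const : R := 2*N%:R^+2*(2`^N%:R^-1)^+2*2`^(p-2).

(** The volume of the ball of radius [r] is twice the Chebyshev bound [(2/l)^p A] for the set where
    [|v| >= l/2]. So around a point with [|v| >= l], the increments of [v] are at least [l/2] on
    half of the ball, and the mean oscillation bound, of order [r^2], controls the measure of such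
    points. *)
Lemma HD_weak_type v H (l A : R) : HD v H -> 0 < l -> 0 < A -> \int[mu]_x `|v x| `^ p <= A ->
 ig (superl l v) /\
 l`^p*\int[mu]_x superl l v x <= weak_const*(A`^N%:R^-1)^+2*gn H^+2.
Proof.
move=> vH l0 A0 vA; have [[mv vi] _ _] := vH.
have N0 := N_gt0.
pose r := 2^-1*(2`^N%:R^-1*((2/l)`^(p/N%:R)*A`^N%:R^-1)).
have dl0 : 0 < 2/l by pos.
have r0 : 0 < r by pos.
have rN : (2*r)^+N = 2*((2/l)`^p*A).
 rewrite /r mulrA divff// mul1r !exprMn -!powR_mulrn ?powR_ge0// -!powRrM.
 by rewrite mulVf ?gt_eqF// divfK ?gt_eqF// !powRr1 ?ltW.
have [|x|x|fi fle] := @HD_avg v H r (fun x => l^+2/8*superl l v x) vH r0.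
- apply: measurable_funM => //; exact: mes_superl.
- pos.
- rewrite superlE; have [lx|lx] := leP l `|v x|; last first.
  rewrite !mulr0; apply: integral_ge0 => h _; pos.
 (* Integrable minorant of the squared increment: positive only where [|v (x+h)| < l/2], and with an
    integral computed by Chebyshev's bound. *)
 pose g h := l^+2/4*(\1_(Bn r) h-(2/l)`^p * `|v (x+h)| `^ p).
 have iv : ig (fun h => `|v (x+h)| `^ p).
  under eq_fun do rewrite addrC; exact: (ig_shift x vi).
 have ig_g : ig g by apply: igZ; apply: igB; [exact: ig_Bn|li].
 have mvx : mes (fun h => v (x+h)).
  under eq_fun do rewrite addrC; exact: (mes_shift x mv).
 apply: (@le_trans _ _ (\int[mu]_h g h)%:E).
  rewrite lee_fin mulr1 IntZ; last by apply: igB; [exact: ig_Bn|li].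
  rewrite IntB; [|exact: ig_Bn|li].
  rewrite IntZ// Int_Bn// rN.
  have -> : \int[mu]_h `|v (x+h)| `^ p = \int[mu]_x `|v x| `^ p.
   under eq_Rintegral do rewrite addrC; exact: (Int_shift x vi).
  have k1 : (2/l)`^p*\int[mu]_x `|v x| `^ p <= (2/l)`^p*A.
   by rewrite ler_wpM2l// powR_ge0.
  have k2 : 0 <= l^+2/4 by pos.
  apply: le_trans (ler_wpM2l k2 (_ : (2/l)`^p*A <= _)).
   pos.
  pos.
 apply: Int_le_eintegral => //.
 - apply: measurable_funM; first by apply: measurable_indic; exact: measurable_Bn.
  mfun.
 - move=> h; pos.
 move=> h; rewrite /g indicE; case: (h \in _); rewrite /=; last first.
  by rewrite sub0r mul0r mulrN oppr_le0 !mulr_ge0 ?powR_ge0 ?sqr_ge0// ltW.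
 rewrite mul1r; have [hl|hl] := ltP `|v (x+h)| (l/2).
  apply: (@le_trans _ _ (l^+2/4)).
   by rewrite ler_piMr ?divr_ge0 ?sqr_ge0// gerBl mulr_ge0// powR_ge0.
  rewrite -[X in _ <= X](real_normK (num_real _)).
  have -> : l^+2/4 = (l/2)^+2 by pos.
  rewrite ler_pXn2r ?nnegrE ?divr_ge0 ?(ltW l0)//.
  have := ler_normB (v (x+h)) (v (x+h)-v x);
    rewrite opprB addrC subrK; move: lx hl; lra.
 apply: (@le_trans _ _ 0); last pos.
 rewrite mulr_ge0_le0 ?divr_ge0 ?sqr_ge0// subr_le0 -powRM ?(ltW dl0)//.
 rewrite -[X in X <= _](_ : 1`^p = 1); last by rewrite powR1.
 apply: ge0_ler_powR; [pos|pos| |].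
  pos.
 rewrite mulrAC ler_pdivlMr//; move: hl; lra.
have l8 : l^+2/8 != 0 by rewrite gt_eqF// divr_gt0// exprn_gt0.
have si : ig (superl l v).
 have := igZ (l^+2/8)^-1 fi; apply: eq_integrable => // x _ /=.
 by rewrite mulrA mulVf// mul1r.
split => //; rewrite IntZ// in fle.
have -> : l`^p = l`^(p-2)*8*(l^+2/8).
 have -> : l`^p = l`^(p-2) * l`^2.
  by rewrite -powRD ?subrK// gt_eqF//.
 rewrite powR_mulrn ?(ltW l0)//; pos.
rewrite -mulrA.
apply: (le_trans (ler_wpM2l _ fle)); first pos.
apply: eqle.
rewrite /weak_const -(powR_two_starN (ltW l0)) -(powR_two_starN (ler0n R 2)).
rewrite /r powRM ?invr_ge0 ?(ltW l0)// -[l^-1]powR_inv1 ?(ltW l0)// -powRrM mulN1r powRN.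
by field; rewrite gt_eqF// powR_gt0.
Qed.

Lemma layer_sum_le1 (e t : R) m : 0 < e ->
 \sum_(j < m) ((e*2^+j < t < 2*(e*2^+j))%R : nat)%:R <= ((t < e*2^+m)%R : nat)%:R :> R.
Proof.
move=> e0; elim: m => [|m IH]; first by rewrite big_ord0.
rewrite big_ord_recr/= exprS mulrCA.
have [h1|h1] := ltP t (e*2^+m).
 move: IH; rewrite h1 => IH.
 rewrite [(_ < t)%R]ltNge (ltW h1)/= addr0 (le_trans IH)//.
 by rewrite (lt_trans h1)// ltr_pM2l// ltr_pMl ?exprn_gt0// ltr1n.
move: IH; rewrite ltNge h1/= => IH.
apply: (@le_trans _ _ (0+((t < e*(2*2^+m))%R : nat)%:R)); last pos.
by rewrite lerD//; case: (_ < t)%R.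
Qed.

Lemma layer_cover (e t q : R) m : 0 < e -> 0 <= q -> 0 <= t ->
 ((2*e <= t < 2*(e*2^+m))%R : nat)%:R*t`^q <=
 \sum_(j < m) (4*(e*2^+j))`^q*((2*(e*2^+j) <= t)%R : nat)%:R.
Proof.
move=> e0 q0 t0; elim: m => [|m IH].
 rewrite big_ord0 mulr1; have [h|h] := leP (2*e) t; last by rewrite mul0r.
 by rewrite mul0r.
have S0 : 0 <= \sum_(j < m) (4*(e*2^+j))`^q*((2*(e*2^+j) <= t)%R : nat)%:R.
 apply: sumr_ge0 => j _; pos.
rewrite big_ord_recr/= exprS; have [h|h] := ltP t (2*(e*2^+m)).
 apply: le_trans (_ : _ <= \sum_(j < m) (4*(e*2^+j))`^q*((2*(e*2^+j) <= t)%R : nat)%:R) _.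
  apply: le_trans IH; rewrite h andbT ler_wpM2r ?powR_ge0// ler_nat.
  by case: (2*e <= t)%R => //; case: (_ < _)%R.
 by rewrite lerDl mulr_ge0 ?powR_ge0.
rewrite mulr1; have [|_] := boolP (2*e <= t < 2*(e*(2*2^+m))); last first.
 by rewrite mul0r addr_ge0 ?powR_ge0.
move=> /andP[_ h2]; rewrite mul1r (le_trans _ (_ : (4*(e*2^+m))`^q <= _))//; last first.
 pos.
apply: ge0_ler_powR; rewrite ?nnegrE//.
 pos.
pos.
Qed.

Definition sob_const : R := 4`^p*(weak_const*4).

Lemma sob_const_ge0 : 0 <= sob_const.
Proof. pos. Qed.

(** Maz'ya's truncation: the weak-type estimate is applied to the truncations of [u] at the levels
    [e 2^j], whose gradients live on disjoint layers, so that the bounds add up to the full gradient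
    norm. The power [2/N] of the left side on the right is divided out afterwards. *)
Lemma HD_sobolev_S u G : HD u G -> \int[mu]_x `|u x| `^ p <=
 sob_const*((\int[mu]_x `|u x| `^ p)`^N%:R^-1)^+2*gn G^+2.
Proof.
move=> uG; set S := \int[mu]_x _; have [[mu' ui] GL _] := uG.
have S0 : 0 <= S by apply: Int_ge0 => x.
have [Sz|Sn] := eqVneq S 0.
 rewrite [X in X <= _]Sz; pos.
have Sp : 0 < S by pos.
pose band (l : R) x := ((l < `|u x| < 2 * l)%R : nat)%:R : R.
have mband l : mes (band l).
 rewrite (_ : band l = \1_[set x | l < `|u x| < 2 * l]); last first.
  by apply/funext => x; rewrite indicE; congr ((nat_of_bool _)%:R); apply/idP/idP; rewrite inE.
 apply: measurable_indic; rewrite (_ : [set x | _] = (fun x => `|u x|) @^-1` `]l, 2 * l[); last first.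
  li.
 by rewrite -[X in measurable X]setTI; mfun.
have bandG l i : ig (fun x => band l x*G i x^+2).
 have [mG Gi] := GL i; apply: (ig_le _ Gi); first mfun.
 move=> x; rewrite ger0_norm; last pos.
 by rewrite /band; case: (_ < _ < _); rewrite ?mul1r// mul0r sqr_ge0.
have weak (l : R) : 0 < l -> ig (superl (2 * l) u) /\
  l`^p*\int[mu]_x superl (2 * l) u x <=
   weak_const*(S`^N%:R^-1)^+2*(4*\sum_i \int[mu]_x (band l x*G i x^+2)).
 move=> l0.
 have vH : HD (fun x => Tl l (u x)) (fun i x => dTl l (u x)*G i x).
  apply: (@HD_comp (16/l) 2) => //.
  - exact: measurable_Tl.
  - exact: measurable_dTl.
  - move=> s; exact: Tl_le.
  - move=> s; exact: dTl_le.
  - move=> s t; exact: Tl_rem.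
 have [[mv vi] HL _] := vH.
 have vS : \int[mu]_x `|Tl l (u x)| `^ p <= S.
  apply: Int_le => // x; apply: ge0_ler_powR; rewrite ?(ltW p0)//.
  have [h|h] := leP `|u x| l; first by rewrite Tl_small// normr0.
  have /andP[a b] := Tl_0l l0 (u x); rewrite ger0_norm; move: h b; lra.
 have [w1 w2] := HD_weak_type vH l0 Sp vS.
 have ss x : superl (2 * l) u x <= superl l (fun x => Tl l (u x)) x.
  rewrite !superlE ler_nat; have [h|//] := leP (2 * l) `|u x|.
  by rewrite Tl_big// gtr0_norm// lexx.
 have si : ig (superl (2 * l) u).
  apply: (ig_le _ w1); first exact: mes_superl.
  by move=> x; rewrite ger0_norm//.
 split => //; apply: (@le_trans _ _ (l`^p*\int[mu]_x superl l (fun x => Tl l (u x)) x)).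
  rewrite ler_wpM2l ?powR_ge0//; exact: Int_le.
 apply: (le_trans w2); rewrite ler_wpM2l//.
  pos.
 rewrite gn_sq mulr_sumr; apply: ler_sum => i _; rewrite -IntZ//.
 apply: Int_le; [exact: L2_mul|exact: igZ|] => x.
 have -> : dTl l (u x)*G i x*(dTl l (u x)*G i x) = dTl l (u x)^+2*G i x^+2 by pos.
 rewrite mulrA ler_wpM2r ?sqr_ge0// /band; have [_|h] := boolP (l < `|u x| < 2 * l).
  rewrite mulr1 -(real_normK (num_real _)) (_ : 4 = 2^+2); last pos.
  by rewrite ler_pXn2r ?nnegrE ?dTl_le.
 by rewrite mulr0 dTl_out// expr0n.
have C0 : 0 <= weak_const*(S`^N%:R^-1)^+2 by pos.
pose K := 4`^p*(weak_const*(S`^N%:R^-1)^+2*(4*gn G^+2)).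
have step (e : R) m : 0 < e ->
  ig (fun x => ((2*e <= `|u x| < 2*(e*2^+m))%R : nat)%:R * `|u x| `^ p) ->
  \int[mu]_x (((2*e <= `|u x| < 2*(e*2^+m))%R : nat)%:R * `|u x| `^ p) <= K.
 move=> e0 ii; have l0 (j : nat) : 0 < e*2^+j by rewrite mulr_gt0// exprn_gt0.
 apply: (@le_trans _ _ (\int[mu]_x (\sum_(j < m) (4*(e*2^+j))`^p*superl (2*(e*2^+j)) u x))).
  apply: Int_le => //.
   apply: ig_sum => j; apply: igZ; exact: (weak _ (l0 j)).1.
  move=> x; under eq_bigr do rewrite superlE.
  by apply: layer_cover => //.
 rewrite Int_sum; last by move=> j; apply: igZ; exact: (weak _ (l0 j)).1.
 apply: (@le_trans _ _ (\sum_(j < m) 4`^p*(weak_const*(S`^N%:R^-1)^+2 *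
   (4*\sum_i \int[mu]_x (band (e*2^+j) x*G i x^+2))))).
  apply: ler_sum => j _; have [w1 w2] := weak _ (l0 j).
  by rewrite IntZ// powRM ?(ltW (l0 j))// -mulrA ler_wpM2l.
 rewrite -!mulr_sumr ler_wpM2l ?powR_ge0// ler_wpM2l// ler_wpM2l//.
 rewrite exchange_big/= gn_sq; apply: ler_sum => i _.
 rewrite -Int_sum//; apply: Int_le; [exact: ig_sum|exact: L2_mul|] => x.
 rewrite -mulr_suml ler_piMl ?sqr_ge0//.
 by rewrite (le_trans (layer_sum_le1 _ m e0))// lern1 leq_b1.
have -> : sob_const*(S`^N%:R^-1)^+2*gn G^+2 = K by rewrite /K /sob_const; ring.

(* The values between [2^(1-n)] and [2^(n+1)], covered by [2 n] layers; they exhaust the nonzero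
   values as [n] grows, and the bound [K] does not depend on [n]. *)
pose b_ n x := ((2*(2 ^- n) <= `|u x| < 2*(2 ^- n*2^+(n+n)))%R : nat)%:R : R.
have mb n : mes (b_ n).
 rewrite (_ : b_ n = \1_[set x | 2*(2 ^- n) <= `|u x| < 2*(2 ^- n*2^+(n+n))]); last first.
  by apply/funext => x; rewrite indicE; congr ((nat_of_bool _)%:R); apply/idP/idP; rewrite inE.
 apply: measurable_indic; rewrite (_ : [set x | _] =
  (fun x => `|u x|) @^-1` `[2*(2 ^- n), 2*(2 ^- n*2^+(n+n))[); last first.
  li.
 by rewrite -[X in measurable X]setTI; mfun.
have bi n : ig (fun x => b_ n x * `|u x| `^ p).
 apply: (ig_le _ ui); first mfun.
 move=> x; rewrite ger0_norm ?mulr_ge0 ?powR_ge0//.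
 by rewrite /b_; case: (_ <= _ < _); rewrite ?mul1r// mul0r.
have [||||||_ //] := @Fatou _ _ R mu (fun n x => b_ n x * `|u x| `^ p) (fun x => `|u x| `^ p) K.
- li.
- mfun.
- move=> n x; pos.
- apply: aeW => x; have [->|u0] := eqVneq (u x) 0.
  rewrite normr0 powR0 ?gt_eqF//; under eq_fun do rewrite mulr0; cv.
 have un : 0 < `|u x| by rewrite normr_gt0.
 apply: cvg_near_cst.
 exists (Num.bound (`|u x|+2/`|u x|)).+1 => // n /= bn.
 have nb : `|u x|+2/`|u x| < 2^+n.
  apply: (@lt_trans _ _ n%:R); last by rewrite -natrX ltr_nat ltn_expl.
  apply: (lt_trans (archi_boundP _)); last by rewrite ltr_nat.
  li.
 have d0 : 0 < 2/`|u x| by pos.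
 rewrite /b_ exprD mulKf ?gt_eqF//.
 have -> : (2*2 ^- n <= `|u x|)%R.
  rewrite ler_pdivrMr// mulrC -ler_pdivrMr//.
  pos.
 have -> : (`|u x| < 2*2^+n)%R by pos.
 by rewrite mul1r.
- apply: nearW => n; apply: step => //; exact: bi.
- li.
Qed.

Definition sob : R := Num.sqrt sob_const.

Lemma sob_ge0 : 0 <= sob. Proof. pos. Qed.
#[local] Hint Resolve sob_ge0 : pos.

(** Since [1 - 2/N = 2/p], dividing by [S^(2/N)] leaves the square of the L^p norm. *)
Theorem HD_sobolev u G : HD u G -> nq p u <= sob*gn G.
Proof.
move=> uG; have := HD_sobolev_S uG; set S := \int[mu]_x _ => /= h.
have c0 := sob_const_ge0.
have S0 : 0 <= S by apply: Int_ge0 => x.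
have [Sz|Sn] := eqVneq S 0.
 by rewrite /nq -/S Sz powR0 ?invr_eq0 ?gt_eqF// mulr_ge0 ?gn_ge0 ?sob_ge0.
have Sp : 0 < S by pos.
have := two_starE; have := N2_gt0; have := N_gt0 => N0 N2 pE.
rewrite -(ler_pXn2r (ltn0Sn 1)) ?nnegrE ?nq_ge0 ?mulr_ge0 ?sob_ge0 ?gn_ge0//.
rewrite exprMn sqr_sqrtr//.
have pw (a : R) : (S`^a)^+2 = S`^(a*2) by rewrite -powR_mulrn ?powR_ge0// -powRrM.
move: h; rewrite -/S !pw mulrAC -ler_pdivrMr ?powR_gt0//.
rewrite -{1}[S](powRr1 S0) -powRB ?Sn ?implybT//.
suff -> : 1-N%:R^-1*2 = p^-1*2 :> R by [].
have -> : p = 2*N%:R/(N%:R-2) by li.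
field; pos.
Qed.

Lemma n2_leB f g : L2 f -> L2 g -> n2 (fun x => f x-g x) <= n2 f+n2 g.
Proof.
move=> fL gL; under [X in n2 X]eq_fun do rewrite -mulN1r.
by rewrite (le_trans (n2D fL (L2Z (-1) gL)))// n2Z// normrN normr1 mul1r.
Qed.

(** * Local compactness by averages over cubes *)

Lemma measurable_factor (C : countType) (z : E -> C) (F : C -> R) :
 (forall c, measurable [set x | z x = c]) -> mes (fun x => F (z x)).
Proof.
move=> mz _ Y mY; rewrite setTI.
rewrite (_ : _ @^-1` Y = \bigcup_(j : nat)
  (if unpickle j is Some c then if F c \in Y then [set x | z x = c] else set0 else set0)).
 apply: bigcupT_measurable => j; case: (unpickle j) => [c|] //.
 by case: ifP.
apply/seteqP; split => x /=.
 by move=> Fx; exists (pickle (z x)) => //; rewrite pickleK mem_set.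
move=> [j _]; case: (unpickle j) => [c|] //.
by case: ifPn => // /set_mem Fc /= ->.
Qed.

(** Index of the half-open cube of side [1/(n+1)] that contains [x]; averages over these countably
    many cubes play the role of mollification. *)
Definition cell (n : nat) (x : E) : {ffun 'I_N -> int} :=
 [ffun i => Num.floor (n.+1%:R*x ord0 i)].

Lemma cellE n c x : (cell n x = c) <->
 forall i, (c i)%:~R/n.+1%:R <= x ord0 i < ((c i)%:~R+1)/n.+1%:R.
Proof.
have n0 : 0 < n.+1%:R :> R by li.
split => [<- i|h].
 rewrite ffunE; have := floor_itv (n.+1%:R*x ord0 i).
 rewrite intrD => /andP[h1 h2]; by rewrite ler_pdivrMr// ltr_pdivlMr// [x ord0 i*_]mulrC h1.
apply/ffunP => i; rewrite ffunE; have /andP[h1 h2] := h i.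
apply: floor_def; rewrite intrD; move: h1 h2.
by rewrite ler_pdivrMr// ltr_pdivlMr// [x ord0 i*_]mulrC => ->.
Qed.

Lemma measurable_cell n c : measurable [set x : E | cell n x = c].
Proof.
rewrite (_ : mkset _ = \bigcap_i ((fun x : E => x ord0 i) @^-1`
  `[(c i)%:~R/n.+1%:R, ((c i)%:~R+1)/n.+1%:R[%classic)).
 apply: fin_bigcap_measurable => // i _; rewrite -[X in measurable X]setTI.
 by apply: measurable_coord => //.
apply/seteqP; split => x /=.
 by move=> /cellE h i _; have := h i.
by move=> h; apply/cellE => i; have := h i I.
Qed.

Lemma cell_norm n x y : cell n x = cell n y -> `|y-x| < n.+1%:R^-1.
Proof.
move=> /cellE h; have /cellE h' : cell n y = cell n y by [].
apply: norm_lt_coord => [|j]//.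
rewrite !mxE; move: (h j) (h' j); rewrite !mulrDl mul1r.
set r := _^-1; set a := _*r => /andP[h1 h2] /andP[h3 h4].
rewrite ltr_norml; apply/andP; split; lra.
Qed.

Definition cind n c : E -> R := \1_[set x | cell n x = c].

Lemma cind_le_Bn n x y : cind n (cell n x) (x+y) <= \1_(Bn n.+1%:R^-1) y.
Proof.
rewrite /cind !indicE; have [/set_mem/= h|//] := boolP (x+y \in [set z | cell n z = cell n x]).
rewrite mem_set//=; have := cell_norm (esym h); by rewrite addrAC subrr add0r.
Qed.

Lemma cind_mes n c : mes (cind n c).
Proof. apply: measurable_indic; exact: measurable_cell. Qed.

Lemma cell_set n c : [set x : E | cell n x = c] =
 [set x | forall i, `[(c i)%:~R/n.+1%:R, ((c i)%:~R+1)/n.+1%:R[%classic (x ord0 i)].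
Proof.
apply/seteqP; split => x /=.
 by move=> /cellE h i; have := h i.
by move=> h; apply/cellE => i; have := h i.
Qed.

Lemma cell_measure n c : mu [set x : E | cell n x = c] = ((n.+1%:R^-1)^+N)%:E.
Proof.
rewrite cell_set; have := @lebesgue_rV_box R N
 (fun i => `[(c i)%:~R/n.+1%:R, ((c i)%:~R+1)/n.+1%:R[%classic).
move=> /= ->; last by move=> i.
rewrite (eq_bigr (fun=> (n.+1%:R^-1)%:E)); last first.
 move=> i _; rewrite lebesgue_measure_itv/= lte_fin ltr_pM2r ?ltr0n//.
 by rewrite ltrDl ltr01; congr EFin; rewrite -mulrBl [_+1]addrC addrK mul1r.
by rewrite prodEFin prodr_const card_ord.
Qed.

Lemma ig_cind n c : ig (cind n c).
Proof.
apply: ig_indic; first exact: measurable_cell.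
by rewrite cell_measure ltry.
Qed.

Lemma Int_cind n c : \int[mu]_x cind n c x = (n.+1%:R^-1)^+N.
Proof.
rewrite /Rintegral integral_indic//; last exact: measurable_cell.
by rewrite setIT cell_measure.
Qed.

Lemma ig_cindM n c v : Lq p v -> ig (fun x => cind n c x * v x).
Proof.
move=> [mv vi]; apply: (ig_le _ (igD (ig_cind n c) vi)).
 apply: measurable_funM => //; exact: cind_mes.
move=> x; rewrite /cind indicE; case: (_ \in _); rewrite ?mul1r ?mul0r ?normr0 ?powR_ge0//.
have [h|h] := leP `|v x| 1; first by rewrite (le_trans h)// lerDl.
have p1 : 1 <= p by move: p2; lra.
by apply: le_trans (le1r_powR (ltW h) p1) _; rewrite lerDr.
Qed.

Definition cavg n v c : R := n.+1%:R^+N*\int[mu]_x (cind n c x * v x).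

Lemma cavg_bound n v c : Lq p v ->
 `|cavg n v c| <= n.+1%:R^+N*(n.+1%:R^-1^+N+\int[mu]_x `|v x| `^ p).
Proof.
move=> vL; have [mv vi] := vL; rewrite normrM ger0_norm ?exprn_ge0// ler_wpM2l ?exprn_ge0//.
rewrite -(Int_cind n c) -IntD//; last exact: ig_cind.
apply: Int_le_norm; [exact: ig_cindM|by apply: igD => //; exact: ig_cind|] => x.
rewrite /cind indicE; case: (_ \in _); rewrite ?mul1r ?mul0r ?normr0 ?powR_ge0//.
have [h|h] := leP `|v x| 1; first by rewrite (le_trans h)// lerDl.
have p1 : 1 <= p by move: p2; lra.
by apply: le_trans (le1r_powR (ltW h) p1) _; rewrite lerDr.
Qed.

Lemma cavg_mes n v : mes (fun x => cavg n v (cell n x)).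
Proof. apply: measurable_factor; exact: measurable_cell. Qed.

(** Points of one cell are at distance less than [1/(n+1)], so the oscillation on cells is bounded
    by that on balls of this radius; [2^N] is the ratio of the volumes of ball and cell. *)
Lemma cavg_osc n v G : HD v G ->
 L2 (fun x => v x-cavg n v (cell n x)) /\
 n2 (fun x => v x-cavg n v (cell n x)) <= Num.sqrt (2^+N)*(N%:R*(n.+1%:R^-1*gn G)).
Proof.
move=> vG; have [vL _ _] := vG; have [mv vi] := vL.
have r0 : 0 < n.+1%:R^-1 :> R by li.
have N2 : 0 < 2^+N :> R by li.
have md : mes (fun x => v x-cavg n v (cell n x)) by apply: measurable_funB => //; exact: cavg_mes.
pose f x := (2^+N)^-1*(v x-cavg n v (cell n x))^+2.
have [|x|x|fi fle] := @HD_avg v G _ f vG r0.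
- mfun.
- pos.
- set c := cell n x; set m := cavg n v c.
 pose t := v x-m.
 (* Tangent to the square at [t]: a minorant of the squared increment whose integral over the cell
    is exactly [t^2] times its volume. It stands in for Jensen's inequality. *)
 pose g y := cind n c (x+y)*(2*t*(v x-v (x+y))-t^+2).
 have sh (F : E -> R) : ig F -> ig (fun y => F (x+y)) /\ \int[mu]_y F (x+y) = \int[mu]_y F y.
  by move=> Fi; split; [under eq_fun do rewrite addrC; exact: ig_shift|
             under eq_Rintegral do rewrite addrC; exact: Int_shift].
 pose F y := 2*t*(v x*cind n c y-cind n c y * v y)-t^+2*cind n c y.
 have iF1 : ig (fun y => v x*cind n c y) by apply: igZ; exact: ig_cind.
 have iF2 : ig (fun y => cind n c y * v y) by exact: ig_cindM.
 have iF3 : ig (fun y => t^+2*cind n c y) by apply: igZ; exact: ig_cind.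
 have iF : ig F by li.
 have gF y : g y = F (x+y) by rewrite /g /F; ring.
 have [igF IgF] := sh _ iF.
 have ig_g : ig g by rewrite (_ : g = fun y => F (x+y))//; exact/funext.
 have Ig : \int[mu]_y g y = t^+2*(n.+1%:R^-1)^+N.
  under eq_Rintegral do rewrite gF; rewrite IgF IntB//; last by apply: igZ; exact: igB.
  rewrite IntZ; last li.
  rewrite IntB// !IntZ; try exact: ig_cind.
  rewrite Int_cind.
  have -> : \int[mu]_y (cind n c y * v y) = (n.+1%:R^-1)^+N * m.
   by rewrite /m mulrA -exprMn mulVf ?expr1n ?mul1r.
  rewrite /t; pos.
 apply: (@le_trans _ _ (\int[mu]_y g y)%:E).
  rewrite Ig lee_fin; apply: eqle; rewrite /f -/m -/t.
  by rewrite exprMn; field.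
 apply: (@Int_le_eintegral) => //.
 + apply: measurable_funM; first by apply: measurable_indic; exact: measurable_Bn.
  apply: measurable_funX; apply: measurable_funB => //.
  under eq_fun do rewrite addrC; exact: mes_shift.
 + move=> y; pos.
 move=> y; apply: (@le_trans _ _ (cind n c (x+y)*(v (x+y)-v x)^+2)).
  apply: ler_wpM2l => //.
  have -> : (v (x+y)-v x)^+2 = (v x-v (x+y))^+2 by pos.
  set b := v x-v (x+y); rewrite -subr_ge0.
  have -> : b^+2-(2*t*b-t^+2) = (b-t)^+2 by pos.
  pos.
 by apply: ler_wpM2r; [pos|exact: cind_le_Bn].
have dL : L2 (fun x => v x-cavg n v (cell n x)).
 split => //; have := igZ (2^+N) fi; rewrite /f.
 by under [X in _.-integrable _ X -> _]eq_fun do rewrite /= mulrA divff ?gt_eqF// mul1r.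
split => //; rewrite -(ler_pXn2r (ltn0Sn 1)) ?nnegrE ?n2_ge0//; last first.
 pos.
rewrite n2_sq exprMn sqr_sqrtr ?(ltW N2)// mulrC -ler_pdivrMr// mulrC -IntZ; last li.
li.
Qed.

Lemma ae_nat (P : nat -> E -> Prop) : (forall n, {ae mu, forall x, P n x}) ->
 {ae mu, forall x, forall n, P n x}.
Proof. by move=> h; apply: ae_foralln. Qed.

(** Rellich's theorem in Cauchy form. Along a diagonal subsequence all cell averages converge; on a
    bounded set the step functions they define then converge in L^2 by domination, and their
    distance to [v_] is O(1/n) uniformly in [k]. *)
Lemma HD_precompact (v_ : nat -> E -> R) (V_ : nat -> 'I_N -> E -> R) (C : R) :
 (forall k, HD (v_ k) (V_ k)) -> (forall k, gn (V_ k) <= C) ->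
 exists2 s : nat -> nat, {homo s : i j/(i < j)%N} & forall (M : R) e, 0 < e ->
  \forall k \near \oo, forall l, (k <= l)%N ->
   n2 (cut M (fun x => v_ (s l) x-v_ (s k) x)) <= e.
Proof.
move=> vV VC.
have vL k : Lq p (v_ k) by case: (vV k).
have C0 : 0 <= C by exact: le_trans (gn_ge0 _) (VC 0%N).
pose D := (sob*C)`^p.
have vD k : \int[mu]_x `|v_ k x| `^ p <= D.
 rewrite -nq_powR//; apply: ge0_ler_powR; rewrite ?nnegrE ?nq_ge0 ?(ltW p0)//.
  pos.
 by rewrite (le_trans (HD_sobolev (vV k)))// ler_wpM2l ?sob_ge0.
pose K n := n.+1%:R^+N*(n.+1%:R^-1^+N+D).
have cK n c k : `|cavg n (v_ k) c| <= K n.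
 by rewrite (le_trans (cavg_bound n c (vL k)))// ler_wpM2l ?exprn_ge0// lerD2l.
have K0 n : 0 <= K n by pos.
(* Pairs of a mesh size and a cell are coded by integers for the diagonal extraction; integers that
   code no pair receive the constant sequence 0. *)
pose a j k := if (unpickle j : option (nat * {ffun 'I_N -> int})) is Some (n, c) then cavg n (v_ k) c else 0.
pose B j := if (unpickle j : option (nat * {ffun 'I_N -> int})) is Some (n, c) then K n else 0.
have [|s sh sc] := @diag_subseq R a B.
 by move=> j k; rewrite /a /B; case: (unpickle j) => [[n c]|]; rewrite ?normr0.
exists s => // M e e0.
pose l_ n c := limn (fun k => cavg n (v_ (s k)) c).
have lc n c : cavg n (v_ (s k)) c @[k --> \oo] --> l_ n c.
 have := sc (pickle (n, c)); rewrite /a pickleK; exact.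
pose A := Num.sqrt (2^+N)*(N%:R*C).
pose n := Num.bound (A*8/e).
have An : A*n.+1%:R^-1 <= e/8.
 rewrite ler_pdivrMr ?ltr0n// mulrC mulrA ler_pdivlMr// -ler_pdivrMr//.
 rewrite (le_trans (ltW (archi_boundP _)))//; last pos.
 pos.
pose m k x := cut M (fun x => cavg n (v_ (s k)) (cell n x)) x.
pose mo x := cut M (fun x => l_ n (cell n x)) x.
have mm k : mes (m k) by apply: mes_cut; exact: cavg_mes.
have mmo : mes mo.
 apply: mes_cut; apply: measurable_factor; exact: measurable_cell.
have lK c : `|l_ n c| <= K n.
 apply: (ler_cvg_to (cvg_norm (lc n c)) (@cvg_cst _ (K n) _ \oo _)).
 by apply: nearW => k.
have m_cut k x : `|m k x-mo x| <= 2*K n*\1_(Bn M) x.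
 rewrite /m /mo !cutE indicE; case: ifPn => h; last first.
  by rewrite subrr normr0 mulr_ge0// mulr_ge0.
 rewrite mem_set// mulr1 (le_trans (ler_normB _ _))//.
 have := cK n (cell n x) (s k); have := lK (cell n x); lra.
have [|||||_ Dc _] := @DCT _ _ R mu (fun k x => (m k x-mo x)^+2) (fun=> 0)
  (fun x => (2*K n)^+2*\1_(Bn M) x).
- move=> k; apply: measurable_funX; mfun.
- li.
- apply: aeW => x; rewrite -[X in _ --> X](mulr0 0); under eq_fun do rewrite expr2.
 have : m k x-mo x ~>0 k.
  rewrite /m -(subrr (cut M (fun x => l_ n (cell n x)) x)); apply: cvgB; last cv.
  rewrite /cut; apply: cvgM; last cv.
  li.
 move=> h; cv.
- apply: igZ; exact: ig_Bn.
- apply: aeW => x k; rewrite ger0_norm ?sqr_ge0// -[X in X <= _](real_normK (num_real _)).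
 apply: (@le_trans _ _ ((2*K n*\1_(Bn M) x)^+2)).
  by rewrite ler_pXn2r ?nnegrE// (le_trans (normr_ge0 _) (m_cut k x)).
 by rewrite exprMn ?sqr_ge0// indicE; case: (_ \in _); rewrite ?expr1n ?expr0n.
rewrite Int0 in Dc.
have mL k : L2 (fun x => m k x-mo x).
 split; first mfun.
 apply: (ig_le _ (igZ ((2*K n)^+2) (ig_Bn M))).
  mfun.
 move=> x; rewrite ger0_norm ?sqr_ge0// -[X in X <= _](real_normK (num_real _)).
 apply: (@le_trans _ _ ((2*K n*\1_(Bn M) x)^+2)).
  by rewrite ler_pXn2r ?nnegrE// (le_trans (normr_ge0 _) (m_cut k x)).
 by rewrite exprMn ?sqr_ge0// indicE; case: (_ \in _); rewrite ?expr1n ?expr0n.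
have Dn : n2 (fun x => m k x-mo x) ~>0 k.
 rewrite -[X in _ --> X](@sqrtr0 R); apply: continuous_cvg Dc; exact: sqrt_continuous.
have e4 : 0 < e/4 by pos.
have [k0 _ hk0] : \forall k \near \oo, n2 (fun x => m k x-mo x) <= e/4.
 move/cvgrPdist_le : Dn => /(_ _ e4); apply: filterS => k.
 by rewrite sub0r normrN ger0_norm// n2_ge0.
exists k0 => // k /= k0k l kl.
have osc j : L2 (cut M (fun x => v_ (s j) x-cavg n (v_ (s j)) (cell n x))) /\
  n2 (cut M (fun x => v_ (s j) x-cavg n (v_ (s j)) (cell n x))) <= e/8.
 have [z1 z2] := cavg_osc n (vV (s j)); have cL := L2_cut M z1; split => //.
 rewrite (le_trans (n2_le cL z1 (norm_cut_le _ _)))// (le_trans z2)//.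
 rewrite (le_trans _ An)// -!mulrA ler_wpM2l ?sqrtr_ge0// ler_wpM2l// mulrC.
 by rewrite ler_wpM2r.
have [z1 z2] := osc l; have [z3 z4] := osc k.
have -> : cut M (fun x => v_ (s l) x-v_ (s k) x) = fun x =>
  (cut M (fun x => v_ (s l) x-cavg n (v_ (s l)) (cell n x)) x -
  cut M (fun x => v_ (s k) x-cavg n (v_ (s k)) (cell n x)) x) +
  ((m l x-mo x)-(m k x-mo x)).
 apply/funext => x; rewrite /m /cut; ring.
have oB := L2B z1 z3; have mB := L2B (mL l) (mL k).
rewrite (le_trans (n2D oB mB))//.
have b1 := n2_leB z1 z3.
have b2 := n2_leB (mL l) (mL k).
have q1 := hk0 _ k0k; have q2 := hk0 _ (leq_trans k0k kl).
move: b1 b2 q1 q2 z2 z4.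
set a1 := n2 _; set a2 := n2 _; set a3 := n2 _; set a4 := n2 _; set a5 := n2 _; set a6 := n2 _.
move=> *; lra.
Qed.

Lemma cvg_fun (f : R -> R) (a : nat -> R) (l : R) : continuous f ->
 a k @[k --> \oo] --> l -> f (a k) @[k --> \oo] --> f l.
Proof. move=> cf al; apply: (cvg_comp _ _ al); cv. Qed.

Lemma HD_Ip_bound u G C : HD u G -> gn G <= C ->
 \int[mu]_x `|u x| `^ p <= (sob*C)`^p.
Proof.
move=> uG GC; have C0 := le_trans (gn_ge0 _) GC.
rewrite -nq_powR//; apply: ge0_ler_powR; rewrite ?nnegrE ?nq_ge0 ?(ltW p0)//.
 pos.
by rewrite (le_trans (HD_sobolev uG))// ler_wpM2l ?sob_ge0.
Qed.

(* [v_] converges to [w] almost everywhere and in L^2 on bounded sets, the gradients [V_] weakly in L^2. *)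
Definition wcvg (v_ : nat -> E -> R) (V_ : nat -> 'I_N -> E -> R) w (W : 'I_N -> E -> R) :=
 [/\ {ae mu, forall x, v_ ^~ x @ \oo --> w x},
   forall M, n2 (cut M (fun x => v_ k x-w x)) ~>0 k &
   forall i f, L2 f -> \int[mu]_x (V_ k i x*f x) @[k --> \oo] --> \int[mu]_x (W i x*f x)].

Lemma cut_mono M M' f x : M <= M' -> `|cut M f x| <= `|cut M' f x|.
Proof.
move=> MM; rewrite !cutE; case: ifPn => xM; last by rewrite normr0.
by rewrite (lt_le_trans xM MM).
Qed.

Lemma wcvg_sub (s : nat -> nat) (v_ : nat -> E -> R) (V_ : nat -> 'I_N -> E -> R) w W : {homo s : i j/(i < j)%N} ->
 wcvg v_ V_ w W -> wcvg (v_ \o s) (V_ \o s) w W.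
Proof.
move=> sh [c1 c2 c3]; split.
- apply: filterS c1 => x c; exact: (cvg_sub sh c).
- move=> M; exact: (cvg_sub sh (c2 M)).
- move=> i f fL; exact: (cvg_sub sh (c3 i f fL)).
Qed.

(** A faster subsequence converges almost everywhere, and Fatou puts its limit [w] in L^p. The
    gradients are tested against [phi] through [- int w d_i phi]; the function representing this
    functional is therefore the weak derivative of [w]. *)
Lemma HD_weak_compact (v_ : nat -> E -> R) (V_ : nat -> 'I_N -> E -> R) (C : R) :
 (forall k, HD (v_ k) (V_ k)) -> (forall k, gn (V_ k) <= C) ->
 exists s : nat -> nat, exists w, exists W,
  [/\ {homo s : i j/(i < j)%N}, HD w W & wcvg (v_ \o s) (V_ \o s) w W].
Proof.
move=> vV VC; have [t th tC] := HD_precompact vV VC.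
have vL k : Lq p (v_ k) by case: (vV k).
have mv k : mes (v_ k) by li.
have [j|r rh rP] := @subseq_near (fun j k => forall l, (k <= l)%N ->
  n2 (cut j%:R (fun x => v_ (t l) x-v_ (t k) x))^+2 <= (8^-1)^+j).
 have e0 : 0 < Num.sqrt ((8^-1)^+j) :> R by li.
 apply: filterS (tC j%:R _ e0) => k h l kl.
 have q0 : 0 <= 8^-1^+j :> R by li.
 rewrite -(sqr_sqrtr q0) ler_pXn2r ?nnegrE ?sqrtr_ge0//; exact: h.
pose s := t \o r; have sh : {homo s : i j/(i < j)%N} by exact: homo_comp.
have cL M k l : L2 (cut M (fun x => v_ (s l) x-v_ (s k) x)).
 have cB : Lq p (fun x => v_ (s l) x-v_ (s k) x) by apply: LqB => //.
 exact: (Lp_L2cut M cB).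
have sP M j l : M <= j%:R -> (j <= l)%N ->
  n2 (cut M (fun x => v_ (s l) x-v_ (s j) x))^+2 <= (8^-1)^+j.
 move=> Mj jl; apply: le_trans (rP j (r l) _); last first.
  by rewrite leq_eqVlt in jl; case/predU1P : jl => [->//|/rh/ltnW].
 rewrite ler_pXn2r ?nnegrE ?n2_ge0//; apply: (n2_le (cL M j l) (cL j%:R j l)) => x; exact: cut_mono.
have aeC : {ae mu, forall x, cvgn (fun k => v_ (s k) x)}.
 have h (M : nat) : {ae mu, forall x, cvgn (fun j => cut M%:R (v_ (s (j+M)%N)) x)}.
  apply: (@ae_cvg_fast _ _ R mu (fun j => cut M%:R (v_ (s (j+M)%N)))).
  - mfun.
  - move=> j; have [_] := cL M%:R (j+M)%N (j.+1+M)%N.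
   by under eq_fun do rewrite /cut mulrBl.
  - move=> j; have := sP M%:R (j+M)%N (j.+1+M)%N.
   rewrite ler_nat leq_addl leqnSn => /(_ isT isT).
   rewrite n2_sq => /le_trans h; apply: le_trans (h _ _).
    apply: eqle.
    by apply: Int_ext => x; rewrite /cut mulrBl.
   by rewrite exprD ler_piMr ?invr_ge0// exprn_ile1 ?invr_ge0// invf_le1// ler1n.
 apply: filterS (ae_nat h) => x hx.
 have [M _ xM] := near_Bn x; have := hx M.
 under eq_fun do rewrite cutE (xM M (leqnn M)).
 move=> /cvg_ex[l hl]; apply/cvg_ex; exists l.
 by rewrite -(cvg_shiftn M).
have [w mw wc] := ae_lim_ex (fun k => mv (s k)) aeC.
have [||||||wi _] := @Fatou _ _ R mu (fun k x => `|v_ (s k) x| `^ p) (fun x => `|w x| `^ p)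
  ((sob*C)`^p).
- by move=> k; have [] := vL (s k).
- mfun.
- li.
- apply: filterS wc => x c.
 exact: (cvg_fun (powR_norm_continuous p0) c).
- apply: nearW => k; exact: (HD_Ip_bound (vV (s k)) (VC (s k))).
- li.
have wL : Lq p w by [].
have lw : loc w by exact: Lp_loc wL.
have wcL M k : L2 (cut M (fun x => v_ (s k) x-w x)).
 have cB : Lq p (fun x => v_ (s k) x-w x) by apply: LqB => //.
 exact: (Lp_L2cut M cB).
have l2c M : n2 (cut M (fun x => v_ (s k) x-w x)) ~>0 k.
 have key : \forall k \near \oo, n2 (cut M (fun x => v_ (s k) x-w x))^+2 <= (8^-1)^+k.
  exists (Num.bound `|M|) => // k /= Mk.
  have Mk' : M <= k%:R.
   rewrite (le_trans (ler_norm M))// (le_trans (ltW (archi_boundP (normr_ge0 _))))//.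
   by rewrite ler_nat.
  have [||||||_] := @Fatou _ _ R mu (fun l x => cut M (fun x => v_ (s l) x-v_ (s k) x) x^+2)
    (fun x => cut M (fun x => v_ (s k) x-w x) x^+2) ((8^-1)^+k).
  - move=> l; li.
  - by apply: measurable_funX; have [] := wcL M k.
  - move=> l x; pos.
  - apply: filterS wc => x c.
   have -> : cut M (fun x => v_ (s k) x-w x) x^+2 = cut M (fun x => w x-v_ (s k) x) x^+2.
    rewrite /cut; pos.
   apply: (@cvg_fun (fun z : R => z^+2)); first exact: exprn_continuous.
   rewrite /cut; apply: cvgM; last cv.
   cv.
  - exists k => // l /= kl; rewrite -n2_sq; exact: sP.
  - move=> x; pos.
  by rewrite n2_sq.
 suff : n2 (cut M (fun x => v_ (s k) x-w x))^+2 ~>0 k.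
  move=> h; have := cvg_fun (@sqrt_continuous R) h.
  rewrite sqrtr0; apply: cvg_trans; apply: near_eq_cvg; apply: nearW => k /=.
  by rewrite sqrtr_sqr ger0_norm// n2_ge0.
 apply: (@squeeze_cvgr _ _ _ _ (fun=> 0) (fun k => (8^-1)^+k)).
 - by apply: filterS key => k h; rewrite sqr_ge0.
 - cv.
 - by apply: cvg_expr; rewrite ger0_norm ?invr_ge0// invf_lt1// ltr1n.
have tw i phi : test_function phi ->
  \int[mu]_x (V_ (s k) i x * phi x) @[k --> \oo] --> - \int[mu]_x (w x * partial i phi x).
 move=> tphi; have td := test_partial i tphi.
 have /test_functionP[_ [M hM]] := td.
 have -> : (fun k => \int[mu]_x (V_ (s k) i x * phi x)) =
   fun k => - \int[mu]_x (v_ (s k) x * partial i phi x).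
  apply/funext => k; have [_ _ wV] := vV (s k); have [_ _ wk] := wV i.
  by rewrite wk// opprK.
 apply: cvgN; apply/subr_cvg0/norm_cvg0P.
 apply: (@squeeze_cvgr _ _ _ _ (fun=> 0) (fun k => n2 (cut M (fun x => v_ (s k) x-w x))*n2 (partial i phi))).
 - apply: nearW => k; rewrite normr_ge0/= -IntB; last 2 first.
  + apply: loc_test => //; exact: Lp_loc.
  + exact: loc_test.
  rewrite (_ : \int[mu]_x _ = \int[mu]_x (cut M (fun x => v_ (s k) x-w x) x * partial i phi x)).
   apply: CS => //; li.
  apply: Int_ext => x; rewrite cutE; case: ifPn => h; first pos.
  by rewrite hM ?mulr0 ?subrr ?mul0r// leNgt.
 - cv.
 - rewrite -[X in _ --> X](mul0r (n2 (partial i phi))); apply: cvgM => //; cv.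
have VL k i : L2 (V_ (s k) i) by case: (vV (s k)).
have Vn k i : n2 (V_ (s k) i) <= C by rewrite (le_trans (n2_le_gn _ _)).
have exW i := L2_weak_limit (VL ^~ i) (Vn ^~ i) (@test_L2) (tw i).
pose W i := s2val (cid2 (exW i)).
have WL i : L2 (W i) := s2valP (cid2 (exW i)).
have Wt i phi (tphi : test_function phi) : \int[mu]_x (W i x * phi x) = - \int[mu]_x (w x * partial i phi x).
 exact: (s2valP' (cid2 (exW i))).2.
exists s, w, W; split => //.
 split => // i; split.
 - exact/loc_integrableP.
 - apply/loc_integrableP; exact: L2_loc.
 - by move=> phi tphi; rewrite Wt// opprK.
split => // i f fL; apply: (@weak_cvg_L2 (fun k => V_ (s k) i) (W i) C) => //.
by move=> phi tphi; rewrite Wt//; mfun.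
Qed.

(** * Critical rescaling *)

Definition rescG G (e : R) (xi : E) : 'I_N -> E -> R :=
 fun i x => e`^((2-N%:R)/2)*(e^-1*G i (e^-1*:(x-xi))).

Lemma rescE (e : R) (xi x : E) : e^-1*:(x-xi) = - (e^-1*:xi)+e^-1*:x.
Proof. by rewrite scalerBr addrC. Qed.

Lemma HD_rescale w G (e : R) xi : 0 < e -> HD w G -> HD (rescale w e xi) (rescG G e xi).
Proof.
move=> e0 wG; have ei : 0 < e^-1 by rewrite invr_gt0.
have := HDZ (e`^((2-N%:R)/2)) (HD_affine (- (e^-1*:xi)) ei wG).
by apply: HD_ext => [x|i x]; rewrite -rescE.
Qed.

Lemma ig_resc (f : E -> R) (e : R) (xi : E) : 0 < e -> ig f ->
 ig (fun x => e ^- N*f (e^-1*:(x-xi))).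
Proof.
move=> e0 fi; have ei : 0 < e^-1 by rewrite invr_gt0.
under eq_fun do rewrite rescE; apply: igZ; exact: ig_affine.
Qed.

Lemma Int_resc (f : E -> R) (e : R) (xi : E) : 0 < e -> ig f ->
 \int[mu]_x (e ^- N*f (e^-1*:(x-xi))) = \int[mu]_x f x.
Proof.
move=> e0 fi; have ei : 0 < e^-1 by rewrite invr_gt0.
under eq_Rintegral do rewrite rescE.
rewrite IntZ; last exact: ig_affine.
by rewrite Int_affine// exprVn invrK mulrA mulVf ?mul1r// expf_neq0// gt_eqF.
Qed.

(** With [resc_sq], the exponent count that makes the L^p norm and the gradient norm invariant under
    rescaling. *)
Lemma resc_pow (e : R) : 0 < e -> (e`^((2-N%:R)/2))`^p = e ^- N.
Proof.
move=> e0; rewrite -powRrM.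
have -> : (2-N%:R)/2 * p = - N%:R.
 have N2 := N2_gt0; rewrite /two_star; field; rewrite gt_eqF//.
by rewrite powRN powR_mulrn// ltW.
Qed.

Lemma resc_sq (e : R) : 0 < e -> (e`^((2-N%:R)/2))^+2*(e^-1)^+2 = e ^- N.
Proof.
move=> e0; rewrite -powR_mulrn ?powR_ge0// -powRrM divfK// powRB; last pos.
by rewrite !powR_mulrn ?(ltW e0)//; field; rewrite !gt_eqF// exprn_gt0.
Qed.

Lemma ip_resc G H (e : R) xi : 0 < e -> L2N G -> L2N H -> ip (rescG G e xi) (rescG H e xi) = ip G H.
Proof.
move=> e0 GL HL; apply: eq_bigr => i _.
rewrite -[RHS](Int_resc xi e0); last li.
apply: Int_ext => x; rewrite -resc_sq// /rescG; pos.
Qed.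

Lemma gn_resc G (e : R) xi : 0 < e -> L2N G -> gn (rescG G e xi) = gn G.
Proof. by move=> e0 GL; rewrite /gn ip_resc. Qed.

Lemma rescK_arg (e : R) (xi x : E) : 0 < e ->
 e^-1*:(e*:(x - - (e^-1*:xi))-xi) = x.
Proof.
move=> e0; rewrite opprK (scalerDr e) scalerA divff ?gt_eqF// scale1r addrK.
by rewrite scalerA mulVf ?gt_eqF// scale1r.
Qed.

Lemma rescaleK w (e : R) (xi : E) : 0 < e ->
 rescale (rescale w e xi) e^-1 (- (e^-1*:xi)) = w.
Proof.
move=> e0; apply/funext => x; rewrite /rescale invrK mulrA -powRM ?invr_ge0 ?(ltW e0)//.
rewrite mulVf ?gt_eqF// powR1 mul1r.
by rewrite rescK_arg.
Qed.

Lemma rescGK G (e : R) (xi : E) : 0 < e ->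
 rescG (rescG G e xi) e^-1 (- (e^-1*:xi)) = G.
Proof.
move=> e0; apply/funext => i; apply/funext => x; rewrite /rescG invrK.
rewrite rescK_arg//.
have -> : e^-1`^((2-N%:R)/2)*(e*(e`^((2-N%:R)/2)*(e^-1*G i x))) = (e^-1`^((2-N%:R)/2)*e`^((2-N%:R)/2))*(e*e^-1)*G i x by pos.
by rewrite -powRM ?invr_ge0 ?(ltW e0)// mulVf ?gt_eqF// powR1 divff ?gt_eqF// !mul1r.
Qed.

Lemma rescaleVK w (e : R) (xi : E) : 0 < e ->
 rescale (rescale w e^-1 (- (e^-1*:xi))) e xi = w.
Proof.
move=> e0; have ei : 0 < e^-1 by rewrite invr_gt0.
have := rescaleK w (- (e^-1*:xi)) ei; rewrite invrK.
by rewrite scalerN scalerA mulfV ?gt_eqF// scale1r opprK.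
Qed.

Lemma rescGVK G (e : R) (xi : E) : 0 < e ->
 rescG (rescG G e^-1 (- (e^-1*:xi))) e xi = G.
Proof.
move=> e0; have ei : 0 < e^-1 by rewrite invr_gt0.
have := rescGK G (- (e^-1*:xi)) ei; rewrite invrK.
by rewrite scalerN scalerA mulfV ?gt_eqF// scale1r opprK.
Qed.

Lemma norm_resc_pow w (e : R) (xi : E) x : 0 < e ->
 `|rescale w e xi x| `^ p = e ^- N * `|w (e^-1*:(x-xi))| `^ p.
Proof. by move=> e0; rewrite normrM ger0_norm ?powR_ge0// powRM ?powR_ge0// resc_pow. Qed.

Lemma gp_resc w phi (e : R) (xi : E) x : 0 < e ->
 gp p (rescale w e xi x)*rescale phi e xi x =
 e ^- N*(gp p (w (e^-1*:(x-xi))) * phi (e^-1*:(x-xi))).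
Proof.
move=> e0; rewrite -resc_pow// /gp /rescale normrM ger0_norm ?powR_ge0// powRM ?powR_ge0//.
set a := e `^ _; have -> : a`^p = a^+2*a`^(p-2).
 rewrite -powR_mulrn ?powR_ge0// powRDn0 ?powR_ge0 ?subr_gt0//.
 congr (_ `^ _); pos.
lra.
Qed.

Implicit Types (a : E -> R).

(** * Energy functionals and their derivatives *)

Section energy.
Let p1 : 0 < p-1. Proof. move: p2; lra. Qed.
Let pp1 : p-1+1 = p. Proof. by rewrite subrK. Qed.
Hint Resolve p2 p0 p1 : core.

Lemma young_eps (al be e : R) : 0 < al -> 0 < be -> 0 < e -> exists2 C, 0 <= C &
 forall s t : R, 0 <= s -> 0 <= t -> s`^al*t`^be <= e*s`^(al+be)+C*t`^(al+be).
Proof.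
move=> al0 be0 e0; pose d := e`^be^-1.
have d0 : 0 < d by pos.
exists ((d^-1)`^al) => [|s t s0 t0]; first pos.
have [ts|ts] := leP t (d*s).
 apply: (@le_trans _ _ (e*s`^(al+be))); last by rewrite lerDl mulr_ge0 ?powR_ge0.
 rewrite -powRDn0// mulrCA ler_wpM2l ?powR_ge0//.
 have -> : e*s`^be = (d*s)`^be.
  by rewrite powRM ?(ltW d0)// -powRrM mulVf ?gt_eqF// powRr1// ltW.
 apply: ge0_ler_powR; pos.
apply: (@le_trans _ _ (d^-1`^al*t`^(al+be))); last first.
 by rewrite lerDr mulr_ge0 ?powR_ge0 ?(ltW e0).
rewrite -powRDn0// mulrA ler_wpM2r ?powR_ge0// -powRM ?invr_ge0 ?(ltW d0)//.
apply: ge0_ler_powR; rewrite ?nnegrE ?mulr_ge0 ?invr_ge0 ?(ltW al0) ?(ltW d0)//.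
by rewrite ler_pdivlMl// ltW.
Qed.

Lemma Lp_Bn M : Lq p (\1_(Bn M) : E -> R).
Proof.
have mB := measurable_Bn M.
split => //.
rewrite (_ : (fun x => _) = \1_(Bn M)); first exact: ig_Bn.
by apply/funext => x; rewrite indicE; case: (_ \in _); rewrite ?normr1 ?powR1// normr0 powR0// gt_eqF.
Qed.

(** Hölder with exponents [p - 2] on the indicator of the ball and 2 on [u], followed by the Sobolev
    inequality. *)
Lemma L2cut_bound M : exists2 K, 0 <= K & forall u U, HD u U -> n2 (cut M u) <= K*gn U.
Proof.
pose b := nq p (\1_(Bn M) : E -> R).
exists (Num.sqrt (2*b`^(p-2))*sob) => [|u U uU].
 pos.
have [uL _ _] := uU.
have c0 : 0 <= 2*b`^(p-2) by pos.
rewrite -(ler_pXn2r (ltn0Sn 1)) ?nnegrE ?n2_ge0 ?mulr_ge0 ?sob_ge0 ?gn_ge0//.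
rewrite n2_sq -mulrA exprMn sqr_sqrtr//.
have p22 : p-2+2 = p by pos.
have h := @holder_nq _ _ _ mu (p-2) 2 (\1_(Bn M) : E -> R) u; rewrite p22 in h.
apply: (@le_trans _ _ (\int[mu]_x (`|(\1_(Bn M) : E -> R) x| `^ (p-2) * `|u x| `^ 2))).
 apply: Int_le.
 - by have [] := Lp_L2cut M uL.
 - have := @Lq_mul _ _ _ mu (p-2) 2 (\1_(Bn M) : E -> R) u; rewrite p22; apply => //.
  + by rewrite subr_ge0 ltW.
  + exact: Lp_Bn.
 - move=> x; rewrite exprMn indicE; case: (_ \in _).
   by rewrite normr1 powR1 expr1n mulr1 mul1r powR_mulrn// real_normK// num_real.
  by rewrite expr0n/= mulr0 mulr_ge0//.
have p20 : 0 < p-2 by rewrite subr_gt0.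
apply: (le_trans (h p20 (ltr0n _ 2) (Lp_Bn M) uL)); rewrite ler_wpM2l//.
rewrite powR_mulrn ?nq_ge0// ler_pXn2r ?nnegrE ?nq_ge0 ?mulr_ge0 ?sob_ge0 ?gn_ge0//.
exact: HD_sobolev.
Qed.

(** With [wt_ok], the data of all functionals in play: the potential is [lambda 1_Omega] or 0, and
    the weight is [Q_Omega], one of its blow-ups, a constant sign or the sign on a half-space. *)
Definition pot_ok a (B M : R) := [/\ mes a, forall x, `|a x| <= B & vanish_out M a].

Definition wt_ok Q := mes Q /\ forall x, `|Q x| <= 1.

Lemma pot0 : pot_ok (fun=> 0) 0 0.
Proof. by split => // x; rewrite ?normr0. Qed.

Lemma pot_int a B M u v : pot_ok a B M -> Lq p u -> Lq p v ->
 ig (fun x => a x*(u x * v x)) /\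
 `|\int[mu]_x (a x*(u x * v x))| <= B*(n2 (cut M u)*n2 (cut M v)).
Proof.
move=> [ma aB aM] uL vL; have u2 := Lp_L2cut M uL; have v2 := Lp_L2cut M vL.
have B0 : 0 <= B := le_trans (normr_ge0 _) (aB 0).
have le x : `|a x*(u x * v x)| <= B * `|cut M u x*cut M v x|.
 rewrite normrM !cutE; case: ifPn => h; first by rewrite ler_wpM2r.
 by rewrite aM ?normr0 ?mul0r ?mulr_ge0// leNgt.
have i1 : ig (fun x => B * `|cut M u x*cut M v x|) by li.
have i2 : ig (fun x => a x*(u x * v x)).
 apply: (ig_le _ i1) => //; apply: measurable_funM => //; apply: measurable_funM; li.
split => //; apply: (le_trans (Int_le_norm i2 i1 le)).
rewrite IntZ; last by apply: ig_norm; exact: L2_mul.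
rewrite ler_wpM2l//; exact: CS_abs.
Qed.

Lemma gp_int u v : Lq p u -> Lq p v ->
 ig (fun x => `|u x| `^ (p-1) * `|v x|) /\
 \int[mu]_x (`|u x| `^ (p-1) * `|v x|) <= 2*nq p u`^(p-1)*nq p v.
Proof.
move=> uL vL; have e1 x : `|v x| = `|v x| `^ 1 by rewrite powRr1.
under eq_fun do rewrite e1.
have h1 := @Lq_mul _ _ _ mu (p-1) 1 u v; have h2 := @holder_nq _ _ _ mu (p-1) 1 u v.
rewrite pp1 in h1 h2; split; first by apply: h1 => //; exact: ltW.
apply: le_trans (h2 p1 ltr01 uL vL) _; apply: ler_wpM2l; first by rewrite mulr_ge0 ?powR_ge0.
by move: (nq_ge0 mu p v); move: (nq p v) => z z0; rewrite powRr1.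
Qed.

Lemma mes_gp u : mes u -> mes (fun x => gp p (u x)).
Proof. move=> mu'; apply: measurable_funM => //; mfun. Qed.
#[local] Hint Resolve mes_gp : mes.

Lemma wt_int Q u v : wt_ok Q -> Lq p u -> Lq p v ->
 ig (fun x => Q x*(gp p (u x) * v x)) /\
 `|\int[mu]_x (Q x*(gp p (u x) * v x))| <= 2*nq p u`^(p-1)*nq p v.
Proof.
move=> [mQ Q1] uL vL; have [i1 i2] := gp_int uL vL.
have le x : `|Q x*(gp p (u x) * v x)| <= `|u x| `^ (p-1) * `|v x|.
 by rewrite normrM [`|gp _ _*_|]normrM gp_norm// ler_piMl ?powR_ge0.
have mm : mes (fun x => Q x*(gp p (u x) * v x)) by mfun.
have i3 : ig (fun x => Q x*(gp p (u x) * v x)) by exact: (ig_le mm i1 le).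
split => //; exact: le_trans (Int_le_norm i3 i1 le) i2.
Qed.

Lemma wt_pow Q u : wt_ok Q -> Lq p u -> ig (fun x => Q x * `|u x| `^ p).
Proof.
move=> [mQ Q1] [mu' ui]; apply: (ig_le _ ui); first mfun.
by move=> x; rewrite normrM [`|_ `^ _|]ger0_norm ?powR_ge0// ler_piMl.
Qed.

Definition dJ a Q u U v V : R :=
 ip U V+\int[mu]_x (a x*(u x * v x))-\int[mu]_x (Q x*(gp p (u x) * v x)).

Definition Jf a Q u U : R :=
 2^-1*(gn U^+2+\int[mu]_x (a x*(u x*u x)))-p^-1*\int[mu]_x (Q x * `|u x| `^ p).

Lemma dJ_pot0 Q u U v V : dJ (fun=> 0) Q u U v V = ip U V-\int[mu]_x (Q x*(gp p (u x) * v x)).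
Proof.
rewrite /dJ (_ : \int[mu]_x _ = 0) ?addr0//.
under eq_Rintegral do rewrite mul0r; exact: Int0. Qed.

Lemma Jf_pot0 Q u U : Jf (fun=> 0) Q u U = 2^-1*gn U^+2-p^-1*\int[mu]_x (Q x * `|u x| `^ p).
Proof.
rewrite /Jf (_ : \int[mu]_x _ = 0) ?addr0//.
under eq_Rintegral do rewrite mul0r; exact: Int0. Qed.

Lemma dJ_diag Q u U : dJ (fun=> 0) Q u U u U = gn U^+2-\int[mu]_x (Q x * `|u x| `^ p).
Proof.
by rewrite dJ_pot0 gn_sq; congr (_ - _); apply: Int_ext => x; rewrite gpE.
Qed.

Lemma dJD a B M Q u U v V w W : pot_ok a B M -> wt_ok Q -> HD u U -> HD v V -> HD w W ->
 dJ a Q u U (fun x => v x+w x) (fun i x => V i x+W i x) = dJ a Q u U v V+dJ a Q u U w W.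
Proof.
move=> ao Qo [uL UL _] [vL VL _] [wL WL _]; rewrite /dJ ipDr//.
have -> : \int[mu]_x (a x*(u x*(v x+w x))) =
  \int[mu]_x (a x*(u x * v x))+\int[mu]_x (a x*(u x*w x)).
 rewrite -IntD; [|exact: (pot_int ao uL vL).1|exact: (pot_int ao uL wL).1].
 apply: Int_ext => x; pos.
have -> : \int[mu]_x (Q x*(gp p (u x)*(v x+w x))) =
  \int[mu]_x (Q x*(gp p (u x) * v x))+\int[mu]_x (Q x*(gp p (u x)*w x)).
 rewrite -IntD; [|exact: (wt_int Qo uL vL).1|exact: (wt_int Qo uL wL).1].
 apply: Int_ext => x; pos.
lra.
Qed.

Lemma dJZ a B M Q u U v V (c : R) : pot_ok a B M -> wt_ok Q -> HD u U -> HD v V ->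
 dJ a Q u U (fun x => c * v x) (fun i x => c*V i x) = c * dJ a Q u U v V.
Proof.
move=> ao Qo [uL UL _] [vL VL _]; rewrite /dJ ipZr//.
have -> : \int[mu]_x (a x*(u x*(c * v x))) = c*\int[mu]_x (a x*(u x * v x)).
 rewrite -IntZ; last exact: (pot_int ao uL vL).1.
 apply: Int_ext => x; pos.
have -> : \int[mu]_x (Q x*(gp p (u x)*(c * v x))) = c*\int[mu]_x (Q x*(gp p (u x) * v x)).
 rewrite -IntZ; last exact: (wt_int Qo uL vL).1.
 apply: Int_ext => x; pos.
lra.
Qed.

Lemma dJ_bound a B M Q u U : pot_ok a B M -> wt_ok Q -> HD u U -> exists2 C, 0 <= C &
 forall v V, HD v V -> `|dJ a Q u U v V| <= C*gn V.
Proof.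
move=> ao Qo uU; have [uL UL _] := uU; have [_ aB _] := ao.
have [K K0 hK] := L2cut_bound M.
have B0 : 0 <= B := le_trans (normr_ge0 _) (aB 0).
exists (gn U+B*(n2 (cut M u)*K)+2*nq p u`^(p-1)*sob) => [|v V vV].
 pos.
have [vL VL _] := vV.
have h1 := ip_CS UL VL; have [_ h2] := pot_int ao uL vL; have [_ h3] := wt_int Qo uL vL.
rewrite (le_trans (ler_normB _ _))// [(_ + _ + _)*gn V]mulrDl [(_ + _)*gn V]mulrDl; apply: lerD.
 rewrite (le_trans (ler_normD _ _))// lerD// (le_trans h2)// -mulrA ler_wpM2l// -mulrA.
 by rewrite ler_wpM2l ?n2_ge0// hK.
rewrite (le_trans h3)// -[X in _ <= X]mulrA ler_wpM2l ?mulr_ge0 ?powR_ge0//; exact: HD_sobolev.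
Qed.

Lemma Jf_frechet a B M Q u U : pot_ok a B M -> wt_ok Q -> HD u U ->
 forall e, 0 < e -> exists2 d, 0 < d & forall v V, HD v V -> gn V <= d ->
 `|Jf a Q (fun x => u x+v x) (fun i x => U i x+V i x)-Jf a Q u U-dJ a Q u U v V| <= e*gn V.
Proof.
move=> ao Qo uU e e0; have [uL UL _] := uU; have [ma aB _] := ao; have [mQ Q1] := Qo.
have [K K0 hK] := L2cut_bound M.
have B0 : 0 <= B := le_trans (normr_ge0 _) (aB 0).
pose D := 2*nq p u`^(p-1)*sob.
(* The constants [e1], [d1] and [d2] make each of three errors at most [e/4] times the norm of the
   increment: the linear and the superlinear part of the nonlinear remainder, and the quadratic
   terms. *)
pose e1 := e/(4*(D+1)).
have e10 : 0 < e1 by pos.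
have [C C0 hC] := gp_increment p2 e10.
pose A := 1+B*K^+2.
have A0 : 0 < A by rewrite ltr_pwDl// mulr_ge0// sqr_ge0.
pose S := C*sob`^p+1.
have S0 : 0 < S by pos.
pose d1 := (e/(4*S))`^(p-1)^-1.
have d10 : 0 < d1 by pos.
pose d2 := e/(4*A).
have d20 : 0 < d2 by pos.
exists (Num.min d1 d2) => [|v V vV]; first by rewrite lt_min d10.
rewrite le_min => /andP[Vd1 Vd2]; have [vL VL _] := vV.
have uvL : Lq p (fun x => u x+v x) by apply: LqD => //.
have [ig_uv _] := pot_int ao uL vL; have [ig_uu _] := pot_int ao uL uL; have [ig_vv avv] := pot_int ao vL vL.
have [ig_g _] := wt_int Qo uL vL; have ig_u := wt_pow Qo uL; have ig_w := wt_pow Qo uvL.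
pose X := \int[mu]_x (Q x * `|u x+v x| `^ p)-\int[mu]_x (Q x * `|u x| `^ p)
  - p*\int[mu]_x (Q x*(gp p (u x) * v x)).
have -> : Jf a Q (fun x => u x+v x) (fun i x => U i x+V i x)-Jf a Q u U-dJ a Q u U v V =
  2^-1*(gn V^+2+\int[mu]_x (a x*(v x * v x)))-p^-1*X.
 have -> : \int[mu]_x (a x*(v x * v x)) = \int[mu]_x (a x*((u x+v x)*(u x+v x)))
   - \int[mu]_x (a x*(u x*u x))-2*\int[mu]_x (a x*(u x * v x)).
  have [ig_ww _] := pot_int ao uvL uvL.
  rewrite -IntB// -IntZ// -IntB; [|li|li].
  apply: Int_ext => x; pos.
 rewrite /Jf /dJ gn_sqD// /X; have l6 (y1 y2 y3 y4 y5 y6 x y z : R) :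
  2^-1*(y1+2*y2+y3+y4)-p^-1*x-(2^-1*(y1+y5)-p^-1*y)-(y2+y6-z) =
  2^-1*(y3+(y4-y5-2*y6))-p^-1*(x-y-p*z) by field; rewrite gt_eqF.
 li.
have mg : mes (fun x => `|gp p (u x+v x)-gp p (u x)| * `|v x|).
 have m1 := mes_gp uvL.1; have m2 := mes_gp uL.1; have m3 := vL.1.
 apply: measurable_funM; last mfun.
 mfun.
have X1 : `|p^-1*X| <= \int[mu]_x (`|gp p (u x+v x)-gp p (u x)| * `|v x|).
 have ib : ig (fun x => `|gp p (u x+v x)-gp p (u x)| * `|v x|).
  have [j1 _] := gp_int uvL vL; have [j2 _] := gp_int uL vL.
  apply: (ig_le mg (igD j1 j2)) => x; rewrite ger0_norm ?mulr_ge0// -mulrDl ler_wpM2r//.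
  by rewrite (le_trans (ler_normB _ _))// !gp_norm.
 rewrite /X -IntB// -IntZ// -IntB; [|li|li].
 rewrite -IntZ; last by apply: igB; [li|li].
 apply: Int_le_norm => //; first by apply: igZ; apply: igB; [li|li].
 move=> x; rewrite normrM normfV (gtr0_norm p0) ler_pdivrMl//.
 have := powR_convex_gap (u x) (u x+v x) p2; rewrite [u x+v x-u x]addrAC subrr add0r => h.
 have -> : Q x * `|u x+v x| `^ p-Q x * `|u x| `^ p-p*(Q x*(gp p (u x) * v x)) =
   Q x*(`|u x+v x| `^ p-`|u x| `^ p-p*(gp p (u x) * v x)) by ring.
 by rewrite normrM (le_trans _ h)// ler_piMl.
have X2 : \int[mu]_x (`|gp p (u x+v x)-gp p (u x)| * `|v x|) <=
  e1*(D*gn V)+C*(sob*gn V)`^p.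
 have [j2 j3] := gp_int uL vL.
 have ib : ig (fun x => e1*(`|u x| `^ (p-1) * `|v x|)+C * `|v x| `^ p).
  apply: igD; apply: igZ => //; li.
 have le x : `|gp p (u x+v x)-gp p (u x)| * `|v x| <=
   e1*(`|u x| `^ (p-1) * `|v x|)+C * `|v x| `^ p.
  apply: (le_trans (ler_wpM2r (normr_ge0 _) (hC (u x) (v x)))).
  rewrite mulrDl -!mulrA lerD2l -[X in _*(_*X)]powRr1//.
  by rewrite powRDn0// pp1.
 apply: (le_trans (Int_le (ig_le mg ib _) ib le)).
  by move=> x; rewrite ger0_norm.
 rewrite IntD; [|li|li].
 rewrite !IntZ//; last li.
 apply: lerD; rewrite ler_wpM2l ?(ltW e10)//.
  rewrite (le_trans j3)// -[X in _ <= X]mulrA ler_wpM2l ?mulr_ge0 ?powR_ge0//.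
  exact: HD_sobolev.
 exact: (HD_Ip_bound vV).
have X3 : e1*(D*gn V) <= e/4*gn V.
 rewrite mulrA ler_wpM2r ?gn_ge0//.
 have D10 : 0 < D+1 by pos.
 have -> : e1*D = e/4*(D/(D+1)) by rewrite /e1; field; rewrite gt_eqF.
 by rewrite ler_piMr ?divr_ge0 ?(ltW e0)// ler_pdivrMr// mul1r lerDl.
have X4 : C*(sob*gn V)`^p <= e/4*gn V.
 rewrite powRM ?sob_ge0 ?gn_ge0// -[p in gn V`^p]pp1 -powRDn0 ?gn_ge0// powRr1 ?gn_ge0//.
 rewrite !mulrA ler_wpM2r ?gn_ge0//.
 apply: (@le_trans _ _ (S*(e/(4*S)))).
  apply: ler_pM; rewrite ?mulr_ge0 ?powR_ge0//; first by rewrite lerDl.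
  have -> : e/(4*S) = d1`^(p-1).
   rewrite -powRrM mulVf ?gt_eqF// powRr1// divr_ge0 ?mulr_ge0 ?(ltW e0) ?(ltW S0)//.
  apply: ge0_ler_powR; pos.
 apply: eqle; field; lra.
have X5 : `|2^-1*(gn V^+2+\int[mu]_x (a x*(v x * v x)))| <= e/4*gn V.
 have h1 : `|\int[mu]_x (a x*(v x * v x))| <= B*(K*gn V)^+2.
  rewrite (le_trans avv)// ler_wpM2l// ler_pM ?n2_ge0// hK//.
 have h2 : A*gn V <= e/4.
  apply: (le_trans (ler_wpM2l (ltW A0) Vd2)).
  by apply: eqle; rewrite /d2; field; rewrite gt_eqF.
 have h3 : gn V^+2+B*(K*gn V)^+2 <= e/4*gn V.
  have -> : gn V^+2+B*(K*gn V)^+2 = A*gn V*gn V by rewrite /A; ring.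
  by rewrite ler_wpM2r ?gn_ge0.
 rewrite normrM ger0_norm ?invr_ge0//.
 have h4 := ler_normD (gn V^+2) (\int[mu]_x (a x*(v x * v x))).
 rewrite [`|gn V^+2|]ger0_norm ?sqr_ge0// in h4.
 have h5 : 0 <= gn V^+2 by pos.
 move: h1 h3 h4 h5 (normr_ge0 (gn V^+2+\int[mu]_x (a x*(v x * v x)))).
 set y := gn V^+2; set z := B*_; set t := e/4*gn V; lra.
rewrite (le_trans (ler_normB _ _))//.
have -> : e*gn V = e/4*gn V+(e/4*gn V+(e/4*gn V+e/4*gn V)) by pos.
rewrite lerD// (le_trans X1)// (le_trans X2)// lerD// (le_trans X4)// lerDl.
pos.
Qed.

Lemma gn0 : gn (fun (_ : 'I_N) (_ : E) => 0 : R) = 0.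
Proof.
rewrite /gn /ip big1 ?sqrtr0// => i _.
by under eq_Rintegral do rewrite mulr0; rewrite Int0.
Qed.

Lemma dual_0 (l : (E -> R) -> R) : D12_dual l -> l (fun=> 0) = 0.
Proof.
move=> [_ [C hC]]; have z0 := HD0.
by apply/eqP; rewrite -normr_le0; have := hC _ (HD_D12 z0); rewrite (D12_normE z0) gn0 mulr0.
Qed.

Lemma dual_Z (l : (E -> R) -> R) (c : R) v : D12_dual l -> D12 v -> l (fun x => c * v x) = c * l v.
Proof.
move=> lD vD; have [ll _] := lD; have z := HD_D12 (HD0).
have := ll c v (fun=> 0) vD z; rewrite (dual_0 lD) addr0 => <-.
congr l; apply/funext => x; pos.
Qed.

Lemma dual_norm_le (l : (E -> R) -> R) v : D12_dual l -> D12 v ->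
 `|l v| <= dual_norm l*D12_norm v.
Proof.
move=> lD vD; have vV := D12_HD vD; have [_ [C hC]] := lD.
have l0v := dual_0 lD; have z0 := HD0.
have hs : has_sup [set `|l v| | v in [set v | D12 v /\ D12_norm v <= 1]].
 split.
  exists 0; exists (fun=> 0); last by rewrite l0v normr0.
  by split=> /=; [exact: (HD_D12 z0)|rewrite (D12_normE z0) gn0].
 exists `|C| => _ [u [uD u1] <-].
 rewrite (le_trans (hC _ uD))// (le_trans (ler_wpM2r (sqrtr_ge0 _) (ler_norm C)))//.
 by rewrite ler_piMr.
have [n0|n0] := eqVneq (D12_norm v) 0.
 by rewrite n0 mulr0; have := hC _ vD; rewrite n0 mulr0.
have np : 0 < D12_norm v by rewrite lt_neqAle eq_sym n0 sqrtr_ge0.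
rewrite -ler_pdivrMr// mulrC -[X in X*_]ger0_norm ?invr_ge0 ?(ltW np)// -normrM -(dual_Z _ lD vD).
apply: sup_ubound; first exact: hs.2.
exists (fun x => (D12_norm v)^-1 * v x) => //.
have cv := HDZ (D12_norm v)^-1 vV.
split=> /=; first exact: (HD_D12 cv).
rewrite (D12_normE cv) gnZ; last by case: vV.
by rewrite -(D12_normE vV) ger0_norm ?invr_ge0 ?(ltW np)// mulVf.
Qed.

Lemma frechet_dJ a B M Q (F : (E -> R) -> R) u U : pot_ok a B M -> wt_ok Q ->
 (forall v V, HD v V -> F v = Jf a Q v V) -> HD u U ->
 is_frechet_derivative F u (fun v => dJ a Q u U v (fun i => weak_partial i v)).
Proof.
move=> ao Qo FJ uU; have e1 v V : HD v V ->
  dJ a Q u U v (fun i => weak_partial i v) = dJ a Q u U v V.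
 move=> vV; have vD := HD_D12 vV; have vW := D12_HD vD.
 congr (_ + _ - _); apply: eq_bigr => i _.
 have [_ UL _] := uU; have [_ WL _] := vW; have [_ VL _] := vV.
 have [mU _] := UL i; have [mW _] := WL i; have [mV _] := VL i.
 apply: Int_aeeq; try exact: measurable_funM.
 by apply: filterS (HD_unique vW vV i) => x h _; rewrite h.
split; first split.
- move=> c u' v' uD vD; have uH := D12_HD uD; have vH := D12_HD vD.
 have cu := HDZ c uH.
 rewrite (e1 _ _ (HDD cu vH)) (dJD ao Qo uU cu vH) (dJZ c ao Qo uU uH).
 lra.
- have [C C0 hC] := dJ_bound ao Qo uU; exists C => v vD.
 by have vV := D12_HD vD; rewrite (D12_normE vV) hC.
move=> e e0; have [d d0 hd] := Jf_frechet ao Qo uU e0; exists d => // v vD.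
have vV := D12_HD vD; rewrite (D12_normE vV) => vd.
have := hd _ _ vV vd; rewrite -(FJ _ _ uU).
by rewrite -(FJ _ _ (HDD uU vV)).
Qed.

(** Both derivatives are evaluated at a small multiple [t v]; the difference scales like [t], so its
    value at [v] is below every [e]. *)
Lemma frechet_unique (F : (E -> R) -> R) u l l' v V : is_frechet_derivative F u l ->
 is_frechet_derivative F u l' -> HD v V -> l v = l' v.
Proof.
move=> [lD lF] [lD' lF'] vV; have vD := HD_D12 vV.
apply/eqP; rewrite -subr_eq0 -normr_le0; apply/ler_addgt0Pr => e e0; rewrite add0r.
pose n := D12_norm v+1.
have n0 : 0 < n by pos.
pose e' := e/(2*n).
have e0' : 0 < e' by pos.
have [d d0 hd] := lF _ e0'; have [d' d0' hd'] := lF' _ e0'.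
pose t := Num.min d d'/n.
have m0 : 0 < Num.min d d' by rewrite lt_min d0.
have t0 : 0 < t by pos.
have tv := HDZ t vV; have tD := HD_D12 tv.
have nt : D12_norm (fun x => t * v x) = t*D12_norm v.
 by rewrite (D12_normE tv) gnZ ?(D12_normE vV) ?gtr0_norm; case: vV.
have tn : t*D12_norm v <= Num.min d d'.
 rewrite mulrAC ler_pdivrMr// ler_wpM2l ?(ltW m0)// lerDl//.
have := hd _ tD; have := hd' _ tD; rewrite nt.
move: tn; rewrite le_min => /andP[td td'] /(_ td') h' /(_ td) h.
rewrite (dual_Z _ lD vD) in h; rewrite (dual_Z _ lD' vD) in h'.
have : `|t*(l v-l' v)| <= t*e.
 have -> : t*(l v-l' v) = (F (u \+ (fun x => t * v x))-F u-t * l' v) -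
   (F (u \+ (fun x => t * v x))-F u-t * l v) by ring.
 rewrite (le_trans (ler_normB _ _))// (le_trans (lerD h' h))//.
 have -> : e'*(t*D12_norm v)+e'*(t*D12_norm v) = t*(e*(D12_norm v/n)).
  by rewrite /e'; field; rewrite gt_eqF.
 by rewrite ler_pM2l// ler_piMr ?(ltW e0)// ler_pdivrMr// mul1r lerDl.
by rewrite normrM (gtr0_norm t0) ler_pM2l.
Qed.

Lemma critical_dJ a B M Q (F : (E -> R) -> R) u U : pot_ok a B M -> wt_ok Q ->
 (forall v V, HD v V -> F v = Jf a Q v V) -> HD u U ->
 (forall v V, HD v V -> dJ a Q u U v V = 0) -> critical_point F u.
Proof.
move=> ao Qo FJ uU dJ0; split; first exact: HD_D12 uU.
have [h1 h2] := frechet_dJ ao Qo FJ uU; split.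
 split; first by move=> *; rewrite mulr0 addr0.
 by exists 0 => v _; rewrite normr0 mul0r.
move=> e e0; have [d d0 hd] := h2 _ e0; exists d => // v vD vd.
have := hd v vD vd; rewrite dJ0//; exact: D12_HD.
Qed.

(** * Splitting off a weak limit *)

Section splitting.

(** The derivative tends to 0 in the dual norm. The weight depends on [k], as it does after zooming
    by varying scales. *)
Definition PS a (Q_ : nat -> E -> R) (v_ : nat -> E -> R) (V_ : nat -> 'I_N -> E -> R) :=
 exists2 eta : nat -> R, eta k ~>0 k &
  forall k phi Phi, HD phi Phi -> `|dJ a (Q_ k) (v_ k) (V_ k) phi Phi| <= eta k*gn Phi.

Lemma PS_sub (s : nat -> nat) a (Q_ v_ : nat -> E -> R) (V_ : nat -> 'I_N -> E -> R) : {homo s : i j/(i < j)%N} ->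
 PS a Q_ v_ V_ -> PS a (Q_ \o s) (v_ \o s) (V_ \o s).
Proof.
move=> sh [eta e0 he]; exists (eta \o s); first exact: (cvg_sub sh e0).
by move=> k; mfun.
Qed.

Lemma cvg_eq (b c : nat -> R) (l : R) : (forall k, b k = c k) -> c k @[k --> \oo] --> l ->
 b k @[k --> \oo] --> l.
Proof. by move=> /funext ->. Qed.

Lemma cvg_ip (V_ : nat -> 'I_N -> E -> R) W Phi : L2N Phi ->
 (forall i f, L2 f -> \int[mu]_x (V_ k i x*f x) @[k --> \oo] --> \int[mu]_x (W i x*f x)) ->
 ip (V_ k) Phi @[k --> \oo] --> ip W Phi.
Proof.
move=> FL c; rewrite /ip; elim: (index_enum _) => [|i s IH].
 apply: (@cvg_eq _ (fun=> 0)) => [k|]; rewrite big_nil//; cv.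
apply: (cvg_eq (fun k => big_cons _ _ _ _ _ _)); rewrite big_cons.
cv.
Qed.

Lemma gp0 : gp p 0 = 0 :> R. Proof. by rewrite /gp mul0r. Qed.

Lemma cvg_bdd_mul (b z : nat -> R) : (forall k, `|b k| <= 1) -> z k ~>0 k ->
 b k*z k ~>0 k.
Proof.
move=> b1 z0; apply/norm_cvg0P.
apply: (@squeeze_cvgr _ _ _ _ (fun=> 0) (fun k => `|z k|)).
- by apply: nearW => k; rewrite normr_ge0/= normrM ler_piMl.
- cv.
- exact/norm_cvg0P.
Qed.

Variables (Q_ : nat -> E -> R) (v_ : nat -> E -> R) (V_ : nat -> 'I_N -> E -> R).
Variables (Qo w : E -> R) (W : 'I_N -> E -> R) (C : R).
Hypotheses (vV : forall k, HD (v_ k) (V_ k)) (VC : forall k, gn (V_ k) <= C).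
Hypotheses (wW : HD w W) (vw : wcvg v_ V_ w W).
Hypotheses (Qk : forall k, wt_ok (Q_ k)) (Qok : wt_ok Qo) (Qc : {ae mu, forall x, Q_ ^~ x @ \oo --> Qo x}).

Let z_ k x := v_ k x-w x.
Let Z_ k i x := V_ k i x-W i x.

Let zZ k : HD (z_ k) (Z_ k). Proof. exact: HDB. Qed.
Let zL k : Lq p (z_ k). Proof. by case: (zZ k). Qed.
Let vL k : Lq p (v_ k). Proof. by case: (vV k). Qed.
Let wL : Lq p w. Proof. by case: wW. Qed.
Let VL k : L2N (V_ k). Proof. by case: (vV k). Qed.
Let WL : L2N W. Proof. by case: wW. Qed.

Let ZC k : gn (Z_ k) <= C+gn W.
Proof. by rewrite (le_trans (gnB (VL k) WL))// lerD2r. Qed.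

Let zI k : \int[mu]_x `|z_ k x| `^ p <= (sob*(C+gn W))`^p.
Proof. exact: HD_Ip_bound (zZ k) (ZC k). Qed.

Let z0 : {ae mu, forall x, z_ ^~ x @ \oo --> (0 : R)}.
Proof.
have [c _ _] := vw; apply: filterS c => x c; rewrite /z_ -(subrr (w x)).
apply: cvgB => //; exact: cvg_cst.
Qed.

Lemma split_gn : gn (V_ k)^+2-gn (fun i x => V_ k i x-W i x)^+2 @[k --> \oo] --> gn W^+2.
Proof.
have [_ _ c] := vw.
have e1 k : gn (V_ k)^+2-gn (fun i x => V_ k i x-W i x)^+2 = 2*ip (V_ k) W-gn W^+2.
 rewrite gn_sqB//; pos.
apply: (cvg_eq e1); have e2 : 2*ip W W-gn W^+2 = gn W^+2 by rewrite gn_sq; ring.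
rewrite -[X in _ --> X]e2; apply: cvgB; last cv.
apply: cvgM; first cv.
exact: cvg_ip.
Qed.

(** Brezis-Lieb lemma with a weight that also converges: [vitali_young] is applied with the
    remainders [z_] as the sequence bounded in L^p. *)
Lemma split_pow :
 \int[mu]_x (Q_ k x * `|v_ k x| `^ p)-\int[mu]_x (Q_ k x * `|v_ k x-w x| `^ p)
  @[k --> \oo] --> \int[mu]_x (Qo x * `|w x| `^ p).
Proof.
pose X k x := Q_ k x * `|v_ k x| `^ p-Q_ k x * `|z_ k x| `^ p-Qo x * `|w x| `^ p.
have iX k : ig (X k).
 by apply: igB; [apply: igB|]; apply: wt_pow.
have mX k : mes (X k) := ig_mes (iX k).
have [||||Xi Xc] := @vitali_young _ _ R mu p ((sob*(C+gn W))`^p) X z_ mX.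
- by move=> k; have [] := zL k.
- li.
- have [c _ _] := vw; apply: filterS2 (filterI c z0) Qc => x [vx zx] Qx.
 rewrite -(subrr (Qo x * `|w x| `^ p)); apply: cvgB; last cv.
 rewrite -[X in _ --> X]subr0; apply: cvgB.
  apply: cvgM => //; exact: (cvg_fun (powR_norm_continuous p0) vx).
 apply: cvg_bdd_mul; first by move=> k; have [_] := Qk k.
 by have := cvg_fun (powR_norm_continuous p0) zx; rewrite normr0 powR0 ?gt_eqF.
- move=> e e0; have [D D0 hD] := powR_increment p0 e0.
 exists (fun x => (D+1) * `|w x| `^ p); first by apply: igZ; case: wL.
 move=> k x; have := hD (z_ k x) (w x); rewrite subrK => h.
 have [_ Q1] := Qk k; have [_ Q2] := Qok.
 have -> : X k x = Q_ k x*(`|v_ k x| `^ p-`|z_ k x| `^ p)-Qo x * `|w x| `^ p by rewrite /X; ring.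
 rewrite (le_trans (ler_normB _ _))// mulrDl mul1r addrA lerD//.
  by rewrite normrM (le_trans _ h)// ler_piMl.
 by rewrite normrM [`|_ `^ _|]ger0_norm ?powR_ge0// ler_piMl.
apply/subr_cvg0/norm_cvg0P; apply: (squeeze_cvgr _ (@cvg_cst _ (0 : R) _ \oo _) Xc).
apply: nearW => k; rewrite normr_ge0/=.
have a1 := wt_pow (Qk k) (vL k); have a2 := wt_pow (Qk k) (zL k); have a3 := wt_pow Qok wL.
rewrite -(IntB a1 a2) -(IntB (igB a1 a2) a3).
exact: (Int_norm_le (iX k)).
Qed.

Lemma weak_gp phi Phi : HD phi Phi ->
 \int[mu]_x (Q_ k x*(gp p (v_ k x-w x) * phi x)) ~>0 k.
Proof.
move=> fF; have [fL _ _] := fF.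
pose X k x := Q_ k x*(gp p (z_ k x) * phi x).
have iX k : ig (X k) by exact: (wt_int (Qk k) (zL k) fL).1.
have mX k : mes (X k) := ig_mes (iX k).
have [||||Xi Xc] := @vitali_young _ _ R mu p ((sob*(C+gn W))`^p) X z_ mX.
- by move=> k; have [] := zL k.
- li.
- apply: filterS z0 => x zx; apply: cvg_bdd_mul; first by move=> k; have [_] := Qk k.
 rewrite -[X in _ --> X](mul0r (phi x)); apply: cvgM; last cv.
 by have := cvg_fun (gp_continuous p2) zx; rewrite gp0.
- move=> e e0; have [D D0 hD] := young_eps p1 ltr01 e0; rewrite pp1 in hD.
 exists (fun x => D * `|phi x| `^ p); first by apply: igZ; case: fL.
 move=> k x; have [_ Q1] := Qk k; have := hD `|z_ k x| `|phi x|; rewrite !normr_ge0 => /(_ isT isT).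
 apply: le_trans; rewrite normrM [`|gp _ _*_|]normrM gp_norm// powRr1//.
 by rewrite ler_piMl ?powR_ge0.
apply/norm_cvg0P; apply: (squeeze_cvgr _ (@cvg_cst _ (0 : R) _ \oo _) Xc).
apply: nearW => k; rewrite normr_ge0/=; exact: (Int_norm_le (iX k)).
Qed.

(* The Brezis-Lieb splitting of the nonlinear term, in the dual of L^p. *)
Lemma split_gp : exists2 eta : nat -> R, eta k ~>0 k &
 forall k phi Phi, HD phi Phi ->
  `|\int[mu]_x (Q_ k x*(gp p (v_ k x) * phi x))-\int[mu]_x (Qo x*(gp p (w x) * phi x))
   - \int[mu]_x (Q_ k x*(gp p (v_ k x-w x) * phi x))| <= eta k*gn Phi.
Proof.
pose q := p/(p-1); have q0 : 0 < q by rewrite divr_gt0.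
have qp1 : (p-1)*q = p by rewrite /q mulrC divfK// gt_eqF.
pose Y k x := Q_ k x*gp p (v_ k x)-Qo x*gp p (w x)-Q_ k x*gp p (z_ k x).
have mY k : mes (Y k).
 have [mQ _] := Qk k; have [mQo _] := Qok.
 apply: measurable_funB; [apply: measurable_funB|]; apply: measurable_funM => //; apply: mes_gp; li.
have Yle e : 0 < e -> exists2 D, 0 <= D & forall k x,
  `|Y k x| <= e * `|z_ k x| `^ (p-1)+D * `|w x| `^ (p-1).
 move=> e0; have [D D0 hD] := gp_increment p2 e0.
 exists (D+1) => [|k x]; first pos.
 have := hD (z_ k x) (w x); rewrite subrK => h.
 have [_ Q1] := Qk k; have [_ Q2] := Qok.
 have -> : Y k x = Q_ k x*(gp p (v_ k x)-gp p (z_ k x))-Qo x*gp p (w x) by rewrite /Y; ring.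
 rewrite (le_trans (ler_normB _ _))// mulrDl mul1r addrA lerD//.
  by rewrite normrM (le_trans _ h)// ler_piMl.
 by rewrite normrM gp_norm// ler_piMl.
pose X k x := `|Y k x| `^ q.
have mX k : mes (X k) by mfun.
have Xle e : 0 < e -> exists2 D, 0 <= D & forall k x,
  X k x <= e * `|z_ k x| `^ p+D * `|w x| `^ p.
 move=> e0; have eq0 : 0 < e/2`^q by rewrite divr_gt0// powR_gt0.
 have [e1 e10 e1q] : exists2 e1 : R, 0 < e1 & e1`^q = e/2`^q.
  exists ((e/2`^q)`^q^-1); first pos.
  by rewrite -powRrM mulVf ?gt_eqF// powRr1// ltW.
 have [D D0 hD] := Yle _ e10; exists (2`^q*D`^q) => [|k x]; first pos.
 apply: (@le_trans _ _ (`|e1 * `|z_ k x| `^ (p-1)+D * `|w x| `^ (p-1)| `^ q)).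
  rewrite /X; apply: ge0_ler_powR; rewrite ?(ltW q0)//.
  by rewrite (le_trans (hD k x))// ler_norm.
 apply: (le_trans (powRD_le _ _ (ltW q0))).
 rewrite !normrM ![`|_ `^ _|]ger0_norm ?powR_ge0// (gtr0_norm e10) (ger0_norm D0).
 rewrite !powRM ?(ltW e10)// -!powRrM qp1 e1q mulrDr !mulrA lerD2r.
 by rewrite ler_wpM2r ?powR_ge0// mulrAC divff ?mul1r// powR_gt0.
have [||||Xi Xc] := @vitali_young _ _ R mu p ((sob*(C+gn W))`^p) X z_ mX.
- by move=> k; have [] := zL k.
- li.
- have [c _ _] := vw; apply: filterS2 (filterI c z0) Qc => x [vx zx] Qx.
 have Yx : Y k x ~>0 k.
  rewrite -[X in _ --> X]subr0; apply: cvgB; last first.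
   apply: cvg_bdd_mul; first by move=> k; have [_] := Qk k.
   by have := cvg_fun (gp_continuous p2) zx; rewrite gp0.
  rewrite -(subrr (Qo x*gp p (w x))); apply: cvgB; last cv.
  apply: cvgM => //; exact: (cvg_fun (gp_continuous p2) vx).
 by have := cvg_fun (powR_norm_continuous q0) Yx; rewrite normr0 powR0 ?gt_eqF.
- move=> e e0; have [D D0 hD] := Xle _ e0.
 exists (fun x => D * `|w x| `^ p); first by apply: igZ; case: wL.
 by move=> k x; rewrite ger0_norm ?powR_ge0.
(* The L^p function with [y^(p-1) = |Y|]; through it the Hölder bound [gp_int] applies to the
   pairing of [Y] with [phi], and the exponent [q] is conjugate to [p]. *)
pose y k x := `|Y k x| `^ (p-1)^-1.
have yE k x : y k x`^(p-1) = `|Y k x| by rewrite /y -powRrM mulVf ?gt_eqF// powRr1.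
have yp k x : `|y k x| `^ p = X k x.
 by rewrite ger0_norm ?powR_ge0// /X -powRrM /q mulrC.
have yL k : Lq p (y k).
 split; first by rewrite /y; mfun.
 by under eq_fun do rewrite yp.
exists (fun k => 2*(\int[mu]_x `|X k x|)`^(p^-1*(p-1))*sob).
 have e1 : 0 < p^-1*(p-1) by pos.
 rewrite -[X in _ --> X](mul0r sob); apply: cvgM; last cv.
 rewrite -[X in _ --> X](mulr0 2); apply: cvgM; first cv.
 have := cvg_fun (powR_norm_continuous e1) Xc; rewrite normr0 powR0 ?gt_eqF//.
 apply: cvg_trans; apply: near_eq_cvg; apply: nearW => k /=.
 by rewrite ger0_norm// Int_ge0.
move=> k phi Phi fF; have [fL _ _] := fF.
have [j1 _] := wt_int (Qk k) (vL k) fL; have [j2 _] := wt_int Qok wL fL.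
have [j3 _] := wt_int (Qk k) (zL k) fL.
rewrite -IntB// -IntB//; last li.
have [i1 i2] := gp_int (yL k) fL.
apply: (@le_trans _ _ (\int[mu]_x (`|y k x| `^ (p-1) * `|phi x|))).
 apply: Int_le_norm => //; first by apply: igB => //; exact: igB.
 move=> x; rewrite [`|y k x|]ger0_norm ?powR_ge0// yE -normrM; apply: eqle.
 congr `|_|; rewrite /Y; ring.
apply: (le_trans i2); have := HD_sobolev fF.
have -> : nq p (y k)`^(p-1) = (\int[mu]_x `|X k x|)`^(p^-1*(p-1)).
 have -> : \int[mu]_x `|X k x| = \int[mu]_x `|y k x| `^ p; last by rewrite powRrM.
 by apply: Int_ext => x; rewrite ger0_norm// powR_ge0.
move=> h; rewrite -[X in _ <= X]mulrA; apply: ler_wpM2l; last li.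
by rewrite mulr_ge0 ?powR_ge0.
Qed.

Variables (a : E -> R) (B M : R).
Hypothesis ao : pot_ok a B M.

Lemma split_pot : \int[mu]_x (a x*(v_ k x * v_ k x)) @[k --> \oo] --> \int[mu]_x (a x*(w x*w x)).
Proof.
have [ma aB aM] := ao; have B0 : 0 <= B := le_trans (normr_ge0 _) (aB 0).
have [_ c _] := vw; have [K K0 hK] := L2cut_bound M.
pose D := B*(2*(K*gn W)+K*(C+gn W)).
apply/subr_cvg0/norm_cvg0P.
apply: (@squeeze_cvgr _ _ _ _ (fun=> 0) (fun k => D*n2 (cut M (z_ k)))); last 2 first.
- cv.
- rewrite -[X in _ --> X](mulr0 D); apply: cvgM; cv.
apply: nearW => k; rewrite normr_ge0/=.
have [i1 _] := pot_int ao (vL k) (vL k); have [i2 _] := pot_int ao wL wL.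
have [i3 h3] := pot_int ao (zL k) wL; have [i4 h4] := pot_int ao (zL k) (zL k).
rewrite -IntB//.
have -> : \int[mu]_x (a x*(v_ k x * v_ k x)-a x*(w x*w x)) =
  2*\int[mu]_x (a x*(z_ k x*w x))+\int[mu]_x (a x*(z_ k x*z_ k x)).
 rewrite -IntZ// -IntD//; last li.
 apply: Int_ext => x; rewrite /z_; pos.
rewrite (le_trans (ler_normD _ _))// normrM ger0_norm//.
have k1 := hK _ _ wW; have k2 := le_trans (hK _ _ (zZ k)) (ler_wpM2l K0 (ZC k)).
have n0 := n2_ge0 mu (cut M (z_ k)).
have m1 : B*(n2 (cut M (z_ k))*n2 (cut M w)) <= B*(n2 (cut M (z_ k))*(K*gn W)).
 by rewrite ler_wpM2l// ler_wpM2l.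
have m2 : B*(n2 (cut M (z_ k))*n2 (cut M (z_ k))) <= B*(n2 (cut M (z_ k))*(K*(C+gn W))).
 by rewrite ler_wpM2l// ler_wpM2l.
have -> : D*n2 (cut M (z_ k)) = 2*(B*(n2 (cut M (z_ k))*(K*gn W))) +
  B*(n2 (cut M (z_ k))*(K*(C+gn W))) by rewrite /D; ring.
rewrite lerD//; first pos.
pos.
Qed.

Hypothesis vPS : PS a Q_ v_ V_.

Lemma split_dJ : exists2 eta : nat -> R, eta k ~>0 k &
 forall k phi Phi, HD phi Phi ->
  `|dJ a (Q_ k) (v_ k) (V_ k) phi Phi-dJ a Qo w W phi Phi-dJ (fun=> 0) (Q_ k) (z_ k) (Z_ k) phi Phi|
   <= eta k*gn Phi.
Proof.
have [ma aB aM] := ao; have B0 : 0 <= B := le_trans (normr_ge0 _) (aB 0).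
have [_ c _] := vw; have [K K0 hK] := L2cut_bound M.
have [eta e0 he] := split_gp.
exists (fun k => B*K*n2 (cut M (z_ k))+eta k).
 rewrite -[X in _ --> X]addr0; apply: cvgD => //.
 rewrite -[X in _ --> X](mulr0 (B*K)); apply: cvgM; cv.
move=> k phi Phi fF; have [fL FL _] := fF.
have [i1 h1] := pot_int ao (zL k) fL; have [i2 _] := pot_int ao (vL k) fL.
have [i3 _] := pot_int ao wL fL.
rewrite dJ_pot0 /dJ.
have -> : ip (V_ k) Phi = ip (Z_ k) Phi+ip W Phi by rewrite ipBl// subrK.
have e1 : \int[mu]_x (a x*(v_ k x * phi x)) =
  \int[mu]_x (a x*(w x * phi x))+\int[mu]_x (a x*(z_ k x * phi x)).
 rewrite -IntD//; apply: Int_ext => x; rewrite /z_; pos.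
rewrite e1; have := he k _ _ fF.
set A1 := \int[mu]_x (Q_ k x*_); set A2 := \int[mu]_x (Qo x*_); set A3 := \int[mu]_x (Q_ k x*_) => hA.
set I1 := \int[mu]_x (a x*(w x*_)); set I2 := \int[mu]_x (a x*(z_ k x*_)).
have -> : ip (Z_ k) Phi+ip W Phi+(I1+I2)-A1-(ip W Phi+I1-A2)-(ip (Z_ k) Phi-A3) = I2-(A1-A2-A3) by pos.
rewrite (le_trans (ler_normB _ _))// mulrDl lerD//.
rewrite (le_trans h1)// -!mulrA ler_wpM2l// [K*_]mulrCA ler_wpM2l ?n2_ge0// hK//.
Qed.

(** For fixed [phi], in the splitting of the derivative the whole tends to 0 by the Palais-Smale
    property and the part of the remainder tends to 0 weakly, so the constant part at [w] is 0. *)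
Lemma split_solution phi Phi : HD phi Phi -> dJ a Qo w W phi Phi = 0.
Proof.
move=> fF; have [eta e0 he] := split_dJ; have [eps ep0 hep] := vPS.
have [_ _ c] := vw; have [_ FL _] := fF.
have c1 : dJ (fun=> 0) (Q_ k) (z_ k) (Z_ k) phi Phi ~>0 k.
 have e1 : (fun k => dJ (fun=> 0) (Q_ k) (z_ k) (Z_ k) phi Phi) =
   fun k => ip (V_ k) Phi-ip W Phi-\int[mu]_x (Q_ k x*(gp p (v_ k x-w x) * phi x)).
  by apply/funext => k; rewrite dJ_pot0 ipBl.
 rewrite e1 -[X in _ --> X]subr0; apply: cvgB; last exact: weak_gp fF.
 rewrite -(subrr (ip W Phi)); apply: cvgB; last cv.
 exact: cvg_ip.
have c2 : (eta k+eps k)*gn Phi ~>0 k.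
 rewrite -[X in _ --> X](mul0r (gn Phi)); apply: cvgM; last cv.
 rewrite -[X in _ --> X]addr0; exact: cvgD.
apply/eqP; rewrite -normr_le0.
have c3 : `|dJ (fun=> 0) (Q_ k) (z_ k) (Z_ k) phi Phi|+(eta k+eps k)*gn Phi ~>0 k.
 rewrite -[X in _ --> X]addr0; apply: cvgD => //; exact/norm_cvg0P.
apply: (ler_cvg_to (@cvg_cst _ _ _ \oo _) c3); apply: nearW => k.
have := he k _ _ fF; have := hep k _ _ fF.
set x := dJ a Qo _ _ _ _; set y := dJ a (Q_ k) _ _ _ _; set t := dJ (fun=> 0) _ _ _ _ _ => h1 h2.
have -> : x = y-t-(y-x-t) by pos.
rewrite mulrDl (le_trans (ler_normB _ _))//.
clearbody x y t; have := ler_normB y t; move: h1 h2; lra.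
Qed.

(** Once [w] is known to be a solution, the splitting of the derivative, uniform in [phi], hands the
    Palais-Smale property over to the remainder; the potential is lost because the remainder
    vanishes locally in L^2. *)
Lemma split_PS : PS (fun=> 0) Q_ (fun k x => v_ k x-w x) (fun k i x => V_ k i x-W i x).
Proof.
have [eta e0 he] := split_dJ; have [eps ep0 hep] := vPS.
exists (fun k => eta k+eps k); first by rewrite -[X in _ --> X]addr0; exact: cvgD.
move=> k phi Phi fF; have := he k _ _ fF; have := hep k _ _ fF.
rewrite (split_solution fF) subr0.
set y := dJ a (Q_ k) _ _ _ _; rewrite -/(Z_ k); set t := dJ (fun=> 0) _ _ _ _ _ => h1 h2.
have -> : t = y-(y-t) by pos.
by rewrite mulrDl (le_trans (ler_normB _ _))// addrC lerD.
Qed.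

Lemma split_energy : Jf a (Q_ k) (v_ k) (V_ k) -
  Jf (fun=> 0) (Q_ k) (fun x => v_ k x-w x) (fun i x => V_ k i x-W i x)
 @[k --> \oo] --> Jf a Qo w W.
Proof.
have e1 k : Jf a (Q_ k) (v_ k) (V_ k) -
  Jf (fun=> 0) (Q_ k) (fun x => v_ k x-w x) (fun i x => V_ k i x-W i x) =
  2^-1*((gn (V_ k)^+2-gn (fun i x => V_ k i x-W i x)^+2)+\int[mu]_x (a x*(v_ k x * v_ k x)))
  - p^-1*(\int[mu]_x (Q_ k x * `|v_ k x| `^ p)-\int[mu]_x (Q_ k x * `|v_ k x-w x| `^ p)).
 rewrite Jf_pot0 /Jf; have l5 (x y y1 y2 y3 y4 y5 : R) :
  x*(y1+y2)-y*y3-(x*y4-y*y5) = x*((y1-y4)+y2)-y*(y3-y5) by ring.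
 li.
apply: (cvg_eq e1).
apply: cvgB; (apply: cvgM; first exact: cvg_cst); last exact: split_pow.
by apply: cvgD; [exact: split_gn|exact: split_pot].
Qed.

End splitting.

End energy.

Lemma cvg0_le (a b : nat -> R) : (forall k, `|a k| <= b k) -> b k ~>0 k ->
 a k ~>0 k.
Proof.
move=> ab b0; apply/norm_cvg0P; apply: (@squeeze_cvgr _ _ _ _ (fun=> 0) b) => //; last cv.
by near=> k; rewrite normr_ge0 ab.
Unshelve. all: by end_near. Qed.

Lemma n2_cvg0 (X : nat -> E -> R) : \int[mu]_x (X k x^+2) ~>0 k ->
 n2 (X k) ~>0 k.
Proof.
move=> h; have := cvg_fun (@sqrt_continuous R) h; by rewrite sqrtr0.
Qed.

(** * Integration by parts and translations along a direction *)

Lemma test_shift_cvg phi (h_ : nat -> E) : test_function phi -> h_ @ \oo --> (0 : E) ->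
 n2 (fun x => phi (x+h_ k)-phi x) ~>0 k.
Proof.
move=> tp h0; apply: n2_cvg0.
have [C C0 hC] := test_bounded tp; have [_ [M vM]] := (test_functionP phi).1 tp.
have [B hB] : exists B, forall k, `|h_ k| <= B.
 have [B [_ hB]] : bounded_fun h_ by apply: cvg_seq_bounded; apply/cvg_ex; exists 0.
 by exists (B+1) => k; apply: (hB (B+1)); [rewrite ltrDl|].
pose g (x : E) : R := (2*C)^+2*\1_(Bn (M+B+1)) x.
have mp := test_mes tp.
have mX k : mes (fun x => (phi (x+h_ k)-phi x)^+2).
 by apply: measurable_funX; apply: measurable_funB => //; apply: mes_shift.
have [|||||_ h _] := @DCT _ _ R mu (fun k x => (phi (x+h_ k)-phi x)^+2) (fun=> 0) g.
- mfun.
- li.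
- apply: aeW => x /=; rewrite (_ : 0 = (phi (x+0)-phi x)^+2); last by rewrite addr0 subrr expr0n.
 have c1 : phi (x+h_ k) @[k --> \oo] --> phi (x+0).
  apply: (cvg_comp (fun k => x+h_ k) phi); last exact: test_continuous.
  apply: cvgD => //; cv.
 apply: (cvg_fun (@exprn_continuous R 2)); apply: cvgB => //; exact: cvg_cst.
- apply: igZ; exact: ig_Bn.
- apply: aeW => x k /=; rewrite /g indicE; have [xB|xB] := boolP (x \in Bn (M+B+1)).
  rewrite mulr1 ger0_norm -real_normK ?num_real// lerXn2r ?nnegrE ?normr_ge0//.
   pos.
  by rewrite (le_trans (ler_normB _ _))// (_ : 2*C = C+C); [exact: lerD|ring].
 rewrite mulr0; move: xB; rewrite notin_setE /= => /negP; rewrite -leNgt => xB.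
 have B0 : 0 <= B := le_trans (normr_ge0 _) (hB 0%N).
 rewrite !vM ?subrr ?expr0n ?normr0//; first by rewrite (le_trans _ xB); lra.
 have := lerB_dist x (- h_ k); rewrite opprK normrN => q.
 apply: le_trans q; have := hB k; lra.
- by have := h; rewrite Int0.
Qed.

Lemma L2_shift_cvg f (h_ : nat -> E) : L2 f -> h_ @ \oo --> (0 : E) ->
 n2 (fun x => f (x+h_ k)-f x) ~>0 k.
Proof.
move=> fL h0; apply/cvgrPdist_le => e e0; have e4 : 0 < e/4 by rewrite divr_gt0.
have [phi tp fp] := test_dense fL e4.
have c := test_shift_cvg tp h0.
have pL := test_L2 tp.
near=> k; rewrite sub0r normrN ger0_norm ?n2_ge0//.
have hk : n2 (fun x => phi (x+h_ k)-phi x) <= e/4.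
 near: k; have /cvgrPdist_le/(_ _ e4) := c; apply: filterS => k.
 by rewrite sub0r normrN ger0_norm ?n2_ge0.
pose d x := f x-phi x; have dL : L2 d by exact: L2B.
have -> : (fun x => f (x+h_ k)-f x) = (fun x => d (x+h_ k)+((phi (x+h_ k)-phi x) + - d x)).
 apply/funext => x; rewrite /d; pos.
have sL : L2 (fun x => phi (x+h_ k)-phi x) by apply: L2B => //; exact: L2_shift.
have dsL : L2 (fun x => d (x+h_ k)) by li.
have dnL : L2 (fun x => - d x) by exact: L2opp.
apply: le_trans (n2D dsL (L2D sL dnL)) _.
have q := n2D sL dnL; rewrite n2N in q; have := n2_shift (h_ k) dL; move: fp q hk; rewrite -/d.
move: (n2 _) (n2 d) (n2 _) (n2 _) => a b c1 d1; lra.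
Unshelve. all: by end_near. Qed.

Lemma vanish_Lq (q : R) f (C M : R) : 0 <= C -> 0 < q -> mes f -> (forall x, `|f x| <= C) -> vanish_out M f -> Lq q f.
Proof.
move=> C0 q0 mf hC vM; split=> //.
apply: (@ig_bounded _ (C`^q) M); first mfun.
 by move=> x; rewrite ger0_norm ?powR_ge0// ge0_ler_powR ?normr_ge0// ltW.
by move=> x /vM ->; rewrite normr0 powR0// gt_eqF.
Qed.

Lemma HD_test phi : test_function phi -> HD phi (fun i => partial i phi).
Proof.
move=> tp; have [C C0 hC] := test_bounded tp; have [_ [M vM]] := (test_functionP phi).1 tp.
have mp := test_mes tp.
split=> [|i|i]; first exact: (vanish_Lq C0 _ mp hC vM).
 exact: test_L2 (test_partial i tp).
have tpi := test_partial i tp.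
apply: (@weak_partial_of_dq phi _ i (@hseq)); [exact: L2_loc (test_L2 tp)|exact: L2_loc (test_L2 tpi)|exact: hseq_neq0|cv|].
move=> psi tps; have [K [L [K0 hK hL]]] := test_taylor i tp.
have ps1 := test_ig tps; have ps2 := test_L2 tps.
apply: (@cvg_of_diff _ (fun=> \int[mu]_x (partial i phi x * psi x))); last cv.
have E1 k : \int[mu]_x (dq phi i (hseq k : R) x * psi x)-\int[mu]_x (partial i phi x * psi x) =
  \int[mu]_x ((hseq k : R)^-1*(taylor_rem phi i (hseq k : R) x) * psi x).
 rewrite -IntB; last exact: L2_mul (test_L2 tpi) ps2.
  apply: Int_ext => x; rewrite /dq /taylor_rem.
  have := @hseq_neq0 k; move: (hseq k : R) (phi _) (phi x) (partial _ _ _) (psi x) => h a b c d h0.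
  by field.
 apply: L2_mul => //; apply: L2Z; apply: L2B; [exact: L2_shift (test_L2 tp)|li].
apply: (cvg_eq E1).
apply: (@cvg0_le _ (fun k => K*\int[mu]_x `|psi x|*hseq k)); last first.
 rewrite [X in _ --> X](_ : 0 = K*\int[mu]_x `|psi x|*0); last pos.
 apply: cvgM; cv.
move=> k; rewrite mulrAC -IntZ; last li.
have h1 : 0 < hseq k :> R by rewrite invr_gt0 ltr0n.
apply: Int_le_norm.
- apply: L2_mul => //; apply: L2Z; apply: L2B.
  by apply: L2B; [exact: L2_shift (test_L2 tp)|li].
 li.
- li.
- move=> x; rewrite normrM ler_wpM2r// normrM ger0_norm; last by rewrite invr_ge0 ltW.
 have := hK (hseq k : R) x; move: (taylor_rem _ _ _ _) h1; move: (hseq k : R) => h t h1 q.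
 rewrite mulrC ler_pdivrMr//; apply: le_trans q _; pos.
Qed.

(** Summation by parts for difference quotients, passed to the limit. Since [u] need only be in L^p,
    the L^2 function [u'] that agrees with it near the support of [v] takes its place in the
    pairings. *)
Lemma IBP u u' v U V i : HD u U -> HD v V -> L2 v -> L2 u' ->
 (forall x h, `|h| <= 1 -> u x * v (x+h*:ebasis i) = u' x * v (x+h*:ebasis i)) ->
 (forall x, u x*V i x = u' x*V i x) ->
 \int[mu]_x (U i x * v x) = - \int[mu]_x (u x*V i x).
Proof.
move=> uU vV vL uL huv huV.
pose h_ k : R := hseq k; have h0 k : h_ k != 0 by exact: hseq_neq0.
have h1 k : `|- h_ k| <= 1 by rewrite normrN ger0_norm ?invr_ge0 ?ler0n// invf_le1 ?ler1n ?ltr0n.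
have hc : h_ @ \oo --> (0 : R) by cv.
have nh0 k : - h_ k != 0 by rewrite oppr_eq0.
have nhc : (fun k => - h_ k) @ \oo --> (0 : R) by rewrite -[X in _ --> X]oppr0; exact: cvgN.
have [_ UL _] := uU; have [_ VL _] := vV.
have dL k : L2 (dq u i (h_ k)) by have [] := HD_dq_L2 i uU (h0 k).
have dvL k : L2 (dq v i (- h_ k)) by have [] := HD_dq_L2 i vV (nh0 k).
have c1 : \int[mu]_x (dq u i (h_ k) x * v x) @[k --> \oo] --> \int[mu]_x (U i x * v x).
 apply: cvg_Int_mul => //; exact: HD_dq_cvg.
have c2 : \int[mu]_x (dq v i (- h_ k) x*u' x) @[k --> \oo] --> \int[mu]_x (V i x*u' x).
 apply: cvg_Int_mul => //; exact: HD_dq_cvg.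
have E1 k : \int[mu]_x (dq u i (h_ k) x * v x) = - \int[mu]_x (dq v i (- h_ k) x*u' x).
 set h := h_ k; pose e : E := ebasis i.
 have i0 : ig (fun x => u x * v x).
  rewrite (_ : (fun x => u x * v x) = fun x => u' x * v x); first li.
  apply/funext => x; have := huv x 0; rewrite scale0r addr0 normr0; pos.
 have i1 : ig (fun x => u x * v (x+(- h)*:e)).
  rewrite (_ : (fun x => _) = fun x => u' x * v (x+(- h)*:e)).
   apply: L2_mul => //; li.
  by apply/funext => x; apply: huv; mfun.
 have i2 := ig_shift (h*:e) i1.
 have e2 := Int_shift (h*:e) i1.
 have K x : x+h*:e + - h*:e = x by rewrite scaleNr addrK.
 have -> : \int[mu]_x (dq u i h x * v x) = h^-1*(\int[mu]_x (u x * v (x+(- h)*:e))-\int[mu]_x (u x * v x)).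
  rewrite -e2 -IntB// -IntZ; last li.
  apply: Int_ext => x; rewrite K /dq; pos.
 rewrite -IntB// -IntZ; last li.
 rewrite -(IntN (L2_mul (dvL k) uL)).
 apply: Int_ext => x; rewrite huv ?h1//.
 have -> : u x * v x = u' x * v x by have := huv x 0; rewrite scale0r addr0 normr0; apply.
 rewrite /dq -/e; rewrite invrN; ring.
have c3 : \int[mu]_x (dq u i (h_ k) x * v x) @[k --> \oo] --> - \int[mu]_x (V i x*u' x).
 apply: (cvg_eq E1); exact: cvgN.
have := cvg_unique _ c1 c3 => -> //; congr (- _).
by apply: Int_ext => x; rewrite mulrC.
Qed.

Lemma IBP_L2 u v U V i : HD u U -> HD v V -> L2 u -> L2 v ->
 \int[mu]_x (U i x * v x) = - \int[mu]_x (u x*V i x).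
Proof. move=> uU vV uL vL; exact: (@IBP u u). Qed.

Lemma IBP_vanish u v U V i M : HD u U -> HD v V -> L2 v -> vanish_out M v -> vanish_out M (V i) ->
 \int[mu]_x (U i x * v x) = - \int[mu]_x (u x*V i x).
Proof.
move=> uU vV vL vM VM; have [uL _ _] := uU.
(* The margin 1 leaves room for the shifts by [|h| <= 1] of the support of [v]. *)
apply: (@IBP u (cut (M+1) u)) => //; first exact: Lp_L2cut.
- move=> x h h1; rewrite cutE; case: ltP => // xM; rewrite vM ?mulr0//.
 have := lerB_dist x (- (h*:(ebasis i : E))); rewrite opprK normrN => q.
 apply: le_trans q; have := norm_hbasis h i; lra.
- move=> x; rewrite cutE; case: ltP => // xM; rewrite VM; move: xM; lra.
Qed.

(** The Euclidean scalar product, while the norm of row vectors is the sup norm; hyperplanes are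
    described by a normal with [lin nu nu = 1]. *)
Definition lin (nu x : E) : R := \sum_i nu ord0 i*x ord0 i.

Lemma linD nu x y : lin nu (x+y) = lin nu x+lin nu y.
Proof. by rewrite -big_split; apply: eq_bigr => i _; rewrite mxE mulrDr. Qed.

Lemma linZ nu (c : R) x : lin nu (c*:x) = c * lin nu x.
Proof. by rewrite mulr_sumr; apply: eq_bigr => i _; rewrite mxE mulrCA. Qed.

Lemma lin_ebasis nu i : lin nu (ebasis i) = nu ord0 i.
Proof.
rewrite /lin (bigD1 i)//= big1 ?addr0; first by rewrite mxE !eqxx mulr1.
by move=> j ji; rewrite mxE (negPf ji) mulr0.
Qed.

Lemma lin_mes nu : mes (lin nu).
Proof.
apply: measurable_sum => i; apply: measurable_funM => //.
exact: (@measurable_coord R N i).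
Qed.

Definition ddir (nu : E) G : E -> R := fun x => \sum_i nu ord0 i*G i x.

Lemma ddir_L2 nu G : L2N G -> L2 (ddir nu G).
Proof. move=> GL; apply: L2_sum => i; li. Qed.
#[local] Hint Resolve ddir_L2 : li.

(** Induction on the coordinates of [nu]: the increment along one more coordinate is taken at a
    translated point, and continuity of translations in L^2 brings it back. *)
Lemma HD_ddq_cvg u U nu (t_ : nat -> R) : HD u U -> (forall k, t_ k != 0) -> t_ @ \oo --> (0 : R) ->
 n2 (fun x => (t_ k)^-1*(u (x+t_ k*:nu)-u x)-ddir nu U x) ~>0 k.
Proof.
move=> uU t0 tc; have [uL UL _] := uU; have [mu' _] := uL.
pose part (s : seq 'I_N) : E := \sum_(i <- s) nu ord0 i*:ebasis i.
have main (s : seq 'I_N) : (forall k, L2 (fun x => u (x+t_ k*:part s)-u x)) /\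
  n2 (fun x => (t_ k)^-1*(u (x+t_ k*:part s)-u x)-\sum_(i <- s) nu ord0 i*U i x) ~>0 k.
 elim: s => [|i s [IL IH]].
  have zero k : (fun x => u (x+t_ k*:part [::])-u x) = fun=> 0.
   by apply/funext => x; rewrite /part big_nil scaler0 addr0 subrr.
  split=> [k|]; first by rewrite zero; exact: L2_0.
  apply: (@cvg_eq _ (fun=> 0)); last cv.
  move=> k; rewrite (_ : (fun x => _) = fun=> 0); last first.
   by apply/funext => x; rewrite /part !big_nil scaler0 addr0 !subrr mulr0 subr0.
  by rewrite /n2 expr0n Int0 sqrtr0.
 set a := part s; set c := nu ord0 i.
 pose D k x := u (x+(t_ k*c)*:ebasis i)-u x.
 have DL k : L2 (D k) by have [] := HD_shift_L2 i (t_ k*c) uU.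
 have DsL k : L2 (fun x => D k (x+t_ k*:a)) by li.
 have split_ k x : u (x+t_ k*:part (i :: s))-u x = D k (x+t_ k*:a)+(u (x+t_ k*:a)-u x).
  rewrite /D /part big_cons -/c scalerDr scalerA addrA [x + _ + _]addrAC; ring.
 have LL k : L2 (fun x => u (x+t_ k*:part (i :: s))-u x).
  rewrite (_ : (fun x => _) = fun x => D k (x+t_ k*:a)+(u (x+t_ k*:a)-u x)).
   li.
  by apply/funext => x.
 split=> //.
 have cs : n2 (fun x => (U i (x+t_ k*:a)-U i x)) ~>0 k.
  apply: L2_shift_cvg => //; rewrite -[X in _ --> X](scale0r a); apply: cvgZr_tmp => //.
 have cD : n2 (fun x => (t_ k)^-1*D k x-c*U i x) ~>0 k.
  have [c0|c0] := eqVneq c 0.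
   apply: (@cvg_eq _ (fun=> 0)); last cv.
   move=> k; rewrite (_ : (fun x => _) = fun=> 0); last first.
    by apply/funext => x; rewrite /D c0 mulr0 scale0r addr0 subrr mulr0 mul0r subr0.
   by rewrite /n2 expr0n Int0 sqrtr0.
  have tc0 k : t_ k*c != 0 by rewrite mulf_neq0.
  have tcc : (fun k => t_ k*c) @ \oo --> (0 : R).
   rewrite -[X in _ --> X](mul0r c); apply: cvgM => //; cv.
  have q := HD_dq_cvg i uU tc0 tcc.
  apply: (@cvg_eq _ (fun k => `|c|*n2 (fun x => dq u i (t_ k*c) x-U i x))).
   move=> k; rewrite -n2Z; last by apply: L2B => //; have [] := HD_dq_L2 i uU (tc0 k).
   congr n2; apply/funext => x; rewrite /D /dq; have := t0 k.
   by move: c0 (u _) (u x) (U i x) => c0 b1 b2 b3 tk; field; rewrite c0.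
  rewrite -[X in _ --> X](mulr0 `|c|); apply: cvgM => //; cv.
 apply: (@cvg0_le _ (fun k => n2 (fun x => (t_ k)^-1*D k x-c*U i x) +
   (`|c|*n2 (fun x => (U i (x+t_ k*:a)-U i x)) +
   n2 (fun x => (t_ k)^-1*(u (x+t_ k*:a)-u x)-\sum_(i <- s) nu ord0 i*U i x)))).
  move=> k; rewrite ger0_norm ?n2_ge0//.
  have L1 : L2 (fun x => (t_ k)^-1*D k x-c*U i x) by apply: L2B; apply: L2Z.
  have L1s : L2 (fun x => (t_ k)^-1*D k (x+t_ k*:a)-c*U i (x+t_ k*:a)).
   exact: (L2_shift (t_ k*:a) L1).
  have L2' : L2 (fun x => U i (x+t_ k*:a)-U i x) by apply: L2B => //; exact: L2_shift.
  have L3 : L2 (fun x => (t_ k)^-1*(u (x+t_ k*:a)-u x)-\sum_(i <- s) nu ord0 i*U i x).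
   by apply: L2B; [exact: L2Z|apply: L2_sum => j; exact: L2Z].
  rewrite -(n2_shift (t_ k*:a) L1) -(n2Z c L2').
  apply: le_trans (lerD (lexx _) (n2D (L2Z c L2') L3)).
  apply: le_trans (n2D L1s (L2D (L2Z c L2') L3)).
  apply: eqle; congr n2; apply/funext => x.
  rewrite split_ big_cons -/c; pos.
 rewrite [X in _ --> X](_ : 0 = 0+(`|c|*0+0)); last pos.
 apply: cvgD => //.
 apply: cvgD => //.
 apply: cvgM; cv.
have [_] := main (index_enum 'I_N).
have -> : part (index_enum 'I_N) = nu.
 apply/rowP => j; rewrite summxE (bigD1 j)//= big1; last first.
  by move=> k kj; rewrite !mxE eqxx eq_sym (negPf kj) mulr0.
 by rewrite !mxE !eqxx mulr1 addr0.
cv.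
Qed.

(** The increment is the sum of [k+1] translated copies of the increment over [t/(k+1)], all of the
    same norm; let [k] grow. With the directional derivative alone and constant 1, it serves as a
    Poincaré inequality on strips. *)
Lemma HD_ddir_shift u U nu (t : R) : HD u U -> n2 (fun x => u (x+t*:nu)-u x) <= `|t|*n2 (ddir nu U).
Proof.
move=> uU; have [uL UL _] := uU.
have [->|t0] := eqVneq t 0.
 rewrite (_ : (fun x => _) = fun=> 0); last by apply/funext => x; rewrite scale0r addr0 subrr.
 by rewrite /n2 expr0n /= Int0 sqrtr0 normr0.
pose t_ k : R := t*hseq k.
have tn0 k : t_ k != 0 by rewrite mulf_neq0 ?hseq_neq0.
have tc : t_ @ \oo --> (0 : R) by rewrite -[X in _ --> X](mulr0 t); apply: cvgM; cv.
have c := HD_ddq_cvg nu uU tn0 tc.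
have DL k : L2 (fun x => u (x+t_ k*:nu)-u x) by have [] := HD_shiftv (t_ k*:nu) uU.
have dL := ddir_L2 nu UL.
have key k : n2 (fun x => u (x+t*:nu)-u x) <=
  `|t|*(n2 (fun x => (t_ k)^-1*(u (x+t_ k*:nu)-u x)-ddir nu U x)+n2 (ddir nu U)).
 have tele x m : u (x+(m%:R*t_ k)*:nu)-u x =
   \sum_(j <- iota 0 m) (u (x+(j%:R*t_ k)*:nu+t_ k*:nu)-u (x+(j%:R*t_ k)*:nu)).
  elim: m => [|m IH]; first by rewrite big_nil mul0r scale0r addr0 subrr.
  have -> : iota 0 m.+1 = iota 0 m ++ [:: m] by rewrite -[X in iota _ X]addn1 iotaD.
  have -> : m.+1%:R*t_ k = m%:R*t_ k+t_ k by pos.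
  rewrite big_cat /= -IH big_seq1 scalerDl addrA.
  lra.
 have tE : t = k.+1%:R*t_ k by rewrite /t_ /hseq mulrCA mulfV ?mulr1// pnatr_eq0.
 rewrite {1}tE (_ : (fun x => _) = fun x => \sum_(j <- iota 0 k.+1) (u (x+(j%:R*t_ k)*:nu+t_ k*:nu)-u (x+(j%:R*t_ k)*:nu))); last first.
  by apply/funext => x.
 have SL j : L2 (fun x => u (x+(j%:R*t_ k)*:nu+t_ k*:nu)-u (x+(j%:R*t_ k)*:nu)).
  exact: (L2_shift ((j%:R*t_ k)*:nu) (DL k)).
 apply: le_trans (n2_sum _ SL) _.
 have -> : \sum_(j <- iota 0 k.+1) n2 (fun x => u (x+(j%:R*t_ k)*:nu+t_ k*:nu)-u (x+(j%:R*t_ k)*:nu))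
   = k.+1%:R*n2 (fun x => u (x+t_ k*:nu)-u x).
  rewrite (eq_bigr (fun=> n2 (fun x => u (x+t_ k*:nu)-u x))); last first.
   by move=> j _; rewrite -(n2_shift ((j%:R*t_ k)*:nu) (DL k)).
  by rewrite big_const_seq count_predT size_iota iter_addr_0 mulr_natl.
 have -> : (fun x => u (x+t_ k*:nu)-u x) = (fun x => t_ k*(((t_ k)^-1*(u (x+t_ k*:nu)-u x)-ddir nu U x)+ddir nu U x)).
  by apply/funext => x; have := tn0 k; move: (t_ k) (u _) (u x) (ddir nu U x) => y b1 b2 b3 y0; field.
 have L1 : L2 (fun x => (t_ k)^-1*(u (x+t_ k*:nu)-u x)-ddir nu U x) by apply: L2B => //; exact: L2Z.
 rewrite n2Z; last li.
 rewrite mulrA -{1}[k.+1%:R]ger0_norm// -normrM -tE.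
 apply: ler_wpM2l => //.
 exact: n2D.
have lim : `|t|*(n2 (fun x => (t_ k)^-1*(u (x+t_ k*:nu)-u x)-ddir nu U x)+n2 (ddir nu U)) @[k --> \oo]
  --> `|t|*(0+n2 (ddir nu U)).
 apply: cvgM; cv.
rewrite add0r in lim; rewrite -(cvg_lim _ lim)//.
by apply: limr_ge; [apply/cvg_ex; eexists; exact: lim|near=> k; exact: key].
Unshelve. all: by end_near. Qed.

Lemma nq_powR2 u : nq p u`^2 = nq p u^+2.
Proof. by rewrite -powR_mulrn ?nq_ge0. Qed.

Lemma powR2 (t : R) : `|t| `^ 2 = t^+2.
Proof. by rewrite -[`|t| `^ 2]/(`|t| `^ 2%:R) powR_mulrn// real_normK ?num_real. Qed.

Lemma powR_p2 (t : R) : `|t| `^ (p-2)*t^+2 = `|t| `^ p.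
Proof. by have pp : 0 < p-2 by [move: p2; lra]; rewrite -(powR2 t) powRDn0// subrK. Qed.

(** The absorption inequality: a factor [h] that is small in L^p makes this integral a small
    fraction of the squared gradient norm. *)
Lemma holder_sobolev h v V : Lq p h -> HD v V -> ig (fun x => `|h x| `^ (p-2) * v x^+2) /\
 \int[mu]_x (`|h x| `^ (p-2) * v x^+2) <= 2*nq p h`^(p-2)*(sob^+2*gn V^+2).
Proof.
move=> hL vV; have [vL _ _] := vV; have a0 : 0 < p-2 by move: p2; lra.
have := @holder_nq _ _ R mu (p-2) 2 h v a0 (ltr0n _ 2).
have := @Lq_mul _ _ R mu (p-2) 2 h v (ltW a0) (ler0n _ 2).
have ee : p-2+2 = p by lra.
have -> : (fun x => `|h x| `^ (p-2) * v x^+2) = fun x => `|h x| `^ (p-2) * `|v x| `^ 2.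
 by apply/funext => x; rewrite powR2.
rewrite ee => /(_ hL vL) i /(_ hL vL) q; split=> //.
have q2 : nq p v`^2 <= sob^+2*gn V^+2.
 by rewrite nq_powR2 -exprMn lerXn2r ?nnegrE ?nq_ge0//; [pos|exact: HD_sobolev].
by apply: (le_trans q); apply: ler_wpM2l q2; apply: mulr_ge0 (powR_ge0 _ _).
Qed.

(** * Multiplication by functions of one direction and sharp cuts along a hyperplane *)

Section half_space_cut.
Variable nu : E.
Hypothesis nu1 : lin nu nu = 1.
Local Notation l := (lin nu).

Lemma nu_le i : `|nu ord0 i| <= 1.
Proof.
rewrite -(@expr_le1 _ 2)// real_normK; move: nu1; rewrite /lin (bigD1 i)//= => <-.
rewrite expr2 lerDl; apply: sumr_ge0 => j _; pos.
Qed.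

Lemma nu_norm : `|nu| <= 1.
Proof. apply: norm_le_coord => // j; exact: nu_le. Qed.

Lemma lin_shift x t : l (x+t*:nu) = l x+t.
Proof. by rewrite linD linZ nu1 mulr1. Qed.

Lemma lin_eb x i h : l (x+h*:ebasis i) = l x+h*nu ord0 i.
Proof. by rewrite linD linZ lin_ebasis. Qed.

Lemma mult_lin (f f1 f2 f3 : R -> R) : D3 f f1 f2 f3 -> exists2 K, 0 <= K & forall c,
 mult_ok K (fun x => f (l x-c)) (fun i x => nu ord0 i*f1 (l x-c)) /\
 mult_ok K (fun x => f1 (l x-c)) (fun i x => nu ord0 i*f2 (l x-c)).
Proof.
move=> fD; have [K K0 [k0 k1 k2 q0 q1]] := D3_quad fD; have [m0 m1 m2] := D3_mes fD.
have ml c : mes (fun x => l x-c) by apply: measurable_funB; [exact: lin_mes|li].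
have mc c (g : R -> R) : measurable_fun setT g -> mes (fun x => g (l x-c)).
 move=> mg; exact: (measurableT_comp mg (ml c)).
have nuM i (a : R) : `|a| <= K -> `|nu ord0 i*a| <= K.
 by move=> aK; rewrite normrM -[K]mul1r ler_pM// nu_le.
have sqM i (h : R) : K*(h*nu ord0 i)^+2 <= K*h^+2.
 rewrite ler_wpM2l// exprMn ler_piMr ?sqr_ge0// -real_normK ?num_real//.
 by rewrite expr_le1// nu_le.
exists K => // c; split; split=> // [|i|i x|i x h]; rewrite ?lin_eb.
- mfun.
- mfun.
- mfun.
- apply: le_trans (sqM i h); rewrite [l x + _ - _]addrAC [h*(_*_)]mulrA [h*_*_]mulrC; exact: q0.
- mfun.
- mfun.
- mfun.
- apply: le_trans (sqM i h); rewrite [l x + _ - _]addrAC [h*(_*_)]mulrA [h*_*_]mulrC; exact: q1.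
Qed.

Lemma D3_comp_mes (f f1 f2 f3 : R -> R) c : D3 f f1 f2 f3 ->
 [/\ mes (fun x => f (l x-c)), mes (fun x => f1 (l x-c)) & mes (fun x => f2 (l x-c))].
Proof.
move=> fD; have [m0 m1 m2] := D3_mes fD.
have ml : mes (fun x => l x-c) by apply: measurable_funB; [exact: lin_mes|li].
by split; [exact: (measurableT_comp m0 ml)|exact: (measurableT_comp m1 ml)|exact: (measurableT_comp m2 ml)].
Qed.

Definition sig (c d : R) : E -> R := \1_[set x | c <= l x < d].
Definition hf (c : R) : E -> R := \1_[set x | l x < c].

Lemma sigE c d x : sig c d x = (c <= l x < d)%R%:R.
Proof. by rewrite /sig; congr ((nat_of_bool _)%:R); apply/idP/idP; rewrite inE. Qed.

Lemma hfE c x : hf c x = (l x < c)%R%:R.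
Proof. by rewrite /hf; congr ((nat_of_bool _)%:R); apply/idP/idP; rewrite inE. Qed.

Lemma mes_hf c : mes (hf c).
Proof.
apply: measurable_indic; rewrite -[X in measurable X]setTI.
exact: (measurable_fun_ltr (lin_mes nu) (measurable_cst c) measurableT (Y := [set true])).
Qed.

Lemma sig_hf c d x : c <= d -> sig c d x = hf d x-hf c x.
Proof.
move=> cd; rewrite sigE !hfE; have [h1|h1] := leP c (l x); rewrite /= ?subr0//.
by rewrite (lt_le_trans h1 cd) subrr.
Qed.

Lemma mes_sig c d : mes (sig c d).
Proof.
have [cd|dc] := leP c d.
 rewrite (_ : sig c d = fun x => hf d x-hf c x); last by apply/funext => x; exact: sig_hf.
 apply: measurable_funB; exact: mes_hf.
rewrite (_ : sig c d = fun=> 0)//.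
apply/funext => x; rewrite sigE; have [h1|h1] := leP c (l x); rewrite //=.
by have -> : (l x < d) = false by apply/negbTE; rewrite -leNgt; apply: le_trans h1; pos.
Qed.
#[local] Hint Resolve mes_sig mes_hf : mes.

Lemma sig01 c d x : `|sig c d x| <= 1.
Proof. by rewrite sigE; case: (_ && _); rewrite ?normr1 ?normr0. Qed.

Lemma hf01 c x : `|hf c x| <= 1.
Proof. by rewrite hfE; case: (_ < _); rewrite ?normr1 ?normr0. Qed.

(** The translates of the strip by the first [n+1] multiples of [hseq n] along [nu] are disjoint
    and, as [|nu| <= 1], carry the ball of radius [M] into that of radius [M + 1]. *)
Lemma strip_int c M n : 0 < M ->
 n.+1%:R*\int[mu]_x (sig (c-hseq n) c x*\1_(Bn M) x) <= (2*(M+1))^+N.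
Proof.
move=> M0; set h : R := hseq n; have h0 : 0 < h by rewrite invr_gt0 ltr0n.
have hn : n.+1%:R*h = 1 by rewrite /h /hseq mulfV// pnatr_eq0.
pose f x : R := sig (c-h) c x*\1_(Bn M) x.
have fi : ig f.
 apply: ig_le (ig_Bn M) _; first by apply: measurable_funM; [mfun|exact: ig_mes (ig_Bn M)].
 move=> x; rewrite normrM -[X in _ <= X]mul1r; apply: ler_pM => //; first exact: sig01.
 by rewrite ger0_norm.
have fsi (j : nat) : ig (fun x => f (x+(j%:R*h)*:nu)) by exact: ig_shift.
have key x m : m%:R*h <= 1 -> \sum_(j <- iota 0 m) f (x+(j%:R*h)*:nu) <= sig (c-m%:R*h) c x*\1_(Bn (M+1)) x.
 elim: m => [|m IH] mh.
  rewrite big_nil; pos.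
 have mE : m.+1%:R*h = m%:R*h+h by pos.
 have mh' : m%:R*h <= 1 by pos.
 have mh0 : 0 <= m%:R*h by pos.
 have -> : iota 0 m.+1 = iota 0 m ++ [:: m] by rewrite -[X in iota _ X]addn1 iotaD.
 rewrite big_cat /= big_seq1.
 have q : f (x+(m%:R*h)*:nu) <= sig (c-m%:R*h-h) (c-m%:R*h) x*\1_(Bn (M+1)) x.
  rewrite /f !sigE lin_shift.
  have -> : (c-h <= l x+m%:R*h < c) = (c-m%:R*h-h <= l x < c-m%:R*h) by pos.
  rewrite ler_wpM2l// !indicE; have [xB|] := boolP (_ \in Bn M) => //.
  suff -> : x \in Bn (M+1) by [].
  move: xB; rewrite !inE /Bn /= => xB.
  have := lerB_dist x (- ((m%:R*h)*:nu)); rewrite opprK normrN normrZ (ger0_norm mh0) => q.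
  have := ler_pM mh0 (normr_ge0 nu) mh' nu_norm; rewrite mulr1.
  pos.
 apply: le_trans (lerD (IH mh') q) _.
 rewrite -mulrDl ler_wpM2r ?indicE//.
 rewrite mE opprD addrA (@sig_hf (c-m%:R*h-h) c); last lra.
 rewrite (@sig_hf (c-m%:R*h) c); last lra.
 rewrite (@sig_hf (c-m%:R*h-h) (c-m%:R*h)); last lra.
 pos.
have main := @Int_le _ _ R mu (fun x => \sum_(j <- iota 0 n.+1) f (x+(j%:R*h)*:nu)) (\1_(Bn (M+1)) : E -> R) (ig_sum _ fsi) (ig_Bn (M+1)).
rewrite Int_Bn in main; last lra.
apply: le_trans (main _).
 rewrite Int_sum// (eq_bigr (fun=> \int[mu]_x f x)); last by move=> j _; exact: Int_shift.
 by rewrite big_const_seq count_predT size_iota iter_addr_0 mulr_natl.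
move=> x; apply: le_trans (key x n.+1 _) _; first pos.
by rewrite -[X in _ <= X]mul1r ler_wpM2r ?indicE// (le_trans (ler_norm _))// sig01.
Qed.

Lemma HD_mul_lin (f f1 f2 f3 : R -> R) c u U : D3 f f1 f2 f3 -> HD u U -> L2 (fun x => f1 (l x-c)*u x) ->
 HD (fun x => f (l x-c)*u x) (fun i x => f (l x-c)*U i x+nu ord0 i*f1 (l x-c)*u x).
Proof.
move=> fD uU fL; have [K K0 hK] := mult_lin fD; have [m1 _] := hK c.
apply: (HD_mul uU m1) => i.
rewrite (_ : (fun x => _) = fun x => nu ord0 i*(f1 (l x-c)*u x)); first li.
apply/funext => x; pos.
Qed.

Lemma HD_mul_lin1 (f f1 f2 f3 : R -> R) c u U : D3 f f1 f2 f3 -> HD u U -> L2 (fun x => f2 (l x-c)*u x) ->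
 HD (fun x => f1 (l x-c)*u x) (fun i x => f1 (l x-c)*U i x+nu ord0 i*f2 (l x-c)*u x).
Proof.
move=> fD uU fL; have [K K0 hK] := mult_lin fD; have [_ m1] := hK c.
apply: (HD_mul uU m1) => i.
rewrite (_ : (fun x => _) = fun x => nu ord0 i*(f2 (l x-c)*u x)); first li.
apply/funext => x; pos.
Qed.

(** The hypothesis is a zero trace in integrated form. The sharp cut is the limit of smooth steps
    [ze] across a strip of width [hseq n], and it must be shown that the term with the derivative of
    the step disappears. *)
Lemma trace_cut w W c : HD w W ->
 n.+1%:R*\int[mu]_x (sig (c-hseq n) c x * `|w x| `^ p) ~>0 n ->
 HD (fun x => hf c x*w x) (fun i x => hf c x*W i x).
Proof.
move=> wW tr; have [wL WL Ww] := wW; have [mw wi] := wL.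
have hfmul u x : `|hf c x*u x| <= `|u x| by rewrite normrM -[X in _ <= X]mul1r ler_wpM2r// hf01.
have mhf := mes_hf c.
have wL' : Lq p (fun x => hf c x*w x).
 by apply: (Lq_le (ltW p0) _ wL) => [|x]; [mfun|pos].
have WL' : L2N (fun i x => hf c x*W i x).
 move=> i; apply: (L2_le _ (WL i)) => [|x]//; apply: measurable_funM => //; li.
split=> // i; have [lw lW ibp] := Ww i.
split; [exact/loc_integrableP/Lp_loc|exact/loc_integrableP/L2_loc/WL'|move=> phi tp].
have [M M0 vM] : exists2 M, 0 < M & vanish_out M phi.
 have [_ [M vM]] := (test_functionP phi).1 tp; exists (`|M|+1) => //.
 move=> x xM; apply: vM; apply: le_trans xM; have := ler_norm M; lra.
have vM1 : vanish_out (M+1) phi by move=> x xM; apply: vM; lra.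
have vMp : vanish_out (M+1) (partial i phi) by apply: partial_vanish => //; case: tp.
have [C C0 hC] := test_bounded tp.
have tpi := test_partial i tp.
have phL := test_L2 tp; have phiL := test_L2 tpi.
(* These make the argument of [S0] equal to [4 (n+1) (c - l x)]: the step rises from 0 at [l x = c]
   to 1 at [l x = c - hseq n]. *)
pose k (n : nat) : R := - (4*n.+1%:R); pose b n : R := 4*n.+1%:R*c.
pose ze n x := S0 (k n*(l x-0)+b n).
pose ze1 n x := k n*S1 (k n*(l x-0)+b n).
have D n := D3_spline (k n) (b n).
have [B B0 hB] := @S_bounded R.
have mze n : mes (ze n) by have [] := D3_comp_mes 0 (D n).
have mze1 n : mes (ze1 n) by have [] := D3_comp_mes 0 (D n).
have kE n x : k n*(l x-0)+b n = 4*n.+1%:R*(c-l x) by rewrite /k /b; ring.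
have n1 n : 0 < n.+1%:R :> R by li.
have ze_far n x : c <= l x -> ze n x = 0 /\ ze1 n x = 0.
 move=> cl; rewrite /ze /ze1 kE; have q : 4*n.+1%:R*(c-l x) <= 0 by apply: mulr_ge0_le0; [li|lra].
 have [-> -> _ _] := S_le0 q; pos.
have ze_near n x : l x <= c-hseq n -> ze n x = 1 /\ ze1 n x = 0.
 move=> cl; rewrite /ze /ze1 kE; have q : 4 <= 4*n.+1%:R*(c-l x).
  rewrite -mulrA ler_peMr//; have : hseq n <= c-l x by lra.
  by rewrite /hseq -[_^-1]mul1r ler_pdivrMr// mulrC.
 have [-> -> _ _] := S_ge4 q; pos.
have ze1_bound n x : `|ze1 n x| <= 4*B*(n.+1%:R*sig (c-hseq n) c x).
 rewrite sigE; have [h1|h1] := leP c (l x).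
  by have [_ ->] := ze_far n x h1; rewrite normr0 andbF mulr0 mulr0.
 have [h2|h2] := leP (c-hseq n) (l x); last first.
  by have [_ ->] := ze_near n x (ltW h2); rewrite normr0 mulr0 mulr0.
 rewrite /= mulr1 /ze1 normrM /k normrN [`|4*_|]ger0_norm//.
 have [_ q _ _] := hB (- (4*n.+1%:R)*(l x-0)+b n).
 rewrite (_ : 4*B*n.+1%:R = 4*n.+1%:R*B); last pos.
 by apply: ler_wpM2l => //.
have zeB n x : `|ze n x| <= B by have [] := hB (k n*(l x-0)+b n).
have zec x : ze n x @[n --> \oo] --> hf c x.
 rewrite hfE; have [h1|h1] := ltP (l x) c; last first.
  by apply: (@cvg_eq _ (fun=> 0)); [move=> n; have [] := ze_far n x h1|cv].
 apply: cvg_near_cst; have c0 : 0 < c-l x by lra.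
 have /cvgrPdist_le/(_ _ c0) := @hseq_cvg; apply: filterS => n.
 rewrite sub0r normrN ger0_norm ?invr_ge0// => q; have [] := ze_near n x => //; lra.
have phHD := HD_test tp.
have E1 n : \int[mu]_x (W i x*(ze n x * phi x)) =
  - (\int[mu]_x (w x*(ze n x * partial i phi x))+\int[mu]_x (w x*(nu ord0 i*ze1 n x * phi x))).
 have vL' : L2 (fun x => ze1 n x * phi x).
  by have [] := L2_mulb phL (mze1 n) (fun x => le_trans (ze1_bound n x) (ler_wpM2l (mulr_ge0 (ler0n _ 4) B0) (ler_wpM2l (ler0n _ _) (le_trans (ler_norm _) (sig01 _ _ _))))).
 have vV := HD_mul_lin (D n) phHD vL'.
 have vL : L2 (fun x => ze n x * phi x) by have [] := L2_mulb phL (mze n) (zeB n).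
 have pL : L2 (fun x => ze n x * partial i phi x) by have [] := L2_mulb phiL (mze n) (zeB n).
 have vL3 : L2 (fun x => nu ord0 i*ze1 n x * phi x).
  rewrite (_ : (fun x => _) = fun x => nu ord0 i*(ze1 n x * phi x)); first li.
  apply/funext => x; pos.
 have v1 : vanish_out (M+1) (fun x => S0 (k n*(l x-0)+b n) * phi x) by move=> x xM; rewrite vM1// !mulr0.
 have v2 := @IBP_vanish w _ W _ i (M+1) wW vV vL v1; rewrite v2; last first.
  by move=> x xM; rewrite vM1// vMp// !mulr0 addr0.
 congr (- _); rewrite -IntD.
 - apply: Int_ext => x; rewrite /ze /ze1; pos.
 - rewrite (_ : (fun x => _) = fun x => cut (M+1) w x*(ze n x * partial i phi x)).
   apply: L2_mul => //; exact: Lp_L2cut.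
  by apply/funext => x; rewrite cutE; case: ltP => // xM; rewrite vMp// !mulr0.
 - rewrite (_ : (fun x => _) = fun x => cut (M+1) w x*(nu ord0 i*ze1 n x * phi x)).
   apply: L2_mul => //; exact: Lp_L2cut.
  by apply/funext => x; rewrite cutE; case: ltP => // xM; rewrite vM1// !mulr0.
have wphi : ig (fun x => w x * partial i phi x) by apply: loc_test => //; exact: Lp_loc.
have Wphi : ig (fun x => W i x * phi x) by li.
have lim u f : ig (fun x => u x*f x) -> mes u -> mes f ->
  \int[mu]_x (u x*(ze n x*f x)) @[n --> \oo] --> \int[mu]_x (hf c x*u x*f x).
 move=> ufi mu' mf.
 have [|||||_ h _] := @DCT _ _ R mu (fun n x => u x*(ze n x*f x)) (fun x => hf c x*u x*f x) (fun x => B * `|u x*f x|).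
 - by move=> n; apply: measurable_funM => //; mfun.
 - mfun.
 - apply: aeW => x /=; rewrite (_ : hf c x*u x*f x = u x*(hf c x*f x)); last pos.
  by apply: cvgM; [cv|apply: cvgM; [exact: zec|exact: cvg_cst]].
 - li.
 - apply: aeW => x n /=; rewrite mulrCA normrM; apply: ler_wpM2r => //.
 cv.
have mW : mes (W i) by li.
have mph := test_mes tp; have mphi := test_mes tpi.
have l1 := lim _ _ Wphi mW mph; have l2 := lim _ _ wphi mw mphi.
have l3 : \int[mu]_x (w x*(nu ord0 i*ze1 n x * phi x)) ~>0 n.
 pose A n := n.+1%:R*\int[mu]_x (sig (c-hseq n) c x * `|w x| `^ p).
 pose D1 := (2*(M+1))^+N : R.
 have D10 : 0 <= D1 by pos.
 (* On the strip [|w| <= e + e^(1-p) |w|^p]: the first part is measured by [strip_int] and is O(e),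
    the second tends to 0 by hypothesis for each fixed [e]. *)
 have bnd e n : 0 < e -> `|\int[mu]_x (w x*(nu ord0 i*ze1 n x * phi x))| <=
   4*B*C*(e*D1+e`^(1-p)*A n).
  move=> e0; pose s := sig (c-hseq n) c.
  have i1 : ig (fun x => s x*\1_(Bn M) x).
   apply: ig_le (ig_Bn M) _; first by apply: measurable_funM; [exact: mes_sig|exact: ig_mes (ig_Bn M)].
   move=> x; rewrite normrM -[X in _ <= X]mul1r; apply: ler_pM => //; first exact: sig01.
   by rewrite ger0_norm.
  have i2 : ig (fun x => s x * `|w x| `^ p).
   apply: (ig_le _ wi); first by apply: measurable_funM; [exact: mes_sig|exact: ig_mes wi].
   move=> x; rewrite normrM -[X in _ <= X]mul1r; apply: ler_pM => //; first exact: sig01.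
   by rewrite ger0_norm.
  have -> : 4*B*C*(e*D1+e`^(1-p)*A n) =
    4*B*C*e*D1+(4*B*C*e`^(1-p)*n.+1%:R)*\int[mu]_x (s x * `|w x| `^ p) by rewrite /A; ring.
  apply: (@le_trans _ _ (4*B*C*e*(n.+1%:R*\int[mu]_x (s x*\1_(Bn M) x)) +
    (4*B*C*e`^(1-p)*n.+1%:R)*\int[mu]_x (s x * `|w x| `^ p))); last first.
   rewrite lerD2r; apply: ler_wpM2l; last exact: strip_int.
   pos.
  rewrite mulrA -IntZ// -IntZ// -IntD; [|li|li].
  apply: Int_le_norm.
  + rewrite (_ : (fun x => _) = fun x => cut M w x*(nu ord0 i*ze1 n x * phi x)).
    apply: L2_mul; first exact: Lp_L2cut.
    rewrite (_ : (fun x => _) = fun x => nu ord0 i*(ze1 n x * phi x)).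
     apply: L2Z; by have [] := L2_mulb phL (mze1 n) (fun x => le_trans (ze1_bound n x) (ler_wpM2l (mulr_ge0 (ler0n _ 4) B0) (ler_wpM2l (ler0n _ _) (le_trans (ler_norm _) (sig01 _ _ _))))).
    apply/funext => x; pos.
   by apply/funext => x; rewrite cutE; case: ltP => // xM; rewrite vM// !mulr0.
  + li.
  + move=> x; have y1 : `|w x| <= e+e`^(1-p) * `|w x| `^ p.
    have [h1|h1] := leP `|w x| e.
     apply: le_trans h1 _; rewrite lerDl; apply: mulr_ge0; pos.
    have w0 : 0 < `|w x| := lt_trans e0 h1.
    rewrite -[X in X <= _](_ : `|w x| `^ (1-p) * `|w x| `^ p = _); last first.
     by rewrite -powRD ?subrK ?powRr1 ?normr_ge0// gt_eqF.
    apply: (@le_trans _ _ (e`^(1-p) * `|w x| `^ p)); last pos.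
    rewrite ler_wpM2r ?powR_ge0// -[1-p]opprB !powRN lef_pV2 ?posrE ?powR_gt0//.
    rewrite ge0_ler_powR ?nnegrE ?ltW//; move: p2; lra.
   rewrite (_ : w x*_ = nu ord0 i*(ze1 n x*(phi x*w x))); last pos.
   have [xM|xM] := ltP `|x| M; last first.
    rewrite vM// mul0r !mulr0 normr0.
    pos.
   have -> : \1_(Bn M) x = 1 :> R by rewrite indicE mem_set.
   rewrite normrM (le_trans (ler_piMl (normr_ge0 _) (nu_le i)))// normrM.
   apply: (@le_trans _ _ (4*B*(n.+1%:R*s x)*(C*(e+e`^(1-p) * `|w x| `^ p)))).
    apply: ler_pM => //; rewrite normrM; exact: ler_pM.
   pos.
 apply/cvgrPdist_le => e e0; pose X := 4*B*C.
 have X0 : 0 <= X by pos.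
 pose e1 := e/(2*(X*D1+1)).
 have XD : 0 <= X*D1 by pos.
 have den : 0 < 2*(X*D1+1) by lra.
 have e10 : 0 < e1 by pos.
 pose Y := X*e1`^(1-p); have Y0 : 0 <= Y by apply: mulr_ge0 => //; exact: powR_ge0.
 have lY : Y*A n @[n --> \oo] --> Y*0 by apply: cvgM; [cv|exact: tr].
 rewrite mulr0 in lY; have e2 : 0 < e/2 by lra.
 have /cvgrPdist_le/(_ _ e2) := lY; apply: filterS => n; rewrite sub0r normrN => q.
 rewrite sub0r normrN; apply: le_trans (bnd e1 n e10) _.
 have z1 : X*D1*e1 <= e/2.
  rewrite /e1 mulrA ler_pdivrMr// (_ : e/2*_ = e*(X*D1+1)); last lra.
  pos.
 have := le_trans (ler_norm _) q; rewrite (_ : X*_ = X*D1*e1+Y*A n); last by rewrite /Y; ring.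
 pos.
have l4 := cvgN (cvgD l2 l3); rewrite addr0 in l4.
have l5 : \int[mu]_x (W i x*(ze n x * phi x)) @[n --> \oo] --> - \int[mu]_x (hf c x*w x * partial i phi x).
 apply: (cvg_eq E1); cv.
have e := cvg_unique _ l1 l5.
have -> : \int[mu]_x (hf c x*w x * partial i phi x) = - - \int[mu]_x (hf c x*w x * partial i phi x) by pos.
by rewrite -[X in - X]e.
Qed.

Lemma ddir_int G Phi phi : L2N G -> L2 phi -> \int[mu]_x (ddir nu G x * phi x) = \sum_i nu ord0 i*\int[mu]_x (G i x * phi x).
Proof.
move=> GL pL; have GpL i : ig (fun x => G i x * phi x) by exact: L2_mul.
rewrite (_ : (fun x => _) = fun x => \sum_i nu ord0 i*(G i x * phi x)).
 by rewrite Int_sum; [apply: eq_bigr => i _; exact: IntZ|move=> i; exact: igZ].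
apply/funext => x; rewrite /ddir mulr_suml; apply: eq_bigr => i _; pos.
Qed.

(** Weak form of the formula for the Laplacian of a product with [f (l x - c)], where [nu] has
    length 1. The right-hand side is again in L^2, so that the cut-off and then the exponential
    weight can be applied in turn. *)
Lemma lap_mul (f f1 f2 f3 : R -> R) c z Z f0 : D3 f f1 f2 f3 -> HD z Z -> L2 f0 ->
 L2 (fun x => f1 (l x-c)*z x) -> L2 (fun x => f2 (l x-c)*z x) ->
 (forall phi Phi, HD phi Phi -> L2 phi -> ip Z Phi = \int[mu]_x (f0 x * phi x)) ->
 let V := fun i x => f (l x-c)*Z i x+nu ord0 i*f1 (l x-c)*z x in
 let g := fun x => f (l x-c)*f0 x-2*(f1 (l x-c) * ddir nu Z x)-f2 (l x-c)*z x in
 L2 g /\ forall phi Phi, HD phi Phi -> L2 phi -> ip V Phi = \int[mu]_x (g x * phi x).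
Proof.
move=> fD zZ fL f1L f2L heq V g.
have [K K0 hK] := mult_lin fD; have [[mf mdf fK dfK _] [mf1 mdf1 f1K df1K _]] := hK c.
have [_ ZL _] := zZ; have dZL := ddir_L2 nu ZL.
have f0L : L2 (fun x => f (l x-c)*f0 x) by have [] := L2_mulb fL mf fK.
have f1dL : L2 (fun x => f1 (l x-c) * ddir nu Z x) by have [] := L2_mulb dZL mf1 f1K.
have gL : L2 g by apply: L2B => //; apply: L2B => //; exact: L2Z.
split=> // phi Phi pP pL; have [_ PL _] := pP.
have f1pL : L2 (fun x => f1 (l x-c) * phi x) by have [] := L2_mulb pL mf1 f1K.
have fpL : L2 (fun x => f (l x-c) * phi x) by have [] := L2_mulb pL mf fK.
have tP := HD_mul_lin fD pP f1pL.
have e1 := heq _ _ tP fpL.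
have zP := HD_mul_lin1 fD zZ f2L.
have fPL i : L2 (fun x => f (l x-c)*Phi i x) by have [] := L2_mulb (PL i) mf fK.
have ibp i : \int[mu]_x ((f1 (l x-c)*z x)*Phi i x) =
  - \int[mu]_x ((f1 (l x-c)*Z i x+nu ord0 i*f2 (l x-c)*z x) * phi x).
 by rewrite (IBP_L2 i zP pP f1L pL) opprK.
have e2 : ip V Phi = \sum_i \int[mu]_x (Z i x*(f (l x-c)*Phi i x))+\sum_i nu ord0 i*\int[mu]_x ((f1 (l x-c)*z x)*Phi i x).
 rewrite -big_split; apply: eq_bigr => i _ /=; rewrite -IntZ; last li.
 rewrite -IntD; [|li|li].
 apply: Int_ext => x; rewrite /V; pos.
have e3 : ip Z (fun i x => f (l x-c)*Phi i x+nu ord0 i*f1 (l x-c) * phi x) =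
  \sum_i \int[mu]_x (Z i x*(f (l x-c)*Phi i x))+\int[mu]_x (ddir nu Z x*(f1 (l x-c) * phi x)).
 rewrite ddir_int//.
 rewrite -big_split; apply: eq_bigr => i _ /=; rewrite -IntZ; last li.
 rewrite -IntD; [|li|li].
 apply: Int_ext => x; pos.
have e4 : \sum_i nu ord0 i*\int[mu]_x ((f1 (l x-c)*z x)*Phi i x) =
  - (\int[mu]_x (ddir nu Z x*(f1 (l x-c) * phi x))+\int[mu]_x (f2 (l x-c)*z x * phi x)).
 have q i : nu ord0 i*\int[mu]_x ((f1 (l x-c)*z x)*Phi i x) =
   - (nu ord0 i*\int[mu]_x (Z i x*(f1 (l x-c) * phi x)) +
    nu ord0 i*nu ord0 i*\int[mu]_x (f2 (l x-c)*z x * phi x)).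
  rewrite ibp mulrN -mulrA -mulrDr; congr (- (_*_)).
  rewrite -IntZ; last li.
  rewrite -IntD; [|li|li].
  apply: Int_ext => x; pos.
 rewrite (eq_bigr _ (fun i _ => q i)) sumrN big_split /= -mulr_suml -/(lin nu nu) nu1 mul1r.
 by rewrite ddir_int.
rewrite e2 e4; have := e3; rewrite e1 => e5.
have -> : \int[mu]_x (g x * phi x) = \int[mu]_x (f0 x*(f (l x-c) * phi x))-2*\int[mu]_x (ddir nu Z x*(f1 (l x-c) * phi x))
  - \int[mu]_x (f2 (l x-c)*z x * phi x).
 have i1 : ig (fun x => f0 x*(f (l x-c) * phi x)) by li.
 have i2 : ig (fun x => ddir nu Z x*(f1 (l x-c) * phi x)) by li.
 have i3 : ig (fun x => f2 (l x-c)*z x * phi x) by li.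
 rewrite -IntZ// -IntB//; last li.
 rewrite -IntB//; last by apply: igB => //; exact: igZ.
 apply: Int_ext => x; rewrite /g; pos.
pos.
Qed.

End half_space_cut.

(** * Unique continuation across a hyperplane *)

Section unique_continuation.
Variable nu : E.
Hypothesis nu1 : lin nu nu = 1.
Local Notation l := (lin nu).

Lemma powR_sq (t q : R) : `|t^+2| `^ q = (`|t| `^ q)^+2.
Proof. by rewrite normrX powRM. Qed.

(** The square is [|w^2|^(p-2) |w|^2], a product of powers of two L^p functions with exponents that
    sum to [p]. *)
Lemma pow_gp_L2 w : Lq p w -> Lq p (fun x => w x^+2) -> L2 (fun x => gp p (w x)).
Proof.
move=> wL w2L; have [mw _] := wL; split; first mfun.
have a0 : 0 <= p-2 by move: p2; lra.
have e : p-2+2 = p by pos.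
have := @Lq_mul _ _ R mu (p-2) 2 (fun x => w x^+2) w a0 (ler0n _ 2); rewrite !e => /(_ w2L wL).
rewrite (_ : (fun x => _) = fun x => gp p (w x)^+2)//; apply/funext => x.
rewrite /gp exprMn mulrC powR_mulrn// real_normK ?num_real//; congr (_*_).
exact: powR_sq.
Qed.

Definition ucK w : R := 2*nq p (fun x => w x^+2)`^(p-2)*sob^+2.

Lemma pot_bound w v V : Lq p (fun x => w x^+2) -> HD v V ->
 L2 (fun x => `|w x| `^ (p-2) * v x) /\ n2 (fun x => `|w x| `^ (p-2) * v x)^+2 <= ucK w*gn V^+2.
Proof.
move=> w2L vV; have [vL _ _] := vV; have [i0 h] := holder_sobolev w2L vV.
have sq x : `|w x^+2| `^ (p-2) * v x^+2 = (`|w x| `^ (p-2) * v x)^+2 by rewrite exprMn powR_sq.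
have mm : mes (fun x => `|w x| `^ (p-2) * v x).
 apply: measurable_funM; last exact: vL.1.
 have [m2 _] := w2L; rewrite (_ : (fun x => _) = fun x => `|w x^+2| `^ ((p-2)/2)); first mfun.
 apply/funext => x; rewrite normrX -powR_mulrn ?normr_ge0// -powRrM; congr (_ `^ _).
 pos.
have sE : (fun x => (`|w x| `^ (p-2) * v x)^+2) = fun x => `|w x^+2| `^ (p-2) * v x^+2.
 by apply/funext => x; rewrite sq.
split; first by split => //; rewrite sE.
by rewrite n2_sq sE /ucK -mulrA.
Qed.

Lemma expRN_le (y : R) : 0 < y -> expR (- y) <= y^-1.
Proof.
move=> y0; rewrite expRN lef_pV2 ?posrE ?expR_gt0//.
apply: le_trans (expR_ge1Dx y); pos.
Qed.

(** This is the equation for a right-hand side [f0] conjugated by [exp (-s l)], and [F] is the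
    weighted [f0]. Testing with twice the derivative of [v] along [nu] removes the gradient term and
    the zero-order term by translation invariance and bounds that derivative by [F / (2 s)]. A
    Poincaré inequality on the strip and a test with [v] itself do the rest. *)
Lemma carleman s c d v V F : 1 <= s -> 0 < d -> d <= 1 -> HD v V -> L2 v -> L2 F ->
 (forall x, ~~ (c <= l x < c+d) -> v x = 0) ->
 (forall phi Phi, HD phi Phi -> L2 phi -> ip V Phi =
   \int[mu]_x ((F x+2*s * ddir nu V x+s^+2 * v x) * phi x)) ->
 n2 v <= n2 F /\ gn V^+2 <= 3/4 * d*n2 F^+2.
Proof.
move=> s1 d0 d1 vV vL FL vs heq; have [_ VL _] := vV; have dL := ddir_L2 nu VL.
have s0 : 0 < s by lra.
have split3 phi Phi : HD phi Phi -> L2 phi -> ip V Phi =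
  \int[mu]_x (F x * phi x)+2*s*\int[mu]_x (ddir nu V x * phi x)+s^+2*\int[mu]_x (v x * phi x).
 move=> pP pL; rewrite (heq _ _ pP pL).
 have i1 : ig (fun x => F x * phi x) by li.
 have i2 : ig (fun x => ddir nu V x * phi x) by li.
 have i3 : ig (fun x => v x * phi x) by li.
 rewrite -IntZ// -[s^+2*_]IntZ// -IntD//; last li.
 rewrite -IntD; [|li|li].
 apply: Int_ext => x; pos.
(* [ddir nu V] is only known to be in L^2 and cannot be tested with; the symmetric difference
   quotients [P k] can, and they converge to its double. *)
have zero : 0 = \int[mu]_x (F x*(2 * ddir nu V x))+2*s*\int[mu]_x (ddir nu V x*(2 * ddir nu V x)).
 pose h_ k : R := hseq k; have h0 k : h_ k != 0 by exact: hseq_neq0.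
 have hc : h_ @ \oo --> (0 : R) by cv.
 have nh0 k : - h_ k != 0 by rewrite oppr_eq0.
 have nhc : (fun k => - h_ k) @ \oo --> (0 : R) by rewrite -[X in _ --> X]oppr0; exact: cvgN.
 pose P k x := (h_ k)^-1*(v (x+h_ k*:nu)-v x)+(- h_ k)^-1*(v (x+(- h_ k)*:nu)-v x).
 have PE k x : P k x = (h_ k)^-1*(v (x+h_ k*:nu)-v (x+(- h_ k)*:nu)).
  rewrite /P invrN; pos.
 have vsL k : L2 (fun x => v (x+h_ k*:nu)) by li.
 have vsnL k : L2 (fun x => v (x+(- h_ k)*:nu)) by exact: L2_shift.
 have q1L k : L2 (fun x => (h_ k)^-1*(v (x+h_ k*:nu)-v x)) by apply: L2Z; exact: L2B.
 have q2L k : L2 (fun x => (- h_ k)^-1*(v (x+(- h_ k)*:nu)-v x)) by apply: L2Z; exact: L2B.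
 have PL k : L2 (P k) by li.
 have Pc : n2 (fun x => P k x-2 * ddir nu V x) ~>0 k.
  apply: (@cvg0_le _ (fun k => n2 (fun x => (h_ k)^-1*(v (x+h_ k*:nu)-v x)-ddir nu V x) +
    n2 (fun x => (- h_ k)^-1*(v (x+(- h_ k)*:nu)-v x)-ddir nu V x))).
   move=> k; rewrite ger0_norm ?n2_ge0//; apply: le_trans (n2D (L2B (q1L k) dL) (L2B (q2L k) dL)).
   apply: eqle; congr n2; apply/funext => x; rewrite /P; pos.
  rewrite [X in _ --> X](_ : 0 = 0+0); last pos.
  apply: cvgD => //; exact: HD_ddq_cvg.
 have tL : L2 (fun x => 2 * ddir nu V x) by li.
 have c1 f : L2 f -> \int[mu]_x (f x*P k x) @[k --> \oo] --> \int[mu]_x (f x*(2 * ddir nu V x)).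
  move=> fL; have := cvg_Int_mul PL tL fL Pc.
  have sw (g : nat -> E -> R) : (fun k => \int[mu]_x (g k x*f x)) = (fun k : nat => \int[mu]_x (f x*g k x)).
   apply/funext => k; apply: Int_ext => x; pos.
  by rewrite sw; under [X in _ --> X -> _]eq_Rintegral do rewrite mulrC.
 have sh k u : ig u -> \int[mu]_x u (x+(- h_ k)*:nu) = \int[mu]_x u x by move=> ui; exact: Int_shift.
 have K k x : x+(- h_ k)*:nu+h_ k*:nu = x by rewrite scaleNr subrK.
 have sym k (f g : E -> R) : L2 f -> L2 g -> \int[mu]_x (f x*g (x+(- h_ k)*:nu)) = \int[mu]_x (g x*f (x+h_ k*:nu)).
  move=> fL gL; have i1 : ig (fun x => g x*f (x+h_ k*:nu)) by apply: L2_mul => //; exact: L2_shift.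
  by rewrite -(sh k _ i1); apply: Int_ext => x; rewrite K mulrC.
 have E1 k : 0 = \int[mu]_x (F x*P k x)+2*s*\int[mu]_x (ddir nu V x*P k x).
  pose Ph i x := (h_ k)^-1*(V i (x+h_ k*:nu)-V i (x+(- h_ k)*:nu)).
  have Pp : HD (P k) Ph.
   have := HDZ (h_ k)^-1 (HDB (HD_shift (h_ k*:nu) vV) (HD_shift ((- h_ k)*:nu) vV)).
   by apply: HD_ext => // x.
  have z1 : ip V Ph = 0.
   rewrite /ip big1// => i _.
   have j1 : ig (fun x => V i x*V i (x+h_ k*:nu)) by apply: L2_mul => //; exact: L2_shift.
   have j2 : ig (fun x => V i x*V i (x+(- h_ k)*:nu)) by apply: L2_mul => //; exact: L2_shift.
   rewrite (_ : \int[mu]_x _ = (h_ k)^-1*(\int[mu]_x (V i x*V i (x+h_ k*:nu))-\int[mu]_x (V i x*V i (x+(- h_ k)*:nu)))).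
    by rewrite sym// subrr mulr0.
   rewrite -IntB// -IntZ; last li.
   apply: Int_ext => x; rewrite /Ph; pos.
  have z2 : \int[mu]_x (v x*P k x) = 0.
   have j1 : ig (fun x => v x * v (x+h_ k*:nu)) by li.
   have j2 : ig (fun x => v x * v (x+(- h_ k)*:nu)) by li.
   rewrite (_ : \int[mu]_x _ = (h_ k)^-1*(\int[mu]_x (v x * v (x+h_ k*:nu))-\int[mu]_x (v x * v (x+(- h_ k)*:nu)))).
    by rewrite sym// subrr mulr0.
   rewrite -IntB// -IntZ; last li.
   apply: Int_ext => x; rewrite PE; pos.
  by have := split3 _ _ Pp (PL k); rewrite z1 z2 mulr0 addr0.
 have lim : \int[mu]_x (F x*P k x)+2*s*\int[mu]_x (ddir nu V x*P k x) @[k --> \oo] -->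
   \int[mu]_x (F x*(2 * ddir nu V x))+2*s*\int[mu]_x (ddir nu V x*(2 * ddir nu V x)).
  by apply: cvgD; [cv|apply: cvgM; [exact: cvg_cst|exact: c1]].
 have l0 : \int[mu]_x (F x*P k x)+2*s*\int[mu]_x (ddir nu V x*P k x) ~>0 k.
  apply: (@cvg_eq _ (fun=> 0)) => //; cv.
 exact: (cvg_unique _ l0 lim).
set D := n2 (ddir nu V); set f := n2 F; have D0 : 0 <= D by exact: n2_ge0.
have f0 : 0 <= f by pos.
have hD : 2*s*D <= f.
 have e1 : \int[mu]_x (F x*(2 * ddir nu V x)) = 2*\int[mu]_x (F x * ddir nu V x).
  by rewrite -IntZ; [apply: Int_ext => x; ring|li].
 have e2 : \int[mu]_x (ddir nu V x*(2 * ddir nu V x)) = 2*D^+2.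
  rewrite n2_sq -IntZ; last li.
  apply: Int_ext => x; pos.
 move: zero; rewrite e1 e2 => zero.
 have := CS FL dL; rewrite -/D -/f => cs.
 have q : 2*s*D^+2 <= f*D.
  have /ler_normlP[+ _] := cs.
  pos.
 have [->|Dn] := eqVneq D 0; first pos.
 have Dp : 0 < D by pos.
 rewrite -(ler_pM2r Dp); apply: le_trans q.
 pos.
(* For [x] in the strip, [x - d nu] lies below it, where [v] is 0; so [|v|] is at most its increment
   over the distance [d]. *)
have vd : n2 v <= d*D.
 have := HD_ddir_shift nu (- d) vV; rewrite normrN gtr0_norm//; apply: le_trans.
 apply: n2_le => //; first by apply: L2B => //; exact: L2_shift.
 move=> x; have [xs|xs] := boolP (c <= l x < c+d); last by rewrite [v x]vs// normr0.
 rewrite [v (x + _)]vs ?sub0r ?normrN// lin_shift//; apply/negP => /andP[h1 _].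
 pos.
have sD : s*D <= f/2 by lra.
have DD : D <= s*D by rewrite ler_peMl.
have vF : n2 v <= f.
 apply: le_trans vd _; apply: (@le_trans _ _ D); last lra.
 by rewrite ler_piMl.
split=> //.
have g1 := split3 _ _ vV vL.
have e1 : \int[mu]_x (ddir nu V x * v x) = 0.
 rewrite ddir_int// big1// => i _.
 have := IBP_L2 i vV vV vL vL; rewrite [X in _ = - X](_ : _ = \int[mu]_x (V i x * v x)).
  move: (\int[mu]_x _) => y h; rewrite (_ : y = 0); lra.
 apply: Int_ext => x; pos.
have e2 : \int[mu]_x (v x * v x) = n2 v^+2.
 by rewrite n2_sq; apply: Int_ext => x.
rewrite gn_sq g1 e1 e2 mulr0 addr0.
have cs := le_trans (ler_norm _) (CS FL vL); rewrite -/f in cs.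
have v0 : 0 <= n2 v by pos.
have sv : s*n2 v <= d*(f/2).
 apply: (@le_trans _ _ (s*(d*D))); first by rewrite ler_wpM2l// ltW.
 by rewrite mulrCA ler_wpM2l// ltW.
have q1 : s^+2*n2 v^+2 <= (d*(f/2))^+2.
 rewrite -exprMn lerXn2r ?nnegrE//; pos.
have q2 : n2 v <= d*(f/2).
 by apply: le_trans sv; rewrite ler_peMl.
have q3 : f*n2 v <= f*(d*(f/2)) by rewrite ler_wpM2l.
have q4 : (d*(f/2))^+2 <= d*(f/2)^+2.
 by rewrite exprMn ler_wpM2r ?sqr_ge0// ler_piMl// ltW.
have -> : 3/4 * d*f^+2 = f*(d*(f/2))+d*(f/2)^+2 by pos.
pos.
Qed.

(** The width for which the gain [3/4 d] of the Carleman estimate times the potential constant [ucK]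
    is at most 1/4. It depends on [w] only through the norm of [w^2], hence not on the position of
    the strip. *)
Definition ucd w : R := (3*(ucK w+1))^-1.

Lemma ucK_ge0 w : 0 <= ucK w.
Proof. pos. Qed.

Lemma ucd_bounds w : [/\ 0 < ucd w, ucd w <= 1 & ucK w*(3/4*ucd w) <= 1/4].
Proof.
have K0 := ucK_ge0 w; have D0 : 0 < 3*(ucK w+1) by lra.
split; first pos.
 rewrite invf_le1; lra.
rewrite mulrA ler_pdivrMr; pos.
Qed.

(** Carleman argument on the strip of width [d]: after absorption of the potential, the weighted
    solution is bounded by the error of the cut-off. This error carries the weight [exp (-s d/2)] at
    most, while [w] below [c + d/4] carries at least [exp (-s d/4)]; let [s] tend to infinity. *)
Lemma uc_core w W c : HD w W -> Lq p (fun x => w x^+2) ->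
 (forall x, l x < c -> w x = 0 /\ forall i, W i x = 0) ->
 (forall phi Phi, HD phi Phi -> ip W Phi = \int[mu]_x (gp p (w x) * phi x)) ->
 (fun x => hf nu (c+ucd w/4) x*w x) = (fun=> 0) %[ae mu].
Proof.
move=> wW w2L w0 weq; have [d0 d1 dK] := ucd_bounds w; set d := ucd w in d0 d1 dK *.
have [wL WL _] := wW; have [mw _] := wL.
have gL := pow_gp_L2 wL w2L.
(* [w] is in L^p, but on the strip it equals, up to sign, its increment over [- d nu], which is in
   L^2. *)
have swL : L2 (fun x => sig nu c (c+d) x*w x).
 have [D1 _] := HD_shiftv ((- d)*:nu) wW.
 apply: (L2_le _ D1) => [|x]; first by apply: measurable_funM => //; exact: mes_sig.
 rewrite sigE; have [/andP[h1 h2]|_] := boolP (c <= l x < c+d); last by rewrite mul0r normr0.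
 have [-> _] : w (x+(- d)*:nu) = 0 /\ forall i, W i (x+(- d)*:nu) = 0 by apply: w0; rewrite lin_shift//; lra.
 by rewrite sub0r normrN mul1r.
(* The argument of the step becomes [8 (d - t)/d]: the cut-off is 1 for [t <= d/2] and 0 for
   [t >= d]. *)
pose k := - 8/d; pose b : R := 8.
have Dx := D3_spline k b; set x0 := (fun t => S0 _) in Dx; set x1 := (fun t => k*S1 _) in Dx.
set x2 := (fun t => k*(k*S2 _)) in Dx; set x3 := (fun t => _) in Dx.
have kE t : k*t+b = 8*((d-t)/d) by rewrite /k /b; field; rewrite gt_eqF.
have xfar t : d <= t -> [/\ x0 t = 0, x1 t = 0 & x2 t = 0].
 move=> dt; rewrite /x0 /x1 /x2 kE; have q : 8*((d-t)/d) <= 0.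
  by apply: mulr_ge0_le0 => //; apply: mulr_le0_ge0; [lra|rewrite invr_ge0 ltW].
 by have [-> -> -> _] := S_le0 q; rewrite !mulr0.
have xnear t : t <= d/2 -> [/\ x0 t = 1, x1 t = 0 & x2 t = 0].
 move=> dt; rewrite /x0 /x1 /x2 kE; have q : 4 <= 8*((d-t)/d).
  rewrite mulrA ler_pdivlMr; lra.
 by have [-> -> -> _] := S_ge4 q; rewrite !mulr0.
have [B B0 hB] : exists2 B, 0 <= B & forall t, [/\ `|x0 t| <= B, `|x1 t| <= B & `|x2 t| <= B].
 by have [_ [B B0 hB]] := Dx; exists B => // t; have [] := hB t.
have [mx0 mx1 mx2] := D3_comp_mes nu c Dx.
have cutL (h : R -> R) : mes (fun x => h (l x-c)) -> (forall t, `|h t| <= B) -> (forall t, d <= t -> h t = 0) ->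
  L2 (fun x => h (l x-c)*w x).
 move=> mh hb h0; have [q _] := L2_mulb swL mh (fun x => hb (l x-c)).
 rewrite (_ : (fun x => _) = fun x => h (l x-c)*(sig nu c (c+d) x*w x))//.
 apply/funext => x; rewrite sigE; have [h1|h1] := ltP (l x) c.
  have [-> _] := w0 x h1; pos.
 have [h2|h2] := ltP (l x) (c+d); first by rewrite mul1r.
 rewrite h0; lra.
have z0L : L2 (fun x => x0 (l x-c)*w x) by apply: cutL => // t; [have [] := hB t|by move=> /xfar[]].
have z1L : L2 (fun x => x1 (l x-c)*w x) by apply: cutL => // t; [have [] := hB t|by move=> /xfar[]].
have z2L : L2 (fun x => x2 (l x-c)*w x) by apply: cutL => // t; [have [] := hB t|by move=> /xfar[]].
have zZ := HD_mul_lin nu1 Dx wW z1L.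
have [f0L zeq] := lap_mul nu1 Dx wW gL z1L z2L (fun phi Phi pP _ => weq phi Phi pP).
set z := (fun x => x0 (l x-c)*w x) in zZ z0L.
set Z := (fun i x => _) in zZ zeq.
set f0 := (fun x => _) in f0L zeq.
have zZ0 x : ~~ (c <= l x < c+d) -> z x = 0 /\ (forall i, Z i x = 0).
 rewrite negb_and -!ltNge => /orP[h1|h1].
  have [e1 e2] := w0 x h1; split; first by rewrite /z e1 mulr0.
  by move=> i; rewrite /Z e1 e2 !mulr0 addr0.
 have [|a0 a1 _] := xfar (l x-c); first by pos.
 by split=> [|i]; rewrite /z /Z a0 ?a1 ?mulr0 ?mul0r ?addr0.
(* The commutator of the cut-off with the Laplacian; it lives above [c + d/2]. *)
pose r x := - 2*(x1 (l x-c) * ddir nu W x)-x2 (l x-c)*w x.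
have rL : L2 r.
 apply: L2B => //; apply: L2Z.
 by have [] := L2_mulb (ddir_L2 nu WL) mx1 (fun x => let: And3 _ h _ := hB (l x-c) in h).
have r0 x : l x < c+d/2 -> r x = 0.
 move=> h1; have [|_ a1 a2] := xnear (l x-c); first lra.
 by rewrite /r a1 a2 !mul0r mulr0 subrr.
have f0E x : f0 x = `|w x| `^ (p-2)*z x+r x.
 rewrite /f0 /r /z /gp; ring.
have hL : L2 (fun x => hf nu (c+d/4) x*w x).
 apply: (L2_le _ swL) => [|x]; first by apply: measurable_funM => //; exact: mes_hf.
 rewrite hfE sigE; have [h1|h1] := ltP (l x) c; first by have [-> _] := w0 x h1; rewrite !mulr0.
 have [h2|h2] := ltP (l x) (c+d/4); last by rewrite mul0r normr0.
 by have -> : l x < c+d by lra.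
have key s : 1 <= s -> n2 (fun x => hf nu (c+d/4) x*w x) <= 2*n2 r*(s*(d/4))^-1.
 move=> s1; have s0 : 0 <= s by lra.
 have De := D3_ew s0; have [Be Be0 hBe] : exists2 B, 0 <= B & forall t, [/\ `|ew0 s t| <= B, `|ew1 s t| <= B & `|ew2 s t| <= B].
  by have [_ [B' B0' hB']] := De; exists B' => // t; have [] := hB' t.
 have [me0 me1 me2] := D3_comp_mes nu c De.
 have v0L : L2 (fun x => ew0 s (l x-c)*z x).
  by have [] := L2_mulb z0L me0 (fun x => let: And3 h _ _ := hBe (l x-c) in h).
 have v1L : L2 (fun x => ew1 s (l x-c)*z x).
  by have [] := L2_mulb z0L me1 (fun x => let: And3 _ h _ := hBe (l x-c) in h).
 have v2L : L2 (fun x => ew2 s (l x-c)*z x).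
  by have [] := L2_mulb z0L me2 (fun x => let: And3 _ _ h := hBe (l x-c) in h).
 have vV := HD_mul_lin nu1 De zZ v1L.
 have [_ veq] := lap_mul nu1 De zZ f0L v1L v2L zeq.
 set v := (fun x => ew0 s (l x-c)*z x) in vV v0L.
 set V := (fun i x => _) in vV veq.
 pose F x := ew0 s (l x-c)*f0 x.
 have FL : L2 F by have [] := L2_mulb f0L me0 (fun x => let: And3 h _ _ := hBe (l x-c) in h).
 have vs x : ~~ (c <= l x < c+d) -> v x = 0 by move=> /zZ0[e _]; rewrite /v e mulr0.
 have veq' phi Phi : HD phi Phi -> L2 phi -> ip V Phi =
   \int[mu]_x ((F x+2*s * ddir nu V x+s^+2 * v x) * phi x).
  move=> pP pL; rewrite (veq _ _ pP pL); apply: Int_ext => x; congr (_*_).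
  have dV : ddir nu V x = ew0 s (l x-c) * ddir nu Z x+ew1 s (l x-c)*z x.
   rewrite /ddir /V mulr_sumr.
   rewrite (eq_bigr (fun i => ew0 s (l x-c)*(nu ord0 i*Z i x)+nu ord0 i*nu ord0 i*(ew1 s (l x-c)*z x))).
    by rewrite big_split -mulr_suml -/(lin nu nu) nu1 mul1r.
   move=> i _; pos.
  have [h1|h1] := ltP (l x) c.
   have nx : ~~ (c <= l x < c+d) by pos.
   have [e1 e2] := zZ0 x nx.
   have dZ : ddir nu Z x = 0 by rewrite /ddir big1// => i _; rewrite e2 mulr0.
   rewrite dV dZ /F /v e1; pos.
  have [|e0 e1 e2] := @ew_ge0 R s (l x-c); first lra.
  rewrite dV /F /v e0 e1 e2; pos.
 have [vF gF] := carleman s1 d0 d1 vV v0L FL vs veq'.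
 have [pL pB] := pot_bound w2L vV.
 have erL : L2 (fun x => ew0 s (l x-c)*r x).
  by have [] := L2_mulb rL me0 (fun x => let: And3 h _ _ := hBe (l x-c) in h).
 have n2F0 : 0 <= n2 F by pos.
 have pF : n2 (fun x => `|w x| `^ (p-2) * v x) <= n2 F/2.
  rewrite -(@ler_pXn2r _ 2)// ?nnegrE ?n2_ge0//; last pos.
  apply: le_trans pB _; apply: (@le_trans _ _ (ucK w*(3/4 * d*n2 F^+2))).
   apply: ler_wpM2l => //; pos.
  rewrite mulrA (_ : (n2 F/2)^+2 = 1/4*n2 F^+2); last pos.
  apply: ler_wpM2r => //; pos.
 have eF : n2 F <= n2 F/2+n2 (fun x => ew0 s (l x-c)*r x).
  apply: le_trans (lerD pF (lexx _)); apply: le_trans (n2D pL erL).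
  apply: eqle; congr n2; apply/funext => x; rewrite /F f0E /v; pos.
 set e2 := expR (- (s*(d/2))); set e4 := expR (- (s*(d/4))).
 have e40 : 0 < e4 by pos.
 have erB : n2 (fun x => ew0 s (l x-c)*r x) <= e2*n2 r.
  rewrite -[e2]gtr0_norm ?expR_gt0// -n2Z//; apply: n2_le => // [|x]; first exact: L2Z.
  have [h1|h1] := ltP (l x) (c+d/2); first by rewrite r0// !mulr0.
  have [|-> _ _] := @ew_ge0 R s (l x-c); first by move: d0; lra.
  have e20 : 0 < e2 by pos.
  rewrite !normrM (gtr0_norm e20) [`|expR _|]gtr0_norm ?expR_gt0//; apply: ler_wpM2r => //.
  rewrite ler_expR lerN2; apply: ler_wpM2l => //; lra.
 have hv : e4*n2 (fun x => hf nu (c+d/4) x*w x) <= n2 v.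
  rewrite -{1}[e4]gtr0_norm// -n2Z//; apply: n2_le => // [|x]; first exact: L2Z.
  rewrite hfE; have [h1|h1] := ltP (l x) c; first by have [-> _] := w0 x h1; rewrite !mulr0 normr0.
  have [h2|h2] := ltP (l x) (c+d/4); last by rewrite mul0r mulr0 normr0.
  have [|x01 _ _] := xnear (l x-c); first by move: d0; lra.
  have [|ee _ _] := @ew_ge0 R s (l x-c); first lra.
  rewrite /v /z x01 ee normrM [`|expR _*_|]normrM (gtr0_norm e40) [`|expR _|]gtr0_norm ?expR_gt0//; apply: ler_wpM2r => //.
  rewrite ler_expR lerN2; apply: ler_wpM2l => //; lra.
 have e24 : e2 = e4*e4 by rewrite -expRD; congr expR; field.
 rewrite -(ler_pM2l e40); apply: le_trans hv _; apply: le_trans vF _.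
 apply: (@le_trans _ _ (2*(e2*n2 r))); first by move: eF erB; move: (n2 F) (n2 _) (e2*_) => y1 y2 y3; lra.
 rewrite e24 (_ : 2*(e4*e4*n2 r) = e4*(2*n2 r*e4)); last ring.
 apply: ler_wpM2l; first pos.
 apply: ler_wpM2l; first by apply: mulr_ge0 => //; exact: n2_ge0.
 apply: expRN_le; apply: mulr_gt0; lra.
apply: n2_eq0 => //; apply/eqP; rewrite eq_le n2_ge0 andbT leNgt; apply/negP => npos.
(* For this [s], the estimate [key] would read [X (d/4) + 2 n2 r <= 2 n2 r]. *)
set X := n2 _ in npos key; pose s := 1+2*n2 r/(X*(d/4)).
have Xd : 0 < X*(d/4) by pos.
have s1 : 1 <= s by rewrite lerDl; apply: divr_ge0; [pos|pos].
have := key s s1; rewrite ler_pdivlMr; last by pos.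
rewrite (_ : X*(s*(d/4)) = X*(d/4)+2*n2 r); last by rewrite /s; field; rewrite (gt_eqF npos) (gt_eqF d0).
pos.
Qed.

(** Turns vanishing almost everywhere into pointwise vanishing of function and gradient: the part
    below the hyperplane, legitimate by [trace_cut] with zero strip masses, is subtracted. The step
    [ucd] is unchanged since it depends on a norm only. *)
Lemma uc_step w W c : HD w W -> Lq p (fun x => w x^+2) ->
 (fun x => hf nu c x*w x) = (fun=> 0) %[ae mu] ->
 (forall phi Phi, HD phi Phi -> ip W Phi = \int[mu]_x (gp p (w x) * phi x)) ->
 (fun x => hf nu (c+ucd w/4) x*w x) = (fun=> 0) %[ae mu].
Proof.
move=> wW w2L h0 weq; have [wL WL _] := wW; have [mw wi] := wL.
have tr n : n.+1%:R*\int[mu]_x (sig nu (c-hseq n) c x * `|w x| `^ p) = 0.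
 rewrite (_ : \int[mu]_x _ = 0) ?mulr0// -(Int0 mu); apply: Int_aeeq.
 - by apply: measurable_funM; [exact: mes_sig|mfun].
 - li.
 - move: h0; apply: filterS => x /= h _; have := h I; rewrite hfE sigE.
  have [h1|h1] := ltP (l x) c; last by rewrite andbF !mul0r.
  by rewrite mul1r => ->; rewrite normr0 powR0 ?mulr0// gt_eqF.
have hH : HD (fun x => hf nu c x*w x) (fun i x => hf nu c x*W i x).
 apply: trace_cut => //; apply: (@cvg_eq _ (fun=> 0)) => //; cv.
have w1W1 := HDB wW hH.
set w1 := (fun x => _) in w1W1; set W1 := (fun i x => _) in w1W1.
have [w1L W1L _] := w1W1; have [mw1 _] := w1L.
have w1w : w1 = w %[ae mu] by move: h0; apply: filterS => x /= h _; rewrite /w1 h// subr0.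
have w2L' : Lq p (fun x => w1 x^+2).
 apply: Lq_aeeq w2L _; first mfun.
 by move: w1w; apply: filterS => x /= h _; rewrite h.
have ww1 : w = w1 %[ae mu] by move: w1w; apply: filterS => x /= h _; rewrite h.
have W1W := HD_unique (HD_aeeq w1W1 mw ww1) wW.
have nqE : nq p (fun x => w1 x^+2) = nq p (fun x => w x^+2).
 apply: nq_aeeq; [mfun|by mfun|].
 by move: w1w; apply: filterS => x /= h _; rewrite h.
have ucE : ucd w1 = ucd w by rewrite /ucd /ucK nqE.
have := uc_core w1W1 w2L'; rewrite ucE => /(_ c) q.
have H1 x : l x < c -> w1 x = 0 /\ forall i, W1 i x = 0.
 by move=> h1; rewrite /w1 /W1 hfE h1; split=> [|i]; rewrite mul1r subrr.
have H2 phi Phi : HD phi Phi -> ip W1 Phi = \int[mu]_x (gp p (w1 x) * phi x).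
 move=> pP; have [pL PL _] := pP; rewrite (_ : ip W1 Phi = ip W Phi); last first.
  apply: eq_bigr => i _; apply: Int_aeeq.
  + mfun.
  + mfun.
  + by move: (W1W i); apply: filterS => x /= h _; rewrite h.
 rewrite (weq _ _ pP); have [mph _] := pL.
 apply: Int_aeeq.
 + mfun.
 + mfun.
 + by move: w1w; apply: filterS => x /= h _; rewrite h.
have := q H1 H2; move: w1w; apply: filterS2 => x /= h1 h2 _.
by rewrite -(h1 I); mfun.
Qed.

Lemma unique_continuation w W c : HD w W -> Lq p (fun x => w x^+2) ->
 (fun x => hf nu c x*w x) = (fun=> 0) %[ae mu] ->
 (forall phi Phi, HD phi Phi -> ip W Phi = \int[mu]_x (gp p (w x) * phi x)) ->
 w = (fun=> 0) %[ae mu].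
Proof.
move=> wW w2L h0 weq; have [d0 _ _] := ucd_bounds w; set d := ucd w in d0.
have step n : (fun x => hf nu (c+n%:R*(d/4)) x*w x) = (fun=> 0) %[ae mu].
 elim: n => [|n IH]; first by rewrite mul0r addr0.
 have := uc_step wW w2L IH weq; rewrite (_ : c+n%:R*(d/4)+d/4 = c+n.+1%:R*(d/4))//.
 pos.
have := ae_nat step; apply: filterS => x /= h _.
have d4 : 0 < d/4 by lra.
pose n := (Num.truncn (`|l x-c|/(d/4))).+1.
have := h n I; rewrite hfE; suff -> : l x < c+n%:R*(d/4) by rewrite mul1r.
have q : `|l x-c|/(d/4) < n%:R by exact: truncnS_gt.
move: q; rewrite ltr_pdivrMr// => q; have := ler_norm (l x-c); lra.
Qed.

End unique_continuation.

(** * The Brezis-Kato estimate *)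

Lemma HD_tsq L u U : 0 < L -> HD u U -> HD (fun x => tsq L (u x)) (fun i x => 2*tmin L (u x)*U i x).
Proof.
move=> L0 uU; apply: (@HD_comp 2 (2*L) u U (tsq L) (fun s => 2*tmin L s)) => //.
- exact: derive_mes (is_derive_tsq L0).
- by apply: measurable_funM; [li|exact: measurable_tmin].
- move=> s; apply: le_trans (tsq_le L0 s) _; rewrite ler_wpM2r// ler_wpM2l//; exact: tmin_leL.
- move=> s; rewrite ger0_norm; last by apply: mulr_ge0 => //; exact: tmin_ge0.
 rewrite ler_wpM2l//; exact: tmin_leL.
- exact: tsq_rem.
Qed.

Lemma HD_tcb L u U : 0 < L -> HD u U -> HD (fun x => tcb L (u x)) (fun i x => 4*tmin L (u x)^+2*U i x).
Proof.
move=> L0 uU.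
have sqL s : tmin L s^+2 <= L^+2.
 by rewrite lerXn2r ?nnegrE ?tmin_ge0//; [pos|exact: tmin_leL].
apply: (@HD_comp (8*L) (4*L^+2) u U (tcb L) (fun s => 4*tmin L s^+2)) => //.
- exact: derive_mes (is_derive_tcb L0).
- by apply: measurable_funM; [mfun|apply: measurable_funX; exact: measurable_tmin].
- by move=> s; apply: le_trans (tcb_le L0 s) _; rewrite ler_wpM2r// ler_wpM2l.
- by move=> s; rewrite ger0_norm; [rewrite ler_wpM2l|pos].
- exact: tcb_rem.
Qed.

Lemma Lp_tail u e : Lq p u -> 0 < e -> exists2 K, 0 <= K &
 Lq p (fun x => if K <= `|u x| then u x else 0) /\ nq p (fun x => if K <= `|u x| then u x else 0) <= e.
Proof.
move=> uL e0; have [mu' ui] := uL.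
pose h (K : R) x : R := if K <= `|u x| then u x else 0.
have mh K : mes (h K).
 apply: measurable_fun_ifT => //.
 apply: measurable_fun_ler; mfun.
have hu K x : `|h K x| <= `|u x| by rewrite /h; case: ifP => // _; rewrite normr0.
have hL K : Lq p (h K) by apply: (Lq_le (ltW p0) (mh K) uL).
have lim : \int[mu]_x `|h n%:R x| `^ p ~>0 n.
 have [|||||_ q _] := @DCT _ _ R mu (fun n x => `|h n%:R x| `^ p) (fun=> 0) (fun x => `|u x| `^ p).
 - by move=> n; mfun.
 - li.
 - apply: aeW => x; apply: cvg_near_cst.
  exists (Num.truncn `|u x|).+1 => // n /= xn; rewrite /h ifF ?normr0 ?powR0//; first by rewrite gt_eqF.
  by apply/negbTE; rewrite -ltNge (lt_le_trans (truncnS_gt _))// ler_nat.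
 - li.
 - apply: aeW => x n /=; rewrite ger0_norm ?powR_ge0// ge0_ler_powR ?nnegrE//.
 by move: q; rewrite Int0.
have ep : 0 < e`^p by pos.
have /cvgrPdist_le/(_ _ ep)[n _ /(_ n (leqnn _))] := lim; rewrite sub0r normrN => q.
exists n%:R => //; split; first mfun.
rewrite nq_leP//; last pos.
apply: le_trans q; exact: ler_norm.
Qed.

(** Test with [tcb L w]. Where [|w| >= K] the function [w] is small in L^p and the nonlinear term is
    absorbed by the gradient of [tsq L w]; where [|w| < K] it is at most [16 K^2 |w|^p]. The
    resulting bound does not depend on [L], and Fatou concludes. *)
Lemma brezis_kato Q w W : wt_ok Q -> HD w W ->
 (forall phi Phi, HD phi Phi -> ip W Phi = \int[mu]_x (Q x*(gp p (w x) * phi x))) ->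
 Lq p (fun x => w x^+2).
Proof.
move=> [mQ Q1] wW weq; have [wL WL _] := wW; have [mw wi] := wL.
pose S : R := sob^+2; have S0 : 0 <= S by exact: sqr_ge0.
(* [D] bounds the power [p - 2] of the norm of the tail; the absorbed fraction is then
   [8 D S <= 1/2]. *)
pose D : R := (16*S+1)^-1; have SD : 0 < 16*S+1 by lra.
have D0 : 0 < D by pos.
have pp : 0 < p-2 by move: p2; lra.
pose de := D`^(p-2)^-1; have de0 : 0 < de by exact: powR_gt0.
have deD : de`^(p-2) = D by rewrite /de -powRrM mulVf ?powRr1 ?gt_eqF// ltW.
have [K K0 [hL hK]] := Lp_tail wL de0.
set h := (fun x => if K <= `|w x| then w x else 0) in hL hK.
set A := \int[mu]_x `|w x| `^ p.
have bound L : 0 < L -> \int[mu]_x `|tsq L (w x)| `^ p <= (sob*Num.sqrt (32*K^+2*A))`^p.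
 move=> L0; have gG := HD_tsq L0 wW; have fF := HD_tcb L0 wW.
 set g := (fun x => tsq L (w x)) in gG *; set G := (fun i x => _) in gG.
 set f := (fun x => tcb L (w x)) in fF; set F := (fun i x => _) in fF.
 have [gL GL _] := gG; have [fL FL _] := fF; have [mg _] := gL.
 apply: (HD_Ip_bound gG).
 have WGF : gn G^+2 = ip W F.
  rewrite gn_sq; apply: eq_bigr => i _; apply: Int_ext => x; rewrite /G /F; pos.
 have [igp _] := wt_int (conj mQ Q1) wL fL.
 have [ihg eh] := holder_sobolev hL gG.
 have pt x : `|Q x*(gp p (w x)*f x)| <= 4*(`|h x| `^ (p-2)*g x^+2)+16*K^+2 * `|w x| `^ p.
  set a := `|w x| `^ (p-2); have a0 : 0 <= a by exact: powR_ge0.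
  have r1 : 0 <= 16*K^+2 * `|w x| `^ p by pos.
  have r2 : 0 <= 4*(`|h x| `^ (p-2)*g x^+2) by exact: mulr_ge0 (ler0n _ 4) (mulr_ge0 (powR_ge0 _ _) (sqr_ge0 _)).
  apply: (@le_trans _ _ (a*(4*g x^+2))).
   rewrite normrM (le_trans (ler_piMl (normr_ge0 _) (Q1 x)))// normrM normrM -/a (ger0_norm a0).
   rewrite (_ : `|w x|*a * `|f x| = a*(`|f x| * `|w x|)); last ring.
   rewrite ler_wpM2l//; exact: tcb_tsq.
  have [Kw|Kw] := leP K `|w x|.
   have hw : h x = w x by rewrite /h Kw.
   by rewrite hw -/a in r2 *; rewrite -[X in X <= _]addr0 lerD// mulrCA.
  apply: (@le_trans _ _ (16*K^+2 * `|w x| `^ p)); last by rewrite lerDr.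
  have g2 : g x^+2 <= 4*(w x^+2*K^+2).
   apply: (@le_trans _ _ ((2 * `|w x| * `|w x|)^+2)).
    have gx : `|g x| <= 2 * `|w x| * `|w x|.
     by apply: le_trans (tsq_le L0 _) _; rewrite ler_wpM2r// ler_wpM2l// tmin_le.
    rewrite -[g x^+2]real_normK ?num_real//; exact: ler_pM.
   rewrite (_ : _^+2 = 4*(`|w x|^+2 * `|w x|^+2)); last ring.
   rewrite real_normK ?num_real// ler_wpM2l// ler_wpM2l ?sqr_ge0// -real_normK ?num_real//.
   by rewrite lerXn2r ?nnegrE// ltW.
  rewrite -(powR_p2 (w x)) -/a (_ : 16*_*_ = a*(4*(4*(w x^+2*K^+2)))); last ring.
  by rewrite ler_wpM2l// ler_wpM2l.
 have e1 : gn G^+2 <= 4*\int[mu]_x (`|h x| `^ (p-2)*g x^+2)+16*K^+2*A.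
  rewrite WGF (weq _ _ fF) -[4*_]IntZ// -[16*_*A]IntZ// -IntD; [|li|exact: igZ].
  apply: le_trans (ler_norm _) _; apply: Int_le_norm => //.
  li.
 have e2 : \int[mu]_x (`|h x| `^ (p-2)*g x^+2) <= 2*D*(S*gn G^+2).
  apply: le_trans eh _; apply: ler_wpM2r; first pos.
  rewrite ler_wpM2l// -deD ge0_ler_powR ?nnegrE ?nq_ge0//; pos.
 have DS : 8*(D*S) <= 1/2.
  have q : D*(16*S+1) = 1 by rewrite /D mulVf// gt_eqF.
  rewrite (_ : D*(16*S+1) = 16*(D*S)+D) in q; last ring.
  clear -q D0; move: q D0; move: (D*S) => y1; lra.
 have G2 : 0 <= gn G^+2 by pos.
 have e3 : 8*(D*S)*gn G^+2 <= 1/2*gn G^+2 by rewrite ler_wpM2r.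
 rewrite -[gn G]ger0_norm ?gn_ge0// -sqrtr_sqr; apply: ler_wsqrtr.
 move: e1 e2 e3; rewrite (_ : 2*D*(S*gn G^+2) = 1/4*(8*(D*S)*gn G^+2)); last by field.
 move: (gn G^+2) (8*_*_) (\int[mu]_x (_*_)) (K^+2) => y1 y2 y3 y4; move: (y4*A) => y5; clear; lra.
set CC := (_*_)`^p in bound.
have [||||||i le] := @Fatou _ _ R mu (fun n x => `|tsq n.+1%:R (w x)| `^ p) (fun x => `|w x^+2| `^ p) CC.
- by move=> n; have [[_ q] _ _] := HD_tsq (ltr0Sn R n) wW.
- by mfun.
- li.
- apply: aeW => x; apply: cvg_near_cst.
 exists (Num.truncn `|w x|).+1 => // n /= xn; rewrite tsq_small; first by rewrite normrX real_normK ?num_real.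
 apply: ltW; rewrite (lt_le_trans (truncnS_gt _))// ler_nat; exact: leq_trans xn _.
- near=> n; exact: bound (ltr0Sn R n).
- li.
by split => //; mfun.
Unshelve. all: by end_near. Qed.

Lemma negative_weight_trivial w W : HD w W ->
 (forall phi Phi, HD phi Phi -> ip W Phi = \int[mu]_x (- 1*(gp p (w x) * phi x))) ->
 w = (fun=> 0) %[ae mu].
Proof.
move=> wW weq; have [wL WL _] := wW; have [mw wi] := wL.
have e := weq _ _ wW.
have e2 : \int[mu]_x (- 1*(gp p (w x)*w x)) = - \int[mu]_x `|w x| `^ p.
 by rewrite -IntN//; apply: Int_ext => x; rewrite gpE// mulN1r.
have I0 : 0 <= \int[mu]_x `|w x| `^ p by apply: Int_ge0 => x.
have := ip_ge0 W; rewrite e e2 => h.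
have z : \int[mu]_x `|w x| `^ p = 0 by pos.
have := Int_eq0 wi (fun x => powR_ge0 _ _) z; apply: filterS => x /= h1 hT.
apply/eqP; rewrite -normr_eq0; apply/eqP; exact: (powR_eq0_eq0 (h1 hT)).
Qed.

(** * Triviality of solutions for a half-space weight *)

Section half_space.
Variable nu : E.
Hypothesis nu1 : lin nu nu = 1.
Local Notation l := (lin nu).

Definition half_weight c : E -> R := fun x => 1-2*hf nu c x.

Lemma half_weight_ok c : wt_ok (half_weight c).
Proof.
split; first by apply: measurable_funB; [mfun|apply: measurable_funM; [exact: measurable_cst|exact: mes_hf]].
move=> x; rewrite /half_weight hfE; case: (_ < _); rewrite ?mulr1 ?mulr0 ?subr0 ?normr1//.
rewrite (_ : 1-2 = - 1 :> R) ?normrN ?normr1//; pos.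
Qed.

(** Discrete Pohozaev-type identity. Translating by [h] against the normal changes the weighted L^p
    integral by twice the mass of the strip. To first order this change is [p] times the pairing of
    the nonlinearity with the increment of [w]. That pairing is o(h), as the equation controls it up
    to an L^2-continuous translate. *)
Lemma half_strip c w W : HD w W ->
 (forall phi Phi, HD phi Phi -> ip W Phi = \int[mu]_x (half_weight c x*(gp p (w x) * phi x))) ->
 n.+1%:R*\int[mu]_x (sig nu (c-hseq n) c x * `|w x| `^ p) ~>0 n.
Proof.
move=> wW weq; have [wL WL _] := wW; have [mw wi] := wL; have [mQ Q1] := half_weight_ok c.
have w2L := brezis_kato (half_weight_ok c) wW weq.
pose g x := gp p (w x); have gL : L2 g by exact: pow_gp_L2.
pose q x := half_weight c x*g x.
have qL : L2 q by have [] := L2_mulb gL mQ Q1.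
have hc : (fun n => - hseq n*:nu) @ \oo --> (0 : E).
 rewrite -[X in _ --> X](scale0r nu) -oppr0; apply: cvgZr_tmp => //; first by apply: cvgN; exact: hseq_cvg.
have cg := L2_shift_cvg gL hc; have cq := L2_shift_cvg qL hc.
pose C : R := N%:R*gn W; have C0 : 0 <= C by apply: mulr_ge0 => //; exact: gn_ge0.
have main n : `|n.+1%:R*\int[mu]_x (sig nu (c-hseq n) c x * `|w x| `^ p)| <=
  C * p*(n2 (fun x => q (x + - hseq n*:nu)-q x)+n2 (fun x => g (x + - hseq n*:nu)-g x)).
 set h : R := hseq n; have h0 : 0 < h by rewrite invr_gt0 ltr0n.
 have hn : n.+1%:R*h = 1 by rewrite /h /hseq mulfV// pnatr_eq0.
 pose e : E := - h*:nu; have eN : `|e| <= h.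
  by rewrite normrZ normrN gtr0_norm// ler_piMr ?nu_norm// ltW.
 pose D x := w (x+e)-w x; have [DL Dn] := HD_shiftv e wW.
 have Dn' : n2 D <= C*h.
  apply: le_trans Dn _; rewrite -mulrA ler_wpM2l// mulrC ler_wpM2l ?gn_ge0//.
 have K x : x+e + - e = x by rewrite addrK.
 have qsL : L2 (fun x => q (x+e)) by li.
 have gsL : L2 (fun x => g (x+e)) by li.
 have DsL : L2 (fun x => D (x + - e)) by li.
 have qD : ig (fun x => q x*D x) by li.
 have qsD : ig (fun x => q (x+e)*D x) by li.
 (* Tested with [w(x+e) - w(x-e)], the gradient term is 0 because the two translates pair equally
    with [W]; a shift of variables rewrites the other side. *)
 have sym : \int[mu]_x (q x*D x)+\int[mu]_x (q (x+e)*D x) = 0.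
  have i1 : ig (fun x => q x*D (x + - e)) by li.
  have e1 : \int[mu]_x (q (x+e)*D x) = \int[mu]_x (q x*D (x + - e)).
   by rewrite -(Int_shift e i1); apply: Int_ext => x; rewrite K.
  have pP := HDB (HD_shift e wW) (HD_shift (- e) wW).
  have := weq _ _ pP; rewrite e1 -IntD//.
  rewrite (_ : \int[mu]_x _ = \int[mu]_x (q x*D x+q x*D (x + - e))); last first.
   apply: Int_ext => x; rewrite /D /q /g subrK; pos.
  move=> <-; rewrite /ip big1// => i _.
  have j1 : ig (fun x => W i x*W i (x+e)) by apply: L2_mul => //; exact: L2_shift.
  have j2 : ig (fun x => W i x*W i (x + - e)) by apply: L2_mul => //; exact: L2_shift.
  rewrite (_ : \int[mu]_x _ = \int[mu]_x (W i x*W i (x+e))-\int[mu]_x (W i x*W i (x + - e))).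
   rewrite -(Int_shift e j2) (_ : \int[mu]_x (W i (x+e)*_) = \int[mu]_x (W i x*W i (x+e))) ?subrr//.
   by apply: Int_ext => x; rewrite K mulrC.
  rewrite -IntB//; apply: Int_ext => x; pos.
 have b1 : `|\int[mu]_x (q x*D x)| <= n2 (fun x => q (x+e)-q x)*(C*h).
  have i1 : L2 (fun x => q (x+e)-q x) by exact: L2B.
  have cs := CS i1 DL.
  have E1 : \int[mu]_x ((q (x+e)-q x)*D x) = - (2*\int[mu]_x (q x*D x)).
   transitivity (\int[mu]_x (q (x+e)*D x)-\int[mu]_x (q x*D x)); last first.
    exact: add0_sub sym.
   rewrite -IntB//; apply: Int_ext => x; ring.
  rewrite E1 normrN normrM ger0_norm// in cs.
  exact: double_le (normr_ge0 _) (ler_wpM2l (n2_ge0 _ _) Dn') cs.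
 have wsL : Lq p (fun x => w (x+e)) by have [] := HD_shift e wW.
 have [_ wsi] := wsL.
 have Qi : ig (fun x => half_weight c x * `|w x| `^ p) by exact: wt_pow (half_weight_ok c) wL.
 have Qsi : ig (fun x => half_weight c x * `|w (x+e)| `^ p) by exact: wt_pow (half_weight_ok c) wsL.
 (* After moving the translation onto the weight, it changes only between the hyperplane and its
    translate, where it jumps by 2. *)
 have E2 : \int[mu]_x (half_weight c x * `|w (x+e)| `^ p)-\int[mu]_x (half_weight c x * `|w x| `^ p) =
   2*\int[mu]_x (sig nu (c-h) c x * `|w x| `^ p).
  have si : ig (fun x => sig nu (c-h) c x * `|w x| `^ p).
   apply: (ig_le _ wi); first by apply: measurable_funM; [exact: mes_sig|mfun].
   move=> x; rewrite normrM -[X in _ <= X]mul1r; apply: ler_pM => //; first exact: sig01.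
   by rewrite ger0_norm.
  have sE : ig (fun x => half_weight c (x + - e) * `|w x| `^ p).
   have := ig_shift (- e) Qsi; rewrite (_ : (fun x => _) = fun x => half_weight c (x + - e) * `|w x| `^ p)//.
   by apply/funext => x; rewrite subrK.
  have -> : \int[mu]_x (half_weight c x * `|w (x+e)| `^ p) = \int[mu]_x (half_weight c (x + - e) * `|w x| `^ p).
   by rewrite -(Int_shift e sE); apply: Int_ext => x; rewrite K.
  rewrite -IntB// -IntZ//; apply: Int_ext => x.
  have -> : half_weight c (x + - e) = 1-2*hf nu (c-h) x.
   rewrite /half_weight !hfE /e scaleNr opprK lin_shift//; congr (_ - _*(nat_of_bool _)%:R).
   by rewrite -ltrBrDr.
  rewrite sig_hf /half_weight; last by rewrite gerBl ltW.
  move: (hf _ _ _) (hf _ _ _) (`|_| `^ _) => y1 y2 y3; ring.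
 have b2 : `|(\int[mu]_x (half_weight c x * `|w (x+e)| `^ p)-\int[mu]_x (half_weight c x * `|w x| `^ p)) -
   p*\int[mu]_x (q x*D x)| <= p*(n2 (fun x => g (x+e)-g x)*(C*h)).
  have i1 : L2 (fun x => g (x+e)-g x) by exact: L2B.
  rewrite -IntB// -IntZ// -IntB; [|li|li].
  have i2 : ig (fun x => p * `|(g (x+e)-g x)*D x|) by li.
  apply: (@le_trans _ _ (\int[mu]_x (p * `|(g (x+e)-g x)*D x|))).
   apply: Int_le_norm => //; first by apply: igB; [li|li].
   move=> x; rewrite (_ : _ - _ = half_weight c x*(`|w (x+e)| `^ p-`|w x| `^ p-p*(g x*(w (x+e)-w x)))); last first.
    rewrite /q /D; ring.
   rewrite normrM (le_trans (ler_piMl (normr_ge0 _) (Q1 x)))//.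
   by apply: le_trans (powR_convex_gap _ _ p2) _; rewrite [`|_*D x|]normrM.
  rewrite IntZ; last by apply: ig_norm; exact: L2_mul.
  apply: (ler_wpM2l (ltW p0)); apply: (le_trans (CS_abs i1 DL)).
  exact: (ler_wpM2l (n2_ge0 mu _) Dn').
 have s0 : 0 <= \int[mu]_x (sig nu (c-h) c x * `|w x| `^ p).
  by apply: Int_ge0 => x; apply: mulr_ge0.
 rewrite E2 in b2; rewrite normrM !ger0_norm//.
 have p01 : 0 <= p := ltW p0.
 set I := \int[mu]_x (sig _ _ _ _*_) in s0 b2 *; set J := \int[mu]_x (q x*D x) in b1 b2.
 set a := n2 (fun x => q (x+e)-q x) in b1 *; set b := n2 (fun x => g (x+e)-g x) in b2 *.
 have I2 : I <= C * p*(a+b)*h.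
  have pJ : `|p*J| <= p*(a*(C*h)) by rewrite normrM (ger0_norm p01) ler_wpM2l.
  have := ler_normD (2*I-p*J) (p*J); rewrite subrK ger0_norm; last pos.
  rewrite (_ : C * p*(a+b)*h = p*(a*(C*h))+p*(b*(C*h))); last ring.
  exact: double_le_add s0 pJ b2.
 apply: (@le_trans _ _ (n.+1%:R*(C * p*(a+b)*h))); first by rewrite ler_wpM2l.
 by rewrite mulrCA hn mulr1.
apply: (cvg0_le main).
rewrite [X in _ --> X](_ : 0 = C * p*(0+0)); last pos.
apply: cvgM; cv.
Qed.

(** The strip estimate makes the part of [w] below the hyperplane a legitimate test function; there
    the weight is -1, so it is 0. Then the weight may be replaced by 1 and unique continuation
    applies. *)
Lemma half_space_trivial c w W : HD w W ->
 (forall phi Phi, HD phi Phi -> ip W Phi = \int[mu]_x (half_weight c x*(gp p (w x) * phi x))) ->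
 w = (fun=> 0) %[ae mu].
Proof.
move=> wW weq; have [wL WL _] := wW; have [mw wi] := wL; have [mQ Q1] := half_weight_ok c.
have w2L := brezis_kato (half_weight_ok c) wW weq.
have hH := trace_cut nu1 wW (half_strip wW weq).
have hi : ig (fun x => hf nu c x * `|w x| `^ p).
 apply: (ig_le _ wi); first by apply: measurable_funM; [exact: mes_hf|mfun].
 move=> x; rewrite normrM -[X in _ <= X]mul1r; apply: ler_pM => //; first exact: hf01.
 by rewrite ger0_norm.
have hpos x : 0 <= hf nu c x * `|w x| `^ p by pos.
have z : \int[mu]_x (hf nu c x * `|w x| `^ p) = 0.
 have e := weq _ _ hH.
 have e2 : \int[mu]_x (half_weight c x*(gp p (w x)*(hf nu c x*w x))) = - \int[mu]_x (hf nu c x * `|w x| `^ p).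
  rewrite -IntN//; apply: Int_ext => x; rewrite [gp _ _*_]mulrCA gpE//.
  rewrite /half_weight hfE; case: (_ < _); rewrite /= ?mul0r ?mulr0 ?oppr0// mulr1; ring.
 have e3 : 0 <= ip W (fun i x => hf nu c x*W i x).
  apply: sumr_ge0 => i _; apply: Int_ge0 => x; rewrite mulrCA -expr2.
  pos.
 have I0 := Int_ge0 mu hpos.
 pos.
have hw0 : (fun x => hf nu c x*w x) = (fun=> 0) %[ae mu].
 have := Int_eq0 hi hpos z; apply: filterS => x /= h1 hT; have := h1 hT; rewrite hfE.
 case: (_ < _); rewrite ?mul0r// !mul1r => /powR_eq0_eq0 h.
 by apply/eqP; rewrite -normr_eq0 h.
apply: (unique_continuation nu1 wW w2L hw0) => phi Phi pP; rewrite (weq _ _ pP).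
have [pL _ _] := pP; have [mph _] := pL; have mgw := mes_gp mw.
apply: Int_aeeq.
- mfun.
- mfun.
- move: hw0; apply: filterS => x /= h hT; have := h hT; rewrite /half_weight hfE.
 by case: (_ < _); rewrite /= ?mulr0 ?subr0 ?mul1r// => ->; rewrite gp0 mul0r mulr0.
Qed.

End half_space.

(** * Cut-offs of cubes and localised testing *)

Lemma mult_okM (K L : R) th dth et det : 0 <= K -> 0 <= L -> mult_ok K th dth -> mult_ok L et det ->
 mult_ok (6*(K*L)) (fun x => th x*et x) (fun i x => dth i x*et x+th x * det i x).
Proof.
move=> K0 L0 [mt md tK dK tR] [me mde eL dL eR].
have KL : 0 <= K*L by pos.
(* Lipschitz bound along the axes: from the derivative and remainder for [|h| <= 1], from the sup
   bound otherwise. *)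
have incr (B : R) (f : E -> R) (df : 'I_N -> E -> R) : 0 <= B -> (forall x, `|f x| <= B) -> (forall i x, `|df i x| <= B) ->
  (forall i x h, `|f (x+h*:ebasis i)-f x-h * df i x| <= B*h^+2) ->
  forall i x h, `|f (x+h*:ebasis i)-f x| <= 2*B * `|h|.
 move=> B0 fB dB fR i x h; have [h1|h1] := leP `|h| 1.
  have -> : f (x+h*:ebasis i)-f x = (f (x+h*:ebasis i)-f x-h * df i x)+h * df i x by pos.
  apply: le_trans (ler_normD _ _) _.
  have q1 : B*h^+2 <= B * `|h|.
   by rewrite ler_wpM2l// -real_normK ?num_real// ler_piMl.
  have q2 : `|h * df i x| <= B * `|h| by rewrite normrM mulrC ler_wpM2r.
  have := fR i x h; lra.
 apply: le_trans (ler_normB _ _) _.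
 have q : 2*B*1 <= 2*B * `|h| by apply: ler_wpM2l; [pos|pos].
 have := fB (x+h*:ebasis i); have := fB x; lra.
have it := incr K th dth K0 tK dK tR; have ie := incr L et det L0 eL dL eR.
split.
- mfun.
- move=> i; apply: measurable_funD; mfun.
- move=> x; rewrite normrM; apply: (@le_trans _ _ (K*L)); first exact: ler_pM.
 lra.
- move=> i x; apply: le_trans (ler_normD _ _) _; rewrite !normrM.
 have q1 : `|dth i x| * `|et x| <= K*L by exact: ler_pM.
 have q2 : `|th x| * `|det i x| <= K*L by exact: ler_pM.
 lra.
- move=> i x h; set y := x+h*:ebasis i.
 have -> : th y*et y-th x*et x-h*(dth i x*et x+th x * det i x) = (th y-th x-h * dth i x)*et x+(th x*(et y-et x-h * det i x)+(th y-th x)*(et y-et x)) by pos.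
 have q1 : `|(th y-th x-h * dth i x)*et x| <= K*h^+2*L.
  by rewrite normrM; apply: ler_pM => //; mfun.
 have q2 : `|th x*(et y-et x-h * det i x)| <= K*(L*h^+2).
  by rewrite normrM; apply: ler_pM => //; mfun.
 have q3 : `|(th y-th x)*(et y-et x)| <= (2*K * `|h|)*(2*L * `|h|).
  by rewrite normrM; apply: ler_pM => //; [exact: it|exact: ie].
 have e3 : (2*K * `|h|)*(2*L * `|h|) = 4*(K*L*h^+2).
  rewrite -[h^+2]real_normK ?num_real; ring.
 rewrite e3 in q3; apply: le_trans (ler_normD _ _) _.
 apply: le_trans (lerD (lexx _) (ler_normD _ _)) _.
 pos.
Qed.

Lemma lin_eb1 (i : 'I_N) : lin (ebasis i : E) (ebasis i) = 1.
Proof. by rewrite lin_ebasis mxE !eqxx. Qed.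

Lemma lin_eb_coord (i : 'I_N) (x : E) : lin (ebasis i) x = x ord0 i.
Proof.
rewrite /lin (bigD1 i)//= big1 ?addr0; first by rewrite mxE !eqxx mul1r.
by move=> j ji; rewrite mxE (negPf ji) mul0r.
Qed.

Lemma cut_coord (y : E) r i (b : bool) : 0 < r -> exists (K : R) (th : E -> R) (dth : 'I_N -> E -> R), [/\ 0 <= K, mult_ok K th dth,
 forall x : E, (-1)^+b*(x ord0 i-y ord0 i) <= r -> th x = 1 &
 forall x : E, 2*r <= (-1)^+b*(x ord0 i-y ord0 i) -> th x = 0 /\ forall j, dth j x = 0].
Proof.
move=> r0; pose k : R := - (4/r*(-1)^+b); pose c : R := 8+4/r*(-1)^+b*y ord0 i.
have [K K0 hK] := mult_lin (lin_eb1 i) (D3_spline k c); have [m1 _] := hK 0.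
have kE x : k*(lin (ebasis i) x-0)+c = 4/r*(2*r-(-1)^+b*(x ord0 i-y ord0 i)).
 rewrite lin_eb_coord /k /c; field; pos.
exists K; eexists; eexists; split; [exact: K0|exact: m1| |] => x hx /=; rewrite kE.
 have q : 4 <= 4/r*(2*r-(-1)^+b*(x ord0 i-y ord0 i)).
  rewrite mulrAC ler_pdivlMr; move: hx; move: (_*_) => t; lra.
 by have [-> _ _ _] := S_ge4 q.
have q : 4/r*(2*r-(-1)^+b*(x ord0 i-y ord0 i)) <= 0.
 apply: mulr_ge0_le0; pos.
have [-> -> _ _] := S_le0 q; split=> // j; pos.
Qed.

(** Balls are cubes, so the cut-off is the product of one-variable steps over the [2 N] faces. *)
Lemma cutoff_ex (y : E) r : 0 < r -> exists (K : R) (th : E -> R) (dth : 'I_N -> E -> R), [/\ 0 <= K, mult_ok K th dth,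
 forall x : E, `|x-y| <= r -> th x = 1 & forall x : E, 2*r <= `|x-y| -> th x = 0 /\ forall i, dth i x = 0].
Proof.
move=> r0.
have main (s : seq ('I_N*bool)) : exists (K : R) (th : E -> R) (dth : 'I_N -> E -> R), [/\ 0 <= K, mult_ok K th dth,
  forall x : E, `|x-y| <= r -> th x = 1 &
  forall (x : E) j, j \in s -> 2*r <= (-1)^+j.2*(x ord0 j.1-y ord0 j.1) -> th x = 0 /\ forall i, dth i x = 0].
 elim: s => [|[i b] s [K [th [dth [K0 tok t1 t0]]]]].
  exists 1, (fun=> 1), (fun _ _ => 0); split=> //; split=> // [x|i x|i x h]; rewrite ?normr1 ?normr0//.
  by rewrite subrr mulr0 subrr normr0 mul1r sqr_ge0.
 have [L [et [det [L0 eok e1 e0]]]] := cut_coord y i b r0.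
 exists (6*(L*K)), (fun x => et x*th x), (fun j x => det j x*th x+et x * dth j x); split.
 - pos.
 - exact: mult_okM.
 - move=> x xr; rewrite t1// e1 ?mulr1//; apply: le_trans xr.
  apply: le_trans (coord_norm _ i); rewrite [(x-y) _ _]mxE [(- y) _ _]mxE.
  case: b {e1 e0 eok} => /=; rewrite ?expr1 ?mulN1r ?expr0 ?mul1r; [rewrite -normrN|]; exact: ler_norm.
 - move=> x j; rewrite in_cons => /orP[/eqP -> /= h|js h].
   by have [-> d0] := e0 x h; rewrite mul0r; split=> // k; rewrite d0 !mul0r addr0.
  by have [-> d0] := t0 x j js h; rewrite mulr0; split=> // k; rewrite d0 !mulr0 addr0.
have [K [th [dth [K0 tok t1 t0]]]] := main (enum {: 'I_N*bool}).
exists K, th, dth; split=> // x xr.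
have [i hi] : exists i, 2*r <= `|(x-y) ord0 i|.
 apply: contrapT => h; have : `|x-y| < 2*r.
  apply: norm_lt_coord => [|j]; first pos.
  by rewrite ltNge; apply/negP => q; apply: h; exists j.
 pos.
rewrite [(x-y) _ _]mxE [(- y) _ _]mxE in hi.
have [s0|s0] := leP 0 (x ord0 i-y ord0 i).
 by apply: (t0 x (i, false)); rewrite ?mem_enum//= mul1r -[X in _ <= X]ger0_norm.
by apply: (t0 x (i, true)); rewrite ?mem_enum//= mulN1r -[X in _ <= X]ltr0_norm.
Qed.

Section localization.
Variables (K M : R) (th : E -> R) (dth : 'I_N -> E -> R).
Hypotheses (K0 : 0 <= K) (tok : mult_ok K th dth) (dM : forall i, vanish_out M (dth i)).
Variables (v : E -> R) (V : 'I_N -> E -> R).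
Hypothesis vV : HD v V.
Let c2 := n2 (cut M v).

Lemma loc_dth i : L2 (fun x => dth i x * v x) /\ n2 (fun x => dth i x * v x) <= K*c2.
Proof.
have [vL _ _] := vV; have [_ md _ dK _] := tok.
have [h1 h2] := L2_mulb (Lp_L2cut M vL) (md i) (dK i).
rewrite (_ : (fun x => dth i x * v x) = fun x => dth i x*cut M v x)//.
by apply/funext => x; rewrite cutE; case: ltP => // xM; rewrite dM// !mul0r.
Qed.

Definition loc1 i x := th x*V i x+dth i x * v x.
Definition loc2 i x := th x * loc1 i x+dth i x*(th x * v x).

Lemma loc1_HD : HD (fun x => th x * v x) loc1.
Proof. by apply: (HD_mul vV tok) => i; have [] := loc_dth i. Qed.

Lemma loc_dth2 i : L2 (fun x => dth i x*(th x * v x)) /\ n2 (fun x => dth i x*(th x * v x)) <= K*(K*c2).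
Proof.
have [h1 h2] := loc_dth i; have [mt _ tK _ _] := tok.
have [h3 h4] := L2_mulb h1 mt tK.
rewrite (_ : (fun x => dth i x*(th x * v x)) = fun x => th x*(dth i x * v x)); last first.
 apply/funext => x; pos.
by split=> //; apply: le_trans h4 _; rewrite ler_wpM2l.
Qed.

Lemma loc2_HD : HD (fun x => th x*(th x * v x)) loc2.
Proof. by apply: (HD_mul loc1_HD tok) => i; have [] := loc_dth2 i. Qed.

Lemma loc2_gn : gn loc2 <= N%:R*(K^+2*(gn V+2*c2)).
Proof.
have [_ VL _] := vV; have [_ L1 _] := loc1_HD; have [mt _ tK _ _] := tok.
apply: gn_le => [|i].
 pos.
have [h1 h2] := L2_mulb (VL i) mt tK.
have [h3 h4] := loc_dth i.
have [h5 h6] := L2_mulb (L1 i) mt tK.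
have [h7 h8] := loc_dth2 i.
have q1 : n2 (loc1 i) <= K*gn V+K*c2.
 apply: le_trans (n2D h1 h3) _; apply: lerD => //.
 by apply: le_trans h2 _; rewrite ler_wpM2l// n2_le_gn.
apply: le_trans (n2D h5 h7) _.
have q2 : K*n2 (loc1 i) <= K*(K*gn V+K*c2) by rewrite ler_wpM2l.
rewrite (_ : K^+2*_ = K*(K*gn V+K*c2)+K*(K*c2)); last pos.
pos.
Qed.

(** Pointwise, the squared gradient of [th v] is the product of the gradients of [v] and [th^2 v]
    plus [v^2] times that of [th]. *)
Lemma loc_identity Q : wt_ok Q ->
 gn loc1^+2 <= dJ (fun=> 0) Q v V (fun x => th x*(th x * v x)) loc2 +
  \int[mu]_x (Q x*(`|v x| `^ p*th x^+2))+N%:R*(K*c2)^+2.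
Proof.
move=> Qok; have [vL VL _] := vV; have [_ L1 _] := loc1_HD; have [_ LL2 _] := loc2_HD.
have dthL i := (loc_dth i).1.
have e1 : gn loc1^+2 = ip V loc2+\sum_i n2 (fun x => dth i x * v x)^+2.
 rewrite gn_sqE -big_split; apply: eq_bigr => i _ /=; rewrite !n2_sq.
 have i1 : ig (fun x => V i x * loc2 i x) by li.
 have [_ i2] := dthL i.
 rewrite -IntD//; apply: Int_ext => x; rewrite /loc2 /loc1; pos.
have e2 : \int[mu]_x (Q x*(gp p (v x)*(th x*(th x * v x)))) = \int[mu]_x (Q x*(`|v x| `^ p*th x^+2)).
 apply: Int_ext => x; rewrite -gpE//; pos.
rewrite e1 dJ_pot0 e2 subrK lerD2l.
apply: (@le_trans _ _ (\sum_(i < N) (K*c2)^+2)); last by rewrite sumr_const card_ord mulr_natl.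
apply: ler_sum => i _; have [_ h] := loc_dth i.
apply: lerXn2r; rewrite ?nnegrE ?n2_ge0//; apply: mulr_ge0 => //; pos.
Qed.

End localization.

Definition bal (y : E) (r : R) : set E := [set x | `|x-y| < r].
Definition mass (v : E -> R) y r : R := \int[mu]_x (\1_(bal y r) x * `|v x| `^ p).

Lemma balE y r : bal y r = ball y r.
Proof. by apply/funext => x; apply/propext; rewrite -ball_normE /= distrC. Qed.

Lemma indic_bal y r x : \1_(bal y r) x = (`|x-y| < r)%R%:R :> R.
Proof. by rewrite indicE; congr ((nat_of_bool _)%:R); apply/idP/idP; rewrite inE. Qed.

Lemma mes_bal y r : mes (\1_(bal y r) : E -> R).
Proof. apply: measurable_indic; rewrite balE; exact: measurable_ballE. Qed.
#[local] Hint Resolve mes_bal : mes.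

Lemma mass_ig v y r : Lq p v -> ig (fun x => \1_(bal y r) x * `|v x| `^ p).
Proof.
move=> [mv vi]; apply: (ig_le _ vi); first by apply: measurable_funM; mfun.
move=> x; rewrite normrM [`|_ `^ _|]ger0_norm ?powR_ge0// indic_bal.
by case: (_ < _); rewrite ?normr1 ?normr0 ?mul1r ?mul0r.
Qed.

Lemma mass_ge0 v y r : 0 <= mass v y r.
Proof. apply: Int_ge0 => x; pos. Qed.

Lemma mass_mono v y y' r r' : Lq p v -> (forall x, `|x-y| < r -> `|x-y'| < r') -> mass v y r <= mass v y' r'.
Proof.
move=> vL sub; apply: Int_le; [exact: mass_ig|exact: mass_ig|move=> x].
rewrite ler_wpM2r ?powR_ge0// !indic_bal; case: (ltP `|x-y| r) => // /sub -> //.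
Qed.

Lemma mass_le v y r : Lq p v -> mass v y r <= \int[mu]_x `|v x| `^ p.
Proof.
move=> vL; have [_ vi] := vL; apply: Int_le => // [|x]; first exact: mass_ig.
by rewrite ler_piMl ?powR_ge0// indic_bal.
Qed.

(** Smallness threshold for a local L^p norm: below it, Hölder and Sobolev bound the nonlinear term
    by half of the gradient term. *)
Definition reg_const : R := (4*sob^+2+1)^-1`^(p-2)^-1.

Lemma reg_const_gt0 : 0 < reg_const.
Proof. by rewrite powR_gt0// invr_gt0 ltr_wpDl// mulr_ge0// sqr_ge0. Qed.

Lemma reg_constE : 2*reg_const`^(p-2)*sob^+2 <= 1/2.
Proof.
have pp : p-2 != 0 by rewrite subr_eq0 gt_eqF.
have S0 : 0 <= sob^+2 by pos.
rewrite -powRrM mulVf// powRr1; last by rewrite invr_ge0; lra.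
move: (sob^+2) S0 => S S0; rewrite mulrAC ler_pdivrMr; lra.
Qed.

(** * Vanishing of small masses for Palais-Smale sequences that tend to 0 locally in L^2 *)

Section vanishing.
Variables (Q_ v_ : nat -> E -> R) (V_ : nat -> 'I_N -> E -> R) (C : R).
Hypotheses (vV : forall k, HD (v_ k) (V_ k)) (VC : forall k, gn (V_ k) <= C).
Hypotheses (Qk : forall k, wt_ok (Q_ k)) (vPS : PS (fun=> 0) Q_ v_ V_).
Hypothesis v0 : forall M, n2 (cut M (v_ k)) ~>0 k.

Lemma vanish_err (K M : R) th dth : 0 <= K -> mult_ok K th dth -> (forall i, vanish_out M (dth i)) ->
 exists2 r : nat -> R, r k ~>0 k &
  forall k, gn (loc1 th dth (v_ k) (V_ k))^+2 <= \int[mu]_x (Q_ k x*(`|v_ k x| `^ p*th x^+2))+r k.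
Proof.
move=> K0 tok dM; have [eta e0 he] := vPS.
exists (fun k => `|eta k|*(N%:R*(K^+2*(C+2*n2 (cut M (v_ k)))))+N%:R*(K*n2 (cut M (v_ k)))^+2).
 suff lim : `|eta k|*(N%:R*(K^+2*(C+2*n2 (cut M (v_ k)))))+N%:R*(K*n2 (cut M (v_ k)))^+2 @[k --> \oo]
   --> `|0 : R|*(N%:R*(K^+2*(C+2*0)))+N%:R*(K*0)^+2.
  by move: lim; rewrite normr0 mul0r mulr0 expr0n mulr0 addr0.
 have c1 : K*n2 (cut M (v_ k)) @[k --> \oo] --> K*0 by apply: cvgM; cv.
 apply: cvgD.
  apply: cvgM; first by apply: cvg_norm.
  apply: cvgM; first cv.
  apply: cvgM; first cv.
  by apply: cvgD; [cv|apply: cvgM; [exact: cvg_cst|exact: v0]].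
 by apply: cvgM; [exact: cvg_cst|exact: (cvg_fun (@exprn_continuous R 2) c1)].
move=> k; apply: le_trans (loc_identity K0 tok dM (vV k) (Qk k)) _.
rewrite [X in X + _]addrC -addrA lerD2l lerD2r.
apply: le_trans (ler_norm _) _; apply: le_trans (he _ _ _ (loc2_HD K0 tok dM (vV k))) _.
apply: (@le_trans _ _ (`|eta k|*gn (loc2 th dth (v_ k) (V_ k)))).
 by rewrite ler_wpM2r ?gn_ge0// ler_norm.
rewrite ler_wpM2l//; apply: le_trans (loc2_gn K0 tok dM (vV k)) _.
by rewrite ler_wpM2l// ler_wpM2l ?sqr_ge0// lerD2r.
Qed.

(** In the localised identity the nonlinear term is absorbed, the mass in the double ball being
    below the threshold; the gradient of [th v_] then tends to 0, and Sobolev gives the mass. *)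
Lemma mass_vanish y r : 0 < r -> (forall k, mass (v_ k) y (2*r) <= reg_const`^p) ->
 mass (v_ k) y r ~>0 k.
Proof.
move=> r0 small; have [K [th [dth [K0 tok t1 t0]]]] := cutoff_ex y r0.
pose M := `|y|+2*r.
have far x : M <= `|x| -> 2*r <= `|x-y|.
 rewrite /M => h; have := lerB_dist x y; lra.
have dM i : vanish_out M (dth i) by move=> x /far /t0[].
have [e e0 he] := vanish_err K0 tok dM.
have pp : 0 < p-2 by move: p2; lra.
have rc0 : 0 <= reg_const := ltW reg_const_gt0.
have b1 k : gn (loc1 th dth (v_ k) (V_ k))^+2 <= 2*e k.
 have [vL _ _] := vV k; have [mQ Q1] := Qk k; have lH := loc1_HD tok dM (vV k); have [lL _ _] := lH.
 pose vb x := \1_(bal y (2*r)) x * v_ k x.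
 have vbL : Lq p vb.
  apply: (Lq_le (ltW p0) _ vL); first by apply: measurable_funM; [mfun|case: vL].
  by move=> x; rewrite /vb indic_bal; case: (_ < _); rewrite ?mul1r// mul0r normr0.
 have vbN : nq p vb <= reg_const.
  rewrite nq_leP//; apply: le_trans (small k); apply: eqle.
  apply: Int_ext => x; rewrite /vb indic_bal; case: (_ < _); rewrite ?mul1r// !mul0r normr0 powR0//.
  pos.
 have [i1 h1] := holder_sobolev vbL lH.
 have i2 : ig (fun x => Q_ k x*(`|v_ k x| `^ p*th x^+2)).
  have [mt _ tK _ _] := tok.
  have q : ig (fun x => K^+2 * `|v_ k x| `^ p) by li.
  apply: (ig_le _ q).
   apply: measurable_funM => //; apply: measurable_funM; last mfun.
   mfun.
  move=> x; rewrite normrM (le_trans (ler_piMl (normr_ge0 _) (Q1 x)))// normrM ger0_norm ?powR_ge0// mulrC.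
  by rewrite ler_wpM2r ?powR_ge0// normrX lerXn2r.
 have q1 : \int[mu]_x (Q_ k x*(`|v_ k x| `^ p*th x^+2)) <= \int[mu]_x (`|vb x| `^ (p-2)*(th x * v_ k x)^+2).
  apply: Int_le => // x; rewrite /vb indic_bal; have [h|h] := ltP `|x-y| (2*r); last first.
   by have [-> _] := t0 x h; rewrite !mul0r expr0n !mulr0.
  rewrite mul1r exprMn [X in _ <= X](_ : _ = `|v_ k x| `^ (p-2) * v_ k x^+2*th x^+2); last ring.
  rewrite powR_p2 -[X in _ <= X]mul1r; apply: ler_wpM2r; first by apply: mulr_ge0; [li|pos].
  exact: le_trans (ler_norm _) (Q1 x).
 have q2 : \int[mu]_x (`|vb x| `^ (p-2)*(th x * v_ k x)^+2) <= 1/2*gn (loc1 th dth (v_ k) (V_ k))^+2.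
  apply: le_trans h1 _; rewrite mulrA; apply: ler_wpM2r; first pos.
  apply: le_trans reg_constE; apply: ler_wpM2r; first pos.
  have h3 : nq p vb`^(p-2) <= reg_const`^(p-2) by rewrite ge0_ler_powR ?nnegrE ?nq_ge0//; exact: ltW.
  exact: (ler_wpM2l (ler0n _ 2) h3).
 have := he k; move: q1 q2; move: (gn _^+2) (\int[mu]_x _) (\int[mu]_x _) => y1 y2 y3; lra.
have g0 : gn (loc1 th dth (v_ k) (V_ k)) ~>0 k.
 have s0 : Num.sqrt (2*e k) ~>0 k.
  rewrite [X in _ --> X](_ : 0 = Num.sqrt (2*0)); last by rewrite mulr0 sqrtr0.
  by apply: (cvg_fun (@sqrt_continuous R)); apply: cvgM; [exact: cvg_cst|exact: e0].
 apply: (@cvg0_le _ _ _ s0) => k; rewrite -sqrtr_sqr; exact: ler_wsqrtr.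
have n0 : (sob*gn (loc1 th dth (v_ k) (V_ k)))`^p ~>0 k.
 have : `|sob*gn (loc1 th dth (v_ k) (V_ k))| `^ p @[k --> \oo] --> `|sob*0| `^ p.
  apply: (cvg_fun (powR_norm_continuous p0)); apply: cvgM; [exact: cvg_cst|exact: g0].
 rewrite mulr0 normr0 powR0 ?gt_eqF//; apply: cvg_eq => k; rewrite ger0_norm//.
 pos.
apply: (@cvg0_le _ _ _ n0) => k; rewrite ger0_norm ?mass_ge0//.
have lH := loc1_HD tok dM (vV k); have [[ml li] _ _] := lH.
apply: le_trans (HD_Ip_bound lH (lexx _)).
have [vL _ _] := vV k; apply: Int_le => // [|x]; first exact: mass_ig.
rewrite indic_bal; case: ltP => h; last by rewrite mul0r.
by rewrite t1 ?mul1r// ltW.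
Qed.

Lemma mass_vanish_all r M : 0 < r -> 0 < M -> (forall k y, mass (v_ k) y r <= reg_const`^p) ->
 mass (v_ k) 0 M ~>0 k.
Proof.
move=> r0 M0 small; have r2 : 0 < r/2 by lra.
have loc0 y : mass (v_ k) y (r/2) ~>0 k.
 by apply: mass_vanish => // k; rewrite mulrC divfK.
have cpt := @compact_ball_le M; rewrite compact_cover in cpt.
have [||D _ cov] := cpt E setT (fun y => ball y (r/2)).
- move=> y _; exact: ball_open.
- move=> x _; exists x => //; exact: ballxx.
pose s : seq E := finmap.enum_fset D.
have sum0 : \sum_(y <- s) mass (v_ k) y (r/2) ~>0 k.
 elim: s => [|y s IH].
  by apply: (@cvg_eq _ (fun=> 0)); [move=> k; rewrite big_nil|cv].
 apply: (@cvg_eq _ (fun k => mass (v_ k) y (r/2)+\sum_(y <- s) mass (v_ k) y (r/2))).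
  by move=> k; rewrite big_cons.
 rewrite -[X in _ --> X]addr0; cv.
apply: (@cvg0_le _ _ _ sum0) => k; rewrite ger0_norm ?mass_ge0//.
have [vL _ _] := vV k; rewrite /mass -Int_sum; last by move=> y; exact: mass_ig.
apply: Int_le; [exact: mass_ig|by apply: ig_sum => y; exact: mass_ig|move=> x].
rewrite -mulr_suml; apply: ler_wpM2r => //.
rewrite indic_bal subr0.
case: ltP => xM; last by apply: sumr_ge0 => y _.
have [y yD yx] := cov x (ltW xM).
have ys : y \in s by li.
rewrite (big_rem y ys) /= -balE in yx *; rewrite indic_bal.
by rewrite (_ : `|x-y| < r/2 = true)// lerDl; apply: sumr_ge0 => z _.
Qed.

(** Outside a ball the weight is -1 and the nonlinear term has the favourable sign, so that no mass
    escapes to infinity, whatever its size. *)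
Lemma mass_exterior R0 : 0 < R0 -> (forall k x, R0 <= `|x| -> Q_ k x = -1) ->
 \int[mu]_x `|v_ k x| `^ p-mass (v_ k) 0 (2*R0) ~>0 k.
Proof.
move=> R00 Qm; have [K [th [dth [K0 tok t1 t0]]]] := cutoff_ex (0 : E) R00.
have [mt md tK dK tR] := tok.
have tok' : mult_ok (K+1) (fun x => 1-th x) (fun i x => - dth i x).
 split.
 - mfun.
 - by move=> i; mfun.
 - by move=> x; apply: le_trans (ler_normB _ _) _; rewrite normr1 addrC lerD2r.
 - by move=> i x; rewrite normrN (le_trans (dK i x))// lerDl.
 - move=> i x h; rewrite (_ : _ - _ = - (th (x+h*:ebasis i)-th x-h * dth i x)); last pos.
  by rewrite normrN (le_trans (tR i x h))// ler_wpM2r ?sqr_ge0// lerDl.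
have K1 : 0 <= K+1 by lra.
have dM i : vanish_out (2*R0) (fun x => - dth i x).
 move=> x; rewrite -{1}[x]subr0 => /t0[_ ->]; pos.
have [e e0 he] := vanish_err K1 tok' dM.
apply: (@cvg0_le _ _ _ e0) => k; have [vL _ _] := vV k; have [mQ Q1] := Qk k; have [mv vi] := vL.
rewrite ger0_norm ?subr_ge0 ?mass_le//.
have i2 : ig (fun x => `|v_ k x| `^ p*(1-th x)^+2).
 have q : ig (fun x => (K+1)^+2 * `|v_ k x| `^ p) by li.
 have [mt' _ tK' _ _] := tok'.
 apply: (ig_le _ q); first by apply: measurable_funM; [mfun|mfun].
 move=> x; rewrite normrM ger0_norm ?powR_ge0// mulrC.
 by rewrite ler_wpM2r ?powR_ge0// normrX lerXn2r.
have E1 : \int[mu]_x (Q_ k x*(`|v_ k x| `^ p*(1-th x)^+2)) = - \int[mu]_x (`|v_ k x| `^ p*(1-th x)^+2).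
 rewrite -IntN//; apply: Int_ext => x; have [h|h] := leP R0 `|x|; first by rewrite Qm// mulN1r.
 by rewrite t1 ?subr0 ?ltW// subrr expr0n !mulr0 oppr0.
have := he k; rewrite E1 => q.
have := le_trans (sqr_ge0 _) q; rewrite addrC subr_ge0; apply: le_trans.
rewrite -IntB//; last exact: mass_ig.
apply: Int_le => // [|x]; first by apply: igB => //; exact: mass_ig.
rewrite indic_bal subr0; case: ltP => h.
 by rewrite mul1r subrr mulr_ge0 ?powR_ge0// sqr_ge0.
by have [|-> _] := t0 x; [rewrite subr0|rewrite mul0r !subr0 expr1n mulr1].
Qed.

End vanishing.

(** * Zooming and concentration of rescaled functions *)

Lemma wt_affine Q (e : R) (xi : E) : wt_ok Q -> wt_ok (fun x => Q (xi+e*:x)).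
Proof. move=> [mQ Q1]; split=> //; mfun. Qed.

Lemma affK (e : R) (xi x : E) : 0 < e -> xi+e*:(e^-1*:(x-xi)) = x.
Proof. by move=> e0; rewrite scalerA mulfV ?gt_eqF// scale1r subrKC. Qed.

Lemma dJ_resc Q w W phi Phi (e : R) (xi : E) : 0 < e -> wt_ok Q -> HD w W -> HD phi Phi ->
 dJ (fun=> 0) Q (rescale w e xi) (rescG W e xi) (rescale phi e xi) (rescG Phi e xi) =
 dJ (fun=> 0) (fun x => Q (xi+e*:x)) w W phi Phi.
Proof.
move=> e0 Qok wW pP; have [wL WL _] := wW; have [pL PL _] := pP.
rewrite !dJ_pot0 ip_resc//; congr (_ - _).
have [i1 _] := wt_int (wt_affine e xi Qok) wL pL.
rewrite -(Int_resc xi e0 i1); apply: Int_ext => x.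
by rewrite gp_resc// affK// mulrCA.
Qed.

Lemma Jf_resc Q w W (e : R) (xi : E) : 0 < e -> wt_ok Q -> HD w W ->
 Jf (fun=> 0) Q (rescale w e xi) (rescG W e xi) = Jf (fun=> 0) (fun x => Q (xi+e*:x)) w W.
Proof.
move=> e0 Qok wW; have [wL WL _] := wW; rewrite !Jf_pot0 (gn_resc xi e0 WL).
have i1 := wt_pow (wt_affine e xi Qok) wL.
suff -> : \int[mu]_x (Q x * `|rescale w e xi x| `^ p) = \int[mu]_x (Q (xi+e*:x) * `|w x| `^ p) by [].
rewrite -(Int_resc xi e0 i1); apply: Int_ext => x.
by rewrite norm_resc_pow// affK// mulrCA.
Qed.

Section sequences.
Variables (Q : E -> R) (e_ : nat -> R) (xi_ : nat -> E).
Hypotheses (Qok : wt_ok Q) (e0 : forall k, 0 < e_ k).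

(** Inverse of the rescaling with parameters [e_ k] and [xi_ k]: it brings the ball of radius [e_ k]
    around [xi_ k] to the unit ball. *)
Definition zoom (z : E -> R) k := rescale z (e_ k)^-1 (- ((e_ k)^-1*:xi_ k)).
Definition zoomG (Z : 'I_N -> E -> R) k := rescG Z (e_ k)^-1 (- ((e_ k)^-1*:xi_ k)).

Lemma zoom_HD z Z k : HD z Z -> HD (zoom z k) (zoomG Z k).
Proof. by move=> zZ; apply: HD_rescale => //; rewrite invr_gt0. Qed.

Lemma zoom_gn Z k : L2N Z -> gn (zoomG Z k) = gn Z.
Proof. by move=> ZL; apply: gn_resc => //; rewrite invr_gt0. Qed.

Lemma zoomK z k : rescale (zoom z k) (e_ k) (xi_ k) = z.
Proof. exact: rescaleVK. Qed.

Lemma zoomGK Z k : rescG (zoomG Z k) (e_ k) (xi_ k) = Z.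
Proof. exact: rescGVK. Qed.

Lemma PS_zoom (z_ : nat -> E -> R) (Z_ : nat -> 'I_N -> E -> R) : (forall k, HD (z_ k) (Z_ k)) ->
 PS (fun=> 0) (fun=> Q) z_ Z_ ->
 PS (fun=> 0) (fun k x => Q (xi_ k+e_ k*:x)) (fun k => zoom (z_ k) k) (fun k => zoomG (Z_ k) k).
Proof.
move=> zZ [eta et0 he]; exists eta; first li.
move=> k phi Phi pP; have [_ PL _] := pP.
rewrite -dJ_resc//; last exact: zoom_HD.
rewrite zoomK zoomGK -(gn_resc (xi_ k) (e0 k) PL); apply: he; exact: HD_rescale.
Qed.

Lemma PS_unzoom (y_ : nat -> E -> R) (Y_ : nat -> 'I_N -> E -> R) : (forall k, HD (y_ k) (Y_ k)) ->
 PS (fun=> 0) (fun k x => Q (xi_ k+e_ k*:x)) y_ Y_ ->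
 PS (fun=> 0) (fun=> Q) (fun k => rescale (y_ k) (e_ k) (xi_ k)) (fun k => rescG (Y_ k) (e_ k) (xi_ k)).
Proof.
move=> yY [eta et0 he]; exists eta; first li.
move=> k phi Phi pP; have [_ PL _] := pP.
have pP' := zoom_HD k pP; have := he k _ _ pP'; rewrite zoom_gn// -dJ_resc//.
by rewrite zoomK zoomGK.
Qed.

End sequences.

Lemma rescale_sub u v (e : R) (xi : E) :
 rescale (fun x => u x-v x) e xi = (fun x => rescale u e xi x-rescale v e xi x).
Proof. by apply/funext => x; rewrite /rescale mulrBr. Qed.

Lemma rescG_sub U V (e : R) (xi : E) :
 rescG (fun i x => U i x-V i x) e xi = (fun i x => rescG U e xi i x-rescG V e xi i x).
Proof. by apply/funext => i; apply/funext => x; rewrite /rescG !mulrBr. Qed.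

Lemma young_tail (q s eta : R) : 1 < q -> 0 <= s -> 0 < eta -> s <= eta+eta`^(1-q)*s`^q.
Proof.
move=> q1 s0 e0; have [h1|h1] := leP s eta.
 apply: le_trans h1 _; rewrite lerDl; apply: mulr_ge0; pos.
have sp : 0 < s := lt_trans e0 h1.
apply: (@le_trans _ _ (eta`^(1-q)*s`^q)); last pos.
have {1}-> : s = s`^(1-q)*s`^q by rewrite -powRD ?subrK ?powRr1// (gt_eqF sp) implybT.
rewrite ler_wpM2r ?powR_ge0// -[1-q]opprB !powRN lef_pV2 ?posrE ?powR_gt0//.
rewrite ge0_ler_powR ?nnegrE; lra.
Qed.

Lemma Lp_far w d : Lq p w -> 0 < d -> exists A, \int[mu]_x `|w x-cut A w x| `^ p <= d.
Proof.
move=> wL d0; have [mw wi] := wL.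
have mc n : mes (fun x => `|w x-cut n%:R w x| `^ p) by mfun.
have [|||||_ h _] := @DCT _ _ R mu (fun n x => `|w x-cut n%:R w x| `^ p) (fun=> 0) (fun x => `|w x| `^ p).
- li.
- li.
- apply: aeW => x /=; have := near_Bn x => h; apply: cvg_near_cst.
 by move: h; apply: filterS => n xn; rewrite cutE xn subrr normr0 powR0// gt_eqF.
- li.
- apply: aeW => x n /=; rewrite ger0_norm ?powR_ge0// cutE; case: ifP => _; last by rewrite subr0.
 by rewrite subrr normr0 powR0 ?powR_ge0// gt_eqF.
move: h; rewrite Int0 => /cvgrPdist_le/(_ _ d0)[n _ /(_ n (leqnn _))]; rewrite sub0r normrN => q.
exists n%:R; apply: le_trans q; exact: ler_norm.
Qed.

(** The part of [w] within distance [A] contributes a factor [e_ k^2]. For the tail, Young's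
    inequality trades the square for [eta] on the bounded set plus a multiple of the small L^p
    mass. *)
Lemma rescale_vanish w W (e_ : nat -> R) (xi_ : nat -> E) M : HD w W -> (forall k, 0 < e_ k) ->
 e_ @ \oo --> (0 : R) -> n2 (cut M (rescale w (e_ k) (xi_ k))) ~>0 k.
Proof.
move=> wW e0 ec; have [wL _ _] := wW; have [mw wi] := wL.
have mr k : mes (rescale w (e_ k) (xi_ k)).
 rewrite /rescale; apply: measurable_funM => //.
 rewrite (_ : (fun x => _) = fun x => w (- ((e_ k)^-1*:xi_ k)+(e_ k)^-1*:x)); first exact: mes_affine.
 by apply/funext => x; rewrite rescE.
have bnd eta A k : 0 < eta -> \int[mu]_x (cut M (rescale w (e_ k) (xi_ k)) x^+2) <=
  e_ k^+2*\int[mu]_x (cut A w x^+2)+(eta*\int[mu]_x (\1_(Bn M) x : R) +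
   eta`^(1-p/2)*\int[mu]_x `|w x-cut A w x| `^ p).
 move=> et0; set e := e_ k; have ek : 0 < e by exact: e0.
 set xi := xi_ k; pose c := e`^((2-N%:R)/2).
 have cE : c^+2 = e ^- N*e^+2.
  by rewrite -(resc_sq ek) -mulrA -exprMn mulVf ?gt_eqF// expr1n mulr1.
 have [_ cAi] := Lp_L2cut A wL.
 have w2L : Lq p (fun x => w x-cut A w x).
  apply: (Lq_le (ltW p0) _ wL); first by apply: measurable_funB => //; exact: mes_cut.
  by move=> x; rewrite cutE; case: ifP => _; rewrite ?subrr ?normr0 ?subr0.
 have [_ w2i] := w2L.
 have i1 := ig_resc xi ek cAi; have i2 := ig_resc xi ek w2i.
 rewrite -(Int_resc xi ek cAi) -(Int_resc xi ek w2i) -!IntZ//; last exact: ig_Bn.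
 rewrite -IntD; [|by apply: igZ; exact: ig_Bn|li].
 have ib : ig (fun x => eta*\1_(Bn M) x) by apply: igZ; exact: ig_Bn.
 rewrite -IntD; [|exact: igZ|li].
 have ge0' x : 0 <= e^+2*(e ^- N*cut A w (e^-1*:(x-xi))^+2).
  by apply: mulr_ge0; [exact: sqr_ge0|apply: mulr_ge0; [rewrite invr_ge0 exprn_ge0// ltW|exact: sqr_ge0]].
 have pt x : cut M (rescale w e xi) x^+2 <= e^+2*(e ^- N*cut A w (e^-1*:(x-xi))^+2) +
   (eta*\1_(Bn M) x+eta`^(1-p/2)*(e ^- N * `|w (e^-1*:(x-xi))-cut A w (e^-1*:(x-xi))| `^ p)).
  have r2 : 0 <= eta`^(1-p/2)*(e ^- N * `|w (e^-1*:(x-xi))-cut A w (e^-1*:(x-xi))| `^ p).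
   by apply: mulr_ge0; [exact: powR_ge0|apply: mulr_ge0; [rewrite invr_ge0 exprn_ge0// ltW|exact: powR_ge0]].
  have r1 : 0 <= eta*\1_(Bn M) x by pos.
  rewrite {1}cutE; case: ltP => xM; last by rewrite expr0n; apply: addr_ge0 => //; exact: addr_ge0.
  set y := e^-1*:(x-xi) in r2 *; have := ge0' x; rewrite -/y => r0.
  rewrite /rescale -/y exprMn cE.
  have [h|h] := ltP `|y| A.
   rewrite cutE h; apply: (@le_trans _ _ (e^+2*(e ^- N*w y^+2))).
    pos.
   by rewrite lerDl; apply: addr_ge0 => //; move: r2; rewrite cutE h.
  have cy : cut A w y = 0 by rewrite cutE ltNge h.
  rewrite cy subr0 expr0n !mulr0 add0r.
  have -> : \1_(Bn M) x = 1 :> R by rewrite indicE mem_set.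
  have q1 : 1 < p/2 by rewrite ltr_pdivlMr// mul1r.
  have := @young_tail (p/2) ((c*w y)^+2) eta q1 (sqr_ge0 _) et0.
  rewrite mulr1 {1}exprMn cE => q; apply: (le_trans q); rewrite lerD2l; apply: ler_wpM2l; first pos.
  rewrite -[(c*w y)^+2]real_normK ?num_real// -[`|c*w y|^+2]powR_mulrn ?normr_ge0// -powRrM [2*(p/2)]mulrC divfK//.
  rewrite normrM powRM// ger0_norm ?powR_ge0//.
  by rewrite resc_pow.
 apply: Int_le => //.
  have [rL _ _] := HD_rescale xi ek wW; by have [_] := Lp_L2cut M rL.
 li.
apply: n2_cvg0; apply/cvgrPdist_le => d d0.
set m := \int[mu]_x (\1_(Bn M) x : R) in bnd.
have m0 : 0 <= m by apply: Int_ge0 => x.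
(* First [eta], then [A] depending on [eta], then [k]: each of the three terms is at most [d/3]. *)
pose eta := d/(3*(m+1)).
have den : 0 < 3*(m+1) by lra.
have et0 : 0 < eta by pos.
have q1 : eta * m <= d/3.
 rewrite /eta mulrAC ler_pdivrMr// (_ : d/3*(3*(m+1)) = d*(m+1)); last pos.
 pos.
pose P := eta`^(1-p/2); have P0 : 0 < P by rewrite powR_gt0.
have [|A hA] := @Lp_far w (d/3/P) wL; first pos.
have q2 : P*\int[mu]_x `|w x-cut A w x| `^ p <= d/3.
 by move: hA; rewrite ler_pdivlMr// mulrC.
have lim : e_ k^+2*\int[mu]_x (cut A w x^+2) ~>0 k.
 rewrite [X in _ --> X](_ : 0 = 0^+2*\int[mu]_x (cut A w x^+2)); last pos.
 by apply: cvgM; [exact: (cvg_fun (@exprn_continuous R 2) ec)|exact: cvg_cst].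
have d3 : 0 < d/3 by lra.
have /cvgrPdist_le/(_ _ d3) := lim; apply: filterS => k; rewrite sub0r normrN => h.
rewrite sub0r normrN ger0_norm; last by apply: Int_ge0 => x; exact: sqr_ge0.
apply: le_trans (bnd eta A k et0) _; rewrite -/P.
have := le_trans (ler_norm _) h; move: q1 q2; move: (eta * m) (P*_) (e_ k^+2*_) => y1 y2 y3; lra.
Qed.

End euclidean.

(** * First-order expansion along moving points *)

Section graph_limit.
Context {R : realType} {m : nat}.
Local Notation F := 'rV[R]_m.

Lemma cvg_coord (a_ : nat -> F) (a : F) j : a_ @ \oo --> a -> a_ k ord0 j @[k --> \oo] --> a ord0 j.
Proof. move=> h; apply: (cvg_comp a_ (fun x : F => x ord0 j) h); exact: coord_contE. Qed.

Lemma cvg_eqV (u_ v_ : nat -> F) (l : F) : (forall k, u_ k = v_ k) -> v_ @ \oo --> l -> u_ @ \oo --> l.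
Proof. by move=> /funext ->. Qed.

Lemma cvg_of_norm (a_ : nat -> F) (a : F) : `|a_ k-a| @[k --> \oo] --> (0 : R) -> a_ @ \oo --> a.
Proof.
move=> h; apply/cvgrPdist_le => e e0; have /cvgrPdist_le/(_ _ e0) := h; apply: filterS => k.
by rewrite sub0r normrN normr_id distrC.
Qed.

Lemma norm_of_cvg (a_ : nat -> F) (a : F) : a_ @ \oo --> a -> `|a_ k-a| @[k --> \oo] --> (0 : R).
Proof.
move=> h; apply/cvgrPdist_le => e e0; have /cvgrPdist_le/(_ _ e0) := h; apply: filterS => k.
by rewrite sub0r normrN normr_id distrC.
Qed.

(** The base point moves with [k], so differentiability at [a] alone does not suffice; the increment
    is taken one coordinate at a time with the mean value theorem and continuity of the partial
    derivatives. *)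
Lemma graph_increment (gam : F -> R) (a_ b_ : nat -> F) (e_ : nat -> R) (a b : F) : smooth gam ->
 (forall k, 0 < e_ k) -> e_ @ \oo --> (0 : R) -> a_ @ \oo --> a -> b_ @ \oo --> b ->
 (e_ k)^-1*(gam (a_ k+e_ k*:b_ k)-gam (a_ k)) @[k --> \oo] --> \sum_j partial j gam a*b ord0 j.
Proof.
move=> sg e0 ec ac bc.
pose part (s : seq 'I_m) (x : F) : F := \sum_(j <- s) x ord0 j*:ebasis j.
have cpart s : part s (b_ k) @[k --> \oo] --> part s b.
 elim: s => [|j s IH].
  apply: (@cvg_eqV _ (fun=> part [::] b)); last cv.
  by move=> k; rewrite /part !big_nil.
 apply: (@cvg_eqV _ (fun k => b_ k ord0 j*:ebasis j+part s (b_ k))).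
  by move=> k; rewrite /part big_cons.
 rewrite (_ : part (j :: s) b = b ord0 j*:ebasis j+part s b); last by rewrite /part big_cons.
 by apply: cvgD; [apply: cvgZr_tmp; exact: cvg_coord|cv].
have ce s : e_ k*:part s (b_ k) @[k --> \oo] --> (0 : F).
 by rewrite -[X in _ --> X](scale0r (part s b)); apply: cvgZ.
have main (s : seq 'I_m) : (e_ k)^-1*(gam (a_ k+e_ k*:part s (b_ k))-gam (a_ k)) @[k --> \oo] -->
  \sum_(j <- s) partial j gam a*b ord0 j.
 elim: s => [|j s IH].
  rewrite big_nil; apply: (@cvg_eq R _ (fun=> 0)); last cv.
  by move=> k; rewrite /part big_nil scaler0 addr0 subrr mulr0.
 pose c_ k := a_ k+e_ k*:part s (b_ k).
 have /choice[t_ ht] : forall k, exists t : R, `|t| <= `|e_ k*b_ k ord0 j| /\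
   gam (c_ k+(e_ k*b_ k ord0 j)*:ebasis j)-gam (c_ k) = e_ k*b_ k ord0 j * partial j gam (c_ k+t*:ebasis j).
  move=> k; have [|t t1 t2] := @line_MVT R m gam j (c_ k) (e_ k*b_ k ord0 j); last by exists t.
  move=> y; exact: smooth_derivable.
 have tc : t_ @ \oo --> (0 : R).
  apply: (@cvg0_le _ _ (fun k => `|e_ k*b_ k ord0 j|)); first by move=> k; have [] := ht k.
  rewrite -[X in _ --> X](normr0 R) -(mul0r (b ord0 j)); apply: cvg_norm; apply: cvgM => //; exact: cvg_coord.
 have cc : c_ k+t_ k*:ebasis j @[k --> \oo] --> a.
  suff : c_ k+t_ k*:ebasis j @[k --> \oo] --> (a+0)+0*:(ebasis j : F) by rewrite scale0r !addr0.
  apply: cvgD; first by apply: cvgD.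
  apply: cvgZ; cv.
 have dc : partial j gam (c_ k+t_ k*:ebasis j) @[k --> \oo] --> partial j gam a.
  apply: (cvg_comp _ (partial j gam) cc); exact: (smooth_continuous (smooth_partial j sg)).
 rewrite big_cons.
 apply: (@cvg_eq R _ (fun k => partial j gam (c_ k+t_ k*:ebasis j)*b_ k ord0 j +
   (e_ k)^-1*(gam (a_ k+e_ k*:part s (b_ k))-gam (a_ k)))).
  move=> k; have [_ E1] := ht k; rewrite /part big_cons -/(part s (b_ k)).
  have -> : a_ k+e_ k*:(b_ k ord0 j*:ebasis j+part s (b_ k)) = c_ k+(e_ k*b_ k ord0 j)*:ebasis j.
   by rewrite scalerDr scalerA addrCA addrC.
  have -> : gam (c_ k+(e_ k*b_ k ord0 j)*:ebasis j)-gam (a_ k) = e_ k*b_ k ord0 j * partial j gam (c_ k+t_ k*:ebasis j)+(gam (c_ k)-gam (a_ k)) by pos.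
  by rewrite mulrDr /c_; congr (_ + _); rewrite -!mulrA mulKf ?gt_eqF// mulrC.
 apply: cvgD => //; apply: cvgM => //; exact: cvg_coord.
have partE x : part (index_enum 'I_m) x = x.
 apply/rowP => j; rewrite summxE (bigD1 j)//= big1; last first.
  by move=> k kj; rewrite !mxE eqxx eq_sym (negPf kj) mulr0.
 by rewrite !mxE !eqxx mulr1 addr0.
apply: (cvg_eq _ (main (index_enum 'I_m))) => k.
by rewrite partE.
Qed.

End graph_limit.

Section decomposition.
Context {R : realType} {N : nat}.
Hypothesis hN : (3 <= N)%N.
Local Notation E := 'rV[R]_N.
Local Notation mu := (Defs_lebesgue_rV__canonical__measure_function_Measure R N).
Notation mes f := (measurable_fun [set: E] f).
Notation ig f := (mu.-integrable [set: E] (EFin \o f)).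
Notation L2 := (L2 mu).
Notation n2 := (n2 mu).
Notation Lq := (Lq mu).
Notation nq := (nq mu).
Local Notation "E ~>0 k" := (E @[k --> \oo] --> (0 : R)) (at level 69, k name).
Implicit Types (f g u phi : E -> R).
Implicit Types (v w th Q : E -> R) (G H U V W Z Phi : 'I_N -> E -> R) (i : 'I_N).
Local Notation p := (two_star R N).

Notation HD := (@HD R N).
Implicit Types (a : E -> R).
Local Notation sob := (sob (R := R) (N := N)).
Local Notation reg_const := (reg_const (R := R) (N := N)).
Let p2 : 2 < p. Proof. exact: two_star_gt2. Qed.
Let p0 : 0 < p. Proof. exact: two_star_gt0. Qed.
#[local] Hint Resolve gn_ge0 n2_ge0 nq_ge0 sob_ge0 : pos.
#[local] Hint Resolve mes_gp mes_cut mes_bal mes_affine mes_shift : mes.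
#[local] Hint Resolve L2_shift : li.
Hint Resolve p2 p0 : core.

(** * Blow-up of a smooth domain *)

Implicit Types (Om : set E) (x y : E).

(** The boundary point is the first exit point: outside the open set [Om], but approached by earlier
    points of the segment, which are inside. *)
Lemma segment_boundary Om (a b : E) : open Om -> Om a -> ~ Om b ->
 exists t, [/\ 0 <= t, t <= 1 & boundary Om (a+t*:(b-a))].
Proof.
move=> oO Oa Ob; pose g (t : R) := a+t*:(b-a).
have gc : continuous g by move=> t; apply: cvgD; [exact: cvg_cst|apply: cvgZr_tmp; exact: cvg_id].
pose S := [set t : R | 0 <= t /\ t <= 1 /\ ~ Om (g t)].
have S1 : S 1 by rewrite /S /= /g scale1r subrKC; split => //.
have lbS : has_lbound S by exists 0 => t [].
have iS : has_inf S by split=> //; exists 1.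
pose T := inf S.
have T0 : 0 <= T by apply: lb_le_inf; [exists 1|move=> t []].
have T1 : T <= 1 by apply: ge_inf.
have before t : 0 <= t -> t < T -> Om (g t).
 move=> t0 tT; apply: contrapT => h; have : T <= t; last pos.
 apply: ge_inf => //; split=> //; split=> //; pos.
have nT : ~ Om (g T).
 move=> OT; have nb : nbhs (g T) Om by exact: open_nbhs_nbhs.
 have /nbhs_ballP[e /= e0 he] := gc T _ nb.
 have [t St tT] := inf_adherent e0 iS; have [t0 [t1 nt]] := St; apply: nt; apply: he.
 have Tt : T <= t by apply: ge_inf.
 rewrite /ball /= ler0_norm; move: tT; rewrite -/T; lra.
have Tp : 0 < T.
 rewrite lt_neqAle T0 andbT; apply/eqP => T00; apply: nT; rewrite -T00 /g scale0r addr0//.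
exists T; split=> //; split; last by rewrite (interior_id _).1.
move=> B nB; have /nbhs_ballP[e /= e0 he] := gc T _ nB.
pose t := Num.max 0 (T-e/2); have t0 : 0 <= t by rewrite le_max lexx.
have tT : t < T by rewrite gt_max Tp /=; lra.
have te : T-e/2 <= t by rewrite le_max lexx orbT.
exists (g t); split; first mfun.
apply: he; rewrite /ball /= ger0_norm; lra.
Qed.

Lemma boundary_out Om x : open Om -> boundary Om x -> closure Om x /\ ~ Om x.
Proof. by move=> oO []; rewrite (interior_id _).1. Qed.

Lemma col'_norm (i : 'I_N) x : `|col' i x| <= `|x|.
Proof. apply: norm_le_coord => // j; rewrite mxE; exact: coord_norm. Qed.

Lemma col'D (i : 'I_N) x y : col' i (x+y) = col' i x+col' i y.
Proof. by apply/rowP => j; rewrite !mxE. Qed.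

Lemma col'Z (i : 'I_N) (c : R) x : col' i (c*:x) = c*:col' i x.
Proof. by apply/rowP => j; rewrite !mxE. Qed.

Lemma col'B (i : 'I_N) x y : col' i (x-y) = col' i x-col' i y.
Proof. by apply/rowP => j; rewrite !mxE. Qed.

Lemma col'_cvg (i : 'I_N) (x_ : nat -> E) (x : E) : x_ @ \oo --> x -> col' i (x_ k) @[k --> \oo] --> col' i x.
Proof.
move=> h; apply: cvg_of_norm; apply: (cvg0_le _ (norm_of_cvg h)) => k.
by rewrite normr_id -col'B col'_norm.
Qed.

Definition graph_of (i : 'I_N) (b : bool) (gam : 'rV[R]_N.-1 -> R) x : R := (-1)^+b*(x ord0 i-gam (col' i x)).

Lemma graph_zero Om y0 r i (b : bool) gam y : open Om -> smooth gam ->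
 (forall x, ball y0 r x -> (Om x <-> 0 < graph_of i b gam x)) -> ball y0 r y -> boundary Om y ->
 graph_of i b gam y = 0.
Proof.
move=> oO sg hO yB bO; have [cO nO] := boundary_out oO bO.
have le0 : graph_of i b gam y <= 0 by rewrite leNgt; apply/negP => h; apply: nO; exact/hO.
apply/eqP; rewrite eq_le le0 leNgt; apply/negP => lt0.
have cg : {for y, continuous (graph_of i b gam)}.
 apply: (@cvgM _ _ (nbhs y) _ (fun=> (-1)^+b) (fun z : E => z ord0 i-gam (col' i z))); first cv.
 apply: (@cvgB _ _ _ (nbhs y) _ (fun z : E => z ord0 i) (fun z : E => gam (col' i z))); first exact: coord_contE.
 have cc : {for y, continuous (col' i : E -> _)}.
  move=> B nB; have /nbhs_ballP[e /= e0 he] := nB.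
  apply/nbhs_ballP; exists e => //= z yz; apply: he; move: yz; rewrite -!ball_normE /= -col'B => yz.
  apply: le_lt_trans yz; exact: col'_norm.
 apply: (continuous_comp cc); exact: smooth_continuous.
have nb : nbhs y [set z | graph_of i b gam z < 0].
 exact: (cg [set t | t < 0] (lt_nbhsl lt0)).
have nB : nbhs y (ball y0 r) by apply: open_nbhs_nbhs; split => //; exact: ball_open.
have [z [Oz [z1 z2]]] := cO _ (filterI nb nB).
by have := (hO z z2).1 Oz; rewrite ltNge (ltW z1).
Qed.

(** Blow-up seen from centres at the bounded rescaled offset [e_ k] from boundary points. Divided by
    the scale, the graph function tends to an affine function, whose sign decides membership in [Om]
    off the limit hyperplane. *)
Lemma half_blow_up Om (y0 : E) r i (b : bool) gam (y_ e_ : nat -> E) (eps : nat -> R) (e0 : E) : open Om -> 0 < r -> smooth gam ->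
 (forall x, ball y0 r x -> (Om x <-> 0 < graph_of i b gam x)) ->
 (forall k, boundary Om (y_ k)) -> y_ @ \oo --> y0 -> (forall k, 0 < eps k) -> eps @ \oo --> (0 : R) ->
 e_ @ \oo --> e0 ->
 exists (nu : E) (c : R), lin nu nu = 1 /\ forall x, lin nu x != c ->
  Q_Omega Om (y_ k+eps k*:(x+e_ k)) @[k --> \oo] --> half_weight nu c x.
Proof.
move=> oO r0 sg hO bO yc ep0 epc ec.
(* [al] is the gradient of the graph function at [y0] and [nu] its normalisation; [c] records the
   limit offset [e0]. *)
pose s : R := (-1)^+b; pose al : E := \row_k (if unlift i k is Some j then - s * partial j gam (col' i y0) else s).
have ali : al ord0 i = s by rewrite mxE unlift_none.
have alj j : al ord0 (lift i j) = - s * partial j gam (col' i y0) by rewrite mxE liftK.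
have linal (z : E) : lin al z = s*(z ord0 i-\sum_j partial j gam (col' i y0)*col' i z ord0 j).
 rewrite /lin (bigD1_ord i)//= ali mulrBr mulr_sumr -sumrN; congr (_ + _).
 apply: eq_bigr => j _; rewrite alj mxE; pos.
have al2 : 0 < lin al al.
 rewrite /lin (bigD1_ord i)//= ali (_ : s*s = 1); last by rewrite -expr2 sqrr_sign.
 apply: ltr_wpDr => //; apply: sumr_ge0 => j _; pos.
pose q := Num.sqrt (lin al al); have q0 : 0 < q by rewrite sqrtr_gt0.
pose nu := q^-1*:al; pose c := - lin nu e0.
have nuE z : lin nu z = q^-1 * lin al z.
 by rewrite mulr_sumr; apply: eq_bigr => k _; rewrite mxE mulrA.
exists nu, c; split.
 rewrite nuE linZ mulrA -expr2 exprVn sqr_sqrtr ?mulVf ?gt_eqF//; exact: ltW.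
move=> x xc.
pose X k := y_ k+eps k*:(x+e_ k).
have Xc : X @ \oo --> y0.
 rewrite -[X in _ --> X]addr0 -(scale0r (x+e0)); apply: cvgD => //; apply: cvgZ => //.
 apply: cvgD => //; cv.
have bc : x+e_ k @[k --> \oo] --> x+e0 by apply: cvgD => //; exact: cvg_cst.
have inball (u_ : nat -> E) : u_ @ \oo --> y0 -> \forall k \near \oo, ball y0 r (u_ k).
 move=> uc; apply: uc; exact: nbhsx_ballx.
pose F k := (eps k)^-1*graph_of i b gam (X k).
pose G k := s*((x+e_ k) ord0 i-(eps k)^-1*(gam (col' i (y_ k)+eps k*:col' i (x+e_ k))-gam (col' i (y_ k)))).
have FG : \forall k \near \oo, F k = G k.
 have := inball _ yc; apply: filterS => k yB.
 have := graph_zero oO sg hO yB (bO k); rewrite /graph_of -/s => z0.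
 have z1 : y_ k ord0 i = gam (col' i (y_ k)).
  apply/eqP; rewrite -subr_eq0; move/eqP: z0; rewrite mulf_eq0 => /orP[|//].
  by rewrite signr_eq0.
 rewrite /F /G /graph_of -/s [col' i (y_ k + _)]col'D [col' i (eps k *: _)]col'Z [(y_ k + _) ord0 i]mxE z1 [(_*:(x+e_ k)) ord0 i]mxE.
 have := ep0 k; move: (eps k) (gam _) (gam _) ((x+e_ k) ord0 i) => t g1 g2 u t0; field; pos.
have Gc : G k @[k --> \oo] --> lin al (x+e0).
 rewrite linal; apply: cvgM; first cv.
 apply: cvgB; first exact: cvg_coord.
 apply: graph_increment => //; exact: col'_cvg.
have lne : lin al (x+e0) != 0.
 apply: contra xc; rewrite linD addrC addr_eq0 => /eqP h.
 by rewrite /c !nuE h mulrN opprK.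
have sgn : (0 < lin al (x+e0)) = (c <= lin nu x).
 rewrite /c !nuE -subr_ge0 opprK -mulrDr -linD pmulr_rge0 ?invr_gt0//.
 pos.
have Xb := inball _ Xc.
have [pos|neg] := ltP 0 (lin al (x+e0)).
 have hw : half_weight nu c x = 1.
  by rewrite /half_weight hfE ltNge -sgn pos mulr0 subr0.
 rewrite hw; apply: cvg_near_cst.
 have Gp : \forall k \near \oo, 0 < G k by exact: (@cvgr_gt R nat \oo _ G (lin al (x+e0)) Gc 0 pos).
 near=> k.
 have O : Om (X k).
  apply/hO; first by near: k.
  have gp : 0 < F k by rewrite (near FG k)//; near: k.
  by move: gp; rewrite pmulr_rgt0 ?invr_gt0.
 by rewrite /Q_Omega mem_set.
have hw : half_weight nu c x = - 1.
 have lc : lin nu x < c by pos.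
 rewrite /half_weight hfE lc mulr1; pos.
rewrite hw; apply: cvg_near_cst.
have neg' : lin al (x+e0) < 0 by pos.
have Gp : \forall k \near \oo, G k < 0 by exact: (@cvgr_lt R nat \oo _ G (lin al (x+e0)) Gc 0 neg').
near=> k.
have O : ~ Om (X k).
 move=> OX; have XB : ball y0 r (X k) by near: k.
 have := (hO _ XB).1 OX; rewrite ltNge; apply/negP/negPn.
 have gp : F k < 0 by rewrite (near FG k)//; near: k.
 by move: gp; rewrite pmulr_rlt0 ?invr_gt0// => /ltW.
by rewrite /Q_Omega memNset.
Unshelve. all: by end_near. Qed.

Lemma Q_Omega_in Om x : Om x -> Q_Omega Om x = 1 :> R.
Proof. by move=> h; rewrite /Q_Omega mem_set. Qed.

Lemma Q_Omega_out Om x : ~ Om x -> Q_Omega Om x = - 1 :> R.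
Proof. by move=> h; rewrite /Q_Omega memNset. Qed.

Lemma Q_Omega_ok Om : open Om -> wt_ok (Q_Omega Om : E -> R).
Proof.
move=> oO; split.
 rewrite (_ : Q_Omega Om = fun x => 2*\1_Om x-1).
  mfun.
  apply: measurable_indic; exact: open_measurable_rV.
 apply/funext => x; rewrite /Q_Omega indicE; case: ifP => _; rewrite ?mulr1 ?mulr0 ?sub0r//.
 pos.
by move=> x; rewrite /Q_Omega; case: ifP => _; rewrite ?normrN normr1.
Qed.

(** Inside a ball the hyperplane lies in strips of width [hseq n], whose measure is O(1/n). *)
Lemma hyperplane_null nu (c : R) : lin nu nu = 1 -> {ae mu, forall x, lin nu x != c}.
Proof.
move=> nu1.
pose f M x : R := \1_[set x | lin nu x = c] x*\1_(Bn M) x.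
have mH : measurable [set x : E | lin nu x = c].
 rewrite (_ : [set x | _] = lin nu @^-1` [set c])//; rewrite -[X in measurable X]setTI.
 by apply: (lin_mes nu measurableT).
have mf M : mes (f M) by apply: measurable_funM; [li|exact: ig_mes (ig_Bn M)].
have f0 M x : 0 <= f M x by pos.
have fi M : ig (f M).
 apply: (ig_le (mf M) (ig_Bn M)) => x; rewrite ger0_norm// /f -[X in _ <= X]mul1r ler_wpM2r//.
have z M : 0 < M -> \int[mu]_x f M x = 0.
 move=> M0; apply/eqP; rewrite eq_le (Int_ge0 _ (f0 M)) andbT leNgt; apply/negP => pos.
 set I := \int[mu]_x f M x in pos; pose D : R := (2*(M+1))^+N.
 have key n : n.+1%:R*I <= D.
  (* The strips are open at the top, so the hyperplane is placed at the lower end of the strip below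
     [c + hseq n]. *)
  apply: le_trans (strip_int nu1 (c+hseq n) n M0); rewrite ler_wpM2l//.
  have si : ig (fun x => sig nu (c+hseq n-hseq n) (c+hseq n) x*\1_(Bn M) x).
   apply: (ig_le _ (ig_Bn M)); first by apply: measurable_funM; [exact: mes_sig|exact: ig_mes (ig_Bn M)].
   move=> x; rewrite normrM -[X in _ <= X]mul1r; apply: ler_pM => //; first exact: sig01.
   by rewrite ger0_norm.
  apply: Int_le => // x; rewrite ler_wpM2r ?indicE// sigE.
  have h0 : 0 < hseq n :> R by rewrite invr_gt0.
  have [xc|//] := boolP (x \in _); move: xc; rewrite inE /= => ->.
  by rewrite addrK lexx ltrDl h0.
 pose n := Num.truncn (D/I); have := key n; rewrite leNgt => /negP; apply.
 rewrite -ltr_pdivrMr//; exact: truncnS_gt.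
have h n : f n.+1%:R = (fun=> 0) %[ae mu] by apply: Int_eq0 (fi _) (f0 _) (z _ _).
have := ae_nat h; apply: filterS => x /= hx; apply/eqP => xc.
have [k _ /(_ k.+1 (leqnSn k))/= xk] := near_Bn x.
have := hx k I; rewrite /f !indicE !mem_set//; first by move/eqP; rewrite mulr1 oner_eq0.
Qed.

(** If neither inside nor outside balls of arbitrarily large blown-up radius recur, boundary points
    stay at distance O(eps k) from the centres; by compactness they and their rescaled offsets
    converge along a subsequence. *)
Lemma trichotomy Om (xi : nat -> E) (eps : nat -> R) : smooth_open_set Om -> bounded_set Om ->
 (forall k, 0 < eps k) -> eps @ \oo --> (0 : R) ->
 exists2 s : nat -> nat, {homo s : i j/(i < j)%N} &
  [\/ forall j x, `|x-xi (s j)| < j.+1%:R*eps (s j) -> Om x,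
    forall j x, `|x-xi (s j)| < j.+1%:R*eps (s j) -> ~ Om x |
    exists (nu : E) (c : R), lin nu nu = 1 /\ forall x, lin nu x != c ->
     Q_Omega Om (xi (s k)+eps (s k)*:x) @[k --> \oo] --> half_weight nu c x].
Proof.
move=> [oO sO] [B [Br hB]] ep0 epc.
have [h1|/existsNP[j1 /existsNP[n1 h1]]] := pselect (forall j n, exists2 k, (n <= k)%N & forall x, `|x-xi k| < j.+1%:R*eps k -> Om x).
 by have [s sh hs] := subseq_ex h1; exists s => //; apply: Or31.
have [h2|/existsNP[j2 /existsNP[n2 h2]]] := pselect (forall j n, exists2 k, (n <= k)%N & forall x, `|x-xi k| < j.+1%:R*eps k -> ~ Om x).
 by have [s sh hs] := subseq_ex h2; exists s => //; apply: Or32.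
(* From [n0] on, the ball of radius [M eps k] contains points of [Om] and points outside it, hence a
   boundary point on the segment between them. *)
pose M : R := (maxn j1 j2).+1%:R; pose n0 := maxn n1 n2.
have bd k : (n0 <= k)%N -> exists y, boundary Om y /\ `|y-xi k| < M*eps k.
 move=> nk.
 have [b [bb Ob]] : exists b, `|b-xi k| < M*eps k /\ ~ Om b.
  apply: contrapT => h; apply: h1; exists k; first exact: leq_trans (leq_maxl _ _) nk.
  move=> x xx; apply: contrapT => nx; apply: h; exists x; split=> //.
  by apply: lt_le_trans xx _; rewrite ler_pM2r// ler_nat ltnS leq_maxl.
 have [a [aa Oa]] : exists a : E, `|a-xi k| < M*eps k /\ Om a.
  apply: contrapT => h; apply: h2; exists k; first exact: leq_trans (leq_maxr _ _) nk.
  move=> x xx Ox; apply: h; exists x; split=> //.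
  by apply: lt_le_trans xx _; rewrite ler_pM2r// ler_nat ltnS leq_maxr.
 have [t [t0 t1 bt]] := segment_boundary oO Oa Ob.
 exists (a+t*:(b-a)); split=> //.
 rewrite (_ : _-xi k = (1-t)*:(a-xi k)+t*:(b-xi k)); last first.
  rewrite scalerBl !scalerBr; move: (t*:a) (t*:b) (t*:xi k) => u v w; rewrite !opprB !addrA; apply/rowP => i; rewrite !mxE; ring.
 apply: le_lt_trans (ler_normD _ _) _; rewrite !normrZ (ger0_norm t0) ger0_norm; last lra.
 have [->|tn] := eqVneq t 0; first pos.
 have tp : 0 < t by pos.
 have q1 : t * `|b-xi k| < t*(M*eps k) by rewrite ltr_pM2l.
 have q2 : (1-t) * `|a-xi k| <= (1-t)*(M*eps k) by rewrite ler_wpM2l ?(ltW aa)//; lra.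
 pos.
have /choice[y_ hy] : forall k, exists y, boundary Om y /\ `|y-xi (k+n0)%N| < M*eps (k+n0)%N.
 move=> k; apply: bd; exact: leq_addl.
have yB k : `|y_ k| <= B+1.
 have [bO _] := hy k; have [cO _] := boundary_out oO bO.
 have cB : closed [set x : E | `|x| <= B+1].
  by apply: compact_closed; [li|exact: compact_ball_le].
 apply: (cB); apply: closure_subset cO => x Ox /=; apply: hB => //; lra.
have [y0 [s1 [_ sh1 yc]]] := @compact_subseq R _ _ y_ (@compact_ball_le R N (B+1)) yB.
have by0 : boundary Om y0.
 split.
  have cl : \forall k \near \oo, closure Om (y_ (s1 k)).
   by apply: nearW => k; have [bO _] := hy (s1 k); have [] := boundary_out oO bO.
  exact: (@closed_cvg _ _ \oo _ (fun k => y_ (s1 k)) (closure Om) (@closed_closure _ Om) cl y0 yc).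
 rewrite (interior_id _).1// => Oy.
 have : \forall k \near \oo, Om (y_ (s1 k)) by apply: yc; exact: open_nbhs_nbhs.
 move=> [k _ /(_ k (leqnn k))]; have [bO _] := hy (s1 k); by have [] := boundary_out oO bO.
have [r [i [b [gam [r0 sg hO]]]]] := sO y0 by0.
pose s2 k := (s1 k+n0)%N.
have sh2 : {homo s2 : i j/(i < j)%N} by move=> u v uv; rewrite ltn_add2r sh1.
pose e_ k := (eps (s2 k))^-1*:(xi (s2 k)-y_ (s1 k)).
have eB k : `|e_ k| <= M.
 have [_ h] := hy (s1 k); rewrite normrZ gtr0_norm ?invr_gt0// distrC.
 rewrite mulrC ler_pdivrMr//; pos.
have [e0 [s3 [_ sh3 ec]]] := @compact_subseq R _ _ e_ (@compact_ball_le R N M) eB.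
exists (s2 \o s3); first exact: homo_comp sh2 sh3.
apply: Or33.
have bO k : boundary Om (y_ (s1 (s3 k))) by have [] := hy (s1 (s3 k)).
have epc' : (fun k => eps (s2 (s3 k))) @ \oo --> (0 : R) by exact: (cvg_sub (homo_comp sh2 sh3) epc).
have yc' : (fun k => y_ (s1 (s3 k))) @ \oo --> y0 by exact: (cvg_sub sh3 yc).
have [nu [c [nu1 hc]]] := half_blow_up oO r0 sg hO bO yc' (fun k => ep0 _) epc' ec.
exists nu, c; split=> // x xc; have := hc x xc.
have -> : (fun k => Q_Omega Om (y_ (s1 (s3 k))+eps (s2 (s3 k))*:(x+e_ (s3 k)))) =
 (fun k => Q_Omega Om (xi ((s2 \o s3) k)+eps ((s2 \o s3) k)*:x) : R).
 apply/funext => k; congr (Q_Omega Om _); rewrite scalerDr scalerA mulfV ?gt_eqF// scale1r.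
 by rewrite /= addrCA subrKC addrC.
cv.
Qed.

Implicit Types (z : E -> R).

(** * Extraction of bubbles *)

Section bubbles.

Lemma Jf_le_small Q u U : wt_ok Q -> HD u U ->
 `|Jf (fun=> 0) Q u U| <= 2^-1*gn U^+2+p^-1*(sob*gn U)`^p.
Proof.
move=> Qok uU; have [mQ Q1] := Qok; have [uL _ _] := uU; have [_ ui] := uL.
rewrite Jf_pot0; apply: le_trans (ler_normB _ _) _; rewrite !normrM.
have n2 : `|2^-1 : R| = 2^-1 by rewrite ger0_norm.
have np : `|p^-1| = p^-1 by rewrite ger0_norm// invr_ge0 ltW.
rewrite n2 np -expr2 real_normK ?num_real// lerD2l; apply: ler_wpM2l; first by rewrite invr_ge0 ltW.
apply: le_trans (HD_Ip_bound hN uU (lexx _)).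
apply: Int_le_norm => //; first exact: wt_pow.
by move=> x; rewrite normrM [`|_ `^ _|]ger0_norm ?powR_ge0// ler_piMl.
Qed.

Lemma powR_cvg0 (a : nat -> R) (q : R) : 0 < q -> a @ \oo --> (0 : R) -> `|a k| `^ q ~>0 k.
Proof.
move=> q0 h; have := cvg_fun (powR_norm_continuous q0) h; by rewrite normr0 powR0// gt_eqF.
Qed.

Lemma Jf_cvg0 Q (u_ : nat -> E -> R) (U_ : nat -> 'I_N -> E -> R) : wt_ok Q -> (forall k, HD (u_ k) (U_ k)) ->
 gn (U_ k) ~>0 k -> Jf (fun=> 0) Q (u_ k) (U_ k) ~>0 k.
Proof.
move=> Qok uU g0.
apply: (@cvg0_le _ _ (fun k => 2^-1*gn (U_ k)^+2+p^-1 * `|sob*gn (U_ k)| `^ p)).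
 move=> k; apply: le_trans (Jf_le_small Qok (uU k)) _.
 rewrite [`|sob*_|]ger0_norm//; apply: mulr_ge0; pos.
rewrite [X in _ --> X](_ : 0 = 2^-1*0^+2+p^-1*0); last pos.
apply: cvgD; (apply: cvgM; first exact: cvg_cst).
 exact: (cvg_fun (@exprn_continuous R 2) g0).
apply: powR_cvg0 => //; rewrite [X in _ --> X](_ : 0 = sob*0); last pos.
apply: cvgM; cv.
Qed.

(** Dyadic version of the concentration function: the radius is the first [M / 2^k] at which no ball
    carries more than [d], so some ball of twice that radius does. Such a [k] exists by absolute
    continuity of the integral. *)
Lemma concentration u (M d : R) : Lq p u -> 0 < M -> 0 < d -> d < mass u 0 M ->
 exists eps (xi : E), [/\ 0 < eps, forall y, mass u y eps <= d & d < mass u xi (2*eps)].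
Proof.
move=> uL M0 d0 dM; have [mu' ui] := uL.
pose P n := exists y, d < mass u y (M/2^+n).
have [n Pn] : exists n, ~ P n.
 have d2 : 0 < d/2 by lra.
 have [K K0 hK] := Int_abs_cont ui (fun x => powR_ge0 _ _) d2.
 pose r : R := Num.min (1/2) (d/(4*(K+1))).
 have KK : 0 < 4*(K+1) by lra.
 have r0 : 0 < r by rewrite lt_min; apply/andP; split; [lra|pos].
 have r1 : 2*r <= 1 by rewrite mulrC -ler_pdivlMr// ge_min lexx.
 have r2 : r*(4*(K+1)) <= d by rewrite -ler_pdivlMr// ge_min lexx orbT.
 exists (Num.truncn (M/r)).+1 => -[y]; apply/negP; rewrite -leNgt.
 set n := (Num.truncn _).+1.
 have nr : M/2^+n <= r.
  rewrite ler_pdivrMr ?exprn_gt0// mulrC -ler_pdivrMr//.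
  apply: le_trans (ltW (truncnS_gt (M/r))) _; rewrite -natrX ler_nat ltnW// ltn_expl//.
 have q0 : 0 < M/2^+n by pos.
 have mb : mu (bal y (M/2^+n)) = ((2*(M/2^+n))^+N)%:E by rewrite balE; exact: lebesgue_ball.
 have mB : measurable (bal y (M/2^+n)) by rewrite balE; exact: measurable_ballE.
 have := hK _ mB; rewrite mb ltry /= => /(_ isT) h.
 have -> : mass u y (M/2^+n) = \int[mu]_x (`|u x| `^ p*\1_(bal y (M/2^+n)) x).
  apply: Int_ext => x; pos.
 apply: le_trans h _.
 have s1 : 2*(M/2^+n) <= 2*r by pos.
 have s0 : 0 <= 2*(M/2^+n) by pos.
 have s2 : (2*(M/2^+n))^+N <= 2*r.
  apply: (le_trans _ s1); case: (N) hN => // N' _; rewrite exprS ler_piMr// exprn_ile1//.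
  pos.
 have s3 : K*(2*(M/2^+n))^+N <= K*(2*r) by rewrite ler_wpM2l.
 pos.
have ex : exists n, `[< ~ P n >] by exists n; apply/asboolP.
case: (ex_minnP ex) => k /asboolP nPk mink.
have k0 : (0 < k)%N.
 by rewrite lt0n; apply/eqP => kz; apply: nPk; rewrite kz; exists 0; rewrite divr1.
have [xi hxi] : P k.-1.
 apply: contrapT => h; have : (k <= k.-1)%N by apply: mink; exact/asboolP.
 by rewrite leqNgt prednK// leqnn.
exists (M/2^+k), xi; split.
- pos.
- by move=> y; rewrite leNgt; apply/negP => h; apply: nPk; exists y.
- rewrite (_ : 2*(M/2^+k) = M/2^+k.-1)//; have t0 : 2^+k.-1 != 0 :> R by rewrite expf_neq0.
 rewrite -{1}(prednK k0) exprS; move: (2 ^+ _) t0 => t t0; pos.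
Qed.

Lemma mass_zoom z (e : R) (xi y : E) r : 0 < e -> Lq p z ->
 mass (rescale z e^-1 (- (e^-1*:xi))) y r = mass z (xi+e*:y) (e*r).
Proof.
move=> e0 zL; have ei0 : 0 < e^-1 by rewrite invr_gt0.
have i1 := mass_ig (xi+e*:y) (e*r) zL.
rewrite -[RHS](Int_resc (- (e^-1*:xi)) ei0 i1); apply: Int_ext => x.
rewrite norm_resc_pow// mulrCA invrK opprK.
have aff : e*:(x+e^-1*:xi) = xi+e*:x by rewrite scalerDr scalerA mulfV ?gt_eqF// scale1r addrC.
rewrite aff; have -> // : \1_(bal (xi+e*:y) (e*r)) (xi+e*:x) = \1_(bal y r) x :> R.
rewrite !indic_bal (_ : xi+e*:x-(xi+e*:y) = e*:(x-y)).
 by rewrite normrZ gtr0_norm// ltr_pM2l.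
by rewrite opprD addrACA subrr add0r scalerBr.
Qed.

Definition sol1 (w : E -> R) (W : 'I_N -> E -> R) :=
 forall phi Phi, HD phi Phi -> dJ (fun=> 0) (fun=> 1) w W phi Phi = 0.

Lemma sol1_energy w W : HD w W -> sol1 w W -> gn W^+2 = \int[mu]_x `|w x| `^ p.
Proof.
move=> wW ws; have := ws _ _ wW; rewrite (dJ_diag hN) => /eqP; rewrite subr_eq0 => /eqP ->.
apply: Int_ext => x; pos.
Qed.

Lemma sol1_Jf w W : HD w W -> sol1 w W -> Jf (fun=> 0) (fun=> 1) w W = (2^-1-p^-1)*gn W^+2.
Proof.
move=> wW ws; rewrite Jf_pot0 mulrBl; congr (_ - _*_).
rewrite (sol1_energy wW ws); apply: Int_ext => x; pos.
Qed.

(** A solution of the limit problem has squared gradient norm equal to its L^p mass, at most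
    [((sob + 1) gn)^p]; solving for [gn] gives this lower bound. The added 1 keeps the base
    positive. *)
Definition quantum : R := ((sob+1)`^p)^-1`^(p-2)^-1.

Lemma quantum_gt0 : 0 < quantum.
Proof. by rewrite powR_gt0// invr_gt0 powR_gt0// ltr_wpDl// sob_ge0. Qed.

Lemma sol1_quantum w W : HD w W -> sol1 w W -> ~ (w = (fun=> 0) %[ae mu]) -> quantum <= gn W.
Proof.
move=> wW ws nz; have [wL _ _] := wW; have [mw wi] := wL.
have e1 := sol1_energy wW ws; have g0 := gn_ge0 W.
have S0 : 0 < sob+1 by pos.
have b1 : gn W^+2 <= ((sob+1)*gn W)`^p.
 rewrite e1; apply: le_trans (HD_Ip_bound hN wW (lexx _)) _.
 rewrite ge0_ler_powR ?nnegrE ?(ltW p0)//.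
 - pos.
 - pos.
 - pos.
have gp' : 0 < gn W.
 rewrite lt_def g0 andbT; apply/eqP => z; apply: nz.
 have : \int[mu]_x `|w x| `^ p = 0 by rewrite -e1 z expr0n.
 move=> I0; have := Int_eq0 wi (fun x => powR_ge0 _ _) I0; apply: filterS => x /= h hT.
 apply/eqP; rewrite -normr_eq0; apply/eqP; exact: (powR_eq0_eq0 (h hT)).
have pp : 0 < p-2 by move: p2; lra.
rewrite leNgt; apply/negP => lt.
have lt' : gn W`^(p-2) < ((sob+1)`^p)^-1.
 have := gt0_ltr_powR pp; move=> /(_ (gn W) quantum); rewrite !nnegrE g0 (ltW quantum_gt0) => /(_ isT isT lt).
 by rewrite -powRrM mulVf ?gt_eqF// powRr1// invr_ge0 powR_ge0.
move: b1; rewrite powRM ?(ltW S0)// leNgt => /negP; apply.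
have -> : gn W`^p = gn W^+2*gn W`^(p-2).
 by rewrite -powR_mulrn// powRDn0// addrC subrK.
rewrite mulrCA -[X in _ < X]mulr1 ltr_pM2l ?exprn_gt0//.
by rewrite -ltr_pdivlMl ?powR_gt0// mulr1.
Qed.

Variable Om : set E.
Hypotheses (Os : smooth_open_set Om) (Ob : bounded_set Om).
Local Notation Q := (Q_Omega Om : E -> R).
Let oO : open Om. Proof. by case: Os. Qed.
Let Qok : wt_ok Q. Proof. exact: Q_Omega_ok. Qed.

Definition vanishing_PS (z : nat -> E -> R) (Z : nat -> 'I_N -> E -> R) :=
 [/\ forall k, HD (z k) (Z k), PS (fun=> 0) (fun=> Q) z Z & forall M, n2 (cut M (z k)) ~>0 k].

Lemma vanishing_PS_sub (s : nat -> nat) (z : nat -> E -> R) (Z : nat -> 'I_N -> E -> R) : {homo s : i j/(i < j)%N} -> vanishing_PS z Z -> vanishing_PS (z \o s) (Z \o s).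
Proof.
move=> sh [zZ zPS z0]; split=> [k||M]; first mfun.
 exact: (PS_sub sh zPS).
exact: (cvg_sub sh (z0 M)).
Qed.

(** Property (i) of the theorem in the form that the blow-up provides and uses: blown-up balls of
    every radius are eventually inside the domain. *)
Definition inner_scale (xi : nat -> E) (eps : nat -> R) :=
 forall A, \forall k \near \oo, forall x, `|x-xi k| < A*eps k -> Om x.

(** Either the sequence tends to 0 along a subsequence, or it is zoomed at its concentration scale;
    the weak limit is nonzero, and a nonzero limit excludes the exterior and half-space cases. *)
Lemma one_bubble (z : nat -> E -> R) (Z : nat -> 'I_N -> E -> R) C : vanishing_PS z Z -> (forall k, gn (Z k) <= C) ->
 (exists2 s : nat -> nat, {homo s : i j/(i < j)%N} & gn (Z (s k)) ~>0 k) \/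
 (exists (s : nat -> nat) (xi : nat -> E) (eps : nat -> R) w W,
  [/\ {homo s : i j/(i < j)%N}, HD w W, sol1 w W & ~ (w = (fun=> 0) %[ae mu])] /\
  [/\ forall k, 0 < eps k, eps @ \oo --> (0 : R), forall k, Om (xi k), inner_scale xi eps &
   wcvg (fun k => zoom eps xi (z (s k)) k) (fun k => zoomG eps xi (Z (s k)) k) w W]).
Proof.
move=> [zZ zPS z0] ZC; pose m k := \int[mu]_x `|z k x| `^ p.
(* If the L^p masses get arbitrarily small, testing with the sequence itself makes the gradients
   small; otherwise they stay above some [a > 0] from [n0] on. *)
have [h1|/existsNP[j0 /existsNP[n0 h1]]] := pselect (forall j n, exists2 k, (n <= k)%N & m k <= j.+1%:R^-1).
 left; have [s sh hs] := subseq_ex h1; exists s => //.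
 have ms : m (s k) ~>0 k.
  apply: (@cvg0_le _ _ (@hseq R)) hseq_cvg => k; rewrite ger0_norm//.
  by apply: Int_ge0 => x.
 have [eta e0 he] := zPS; have es := cvg_sub sh e0.
 have b k : gn (Z (s k))^+2 <= `|eta (s k)|*C+m (s k).
  have [zL _ _] := zZ (s k); have [_ zi] := zL; have [mQ Q1] := Qok.
  have := he (s k) _ _ (zZ (s k)); rewrite (dJ_diag hN).
  have qb : \int[mu]_x (Q x * `|z (s k) x| `^ p) <= m (s k).
   apply: le_trans (ler_norm _) _; apply: Int_le_norm => //; first exact: wt_pow.
   by move=> x; rewrite normrM [`|_ `^ _|]ger0_norm ?powR_ge0// ler_piMl.
  have q1 : eta (s k)*gn (Z (s k)) <= `|eta (s k)|*C.
   apply: (@le_trans _ _ (`|eta (s k)|*gn (Z (s k)))); first by rewrite ler_wpM2r ?gn_ge0// ler_norm.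
   by rewrite ler_wpM2l.
  move=> /(le_trans (ler_norm _)) q2; move: q1 q2 qb.
  pos.
 have lim : Num.sqrt (`|eta (s k)|*C+m (s k)) ~>0 k.
  rewrite [X in _ --> X](_ : 0 = Num.sqrt (`|0 : R|*C+0)); last by rewrite normr0 mul0r addr0 sqrtr0.
  apply: (cvg_fun (@sqrt_continuous R)); apply: cvgD => //.
  by apply: cvgM; [apply: cvg_norm|exact: cvg_cst].
 apply: (cvg0_le _ lim) => k; rewrite -sqrtr_sqr; exact: ler_wsqrtr.
right.
have big k : (n0 <= k)%N -> j0.+1%:R^-1 < m k.
 by move=> nk; rewrite ltNge; apply/negP => h; apply: h1; exists k.
set a : R := j0.+1%:R^-1 in big; have a0 : 0 < a by rewrite invr_gt0.
(* Outside this ball the weight is -1, so that by [mass_exterior] at least half of the lower bound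
   [a] stays in a fixed ball. *)
have [R0 [R00 hR0]] : exists R0, 0 < R0 /\ forall x, R0 <= `|x| -> Q x = -1.
 have [B [_ hB]] := Ob; exists (`|B|+2); split => //.
 move=> x xB; apply: Q_Omega_out => Ox; have := hB (`|B|+1) _ x Ox.
 by move=> /(_ _) h; have : `|x| <= `|B|+1 by [apply: h; have := ler_norm B; lra]; lra.
pose M := 2*R0; have M0 : 0 < M by rewrite /M; lra.
have [n1 n01 mass1] : exists2 n1, (n0 <= n1)%N & forall k, (n1 <= k)%N -> a/2 <= mass (z k) 0 M.
 have ext := mass_exterior hN zZ ZC (fun=> Qok) zPS z0 R00 (fun _ => hR0).
 have a2 : 0 < a/2 by lra.
 have /cvgrPdist_le/(_ _ a2)[n _ hn] := ext.
 exists (maxn n0 n); first exact: leq_maxl.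
 move=> k; rewrite geq_max => /andP[k0 k1]; have := hn k k1; rewrite sub0r normrN => q.
 have := le_trans (ler_norm _) q; have := big k k0; rewrite /m; lra.
pose s0 k := (k+n1)%N; have sh0 : {homo s0 : i j/(i < j)%N} by move=> i j; rewrite ltn_add2r.
pose zz := z \o s0; pose ZZ := Z \o s0.
have [zzZ zzPS zz0] := vanishing_PS_sub sh0 (And3 zZ zPS z0).
have zzL k : Lq p (zz k) by case: (zzZ k).
have ZZC k : gn (ZZ k) <= C by mfun.
(* Below the vanishing threshold, and below the mass [a/2] in the ball of radius [M], so that a
   concentration scale exists. *)
pose d : R := Num.min (reg_const`^p) (a/4).
have rp : 0 < reg_const`^p by rewrite powR_gt0// reg_const_gt0.
have d0 : 0 < d by rewrite lt_min rp; lra.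
have dreg : d <= reg_const`^p by rewrite /d ge_min lexx.
have da : d <= a/4 by rewrite /d ge_min lexx orbT.
have massM k : a/2 <= mass (zz k) 0 M by apply: mass1; exact: leq_addl.
have /choice[f hf] : forall k, exists f : R*E, [/\ 0 < f.1, forall y, mass (zz k) y f.1 <= d & d < mass (zz k) f.2 (2*f.1)].
 move=> k; have [|e [xi [h2 h3 h4]]] := concentration (zzL k) M0 d0; last by exists (e, xi).
 have := massM k; lra.
pose eps k := (f k).1; pose xi k := (f k).2.
have ep0 k : 0 < eps k by have [] := hf k.
(* Otherwise, along a subsequence, all balls of one fixed radius carry at most [d], and
   [mass_vanish_all] contradicts the mass [a/2] in the ball of radius [M]. *)
have epc : eps @ \oo --> (0 : R).
 apply: contrapT => nc.
 have [e e0 he] : exists2 e : R, 0 < e & forall (j n : nat), exists2 k, (n <= k)%N & e <= eps k.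
  apply: contrapT => h; apply: nc; apply/cvgrPdist_le => e e0.
  have [n hn] : exists n, forall k, (n <= k)%N -> eps k < e.
   apply: contrapT => h2; apply: h; exists e => // _ n; apply: contrapT => h3; apply: h2; exists n => k nk.
   by rewrite ltNge; apply/negP => h4; apply: h3; exists k.
  exists n => // k /= nk; rewrite sub0r normrN gtr0_norm//; exact: ltW (hn k nk).
 have [s sh hs] := subseq_ex he.
 have [szZ szPS sz0] := vanishing_PS_sub sh (And3 zzZ zzPS zz0).
 have small k y : mass ((zz \o s) k) y e <= reg_const`^p.
  have [_ h2 _] := hf (s k); apply: (le_trans _ (le_trans (h2 y) dreg)).
  by apply: mass_mono; [exact: zzL|move=> x xy; apply: lt_le_trans xy (hs k)].
 have van := mass_vanish_all hN szZ (fun k => ZZC (s k)) (fun=> Qok) szPS sz0 e0 M0 small.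
 have a4 : 0 < a/4 by lra.
 have /cvgrPdist_le/(_ _ a4)[n _ /(_ n (leqnn n))] := van; rewrite sub0r normrN => q.
 have := le_trans (ler_norm _) q; have := massM (s n); rewrite /=; lra.
pose v k := zoom eps xi (zz k) k; pose V k := zoomG eps xi (ZZ k) k.
have vV k : HD (v k) (V k) by apply: zoom_HD.
have VC k : gn (V k) <= C by rewrite /V zoom_gn//; case: (zzZ k).
have vPS : PS (fun=> 0) (fun k x => Q (xi k+eps k*:x)) v V by exact: PS_zoom.
have [s1 [w [W [sh1 wW vw]]]] := HD_weak_compact hN vV VC.
(* With limit 0 the zoomed sequence vanishes locally in L^2 while unit balls carry at most [d]; then
   the ball of radius 2 loses its mass, against the choice of the scale. *)
have wnz : ~ (w = (fun=> 0) %[ae mu]).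
 move=> wz; have [_ loc_ _] := vw.
 have v0 M' : n2 (cut M' (v (s1 k))) ~>0 k.
  apply: (cvg_eq _ (loc_ M')) => k; apply: n2_aeeq.
  - by apply: mes_cut; case: (vV (s1 k)) => -[].
  - by apply: mes_cut; apply: measurable_funB; [case: (vV (s1 k)) => -[]|case: wW => -[]].
  - by move: wz; apply: filterS => x /= h _; rewrite /cut (h I) subr0.
 have small k y : mass ((v \o s1) k) y 1 <= reg_const`^p.
  have [_ h2 _] := hf (s1 k); rewrite /= /v mass_zoom// mulr1.
  exact: le_trans (h2 _) dreg.
 have van := mass_vanish_all hN (fun k => vV (s1 k)) (fun k => VC (s1 k)) (fun k => wt_affine _ _ Qok) (PS_sub sh1 vPS) v0 ltr01 (ltr0n R 2) small.
 have /cvgrPdist_lt/(_ _ d0)[n _ /(_ n (leqnn n))] := van; rewrite sub0r normrN => q.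
 have [_ _ h3] := hf (s1 n); move: (le_lt_trans (ler_norm _) q).
 by rewrite /= /v mass_zoom// scaler0 addr0 mulrC ltNge (ltW h3).
have epc1 : (eps \o s1) @ \oo --> (0 : R) by exact: (cvg_sub sh1 epc).
have [s2 sh2 cases] := trichotomy (xi \o s1) Os Ob (fun k => ep0 (s1 k)) epc1.
pose sg := s1 \o s2; have sgh : {homo sg : i j/(i < j)%N} by exact: homo_comp sh1 sh2.
have vw2 := wcvg_sub sh2 vw.
have solve Qo : wt_ok Qo -> {ae mu, forall x, Q (xi (sg k)+eps (sg k)*:x) @[k --> \oo] --> Qo x} ->
  forall phi Phi, HD phi Phi -> dJ (fun=> 0) Qo w W phi Phi = 0.
 move=> Qook Qoc phi Phi pP.
 exact: (split_solution hN (fun k => vV (sg k)) (fun k => VC (sg k)) wW vw2 (fun k => wt_affine _ _ Qok) Qook Qoc pot0 (PS_sub sgh vPS) pP).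
have toip Qo : (forall phi Phi, HD phi Phi -> dJ (fun=> 0) Qo w W phi Phi = 0) ->
  forall phi Phi, HD phi Phi -> ip W Phi = \int[mu]_x (Qo x*(gp p (w x) * phi x)).
 move=> h phi Phi pP; have := h _ _ pP; rewrite dJ_pot0 => /eqP; pos.
have far (x : E) : \forall k \near \oo, `|x| < k.+1%:R.
 have := near_Bn x; apply: filterS => k h; apply: lt_le_trans h _; by pos.
have inb (x : E) k : `|x| < k.+1%:R -> `|(xi (sg k)+eps (sg k)*:x)-xi (sg k)| < k.+1%:R*eps (sg k).
 by move=> h; rewrite addrAC subrr add0r normrZ gtr0_norm// mulrC ltr_pM2r.
have wt1 : wt_ok (fun _ : E => 1 : R).
 by split; [li|move=> x; rewrite normr1].
have wtN : wt_ok (fun _ : E => - 1 : R).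
 by split; [li|move=> x; rewrite normrN1].
case: cases => [cI|cO|[nu [c [nu1 cH]]]].
- exists (s0 \o sg), (xi \o sg), (eps \o sg), w, W.
 have ws : sol1 w W.
  apply: solve => //; apply: aeW => x; apply: cvg_near_cst; have := far x; apply: filterS => k h.
  apply: Q_Omega_in; apply: (cI k); exact: inb.
 split; split=> //.
 + exact: homo_comp sh0 sgh.
 + by move=> k; mfun.
 + exact: (cvg_sub sgh epc).
 + move=> k; apply: (cI k); rewrite /= subrr normr0; pos.
 + move=> A; pose n := Num.truncn `|A|; exists n => // k /= nk x xx; apply: (cI k); apply: lt_le_trans xx _.
  apply: ler_wpM2r; first pos.
  apply: le_trans (ler_norm _) _; apply: le_trans (ltW (truncnS_gt _)) _; rewrite ler_nat; exact: nk.
- exfalso; apply: wnz; apply: (negative_weight_trivial hN wW); apply: toip; apply: (solve _ wtN).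
 apply: aeW => x; apply: cvg_near_cst; have := far x; apply: filterS => k h.
 apply: Q_Omega_out; apply: (cO k); exact: inb.
- exfalso; apply: wnz; apply: (half_space_trivial hN nu1 (c := c) wW); apply: toip.
 apply: solve; first exact: half_weight_ok.
 by have := hyperplane_null c nu1; apply: filterS => x; mfun.
Qed.

(** The splitting is applied to the zoomed sequence, whose weights tend to 1 because blown-up balls
    fill the domain, and is carried back by scale invariance. The rescaled bubble vanishes locally
    in L^2, which keeps the class stable. *)
Lemma remove_bubble (z : nat -> E -> R) (Z : nat -> 'I_N -> E -> R) C (xi : nat -> E) (eps : nat -> R) w W :
 vanishing_PS z Z -> (forall k, gn (Z k) <= C) -> HD w W -> (forall k, 0 < eps k) -> eps @ \oo --> (0 : R) ->
 inner_scale xi eps -> wcvg (fun k => zoom eps xi (z k) k) (fun k => zoomG eps xi (Z k) k) w W ->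
 let z' := fun k x => z k x-rescale w (eps k) (xi k) x in
 let Z' := fun k i x => Z k i x-rescG W (eps k) (xi k) i x in
 [/\ vanishing_PS z' Z', gn (Z k)^+2-gn (Z' k)^+2 @[k --> \oo] --> gn W^+2 &
  Jf (fun=> 0) Q (z k) (Z k)-Jf (fun=> 0) Q (z' k) (Z' k) @[k --> \oo] --> Jf (fun=> 0) (fun=> 1) w W].
Proof.
move=> [zZ zPS z0] ZC wW ep0 epc ins vw z' Z'; have [_ WL _] := wW.
pose v k := zoom eps xi (z k) k; pose V k := zoomG eps xi (Z k) k.
have vV k : HD (v k) (V k) by apply: zoom_HD.
have VC k : gn (V k) <= C by rewrite /V zoom_gn//; case: (zZ k).
have vPS : PS (fun=> 0) (fun k x => Q (xi k+eps k*:x)) v V by exact: PS_zoom.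
have wt1 : wt_ok (fun _ : E => 1 : R).
 by split; [li|move=> x; rewrite normr1].
have Qc : {ae mu, forall x, Q (xi k+eps k*:x) @[k --> \oo] --> (1 : R)}.
 apply: aeW => x; apply: cvg_near_cst; have := ins (`|x|+1); apply: filterS => k h.
 apply: Q_Omega_in; apply: h; rewrite addrAC subrr add0r normrZ gtr0_norm// mulrC ltr_pM2r//.
 pos.
have Qk k := wt_affine (eps k) (xi k) Qok.
have z'E k : z' k = rescale (fun x => v k x-w x) (eps k) (xi k).
 by rewrite rescale_sub zoomK.
have Z'E k : Z' k = rescG (fun i x => V k i x-W i x) (eps k) (xi k).
 by rewrite rescG_sub zoomGK.
have dD k : HD (fun x => v k x-w x) (fun i x => V k i x-W i x) by exact: HDB.
have z'Z k : HD (z' k) (Z' k) by rewrite z'E Z'E; exact: HD_rescale.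
split; [split; [exact: z'Z| |]| |].
- have := PS_unzoom hN Qok ep0 dD (split_PS hN vV VC wW vw Qk wt1 Qc pot0 vPS).
 have -> : (fun k => rescale (fun x => v k x-w x) (eps k) (xi k)) = z' by apply/funext => k.
 by have -> : (fun k => rescG (fun i x => V k i x-W i x) (eps k) (xi k)) = Z' by apply/funext => k.
- move=> M; have r0 := rescale_vanish hN xi M wW ep0 epc.
 apply: (@cvg0_le _ _ (fun k => n2 (cut M (z k))+n2 (cut M (rescale w (eps k) (xi k))))).
  move=> k; rewrite ger0_norm ?n2_ge0//.
  have [zL _ _] := zZ k; have [rL _ _] := HD_rescale (xi k) (ep0 k) wW.
  apply: le_trans (n2_leB (Lp_L2cut hN M zL) (Lp_L2cut hN M rL)).
  apply: eqle; congr n2; apply/funext => x.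
  by rewrite /cut mulrBl.
 by rewrite [X in _ --> X](_ : 0 = 0+0); [exact: cvgD|rewrite addr0].
- apply: (cvg_eq _ (split_gn vV wW vw)) => k.
 rewrite Z'E gn_resc//; last by case: (dD k).
 by rewrite zoom_gn//; case: (zZ k).
- apply: (cvg_eq _ (split_energy hN vV VC wW vw Qk wt1 Qc pot0)) => k.
 rewrite z'E Z'E -(Jf_resc hN (xi k) (ep0 k) Qok (dD k)) -(Jf_resc hN (xi k) (ep0 k) Qok (vV k)).
 have -> : rescale (v k) (eps k) (xi k) = z k by exact: zoomK.
 by have -> : rescG (V k) (eps k) (xi k) = Z k by exact: zoomGK.
Qed.

(** Families are indexed by [nat], with meaning below [m] only, so that adding a bubble is a shift
    of indices rather than a change of finite type. *)
Definition bubble_family m (xi : nat -> nat -> E) (eps : nat -> nat -> R) (w : nat -> E -> R) (W : nat -> 'I_N -> E -> R) :=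
 forall j, (j < m)%N -> [/\ HD (w j) (W j), sol1 (w j) (W j) & ~ (w j = (fun=> 0) %[ae mu])] /\
  [/\ forall k, 0 < eps j k, forall k, Om (xi j k) & inner_scale (xi j) (eps j)].

Definition ncons (X : Type) (a : X) (f : nat -> X) (i : nat) : X := if i is j.+1 then f j else a.

Definition decomposes (z : nat -> E -> R) (Z : nat -> 'I_N -> E -> R) :=
 exists (s : nat -> nat) m (xi : nat -> nat -> E) (eps : nat -> nat -> R) (w : nat -> E -> R) (W : nat -> 'I_N -> E -> R),
  [/\ {homo s : i j/(i < j)%N}, bubble_family m xi eps w W,
  gn (fun i x => Z (s k) i x-\sum_(j < m) rescG (W j) (eps j k) (xi j k) i x) ~>0 k &
  Jf (fun=> 0) Q (z (s k)) (Z (s k)) @[k --> \oo] --> \sum_(j < m) Jf (fun=> 0) (fun=> 1) (w j) (W j)].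

Lemma decomposes0 (z : nat -> E -> R) (Z : nat -> 'I_N -> E -> R) (s : nat -> nat) : vanishing_PS z Z -> {homo s : i j/(i < j)%N} ->
 gn (Z (s k)) ~>0 k -> decomposes z Z.
Proof.
move=> [zZ _ _] sh g0; exists s, 0%N, (fun _ _ => 0), (fun _ _ => 1), (fun _ _ => 0), (fun _ _ _ => 0); split=> //.
 apply: (cvg_eq _ g0) => k; congr gn; apply/funext => i; apply/funext => x.
 by rewrite big_ord0 subr0.
by rewrite big_ord0; apply: Jf_cvg0.
Qed.

(** Induction on a bound for the number of half quanta contained in the squared gradient norms. *)
Lemma bubble_decomposition n (z : nat -> E -> R) (Z : nat -> 'I_N -> E -> R) : vanishing_PS z Z -> (forall k, gn (Z k)^+2 <= n%:R*(quantum^+2/2)) ->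
 decomposes z Z.
Proof.
have q0 := quantum_gt0; set c := quantum^+2/2; have c0 : 0 < c by pos.
elim: n z Z => [|n IH] z Z zg ZC.
 apply: (@decomposes0 z Z id) => //; apply: (@cvg_eq R _ (fun=> 0)); last exact: cvg_cst.
 move=> k; apply/eqP; rewrite -sqrf_eq0; have := ZC k; rewrite mul0r => h.
 by rewrite eq_le sqr_ge0 h.
have C1 k : gn (Z k) <= Num.sqrt (n.+1%:R*c).
 rewrite -[gn _]ger0_norm ?gn_ge0// -sqrtr_sqr; exact: ler_wsqrtr.
have [[s sh g0]|[s [xi [eps [w [W [[sh wW ws wnz] [ep0 epc xiO ins vw]]]]]]]] := one_bubble zg C1.
 exact: decomposes0 zg sh g0.
have zsg := vanishing_PS_sub sh zg.
have [] := remove_bubble zsg (fun k => C1 (s k)) wW ep0 epc ins vw.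
set z' := (fun k x => _); set Z' := (fun k i x => _) => z'g gc Jc.
have wq := sol1_quantum wW ws wnz.
have qW : c < gn W^+2.
 have : quantum^+2 <= gn W^+2 by apply: lerXn2r; rewrite ?nnegrE ?gn_ge0// ltW.
 by have : 0 < quantum^+2 by [exact: exprn_gt0]; rewrite /c; lra.
(* The loss tends to at least [quantum^2]; half of it is exceeded from some index on, and the
   sequence is restarted there. *)
have [n2 _ hn2] := @cvgr_gt R nat \oo _ _ _ gc c qW.
pose s0 k := (k+n2)%N; have sh0 : {homo s0 : i j/(i < j)%N} by move=> i j; rewrite ltn_add2r.
have Z'C k : gn ((Z' \o s0) k)^+2 <= n%:R*c.
 have := hn2 (s0 k) (leq_addl _ _); have := ZC (s (s0 k)).
 rewrite -natr1 mulrDl /=; move: (gn _^+2) (gn _^+2) => y1 y2; lra.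
have [s' [m [xi' [eps' [w' [W' [sh' fam gl Jl]]]]]]] := IH _ _ (vanishing_PS_sub sh0 z'g) Z'C.
pose r := s0 \o s'; have rh : {homo r : i j/(i < j)%N} by exact: homo_comp sh0 sh'.
exists (s \o r), m.+1, (ncons (xi \o r) xi'), (ncons (eps \o r) eps'), (ncons w w'), (ncons W W'); split.
- exact: homo_comp sh rh.
- move=> [_|j jm] /=; last mfun.
 split; split=> //.
 by move=> A; have := near_sub rh (ins A).
- apply: (cvg_eq _ gl) => k; congr gn; apply/funext => i; apply/funext => x.
 by rewrite big_ord_recl opprD addrA.
- rewrite big_ord_recl /=.
 have := cvg_sub rh Jc => J1.
 apply: (@cvg_eq R _ (fun k => (Jf (fun=> 0) Q ((z \o s) (r k)) ((Z \o s) (r k))-Jf (fun=> 0) Q (z' (r k)) (Z' (r k))) +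
   Jf (fun=> 0) Q (z' (r k)) (Z' (r k)))); first by move=> k; rewrite subrK.
 by apply: cvgD.
Qed.

End bubbles.

(** * Coercivity, boundedness of Palais-Smale sequences and conclusion *)

Lemma HD_sum m (f : 'I_m -> E -> R) (F : 'I_m -> 'I_N -> E -> R) : (forall j, HD (f j) (F j)) ->
 HD (fun x => \sum_j f j x) (fun i x => \sum_j F j i x).
Proof.
elim: m f F => [|m IH] f F fF.
 by apply: (HD_ext _ _ (HD0 hN)) => [x|i x]; rewrite big_ord0.
apply: (HD_ext _ _ (HDD hN (fF ord0) (IH _ _ (fun j => fF (lift ord0 j))))) => [x|i x]; by rewrite big_ord_recl.
Qed.

Lemma wt_ok1 : wt_ok (fun _ : E => 1 : R).
Proof. by split; [li|move=> x; rewrite normr1]. Qed.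

Lemma J_inftyE v V : HD v V -> J_infty v = Jf (fun=> 0) (fun=> 1) v V.
Proof.
move=> vV; rewrite Jf_pot0 /J_infty (D12_normE hN vV); congr (_ - _*_).
apply: Int_ext => x; pos.
Qed.

Variable Om : set E.
Hypotheses (Os : smooth_open_set Om) (Ob : bounded_set Om).
Variable lam : R.
Hypotheses (lamgt : (- Lambda Om < lam%:E)%E) (lam0 : lam <= 0).
Local Notation Q := (Q_Omega Om : E -> R).
Let a : E -> R := fun x => lam*\1_Om x.
Let oO : open Om. Proof. by case: Os. Qed.
Let Qok : wt_ok Q. Proof. exact: Q_Omega_ok. Qed.

Lemma bounded_pot (t : R) : exists M, pot_ok (fun x => t*\1_Om x) `|t| M.
Proof.
have [B [_ hB]] := Ob; exists (`|B|+2); split.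
- apply: measurable_funM => //.
 exact: measurable_indic (open_measurable_rV oO).
- by move=> x; rewrite normrM ler_piMr// indicE; case: (_ \in _); rewrite ?normr1 ?normr0.
- move=> x xB; rewrite indicE memNset ?mulr0// => Ox.
 have h : `|x| <= `|B|+1 by apply: hB => //; have := ler_norm B; lra.
 pos.
Qed.

Lemma J_lambdaE v V : HD v V -> J_lambda Om lam v = Jf a Q v V.
Proof.
move=> vV; have [vL VL _] := vV; have [M ao] := bounded_pot lam.
have vD := D12_HD hN (HD_D12 hN vV); have [_ wL _] := vD.
rewrite /J_lambda /Jf IntD; last 2 first.
- apply: ig_sum => i; li.
- by have [] := pot_int hN ao vL vL.
by rewrite (Int_grad_sq hN (HD_D12 hN vV)) (HD_gn_unique vD vV).
Qed.

Lemma coercive : exists2 kap : R, 0 < kap & forall u U, HD u U ->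
 kap*gn U^+2 <= gn U^+2+\int[mu]_x (a x*(u x*u x)).
Proof.
(* [Lambda Om] may be infinite; a real number [m] between [- lam] and it gives the constant
   [1 + lam / m]. *)
have [m [m0 mL]] : exists m : R, - lam < m /\ (m%:E <= Lambda Om)%E.
 move: lamgt; move: (Lambda Om) => L; case: L => [r|_|].
 - by rewrite lte_fin => h; exists r; split; [lra|].
 - by exists (- lam+1); split; [lra|exact: leey].
 - li.
have mp : 0 < m by move: lam0; lra.
exists (1+lam/m).
 rewrite -(ltr_pM2r mp) mul0r mulrDl mul1r divfK; lra.
move=> u U uU; have [uL _ _] := uU; have [mu' ui] := uL.
pose den : R := \int[mu]_(x in Om) (u x^+2).
have denE : den = \int[mu]_x (\1_Om x*u x^+2).
 rewrite /den Rintegral_mkcond; apply: Int_ext => x.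
 by rewrite patchE indicE; case: (x \in Om); rewrite ?mul1r ?mul0r.
have den0 : 0 <= den by rewrite denE; apply: Int_ge0 => x; rewrite mulr_ge0// sqr_ge0.
have [M po] := bounded_pot 1.
have igd : ig (fun x => \1_Om x*u x^+2).
 by have [h _] := pot_int hN po uL uL; move: h; congr (integrable _ _ _); apply/funext => x; rewrite /= mul1r.
have aE : \int[mu]_x (a x*(u x*u x)) = lam * den.
 rewrite denE -IntZ//; apply: Int_ext => x; by rewrite [RHS]mulrA.
rewrite aE.
have md : m * den <= gn U^+2.
 have [dz|dz] := eqVneq den 0; first by rewrite dz mulr0 sqr_ge0.
 have nt : nontrivial u.
  move=> uz; move/eqP: dz; apply; rewrite denE -[RHS](Int0 mu); apply: Int_aeeq => //.
  - exact: ig_mes igd.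
  - by move: uz; apply: filterS => x /= h _; rewrite (h I) expr0n mulr0.
 have : (m%:E <= rayleigh Om u)%E.
  apply: le_trans mL _; apply: ereal_inf_lbound; exists u => //; split=> //; exact: (HD_D12 hN uU).
 rewrite /rayleigh -/den (negbTE dz) (Int_grad_sq hN (HD_D12 hN uU)) lee_fin.
 rewrite (HD_gn_unique (D12_HD hN (HD_D12 hN uU)) uU) ler_pdivlMr// lt_def dz den0//.
have : - lam/m*(m * den) <= - lam/m*gn U^+2.
 by rewrite ler_wpM2l// divr_ge0 ?oppr_ge0// ltW.
rewrite mulrA divfK ?gt_eqF// mulrDl mul1r mulNr mulNr.
pos.
Qed.

(** The combination in which the nonlinear term cancels. With coercivity it bounds Palais-Smale
    sequences and shows that solutions have nonnegative energy. *)
Lemma Jf_dJ_diag u U : HD u U -> Jf a Q u U-p^-1 * dJ a Q u U u U =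
 (2^-1-p^-1)*(gn U^+2+\int[mu]_x (a x*(u x*u x))).
Proof.
move=> uU; rewrite /Jf /dJ -gn_sq.
have -> : \int[mu]_x (Q x*(gp p (u x)*u x)) = \int[mu]_x (Q x * `|u x| `^ p).
 by apply: Int_ext => x; rewrite gpE.
pos.
Qed.

Let exp_gap : 0 < 2^-1-p^-1.
Proof. by rewrite subr_gt0 ltf_pV2 ?posrE. Qed.

Lemma solution_energy_ge0 u U : HD u U -> (forall phi Phi, HD phi Phi -> dJ a Q u U phi Phi = 0) ->
 0 <= Jf a Q u U.
Proof.
move=> uU us; have := Jf_dJ_diag uU; rewrite (us _ _ uU) mulr0 subr0 => ->.
have [kap k0 hk] := coercive; apply: mulr_ge0; first pos.
by apply: le_trans (hk _ _ uU); apply: mulr_ge0; [exact: ltW|pos].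
Qed.

Lemma PS_bounded (c : R) (z : nat -> E -> R) (Z : nat -> 'I_N -> E -> R) : (forall k, HD (z k) (Z k)) ->
 PS a (fun=> Q) z Z -> Jf a Q (z k) (Z k) @[k --> \oo] --> c -> exists C, forall k, gn (Z k) <= C.
Proof.
move=> zZ [eta e0 he] Jc; have [kap k0 hk] := coercive.
have seqb (b : nat -> R) (l : R) : b @ \oo --> l -> exists2 B, 0 <= B & forall k, `|b k| <= B.
 move=> bl; have /cvg_seq_bounded/pinfty_ex_gt0[B B0 hB] : cvgn b by apply/cvg_ex; exists l.
 by exists B; [pos|move=> k; exact: hB].
have [B B0 hB] := seqb _ _ Jc; have [T T0 hT] := seqb _ _ e0.
set q := (2^-1-p^-1)*kap; have q0 : 0 < q by exact: mulr_gt0.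
have pi0 : 0 <= p^-1 by rewrite invr_ge0 ltW.
exists ((B+p^-1*T)/q+1) => k.
have h1 : q*gn (Z k)^+2 <= B+p^-1*T*gn (Z k).
 apply: (@le_trans _ _ (Jf a Q (z k) (Z k)-p^-1 * dJ a Q (z k) (Z k) (z k) (Z k))).
  by rewrite Jf_dJ_diag// /q -mulrA; apply: ler_wpM2l; [pos|exact: hk].
 apply: lerD; first exact: le_trans (ler_norm _) (hB k).
 rewrite -mulrN -mulrA; apply: ler_wpM2l => //.
 apply: le_trans (ler_norm _) _; rewrite normrN; apply: le_trans (he k _ _ (zZ k)) _.
 by apply: ler_wpM2r; [exact: gn_ge0|exact: le_trans (ler_norm _) (hT k)].
have g0 := gn_ge0 (Z k); set g := gn (Z k) in h1 g0 *.
have [g1|g1] := leP g 1.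
 apply: le_trans g1 _; rewrite lerDr; apply: divr_ge0; last pos.
 pos.
suff : g <= (B+p^-1*T)/q by lra.
rewrite ler_pdivlMr// -(ler_pM2r (lt_trans ltr01 g1)) mulrDl.
rewrite -mulrA mulrCA; apply: le_trans h1 _; rewrite lerD2r.
by rewrite ler_peMr// ltW.
Qed.

Lemma inner_scale_dist (xi : nat -> E) (eps : nat -> R) : (forall k, 0 < eps k) -> (forall k, Om (xi k)) ->
 inner_scale Om xi eps -> (eps k)^-1 * dist_set (xi k) (boundary Om) @[k --> \oo] --> +oo.
Proof.
move=> e0 xiO ins; apply/cvgryPge => A; have := ins A; apply: filterS => k h.
rewrite ler_pdivlMl// mulrC; apply: lb_le_inf.
 (* The infimum over an empty boundary would be 0; boundedness of [Om] provides a point outside, and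
    the segment to it a boundary point. *)
 have [b nb] : exists b, ~ Om b.
  have [B [_ hB]] := Ob; exists (const_mx (`|B|+2)) => Ox.
  have h1 : `|const_mx (`|B|+2) : E| <= `|B|+1 by apply: hB => //; have := ler_norm B; lra.
  have i0 : 'I_N by case: (N) hN => // N' _; exact: ord0.
  have := le_trans (coord_norm (const_mx (`|B|+2)) i0) h1; rewrite mxE ger0_norm//; lra.
 have [t [_ _ tb]] := segment_boundary oO (xiO k) nb.
 by exists (eucl_dist (xi k) (xi k+t*:(b-xi k))); exists (xi k+t*:(b-xi k)).
move=> _ [y yb <-]; have [_ ny] := boundary_out oO yb.
have h1 : A*eps k <= `|y-xi k| by rewrite leNgt; apply/negP => h2; apply: ny; exact: h.
apply: le_trans h1 _; apply: norm_le_coord; first pos.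
move=> j; rewrite -sqrtr_sqr; apply: ler_wsqrtr; rewrite (bigD1 j)//= !mxE -sqrrN opprB lerDl.
apply: sumr_ge0 => i _; pos.
Qed.

Lemma struwe (c : R) (u_ : nat -> E -> R) (dJ_ : nat -> (E -> R) -> R) : (forall k, D12 (u_ k)) ->
 J_lambda Om lam (u_ k) @[k --> \oo] --> c ->
 (forall k, is_frechet_derivative (J_lambda Om lam) (u_ k) (dJ_ k)) ->
 dual_norm (dJ_ k) ~>0 k ->
 exists (s : nat -> nat) (u : E -> R) (m : nat)
     (xi : 'I_m -> nat -> E) (eps : 'I_m -> nat -> R) (w : 'I_m -> (E -> R)),
  [/\ {homo s : i j/(i < j)%N}, critical_point (J_lambda Om lam) u,
    (forall j k, Om (xi j k)), (forall j k, 0 < eps j k) &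
    (forall j, critical_point (@J_infty R N) (w j) /\ nontrivial (w j))] /\
  [/\ (forall j, (eps j k)^-1 * dist_set (xi j k) (boundary Om) @[k --> \oo] --> +oo),
    D12_norm (fun x => u_ (s k) x-u x-\sum_(j < m) rescale (w j) (eps j k) (xi j k) x) ~>0 k &
    J_lambda Om lam u+\sum_(j < m) J_infty (w j) = c /\ 0 <= c].
Proof.
move=> uD Jc dJd dJ0; have [M ao] := bounded_pot lam.
pose U_ k := fun i => weak_partial i (u_ k).
have uU k : HD (u_ k) (U_ k) by exact: (D12_HD hN).
have uPS : PS a (fun=> Q) u_ U_.
 (* By uniqueness of the Fréchet derivative the given functionals agree with [dJ], so their dual
    norms serve as Palais-Smale errors. *)
 exists (fun k => dual_norm (dJ_ k)) => // k phi Phi pP.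
 have fd := frechet_dJ hN ao Qok J_lambdaE (uU k).
 have pD := D12_HD hN (HD_D12 hN pP).
 have -> : dJ a Q (u_ k) (U_ k) phi Phi = dJ_ k phi.
  rewrite -(frechet_unique hN fd (dJd k) pP); congr (_ + _ - _).
  apply: eq_bigr => i _; have [_ UL _] := uU k; have [_ PL _] := pP; have [_ PL' _] := pD.
  apply: Int_aeeq.
  - by apply: measurable_funM; [case: (UL i)|case: (PL i)].
  - by apply: measurable_funM; [case: (UL i)|case: (PL' i)].
  - by have := HD_unique pP pD i; apply: filterS => x /= h hT; rewrite (h hT).
 by rewrite -(D12_normE hN pP); apply: (dual_norm_le hN); [case: (dJd k)|exact: (HD_D12 hN pP)].
have Jc' : Jf a Q (u_ k) (U_ k) @[k --> \oo] --> c.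
 by apply: (cvg_eq _ Jc) => k; rewrite (J_lambdaE (uU k)).
have [C UC] := PS_bounded uU uPS Jc'.
have [s [u [U [sh uU' us]]]] := HD_weak_compact hN uU UC.
have vV k : HD ((u_ \o s) k) ((U_ \o s) k) by mfun.
have VC k : gn ((U_ \o s) k) <= C by mfun.
have vPS : PS a (fun=> Q) (u_ \o s) (U_ \o s) := PS_sub sh uPS.
have Qc : {ae mu, forall x, (fun _ : nat => Q) ^~ x @ \oo --> Q x} by apply: aeW => x; exact: cvg_cst.
have sol phi Phi (pP : HD phi Phi) := split_solution hN vV VC uU' us (fun=> Qok) Qok Qc ao vPS pP.
have zPS := split_PS hN vV VC uU' us (fun=> Qok) Qok Qc ao vPS.
have en := split_energy hN vV VC uU' us (fun=> Qok) Qok Qc ao.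
pose z k x := u_ (s k) x-u x; pose Z k i x := U_ (s k) i x-U i x.
have zZ k : HD (z k) (Z k) by apply: HDB => //.
have zg : vanishing_PS Om z Z by split=> //; case: us.
have qz := quantum_gt0.
(* The bounded gradient norms contain finitely many half quanta, which starts the induction. *)
have [n hn] : exists n, forall k, gn (Z k)^+2 <= n%:R*(quantum^+2/2).
 set q := _/2; have q0 : 0 < q by rewrite divr_gt0// exprn_gt0.
 exists (Num.truncn ((C+gn U)^+2/q)).+1 => k.
 rewrite -ler_pdivrMr//; apply: le_trans (ltW (truncnS_gt _)).
 rewrite ler_pM2r ?invr_gt0//; apply: lerXn2r; rewrite ?nnegrE ?gn_ge0//.
  by apply: addr_ge0; [exact: le_trans (gn_ge0 _) (UC 0%N)|exact: gn_ge0].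
 have [_ UL _] := uU (s k); have [_ UL' _] := uU'.
 by apply: le_trans (gnB UL UL') _; rewrite lerD2r.
have [s' [m [xi [eps [w [W [sh' fam gl Jl]]]]]]] := bubble_decomposition Os Ob zg hn.
have wj (j : 'I_m) := fam j (ltn_ord j).
exists (s \o s'), u, m, (fun j => xi j), (fun j => eps j), (fun j => w j); split; split.
- exact: homo_comp sh sh'.
- exact: (critical_dJ hN ao Qok J_lambdaE uU' sol).
- by move=> j k; have [_ []] := wj j.
- by move=> j k; have [_ []] := wj j.
- move=> j; have [[wW ws wn] _] := wj j; split => //.
 exact: (critical_dJ hN (@pot0 R N) wt_ok1 (@J_inftyE) wW ws).
- move=> j; have [_ [e0 xO ins]] := wj j; exact: inner_scale_dist.
- apply: (cvg_eq _ gl) => k; apply: (D12_normE hN); apply: (HDB hN (zZ (s' k))).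
 apply: (@HD_sum m (fun j => rescale (w j) (eps j k) (xi j k)) (fun j => rescG (W j) (eps j k) (xi j k))).
 move=> j; have [[wW _ _] [e0 _ _]] := wj j; exact: HD_rescale.
have cE : Jf a Q u U+\sum_(j < m) Jf (fun=> 0) (fun=> 1) (w j) (W j) = c.
 have := cvg_sub sh' en => en'.
 have L1 : Jf a Q (u_ (s (s' k))) (U_ (s (s' k))) @[k --> \oo] -->
  (Jf a Q u U+\sum_(j < m) Jf (fun=> 0) (fun=> 1) (w j) (W j) : R).
  apply: (@cvg_eq R _ _ _ _ (cvgD en' Jl)) => k; by rewrite subrK.
 have L2 := cvg_sub (homo_comp sh sh') Jc'.
 exact: (cvg_unique _ L1 L2).
have sE : \sum_(j < m) J_infty (w j) = \sum_(j < m) Jf (fun=> 0) (fun=> 1) (w j) (W j).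
 apply: eq_bigr => j _; have [[wW _ _] _] := wj j; exact: J_inftyE.
rewrite (J_lambdaE uU') sE; split => //; rewrite -cE; apply: addr_ge0.
 exact: solution_energy_ge0 uU' sol.
apply: sumr_ge0 => j _; have [[wW ws _] _] := wj j; rewrite (sol1_Jf wW ws).
pos.
Qed.

End decomposition.

Theorem theorem4p1 (R : realType) (N : nat) (hN : (3 <= N)%N)
    (Omega : set 'rV[R]_N)
    (Omega_bounded : bounded_set Omega)
    (Omega_smooth : smooth_open_set Omega)
    (lambda : R) (lambda_gt : (- Lambda Omega < lambda%:E)%E)
    (lambda_le0 : lambda <= 0)
    (c : R)
    (u_ : nat -> ('rV[R]_N -> R))
    (u_D12 : forall k, D12 (u_ k))
    (J_cvg : J_lambda Omega lambda (u_ k) @[k --> \oo] --> c)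
    (dJ : nat -> (('rV[R]_N -> R) -> R))
    (dJ_derivative : forall k,
      is_frechet_derivative (J_lambda Omega lambda) (u_ k) (dJ k))
    (dJ_cvg0 : dual_norm (dJ k) @[k --> \oo] --> 0) :
  exists (s : nat -> nat) (u : 'rV[R]_N -> R) (m : nat)
         (xi : 'I_m -> nat -> 'rV[R]_N) (eps : 'I_m -> nat -> R)
         (w : 'I_m -> ('rV[R]_N -> R)),
    [/\ {homo s : i j / (i < j)%N},
        critical_point (J_lambda Omega lambda) u,
        (forall i k, Omega (xi i k)),
        (forall i k, 0 < eps i k) &
        (forall i, critical_point (@J_infty R N) (w i) /\ nontrivial (w i))] /\
    [/\ (forall i, (eps i k)^-1 * dist_set (xi i k) (boundary Omega)
                     @[k --> \oo] --> +oo),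
        D12_norm (fun x => u_ (s k) x - u x
                     - \sum_(i < m) rescale (w i) (eps i k) (xi i k) x)
          @[k --> \oo] --> 0 &
        J_lambda Omega lambda u + \sum_(i < m) J_infty (w i) = c /\ 0 <= c].
Proof. exact: (struwe hN Omega_smooth Omega_bounded lambda_gt lambda_le0 u_D12 J_cvg dJ_derivative dJ_cvg0). Qed.
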